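(* Let $a=(a_{ij}):\mathbb R^d\to\mathbb R^d\otimes\mathbb R^d$ be a bounded function, continuous on $\mathbb R^d\setminus\{\mathbf 0\}$, taking values in the symmetric non-negative definite $d\times d$ matrices. Let $v$ be a probability distribution on $\mathbb R^d$ and suppose that the $\mathcal C(\mathbb R_+;\mathbb R^d)$ martingale problem for $(G,v)$ is well-posed, where $Gf:=\frac12\sum_{i,j}a_{ij}\partial_i\partial_jf$ for smooth compactly supported $f:\mathbb R^d\to\mathbb R$. For each $n\in\mathbb N$ let $Z_n$ be a process with sample paths in $\mathcal D(\mathbb R_+;\mathbb R^d)$ and let $A_n=(A_n^{ij})$ be a symmetric $d\times d$-matrix-valued process started at zero such that each $A_n^{ij}$ has sample paths in $\mathcal D(\mathbb R_+;\mathbb R)$ and $A_n(t)-A_n(s)$ is non-negative definite for all $t>s\ge0$. Set $\mathcal F^n_t:=\sigma(Z_n(s),A_n(s),s\le t)$ and suppose that $Z_n^i$ and $Z_n^iZ_n^j-A_n^{ij}$ are $(\mathcal F^n_t)$-adapted local martingales for all $i,j\in\{1,\dots,d\}$. Let $\tau_n^r:=\inf\{t\ge0:\|Z_n(t)\|\ge r\text{ or }\|Z_n(t-)\|\ge r\}$ (with $\inf\emptyset:=\infty$) and suppose that for every $r>0$, $T>0$ and $i,j\in\{1,\dots,d\}$, $$\lim_{n\to\infty}\mathbb E\Big[\sup_{0\le t\le T\wedge\tau_n^r}\|Z_n(t)-Z_n(t-)\|^2\Big]=0,\qquad \lim_{n\to\infty}\mathbb E\Big[\sup_{0\le t\le T\wedge\tau_n^r}|A_n^{ij}(t)-A_n^{ij}(t-)|\Big]=0,$$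 and, as $n\to\infty$, $$\sup_{0\le t\le T\wedge\tau_n^r}\Big|A_n^{ij}(t)-\int_0^ta_{ij}(Z_n(s))\,\mathrm ds\Big|\longrightarrow0\quad\text{in probability.}$$ Assume $\sup_{n\in\mathbb N}\mathbb E\|Z_n(0)\|^2<\infty$. Suppose that $Z_n(0)$ converges weakly to $v$ and that $\|Z_n\|$ converges weakly to the law of a Bessel process of dimension greater than one. Then $Z_n$ converges weakly to the solution of the martingale problem for $(G,v)$.
   Context: $\mathcal C(\mathbb R_+;\mathbb R^d)$ and $\mathcal D(\mathbb R_+;\mathbb R^k)$ are the spaces of continuous functions and of right-continuous functions with left limits, the latter with the Skorohod topology (weak convergence of processes is on this space). By convention $x(0-):=x(0)$, and $s\wedge t:=\min\{s,t\}$ for $s,t\in[0,\infty]$. The $\mathcal C(\mathbb R_+;\mathbb R^d)$ martingale problem for $(G,v)$ is well-posed if there is exactly one law on $\mathcal C(\mathbb R_+;\mathbb R^d)$ under which the coordinate process $Z$ has $Z(0)\sim v$ and $f(Z(t))-f(Z(0))-\int_0^tGf(Z(s))\,\mathrm ds$ is a martingale for every smooth compactly supported $f$; the process with this law is the solution of the martingale problem. *)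

(* Defs.v *)
From HB Require Import structures.
From mathcomp Require Import all_boot all_order all_algebra.
From mathcomp Require Import all_classical all_reals all_analysis.

Set Implicit Arguments.
Unset Strict Implicit.
Unset Printing Implicit Defensive.
Import Order.TTheory GRing.Theory Num.Theory.
Import numFieldNormedType.Exports.

Local Open Scope classical_set_scope.
Local Open Scope ring_scope.

(** * Path spaces *)

(* A path on [0, oo) is encoded as a function on R that is constant on
   ]-oo, 0]. This is a bijective encoding of functions on [0, oo), and it
   makes the convention x(0-) = x(0) a fact about left limits. *)
Definition cadlag (R : realType) (V : ptopologicalType) (x : R -> V) : Prop :=
  [/\ forall t, t < 0 -> x t = x 0,
      forall t, x s @[s --> t^'+] --> x t &
      forall t, cvg (x s @[s --> t^'-])].

Definition left_limit (R : realType) (V : ptopologicalType) (x : R -> V)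
  (t : R) : V := lim (x s @[s --> t^'-]).

Record skorokhod (R : realType) (V : pseudoMetricNormedZmodType R) :=
  Skorokhod { path_fun :> R -> V ; path_cadlag : cadlag path_fun }.

HB.instance Definition _ (R : realType) (V : pseudoMetricNormedZmodType R) :=
  gen_eqMixin (skorokhod V).
HB.instance Definition _ (R : realType) (V : pseudoMetricNormedZmodType R) :=
  gen_choiceMixin (skorokhod V).

Lemma cadlag_cst (R : realType) (V : pseudoMetricNormedZmodType R) (c : V) :
  cadlag (fun _ : R => c).
Proof.
split=> // t; first exact: cvg_cst.
by apply/cvg_ex; exists c; exact: cvg_cst.
Qed.

HB.instance Definition _ (R : realType) (V : pseudoMetricNormedZmodType R) :=
  isPointed.Build (skorokhod V) (Skorokhod (cadlag_cst 0)).

(* The increasing bijections of [0, oo), extended to R. *)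
Definition time_change (R : realType) (lam : R -> R) : Prop :=
  [/\ lam 0 = 0, {homo lam : s t / s < t} & forall u, exists t, lam t = u].

Definition skorokhod_ball (R : realType) (V : pseudoMetricNormedZmodType R)
    (x : skorokhod V) (T e : R) : set (skorokhod V) :=
  [set y | exists2 lam, time_change lam &
    forall t, 0 <= t <= T -> `|lam t - t| < e /\ `|y t - x (lam t)| < e].

(* The J1 topology of D([0, oo); V): the sets [skorokhod_ball x T e] form a
   neighbourhood basis at x, because x_n --> x iff for every T there are time
   changes lam_n such that |lam_n t - t| and |x_n t - x (lam_n t)| tend to 0
   uniformly on [0, T] (Ethier & Kurtz, Proposition 3.5.3). *)
Definition skorokhod_nbhs (R : realType) (V : pseudoMetricNormedZmodType R)
    (x : skorokhod V) : set_system (skorokhod V) :=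
  filter_from [set Te : R * R | 0 < Te.2]
    (fun Te => skorokhod_ball x Te.1 Te.2).

HB.instance Definition _ (R : realType) (V : pseudoMetricNormedZmodType R) :=
  hasNbhs.Build (skorokhod V) (@skorokhod_nbhs R V).

Section skorokhod_topology.
Context (R : realType) (V : pseudoMetricNormedZmodType R).
Implicit Types x y : skorokhod V.

Lemma time_change_id : time_change (@id R).
Proof. by split=> // u; exists u. Qed.

Lemma time_change_comp (lam mu : R -> R) :
  time_change lam -> time_change mu -> time_change (lam \o mu).
Proof.
move=> [l0 linc lsurj] [m0 minc msurj]; split => [|s t st|u] /=.
- by rewrite m0.
- exact/linc/minc.
- by have [v <-] := lsurj u; have [w <-] := msurj v; exists w.
Qed.

Lemma skorokhod_ball_refl x T e : 0 < e -> skorokhod_ball x T e x.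
Proof.
move=> e0; exists id; first exact: time_change_id.
by move=> t _; rewrite !subrr !normr0.
Qed.

Lemma skorokhod_ball_sub x T T' e e' : T' <= T -> e <= e' ->
  skorokhod_ball x T e `<=` skorokhod_ball x T' e'.
Proof.
move=> TT ee y [lam tlam H]; exists lam => // t /andP[t0 tT].
have [|h1 h2] := H t; first by rewrite t0 (le_trans tT).
by split; [exact: lt_le_trans h1 ee|exact: lt_le_trans h2 ee].
Qed.

Lemma skorokhod_nbhs_filter x : ProperFilter (nbhs x).
Proof.
apply: filter_from_proper; last first.
  by move=> [T e] /= e0; exists x; exact: skorokhod_ball_refl.
apply: filter_from_filter; first by exists (0, 1) => /=.
move=> [T e] [T' e'] /= e0 e0'.
exists (Order.max T T', Order.min e e') => /=; first by rewrite lt_min e0.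
by move=> y xy; split; apply: skorokhod_ball_sub xy;
  rewrite ?le_max ?ge_min lexx ?orbT.
Qed.

Lemma skorokhod_nbhs_singleton x (A : set (skorokhod V)) : nbhs x A -> A x.
Proof. by move=> [[T e] /= e0]; apply; exact: skorokhod_ball_refl. Qed.

Lemma skorokhod_nbhs_nbhs x (A : set (skorokhod V)) :
  nbhs x A -> nbhs x (nbhs^~ A).
Proof.
move=> [[T e] /= e0 xA]; exists (T + e, e / 2) => /=; first exact: divr_gt0.
move=> y [lam tlam xy]; exists (T, e / 2) => /=; first exact: divr_gt0.
move=> z [mu tmu yz]; apply: xA; exists (lam \o mu).
  exact: time_change_comp.
move=> t tT /=; have [mut zt] := yz t tT; case/andP: tT => t0 tT.
have mu0 : 0 <= mu t.
  case: tmu => mu00 muinc _; move: t0; rewrite le_eqVlt => /predU1P[<-|t0].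
    by rewrite mu00.
  by rewrite -mu00 ltW// muinc.
have [|lmu ymu] := xy (mu t).
  rewrite mu0/= -(subrK t (mu t)) addrC lerD//.
  apply: le_trans (ler_norm _) _; apply: le_trans (ltW mut) _.
  by rewrite ler_pdivrMr// ler_peMr ?ler1n// ltW.
split.
- have -> : lam (mu t) - t = (lam (mu t) - mu t) + (mu t - t).
    by rewrite addrA subrK.
  by apply: le_lt_trans (ler_normD _ _) _; rewrite [ltRHS]splitr ltrD.
- have -> : z t - x (lam (mu t)) = (z t - y (mu t)) + (y (mu t) - x (lam (mu t))).
    by rewrite addrA subrK.
  by apply: le_lt_trans (ler_normD _ _) _; rewrite [ltRHS]splitr ltrD.
Qed.

HB.instance Definition _ := Nbhs_isNbhsTopological.Build (skorokhod V)
  skorokhod_nbhs_filter skorokhod_nbhs_singleton skorokhod_nbhs_nbhs.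

End skorokhod_topology.

Record cpath (R : realType) (V : pseudoMetricNormedZmodType R) :=
  CPath { cpath_path :> skorokhod V ;
          cpath_continuous : continuous (cpath_path : R -> V) }.

HB.instance Definition _ (R : realType) (V : pseudoMetricNormedZmodType R) :=
  gen_eqMixin (cpath V).
HB.instance Definition _ (R : realType) (V : pseudoMetricNormedZmodType R) :=
  gen_choiceMixin (cpath V).

Definition cpath0 (R : realType) (V : pseudoMetricNormedZmodType R) :
  cpath V := @CPath R V point (fun _ => cvg_cst _).

HB.instance Definition _ (R : realType) (V : pseudoMetricNormedZmodType R) :=
  isPointed.Build (cpath V) (@cpath0 R V).

(* The norm of R^d: the library norm of ['rV[R]_d] is the sup norm, which
   induces the same topology but is not the one of the statement. *)
Definition enorm (R : realType) (d : nat) (x : 'rV[R]_d) : R :=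
  Num.sqrt (\sum_(i < d) x 0 i ^+ 2).

Lemma enorm_continuous (R : realType) (d : nat) :
  continuous (@enorm R d).
Proof.
move=> x; apply: continuous_comp; last exact: sqrt_continuous.
apply: (@cvg_big R _ _ _ _ _ _ (nbhs x)) => [|i _].
  exact: add_continuous.
apply: (cvg_comp (fun y : 'rV[R]_d => y 0 i) (fun u : R => u ^+ 2)).
  exact: coord_continuous.
exact: exprn_continuous.
Qed.

Lemma cadlag_comp (R : realType) (V W : pseudoMetricNormedZmodType R)
    (g : V -> W) (x : R -> V) :
  continuous g -> cadlag x -> cadlag (g \o x).
Proof.
move=> cg [xneg xr xl]; split => [t t0|t|t] /=.
- by rewrite xneg.
- exact: (cvg_comp _ _ (xr t) (cg _)).
- apply/cvg_ex; exists (g (lim (x s @[s --> t^'-]))).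
  exact: (cvg_comp _ _ (xl t) (cg _)).
Qed.

Definition enorm_path (R : realType) (d : nat) (x : skorokhod 'rV[R]_d) :
    skorokhod R :=
  Skorokhod (cadlag_comp (@enorm_continuous R d) (path_cadlag x)).

(** * Processes, filtrations, martingales *)

Notation borel U := (g_sigma_algebraType (@open U)).

Definition measurable_process (R : realType) (disp : measure_display)
    (T : measurableType disp) (U : ptopologicalType) (X : T -> R -> U) : Prop :=
  forall t, 0 <= t -> measurable_fun [set: T] (fun w => X w t : borel U).

Definition past (R : realType) (T : Type) (U : topologicalType)
    (X : T -> R -> U) (t : R) : set (set T) :=
  [set E | exists2 s, 0 <= s <= t &
           exists2 B, <<s @open U >> B & E = [set w | B (X w s)]].

Definition joint_filtration (R : realType) (T : Type) (U W : topologicalType)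
    (X : T -> R -> U) (Y : T -> R -> W) (t : R) : set (set T) :=
  <<s past X t `|` past Y t >>.

Definition filtration (R : realType) (disp : measure_display)
    (T : measurableType disp) (F : R -> set (set T)) : Prop :=
  [/\ forall t, 0 <= t -> sigma_algebra [set: T] (F t),
      forall t, 0 <= t -> F t `<=` measurable &
      forall s t : R, 0 <= s -> s <= t -> F s `<=` F t].

Definition adapted (R : realType) (T : Type) (F : R -> set (set T))
    (X : T -> R -> R) : Prop :=
  forall t, 0 <= t -> forall B : set R, measurable B -> F t [set w | B (X w t)].

Definition martingale (R : realType) (disp : measure_display)
    (T : measurableType disp) (P : probability T R) (F : R -> set (set T))
    (M : T -> R -> R) : Prop :=
  [/\ adapted F M,
      forall t, 0 <= t -> P.-integrable [set: T] (fun w => (M w t)%:E) &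
      forall s t : R, 0 <= s -> s <= t -> forall E, F s E ->
        (\int[P]_(w in E) (M w t)%:E = \int[P]_(w in E) (M w s)%:E)%E].

Definition stopping_time (R : realType) (T : Type) (F : R -> set (set T))
    (tau : T -> \bar R) : Prop :=
  (forall w, (0 <= tau w)%E) /\
  (forall t, 0 <= t -> F t [set w | (tau w <= t%:E)%E]).

Definition stopped (R : realType) (T : Type) (M : T -> R -> R)
    (tau : T -> \bar R) : T -> R -> R :=
  fun w t => M w (fine (Order.min t%:E (tau w))).

Definition local_martingale (R : realType) (disp : measure_display)
    (T : measurableType disp) (P : probability T R) (F : R -> set (set T))
    (M : T -> R -> R) : Prop :=
  adapted F M /\
  exists tau : nat -> T -> \bar R,
    [/\ forall k, stopping_time F (tau k),
        forall k w, (tau k w <= tau k.+1 w)%E,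
        {ae P, forall w, tau ^~ w @ \oo --> +oo%E} &
        forall k, martingale P F (stopped M (tau k))].

(** * Modes of convergence *)

(* Random elements, possibly on different probability spaces. For S one of
   ['rV_d] and [skorokhod V] with V separable, f \o X n is measurable as soon
   as the process X n is, since Borel sets are generated by the coordinates. *)
Definition weak_cvg (R : realType) (S : topologicalType)
    (disp : nat -> measure_display) (T : forall n, measurableType (disp n))
    (P : forall n, probability (T n) R) (X : forall n, T n -> S)
    (disp' : measure_display) (T' : measurableType disp')
    (P' : probability T' R) (Y : T' -> S) : Prop :=
  forall f : S -> R, continuous f -> (exists C, forall x, `|f x| <= C) ->
    (\int[P n]_w (f (X n w))%:E)%E @[n --> \oo] --> (\int[P']_w (f (Y w))%:E)%E.

Definition cvg_prob0 (R : realType)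
    (disp : nat -> measure_display) (T : forall n, measurableType (disp n))
    (P : forall n, probability (T n) R) (X : forall n, T n -> \bar R) : Prop :=
  forall e : R, 0 < e ->
    P n [set w | (e%:E < `|X n w|)%E] @[n --> \oo] --> 0%E.

(** * Bessel processes *)

Definition brownian_motion (R : realType) (disp : measure_display)
    (T : measurableType disp) (P : probability T R) (F : R -> set (set T))
    (B : T -> R -> R) : Prop :=
  [/\ forall w, B w 0 = 0,
      forall w, {within `[0, +oo[, continuous (B w)},
      adapted F B &
      forall s t : R, 0 <= s -> s < t -> forall E, F s E ->
        forall U : set R, measurable U ->
        (P (E `&` [set w | U (B w t - B w s)%R]) =
         P E * normal_prob 0%R (Num.sqrt (t - s)%R) U)%E].

(* I = int_0^. H dB, for H continuous and adapted and B a Brownian motion: for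
   such integrands the Ito integral is the limit in probability of the
   left-point Riemann sums. Each [I _ t] is thereby fixed almost surely. *)
Definition ito_integral (R : realType) (disp : measure_display)
    (T : measurableType disp) (P : probability T R)
    (H B I : T -> R -> R) : Prop :=
  forall t, 0 <= t ->
    cvg_prob0 (fun _ : nat => P) (fun n w =>
      (\sum_(k < n) H w (k%:R * t / n%:R) *
         (B w (k.+1%:R * t / n%:R) - B w (k%:R * t / n%:R)) - I w t)%:E).

(* X solves dX = delta dt + 2 sqrt(X) dB. *)
Definition squared_bessel (R : realType) (disp : measure_display)
    (T : measurableType disp) (P : probability T R) (delta : R)
    (X : T -> R -> R) : Prop :=
  [/\ forall w t, 0 <= t -> 0 <= X w t,
      forall w, {within `[0, +oo[, continuous (X w)} &
      exists (F : R -> set (set T)) (B : T -> R -> R),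
        [/\ filtration F, brownian_motion P F B, adapted F X &
            ito_integral P (fun w t => 2 * Num.sqrt (X w t)) B
              (fun w t => X w t - X w 0 - delta * t)]].

Definition bessel (R : realType) (disp : measure_display)
    (T : measurableType disp) (P : probability T R) (delta : R)
    (rho : T -> R -> R) : Prop :=
  exists2 X, squared_bessel P delta X &
    forall w t, 0 <= t -> rho w t = Num.sqrt (X w t).

(** * Martingale problem on continuous paths *)

Definition partial (R : realType) (d : nat) (i : 'I_d) (f : 'rV[R]_d -> R) :
  'rV[R]_d -> R := fun x => derive f x (delta_mx 0 i).

Definition iter_partial (R : realType) (d : nat) (s : seq 'I_d)
  (f : 'rV[R]_d -> R) : 'rV[R]_d -> R := foldr (@partial R d) f s.

Definition smooth (R : realType) (d : nat) (f : 'rV[R]_d -> R) : Prop :=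
  forall s : seq 'I_d, continuous (iter_partial s f) /\
    forall i x, derivable (iter_partial s f) x (delta_mx 0 i).

Definition compactly_supported (R : realType) (d : nat) (f : 'rV[R]_d -> R) :
  Prop := compact (closure [set x | f x != 0]).

Definition generator (R : realType) (d : nat) (a : 'rV[R]_d -> 'M[R]_d)
    (f : 'rV[R]_d -> R) : 'rV[R]_d -> R :=
  fun x => 2^-1 * \sum_(i < d) \sum_(j < d) a x i j * partial i (partial j f) x.

(* The sigma-algebra of C([0, oo); V) generated by the coordinates. *)
Definition coordinate_sets (R : realType) (V : pseudoMetricNormedZmodType R) :
    set (set (cpath V)) :=
  \bigcup_(t in [set t : R | 0 <= t]) past (fun z : cpath V => z : R -> V) t.

Notation cpath_space V := (g_sigma_algebraType (@coordinate_sets _ V)).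

Definition martingale_problem (R : realType) (d : nat)
    (a : 'rV[R]_d -> 'M[R]_d) (v : probability (borel 'rV[R]_d) R)
    (Q : probability (cpath_space 'rV[R]_d) R) : Prop :=
  (forall B : set (borel 'rV[R]_d), measurable B ->
     Q [set z : cpath 'rV[R]_d | B (z 0)] = v B) /\
  (forall f : 'rV[R]_d -> R, smooth f -> compactly_supported f ->
     martingale Q (fun t => <<s past (fun z : cpath 'rV[R]_d => z : R -> _) t >>)
       (fun (z : cpath 'rV[R]_d) t => f (z t) - f (z 0) -
          \int[lebesgue_measure]_(s in `[0, t]) generator a f (z s))).

Definition well_posed (R : realType) (d : nat)
    (a : 'rV[R]_d -> 'M[R]_d) (v : probability (borel 'rV[R]_d) R) : Prop :=
  exists2 Q, martingale_problem a v Q &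
    forall Q', martingale_problem a v Q' ->
      forall E, measurable E -> Q' E = Q E.

(** * Matrices, exit times, suprema *)

Definition symmetric_mx (R : realType) (d : nat) (M : 'M[R]_d) : Prop :=
  M^T = M.

Definition nonneg_def (R : realType) (d : nat) (M : 'M[R]_d) : Prop :=
  forall u : 'rV[R]_d, 0 <= (u *m M *m u^T) 0 0.

Definition exit_time (R : realType) (d : nat) (x : skorokhod 'rV[R]_d)
    (r : R) : \bar R :=
  ereal_inf (EFin @`
    [set t | 0 <= t /\ (r <= enorm (x t) \/ r <= enorm (left_limit x t))]).

Definition sup_upto (R : realType) (T : \bar R) (g : R -> R) : \bar R :=
  ereal_sup [set (g t)%:E | t in [set t | 0 <= t /\ (t%:E <= T)%E]].

(* Main.v *)
(* Fix an ultrafilter U on nat containing the cofinite sets, and consider the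
   Loeb probability space over the ultraproduct of the sample spaces. Stopping
   Z_n when the norm of Z_n or a diagonal entry of A_n becomes large, a
   second-moment maximal inequality on the blocks of a fine time grid bounds
   the oscillation of Z_n in probability; so for almost every point of the Loeb
   space the standard part Phi of (Z_n) is a continuous path, and Z_n converges
   to Phi along U locally uniformly. Hence E f(Z_n) tends to E f(Phi) along U
   for every bounded continuous f on the Skorokhod space.

   A discrete Ito expansion shows that the increment over [s, t] of
   f(Z_n) - int Gf(Z_n) has nearly zero mean on every event of F^n_s, uniformly
   over these events. The property passes to Phi although a may be
   discontinuous at 0, because Phi spends no time at 0: a squared Bessel process
   of positive dimension does not vanish at a fixed positive time, as the
   exponential martingales driven by solutions of the Riccati equation
   g' = 2 g^2 show. So the law of Phi solves the martingale problem; by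
   well-posedness it does not depend on U, which gives convergence. *)

From HB Require Import structures.
From mathcomp Require Import all_boot all_order all_algebra.
From mathcomp Require Import all_classical all_reals all_analysis.
From mathcomp Require Import ring lra measurable_realfun.
Require Import Defs.
Import Order.TTheory GRing.Theory Num.Theory.
Import numFieldNormedType.Exports.

Set Implicit Arguments.
Unset Strict Implicit.
Unset Printing Implicit Defensive.

Local Open Scope classical_set_scope.
Local Open Scope ring_scope.

(** * Expectations *)

(** Three obstacles shape the route. On a block of length h, a maximal inequality bounds the
    probability of a large oscillation only by a multiple of h, while there are T/h blocks; it is
    therefore applied twice inside each block, which yields order h^2. Next, the filtrations are
    raw, so the time at which the norm or a diagonal entry first exceeds its level is only known
    through the events {time < u}; optional stopping is proved for such times. The overshoot is a
    single jump, controlled by the hypotheses although the suprema in them may fail to be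
    measurable. Finally, passing martingale properties to the limit needs a class of events on the
    Loeb space: those approximable in probability by sequences of events of the filtrations at a
    given time. They form a sigma-algebra, which contains the past of the limit path because an open
    set is the set where some continuous function is positive. *)

Lemma truncn_lt (R : archiRealFieldType) (x : R) n : (Num.truncn x < n)%N -> x < n%:R.
Proof. by move=> xn; apply: lt_le_trans (truncnS_gt _) _; rewrite ler_nat. Qed.

Lemma ler_normB2 (R : numDomainType) (x y c : R) : `|x| <= c -> `|y| <= c -> `|x - y| <= 2 * c.
Proof. by move=> xc yc; apply: le_trans (ler_normB _ _) _; rewrite mulr_natl mulr2n lerD. Qed.

Lemma ler_norm_sumr (R : numDomainType) I (r : seq I) (F G : I -> R) :
  (forall i, `|F i| <= G i) -> `|\sum_(i <- r) F i| <= \sum_(i <- r) G i.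
Proof. by move=> FG; apply: le_trans (ler_norm_sum _ _ _) _; apply: ler_sum => i _. Qed.

Section indicator.
Context (T : Type) (R : realType) (A : set T) (w : T).

Lemma indicT : A w -> \1_A w = 1 :> R.
Proof. by move=> Aw; rewrite indicE mem_set. Qed.

Lemma indicF : ~ A w -> \1_A w = 0 :> R.
Proof. by move=> Aw; rewrite indicE memNset. Qed.

Lemma norm_indic_le1 : `|\1_A w : R| <= 1.
Proof. by rewrite indicE; case: (_ \in _); rewrite ?normr1 ?normr0. Qed.

End indicator.

Section expectation.
Context d (T : measurableType d) (R : realType) (P : probability T R).
Implicit Types (f g : T -> R) (A B E : set T).

Definition mfun f := measurable_fun [set: T] f.
Definition intg f := P.-integrable [set: T] (EFin \o f).
Definition expct f : R := Rintegral P setT f.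
Definition prb A : R := fine (P A).

Lemma intg_meas f : intg f -> mfun f.
Proof. by move=> /measurable_int/measurable_EFinP. Qed.

Lemma intg_le f g : mfun f -> intg g -> (forall w, `|f w| <= `|g w|) -> intg f.
Proof.
move=> mf ig fg; apply: (le_integrable _ _ _ ig) => //=.
  exact/measurable_EFinP.
by move=> w _; rewrite lee_fin.
Qed.

Lemma intg_cst (c : R) : intg (cst c).
Proof. exact: finite_measure_integrable_cst. Qed.

Lemma intg_bnd f C : mfun f -> (forall w, `|f w| <= C) -> intg f.
Proof.
move=> mf fC; apply: (intg_le mf (intg_cst C)) => w.
exact: le_trans (fC w) (ler_norm _).
Qed.

Lemma intgD f g : intg f -> intg g -> intg (fun w => f w + g w).
Proof. by move=> fi gi; exact: (integrableD _ fi gi). Qed.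

Lemma intgN f : intg f -> intg (fun w => - f w).
Proof. by move=> fi; exact: (integrableN fi). Qed.

Lemma intgB f g : intg f -> intg g -> intg (fun w => f w - g w).
Proof. by move=> fi gi; apply: intgD => //; exact: intgN. Qed.

Lemma intgZ (c : R) f : intg f -> intg (fun w => c * f w).
Proof. by move=> fi; exact: (integrableZl _ _ fi). Qed.

Lemma intg_norm f : intg f -> intg (fun w => `|f w|).
Proof. by move=> fi; exact: (integrable_norm fi). Qed.

Lemma intg_sum I (r : seq I) (F : I -> T -> R) :
  (forall i, intg (F i)) -> intg (fun w => \sum_(i <- r) F i w).
Proof.
move=> Fi; rewrite /intg (_ : _ \o _ = fun w => (\sum_(i <- r) (F i w)%:E)%E).
  by apply: integrable_sum => // i _; exact: Fi.
by apply/funext => w /=; rewrite sumEFin.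
Qed.

Lemma mfun_indic A : measurable A -> mfun \1_A.
Proof. by move=> mA; exact: measurable_indic. Qed.

Lemma intg_indic A : measurable A -> intg \1_A.
Proof. by move=> mA; apply: (intg_bnd (mfun_indic mA)) => w; exact: norm_indic_le1. Qed.

Lemma intg_mulb f g C : mfun f -> (forall w, `|f w| <= C) -> intg g ->
  intg (fun w => f w * g w).
Proof.
move=> mf fC ig; apply: (@intg_le _ (fun w => C * g w)).
- by apply: measurable_funM => //; exact: intg_meas.
- exact: intgZ.
- by move=> w; rewrite !normrM ler_wpM2r// (le_trans (fC w))// ler_norm.
Qed.

Lemma intg_mul1 A g : measurable A -> intg g -> intg (fun w => \1_A w * g w).
Proof.
by move=> mA; apply: intg_mulb (mfun_indic mA) _ => w; exact: norm_indic_le1.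
Qed.

Lemma EFin_expct f : intg f -> (expct f)%:E = (\int[P]_w (f w)%:E)%E.
Proof. by move=> fi; rewrite /expct/Rintegral fineK// integrable_fin_num. Qed.

Lemma expctD f g : intg f -> intg g ->
  expct (fun w => f w + g w) = expct f + expct g.
Proof. by move=> fi gi; exact: RintegralD. Qed.

Lemma expctB f g : intg f -> intg g ->
  expct (fun w => f w - g w) = expct f - expct g.
Proof. by move=> fi gi; exact: RintegralB. Qed.

Lemma expctZ (c : R) f : intg f -> expct (fun w => c * f w) = c * expct f.
Proof. by move=> fi; exact: RintegralZl. Qed.

Lemma expctN f : intg f -> expct (fun w => - f w) = - expct f.
Proof.
move=> fi; rewrite -mulN1r -expctZ//; congr expct; apply/funext => w.
by rewrite mulN1r.
Qed.

Lemma expct_cst (c : R) : expct (cst c) = c.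
Proof.
rewrite /expct Rintegral_cst// (_ : fine _ = 1) ?mulr1//.
by rewrite -[1]/(fine 1%E); congr fine; exact: probability_setT.
Qed.

Lemma expct_le f g : intg f -> intg g -> (forall w, f w <= g w) ->
  expct f <= expct g.
Proof. by move=> fi gi fg; apply: le_Rintegral. Qed.

Lemma expct_ge0 f : (forall w, 0 <= f w) -> 0 <= expct f.
Proof. by move=> f0; apply: Rintegral_ge0. Qed.

Lemma expct_norm f : intg f -> `|expct f| <= expct (fun w => `|f w|).
Proof. by move=> fi; apply: le_normr_Rintegral. Qed.

Lemma expct_sum I (r : seq I) (F : I -> T -> R) : (forall i, intg (F i)) ->
  expct (fun w => \sum_(i <- r) F i w) = \sum_(i <- r) expct (F i).
Proof.
move=> Fi; elim: r => [|i r IH].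
  rewrite big_nil -[RHS](expct_cst 0); congr expct.
  by apply/funext => w; rewrite big_nil.
rewrite big_cons -IH -expctD//; last exact: intg_sum.
by congr expct; apply/funext => w; rewrite big_cons.
Qed.

Lemma prb_fin A : measurable A -> P A = (prb A)%:E.
Proof. by move=> mA; rewrite /prb fineK// fin_num_measure. Qed.

Lemma prb_indic A : measurable A -> prb A = expct \1_A.
Proof. by move=> mA; rewrite /expct /Rintegral integral_indic// setIT. Qed.

Lemma prb_ge0 A : 0 <= prb A.
Proof. exact: fine_ge0. Qed.

Lemma prb_le A B : measurable A -> measurable B -> A `<=` B -> prb A <= prb B.
Proof.
move=> mA mB AB; rewrite -lee_fin -!prb_fin//; apply: le_measure => //.
- by rewrite inE.
- by rewrite inE.
Qed.

Lemma prb_le1 A : measurable A -> prb A <= 1.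
Proof. by move=> mA; rewrite -lee_fin -prb_fin//; exact: probability_le1. Qed.

Lemma prbT : prb setT = 1.
Proof. by rewrite /prb probability_setT. Qed.

Lemma prb0 : prb set0 = 0.
Proof. by rewrite /prb measure0. Qed.

Lemma prbU A B : measurable A -> measurable B ->
  prb (A `|` B) <= prb A + prb B.
Proof.
move=> mA mB; rewrite -lee_fin EFinD -!prb_fin//; last exact: measurableU.
exact: measureU2.
Qed.

Lemma prb_bigU n (F : nat -> set T) : (forall i, measurable (F i)) ->
  prb (\big[setU/set0]_(i < n) F i) <= \sum_(i < n) prb (F i).
Proof.
move=> mF; elim: n => [|n IH]; first by rewrite !big_ord0 prb0.
rewrite !big_ord_recr/= (le_trans (prbU _ _))//; last by rewrite lerD2r.
exact: bigsetU_measurable.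
Qed.

Lemma prbD A B : measurable A -> measurable B -> B `<=` A ->
  prb (A `\` B) = prb A - prb B.
Proof.
move=> mA mB BA; apply: EFin_inj; rewrite EFinB -!prb_fin//; last exact: measurableD.
by rewrite measureD// ?setIidr// (le_lt_trans (probability_le1 P mA))// ltry.
Qed.

Lemma prb_cvg_bigcup (E : nat -> set T) : (forall k, measurable (E k)) ->
  prb (\big[setU/set0]_(i < k) E i) @[k --> \oo] --> prb (\bigcup_i E i).
Proof.
move=> mE; have mUE k : measurable (\big[setU/set0]_(i < k) E i).
  exact: bigsetU_measurable.
have := @nondecreasing_cvg_mu _ T R P (fun k => \big[setU/set0]_(i < k) E i) mUE.
have -> : \bigcup_k \big[setU/set0]_(i < k) E i = \bigcup_i E i.
  apply/seteqP; split=> [x [k _]|x [k _ Ek]].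
    by rewrite -(bigcup_mkord k E) => -[i _ Ei]; exists i.
  by exists k.+1 => //; rewrite -(bigcup_mkord k.+1 E); exists k => /=.
move=> /(_ (bigcupT_measurable _ mE)) H.
have H0 : {homo (fun k => \big[setU/set0]_(i < k) E i) : n m / (n <= m)%N >-> (n <= m)%O}.
  by move=> m n mn; apply/subsetPset/subset_bigsetU.
have {H H0} : P (\big[setU/set0]_(i < k) E i) @[k --> \oo] --> P (\bigcup_i E i) := H H0.
rewrite (prb_fin (bigcupT_measurable _ mE)); under eq_fun do rewrite prb_fin//.
by move/fine_cvgP => [_].
Qed.

Lemma measurable_leR f g : mfun f -> mfun g -> measurable [set w | f w <= g w].
Proof.
by move=> mf mg; rewrite -[X in measurable X]setTI; exact: measurable_fun_le.
Qed.

Lemma measurable_ltR f g : mfun f -> mfun g -> measurable [set w | f w < g w].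
Proof.
move=> mf mg; rewrite (_ : [set _ | _] = ~` [set w | g w <= f w]).
  by apply: measurableC; exact: measurable_leR.
by apply/seteqP; split => w /=; rewrite real_ltNge ?num_real// => /negP.
Qed.

Lemma measurable_le_cst f c : mfun f -> measurable [set w | f w <= c].
Proof. by move=> mf; exact: (measurable_leR mf (measurable_cst c)). Qed.

Lemma measurable_ge_cst f c : mfun f -> measurable [set w | c <= f w].
Proof. by move=> mf; exact: (measurable_leR (measurable_cst c) mf). Qed.

Lemma measurable_lt_cst f c : mfun f -> measurable [set w | f w < c].
Proof. by move=> mf; exact: (measurable_ltR mf (measurable_cst c)). Qed.

Lemma measurable_gt_cst f c : mfun f -> measurable [set w | c < f w].
Proof. by move=> mf; exact: (measurable_ltR (measurable_cst c) mf). Qed.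

Lemma mfun_norm f : mfun f -> mfun (fun w => `|f w|).
Proof. by move=> mf; exact: measurableT_comp. Qed.

Lemma expct_dct_ae (f_ : nat -> T -> R) f g : (forall n, mfun (f_ n)) -> mfun f ->
  {ae P, forall w, f_ n w @[n --> \oo] --> f w} -> intg g -> (forall n w, `|f_ n w| <= g w) ->
  expct (f_ n) @[n --> \oo] --> expct f.
Proof.
move=> mf_ mf fcvg gi fg.
have [] := @dominated_convergence _ _ R P setT measurableT (fun n => EFin \o f_ n) (EFin \o f) (EFin \o g).
- by move=> n; apply/measurable_EFinP; exact: mf_.
- exact/measurable_EFinP.
- by apply: filterS fcvg => w fw _; apply/cvg_EFin; [exact: nearW|exact: fw].
- exact: gi.
- by apply: aeW => w n _; rewrite /= lee_fin.
move=> fi _ cv; rewrite /expct /Rintegral; apply: fine_cvg; rewrite fineK//.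
exact: integrable_fin_num.
Qed.

Lemma expct_dct (f_ : nat -> T -> R) f g :
  (forall n, mfun (f_ n)) -> (forall w, f_ n w @[n --> \oo] --> f w) ->
  intg g -> (forall n w, `|f_ n w| <= g w) ->
  expct (f_ n) @[n --> \oo] --> expct f.
Proof.
move=> mf fcvg; apply: expct_dct_ae => //; last exact: aeW.
by apply: (@measurable_fun_cvg _ _ _ _ f_) => // w _; exact: fcvg.
Qed.

Section null.
Variable G : set (set T).
Hypothesis Gm : forall E, <<s G >> E -> measurable E.
Notation GT := (g_sigma_algebraType G).

Lemma mfun_sub (h : T -> R) : measurable_fun [set: GT] h -> mfun h.
Proof. by move=> mh _ B mB; apply: Gm; exact: mh. Qed.

(** The sum counts the k with k + 1 <= (n + 1) x, so it is the integer part of (n + 1) x. *)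
Lemma layer_cake (x : R) n : 0 <= x <= 1 ->
  `|x - n.+1%:R^-1 * \sum_(k < n.+1) ((k.+1%:R <= n.+1%:R * x)%R)%:R| <= n.+1%:R^-1.
Proof.
move=> /andP[x0 x1]; set y := n.+1%:R * x.
have y0 : 0 <= y by rewrite mulr_ge0.
have yn : y <= n.+1%:R by rewrite ler_piMr.
have /andP[m1 m2] := truncn_itv y0; set m := Num.truncn y in m1 m2.
have mn : (m <= n.+1)%N by rewrite -(ler_nat R) (le_trans m1).
have -> : \sum_(k < n.+1) ((k.+1%:R <= y)%R)%:R = m%:R :> R.
  rewrite -natr_sum; congr (_%:R).
  transitivity (\sum_(k < n.+1) (k < m)%N)%N.
    apply: eq_bigr => k _; congr nat_of_bool.
    apply/idP/idP => [ky|km]; last by rewrite (le_trans _ m1)// ler_nat.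
    by rewrite -ltnS -(ltr_nat R) (le_lt_trans ky).
  rewrite -(big_mkord xpredT (fun k => (k < m)%N : nat)) (big_cat_nat _ mn)//=.
  rewrite big_nat_cond (eq_bigr (fun=> 1%N)); last first.
    by move=> i /andP[/andP[_ ->]].
  rewrite -big_nat_cond sum_nat_const_nat subn0 muln1 big_nat_cond big1 ?addn0//.
  by move=> i /andP[/andP[mi _] _]; rewrite ltnNge mi.
rewrite -{1}(mulKf (lt0r_neq0 (ltr0Sn R n)) x) -/y -mulrBr normrM ger0_norm ?invr_ge0//.
rewrite ler_piMr ?invr_ge0// ger0_norm ?subr_ge0// lerBlDr addrC.
by move: (ltW m2); rewrite -addn1 natrD.
Qed.

(** The range [-D, D] is cut into N + 1 layers and [staircase] reassembles the superlevel sets. The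
    error is uniform in w, which lets identities pass from events to bounded functions, both here
    and on the Loeb space. *)
Definition level (D : R) N (h : T -> R) k : set T := [set w | k.+1%:R * (2 * D) <= N.+1%:R * (h w + D)].

Definition staircase D N h w : R := 2 * D / N.+1%:R * \sum_(k < N.+1) \1_(level D N h k) w - D.

Lemma staircase_dist D N h w : 0 < D -> `|h w| <= D -> `|h w - staircase D N h w| <= 2 * D / N.+1%:R.
Proof.
move=> D0 hD; have DD0 : 0 < 2 * D by rewrite mulr_gt0.
have y01 : 0 <= (h w + D) / (2 * D) <= 1.
  move: hD; rewrite ler_norml => /andP[h1 h2]; rewrite ler_pdivrMr// mul1r divr_ge0 ?(ltW DD0)//=.
    by rewrite mulr_natl mulr2n lerD2r.
  by rewrite -lerBlDr sub0r.
have -> : staircase D N h w =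
    2 * D / N.+1%:R * (\sum_(k < N.+1) ((k.+1%:R <= N.+1%:R * ((h w + D) / (2 * D)))%R)%:R) - D.
  congr (_ * _ - _); apply: eq_bigr => k _; rewrite mulrA ler_pdivlMr//.
  have [kw|/negP kw] := boolP (k.+1%:R * (2 * D) <= N.+1%:R * (h w + D)); first by rewrite indicT.
  by rewrite indicF.
have := layer_cake N y01; rewrite -(ler_pM2l DD0) -{1}(gtr0_norm DD0) -normrM.
set S := \sum_(k < N.+1) _; congr (`|_| <= _).
by field; rewrite addrC natr1 pnatr_eq0/= gt_eqF.
Qed.

Lemma expct_staircase D N h X : (forall k, measurable (level D N h k)) -> intg X ->
  intg (fun w => staircase D N h w * X w) /\ expct (fun w => staircase D N h w * X w) =
    2 * D / N.+1%:R * \sum_(k < N.+1) expct (fun w => \1_(level D N h k) w * X w) - D * expct X.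
Proof.
move=> ml iX; have iL k : intg (fun w => \1_(level D N h k) w * X w) by exact: intg_mul1.
have iS : intg (fun w => \sum_(k < N.+1) \1_(level D N h k) w * X w).
  by apply: (@intg_sum _ _ (fun (k : 'I_N.+1) w => \1_(level D N h k) w * X w)).
rewrite (_ : (fun w => _) = fun w => 2 * D / N.+1%:R * \sum_(k < N.+1) (\1_(level D N h k) w * X w) - D * X w); last first.
  by apply/funext => w; rewrite /staircase mulrBl -[X in X - _]mulrA mulr_suml.
split; first by apply: intgB; exact: intgZ.
rewrite expctB ?expctZ//; [|exact: intgZ|exact: intgZ].
by rewrite (@expct_sum _ _ (fun (k : 'I_N.+1) w => \1_(level D N h k) w * X w)).
Qed.

(** The staircases of h are combinations of indicators of events in the sigma-algebra and converge
    to h uniformly. *)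
Lemma expct_mul_bnd_eq0 (X h : T -> R) C :
  intg X -> (forall E, <<s G >> E -> expct (fun w => \1_E w * X w) = 0) ->
  measurable_fun [set: GT] h -> (forall w, `|h w| <= C) ->
  expct (fun w => h w * X w) = 0.
Proof.
(* C may be 0, whereas the layers need a range of positive height. *)
move=> Xi XE mh hC; pose D := C + 1; have C0 : 0 <= C by exact: le_trans (hC point).
have D0 : 0 < D by rewrite ltr_wpDl.
have hD w : `|h w| <= D by rewrite (le_trans (hC w))// lerDl.
have FG N k : <<s G >> (level D N h k).
  rewrite /level -[X in <<s G>> X]setTI; apply: (@measurable_fun_le _ GT R setT) => //.
  by apply: measurable_funM => //; exact: measurable_funD.
have st N := @expct_staircase D N h X (fun k => Gm (FG N k)) Xi.
have X0 : expct X = 0.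
  rewrite -[RHS](XE setT (@measurableT _ GT)); congr expct.
  by apply/funext => w; rewrite indicT// mul1r.
have s0 N : expct (fun w => staircase D N h w * X w) = 0.
  by have [_ ->] := st N; rewrite X0 mulr0 subr0 big1 ?mulr0// => k _; exact: XE.
have hX : intg (fun w => h w * X w) by apply: intg_mulb hC Xi; exact: mfun_sub.
have key N : `|expct (fun w => h w * X w)| <= 2 * D * N.+1%:R^-1 * expct (fun w => `|X w|).
  have [iN _] := st N; rewrite -[expct (fun w => h w * X w)]subr0 -(s0 N) -expctB//.
  apply: (le_trans (expct_norm _)); first exact: intgB.
  rewrite -expctZ; last exact: intg_norm.
  apply: expct_le; [by apply: intg_norm; exact: intgB|by apply: intgZ; exact: intg_norm|move=> w].
  by rewrite -mulrBl normrM ler_wpM2r//; exact: staircase_dist.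
apply/eqP; rewrite -normr_eq0 eq_le normr_ge0 andbT.
apply: (ler_cvg_to (@cvg_cst _ _ _ \oo _) _ (nearW _ key)).
rewrite [X in _ --> X](_ : 0 = 2 * D * 0 * expct (fun w => `|X w|)); last by rewrite mulr0 mul0r.
by apply: cvgMl; apply: cvgMr; exact: cvg_harmonic.
Qed.

(** Truncation to |h| <= n, then dominated convergence with bound |h X|. *)
Lemma expct_mul_eq0 (X h : T -> R) :
  intg X -> (forall E, <<s G >> E -> expct (fun w => \1_E w * X w) = 0) ->
  measurable_fun [set: GT] h -> intg (fun w => h w * X w) ->
  expct (fun w => h w * X w) = 0.
Proof.
move=> Xi XE mh hXi.
pose F n : set T := [set w | `|h w| <= n%:R].
have FG n : measurable_fun [set: GT] (\1_(F n) : T -> R).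
  apply: measurable_indic; rewrite /F -[X in measurable X]setTI.
  apply: (@measurable_fun_le _ GT R setT) => //.
  exact: measurableT_comp.
have E n : expct (fun w => \1_(F n) w * (h w * X w)) = 0.
  under eq_fun do rewrite mulrA.
  apply: (@expct_mul_bnd_eq0 _ _ n%:R) => //; first exact: measurable_funM.
  move=> w; have [Fw|Fw] := pselect (F n w); first by rewrite indicT// mul1r.
  by rewrite indicF// mul0r normr0.
suff : expct (fun w => \1_(F n) w * (h w * X w)) @[n --> \oo] --> expct (fun w => h w * X w).
  under eq_fun do rewrite E.
  by move=> H; apply/esym/(cvg_unique _ (@cvg_cst _ _ _ \oo _) H).
apply: (@expct_dct _ _ (fun w => `|h w * X w|)) => //.
- by move=> n; apply: measurable_funM; [exact: mfun_sub|exact: intg_meas].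
- move=> w; apply: cvg_near_cst.
  exists (Num.truncn `|h w|).+1 => // n /= nh.
  rewrite indicT ?mul1r//; apply: le_trans (ltW (truncnS_gt _)) _.
  by rewrite ler_nat.
- exact: intg_norm.
- by move=> n w; rewrite normrM ler_piMl// norm_indic_le1.
Qed.

End null.

End expectation.

Section law.
Context d d' (T : measurableType d) (T' : measurableType d') (R : realType).
Context (P : probability T R) (f : T -> T') (mf : measurable_fun [set: T] f).

Definition law : probability T' R := distribution P (mfun_Sub (mem_set mf)).

Lemma ge0_integral_law (g : T' -> \bar R) :
  measurable_fun [set: T'] g -> (forall y, 0 <= g y)%E ->
  (\int[law]_y g y = \int[P]_x g (f x))%E.
Proof. by move=> mg g0; rewrite /law ge0_integral_distribution. Qed.

Lemma expct_law (g : T' -> R) : mfun g -> intg P (g \o f) ->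
  expct law g = expct P (g \o f).
Proof.
move=> mg ig; rewrite /expct /Rintegral; congr fine.
by rewrite /law integral_distribution//; exact/measurable_EFinP.
Qed.

End law.

(** Only x is confined to K; y may leave it. This is the form needed for functions that vanish off
    K. *)
Lemma heine (R : realType) (V : normedModType R) (K : set V) (f : V -> R) (e : R) :
  compact K -> continuous f -> 0 < e ->
  exists2 del, 0 < del & forall x y, K x -> `|y - x| < del -> `|f y - f x| < e.
Proof.
move=> cK cf e0; move: cK; rewrite compact_near_coveringP.
move=> /(_ _ (0^'+) (fun del x => forall y, `|y - x| < del -> `|f y - f x| < e)) H.
have {}H : \forall del \near (0 : R)^'+, K `<=` (fun x => forall y, `|y - x| < del -> `|f y - f x| < e).
  apply: H => x _.
  have /cvgrPdist_lt/(_ _ (divr_gt0 e0 (ltr0Sn R 1))) := cf x.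
  move=> /nbhs_ballP[eta /= eta0 Heta].
  exists (ball x (eta / 2), [set del | 0 < del < eta / 2]) => /=.
    split; first by apply: nbhsx_ballx; exact: divr_gt0.
    exists (eta / 2); rewrite /= ?divr_gt0// => z /=; rewrite sub0r normrN => zeta z0.
    by rewrite z0 (le_lt_trans (ler_norm z)).
  move=> [x' del] /= [xx' /andP[del0 deleta]] y yx'; rewrite -ball_normE/= in xx'.
  have near z : `|x - z| < eta -> `|f x - f z| < e / 2 by move=> xz; apply: Heta; rewrite -ball_normE.
  rewrite -(subrKA (f x)) [e]splitr; apply: (le_lt_trans (ler_normD _ _)); apply: ltrD.
    rewrite distrC; apply: near; rewrite -(subrKA x') [eta]splitr.
    by apply: (le_lt_trans (ler_normD _ _)); rewrite ltrD// distrC (lt_trans yx').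
  by apply: near; apply: (lt_trans xx'); rewrite ltr_pdivrMr// ltr_pMr// ltr1n.
have [del [del0 Hd]] := filter_ex (filterI (nbhs_right_gt (0 : R)) H).
by exists del => // x y Kx; exact: Hd.
Qed.

(** Continuity on the half-line becomes continuity on R of the path frozen at its initial value, so
    that results on continuous functions of a real variable apply. *)
Lemma continuous_max0 (R : realType) (f : R -> R) :
  {within `[0, +oo[, continuous f} -> continuous (fun s : R => f (Num.max s 0)).
Proof.
move=> /subspace_continuousP cf s.
have m0 : (`[0, +oo[%classic : set R) (Num.max s 0) by rewrite /= in_itv/= andbT le_max lexx orbT.
apply: (cvg_comp (fun s : R => Num.max s 0) f _ (cf _ m0)).
move=> A /= VA.
have cm : (fun s : R => Num.max s 0) x @[x --> s] --> Num.max s 0.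
  by apply: continuous_max; [exact: cvg_id|exact: cvg_cst].
have {}VA : \forall x \near s, (`[0, +oo[%classic : set R) (Num.max x 0) -> A (Num.max x 0) := cm _ VA.
apply: filterS VA => x /=; apply.
by rewrite /= in_itv/= andbT le_max lexx orbT.
Qed.

(** * Loeb spaces *)

Section ultralimit.
Context (U : set_system nat) {UU : UltraFilter U}.

Lemma ultraE (A : set nat) : U (~` A) <-> ~ U A.
Proof.
split=> [UcA UA|nUA]; last by have [] := in_ultra_setVsetC A UU.
by have /filter_ex[] : U set0 by rewrite -(setICr A); exact: filterI.
Qed.

Hypothesis Uoo : \oo `<=` U.

Lemma near_infty N : \forall n \near U, (N <= n)%N.
Proof. by apply: Uoo; exists N. Qed.

Context (R : realType).
Implicit Types (u v : nat -> R).

Lemma ultra_cvg u C : (\forall n \near U, `|u n| <= C) ->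
  exists l : R, u n @[n --> U] --> l.
Proof.
move=> uC.
have := @segment_compact R (- C) C (u n @[n --> U]) _.
case=> [|l [_ ul]].
  by apply: filterS uC => n; rewrite ler_norml /= in_itv.
exists l => V lV; have [//|UcV] := in_ultra_setVsetC (u @^-1` V) UU.
have [x [+ Vx]] := ul (~` V) V UcV lV.
by [].
Qed.

(** A genuine limit for bounded sequences; for others, whatever default [lim] returns. *)
Definition ulim u : R := lim (u n @[n --> U]).

Lemma ulimP u C : (\forall n \near U, `|u n| <= C) -> u n @[n --> U] --> ulim u.
Proof. by move=> /ultra_cvg[l ul]; rewrite /ulim (cvg_lim _ ul). Qed.

Lemma ulim_eq u l : u n @[n --> U] --> l -> ulim u = l.
Proof. by move=> ul; apply: cvg_lim. Qed.

Lemma ulim_cst (c : R) : ulim (cst c) = c.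
Proof. by apply: ulim_eq; exact: cvg_cst. Qed.

Lemma ulim_near u v : (\forall n \near U, u n = v n) -> ulim u = ulim v.
Proof.
move=> uv; rewrite /ulim; congr lim; apply/seteqP; split=> A /= UA.
- by apply: filterS2 uv UA => n /= ->.
- by apply: filterS2 uv UA => n /= <-.
Qed.

Lemma ulim_norm u C : (\forall n \near U, `|u n| <= C) -> `|ulim u| <= C.
Proof.
move=> uC; apply: ler_cvg_to (cvg_norm (ulimP uC)) (cvg_cst C) uC.
Qed.

Lemma ulimD u v C : (\forall n \near U, `|u n| <= C) ->
  (\forall n \near U, `|v n| <= C) ->
  ulim (fun n => u n + v n) = ulim u + ulim v.
Proof. by move=> uC vC; apply: ulim_eq; exact: cvgD (ulimP uC) (ulimP vC). Qed.

Lemma ulimB u v C : (\forall n \near U, `|u n| <= C) ->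
  (\forall n \near U, `|v n| <= C) ->
  ulim (fun n => u n - v n) = ulim u - ulim v.
Proof. by move=> uC vC; apply: ulim_eq; exact: cvgB (ulimP uC) (ulimP vC). Qed.

Lemma ulimM u v C : (\forall n \near U, `|u n| <= C) ->
  (\forall n \near U, `|v n| <= C) ->
  ulim (fun n => u n * v n) = ulim u * ulim v.
Proof. by move=> uC vC; apply: ulim_eq; exact: cvgM (ulimP uC) (ulimP vC). Qed.

Lemma ulim_sum I (r : seq I) (F : I -> nat -> R) C :
  (forall i, \forall n \near U, `|F i n| <= C) ->
  ulim (fun n => \sum_(i <- r) F i n) = \sum_(i <- r) ulim (F i).
Proof.
move=> FC; apply: ulim_eq; elim: r => [|i r IH].
  rewrite big_nil; under eq_fun do rewrite big_nil; exact: cvg_cst.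
rewrite big_cons; under eq_fun do rewrite big_cons.
by apply: cvgD IH; exact: ulimP (FC i).
Qed.

Lemma near_ulim_gt u (c : R) C : (\forall n \near U, `|u n| <= C) ->
  c < ulim u -> \forall n \near U, c < u n.
Proof. by move=> /ulimP uc cu; apply: (cvgr_gt _ uc). Qed.

Lemma ulim_ge u (c : R) C : (\forall n \near U, `|u n| <= C) ->
  (\forall n \near U, c <= u n) -> c <= ulim u.
Proof. by move=> /ulimP uc cu; apply: ler_cvg_to (cvg_cst c) uc cu. Qed.

Lemma ulim_le_cst u (c : R) C : (\forall n \near U, `|u n| <= C) ->
  (\forall n \near U, u n <= c) -> ulim u <= c.
Proof. by move=> /ulimP uc cu; apply: ler_cvg_to uc (cvg_cst c) cu. Qed.

End ultralimit.
#[global] Hint Extern 0 (is_true (`|_| <= _)) => assumption : core.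

Record free_ultrafilter := FreeUltrafilter {
  free_sets :> set_system nat ;
  free_ultra : UltraFilter free_sets ;
  free_infty : \oo `<=` free_sets }.
#[global] Existing Instance free_ultra.

(** Sequences that agree on a set of U are not identified; instead, internal sets and standard parts
    are invariant under changes outside such a set. *)
Definition uprod (U : free_ultrafilter)
  (disp : nat -> measure_display) (Omega : forall n, measurableType (disp n)) :=
  forall n, Omega n.

Section loeb.
Context (R : realType) (U : free_ultrafilter).
Context (disp : nat -> measure_display) (Omega : forall n, measurableType (disp n)).
Notation FU := (free_sets U).
Notation T := (uprod U Omega).

Definition internal (F : forall n, set (Omega n)) : set T :=
  [set w | \forall n \near FU, F n (w n)].

Definition internal_sets : set (set T) :=
  [set E | exists2 F, (forall n, measurable (F n)) & E = internal F].

Lemma internalC F : internal (fun n => ~` F n) = ~` internal F.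
Proof.
apply/seteqP; split=> w /=; first by move=> /ultraE.
by move=> h; apply/ultraE.
Qed.

Lemma internalI F G : internal (fun n => F n `&` G n) = internal F `&` internal G.
Proof.
apply/seteqP; split=> w /=; last by move=> [h1 h2]; exact: filterI.
by move=> h; split; apply: filterS h => n [].
Qed.

Lemma internalU F G : internal (fun n => F n `|` G n) = internal F `|` internal G.
Proof.
rewrite -[RHS]setCK setCU -!internalC -internalI -internalC.
by congr internal; apply: functional_extensionality_dep => n; rewrite setCI !setCK.
Qed.

Lemma internal0 : internal (fun=> set0) = set0.
Proof. by apply/seteqP; split=> w //= /filter_ex[]. Qed.

Lemma internalT : internal (fun=> setT) = setT.
Proof. by rewrite -setC0 -internal0 -internalC; congr internal; apply: functional_extensionality_dep => n; rewrite setC0. Qed.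

Lemma internal_bigU (F : nat -> forall n, set (Omega n)) k : internal (fun n => \big[setU/set0]_(i < k) F i n) =
  \big[setU/set0]_(i < k) internal (F i).
Proof.
elim: k => [|k IH].
  by rewrite big_ord0 -internal0; congr internal; apply: functional_extensionality_dep => n; rewrite big_ord0.
rewrite big_ord_recr/= -IH -internalU; congr internal; apply: functional_extensionality_dep => n.
by rewrite big_ord_recr.
Qed.

(** Choosing a point of F n outside G n wherever one exists would produce a point of the first
    internal set outside the second. Hence an internal set determines its representing sequence up
    to U. *)
Lemma internal_sub F G : internal F `<=` internal G ->
  \forall n \near FU, F n `<=` G n.
Proof.
move=> FG; have [//|UcV] := in_ultra_setVsetC [set n | F n `<=` G n] (free_ultra U).
pose w : T := fun n => xget point (F n `\` G n).
have wP : \forall n \near FU, (F n `\` G n) (w n).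
  apply: filterS UcV => n /= /existsNP[x /not_implyP[Fx nGx]].
  by rewrite /w; case: xgetP => // /(_ x) /=; tauto.
have Fw : internal F w by apply: filterS wP => n [].
have /(filterI wP)/filter_ex[n [[_ h] /h]] := FG w Fw; tauto.
Qed.

Lemma internal_eq F G : internal F = internal G -> \forall n \near FU, F n = G n.
Proof.
move=> FG; have h1 := @internal_sub F G; have h2 := @internal_sub G F.
rewrite FG in h1 h2; near=> n; apply/seteqP; split; near: n; [exact: h1|exact: h2].
Unshelve. all: by end_near.
Qed.

HB.instance Definition _ := gen_eqMixin T.
HB.instance Definition _ := gen_choiceMixin T.
HB.instance Definition _ := isPointed.Build T (fun n => point : Omega n).

Let internal_sets0 : internal_sets set0.
Proof. by exists (fun=> set0) => //; rewrite internal0. Qed.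

Let internal_setsU : setU_closed internal_sets.
Proof.
move=> _ _ [F mF ->] [G mG ->]; exists (fun n => F n `|` G n); last by rewrite internalU.
by move=> n; exact: measurableU.
Qed.

Let internal_setsC : setC_closed internal_sets.
Proof.
move=> _ [F mF ->]; exists (fun n => ~` F n); last by rewrite internalC.
by move=> n; exact: measurableC.
Qed.

HB.instance Definition _ := @isAlgebraOfSets.Build default_measure_display T
  internal_sets internal_sets0 internal_setsU internal_setsC.

(** Countable saturation: if no finite subfamily covers, a diagonal sequence escapes the whole
    family. *)
Lemma saturation E (F : nat -> forall n, set (Omega n)) :
  internal E `<=` \bigcup_i internal (F i) ->
  exists k, internal E `<=` \big[setU/set0]_(i < k) internal (F i).
Proof.
move=> EF; apply: contrapT => /forallNP noN.
pose D k n := E n `\` \big[setU/set0]_(i < k) F i n.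
have D0 k : \forall n \near FU, D k n !=set0.
  have [//|UcV] := in_ultra_setVsetC [set n | D k n !=set0] (free_ultra U).
  exfalso; apply: (noN k) => w Ew; rewrite -internal_bigU.
  apply: filterS2 UcV Ew => n /= h En; apply: contrapT => nF.
  by apply: h; exists (w n).
pose good k n := `[< D k n !=set0 >].
(* The largest k <= n such that the first k sets fail to cover E n. For U-most n the index 0
   qualifies, so the maximum is attained at a qualifying index; and for U-most n it is at least any
   prescribed index. *)
pose K n := \max_(k < n.+1 | good k n) k.
pose w : T := fun n => xget point (D (K n) n).
have Kle n k : good k n -> (k <= n)%N -> (k <= K n)%N.
  move=> gk kn; have kn' : (k < n.+1)%N by rewrite ltnS.
  exact: (@leq_bigmax_cond _ (fun k : 'I_n.+1 => good k n) _ (Ordinal kn')).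
have wD : \forall n \near FU, D (K n) n (w n).
  apply: filterS (D0 0%N) => n h0; rewrite /w; case: xgetP => // /= Dn.
  exfalso; have : good (K n) n.
    have g0 : good (@ord0 n) n by apply/asboolP.
    rewrite /K; case: (@eq_bigmax_cond _ [pred k : 'I_n.+1 | good k n] (fun k => k : nat)).
      by apply/card_gt0P; exists ord0.
    move=> j gj Ej; have -> : \max_(k < n.+1 | good k n) k = j by exact: Ej.
    by move: gj; rewrite inE.
  by move=> /asboolP[x Dx]; apply: (Dn x).
have /EF[i _ Fi] : internal E w by apply: filterS wD => n [].
have [n [[[_ h] Fin] [ni gi]]] :=
  filter_ex (filterI (filterI wD Fi) (filterI (near_infty (@free_infty U) i.+1) (D0 i.+1))).
apply: h.
rewrite -(bigcup_mkord _ (fun i => F i n)); exists i => //=.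
by apply: Kle => //; apply/asboolP.
Qed.

Context (P : forall n, probability (Omega n) R).

(** Picks a representing sequence, unique up to U by [internal_eq]. Empty sets are the default for
    sets that are not internal, so that [ucontent] is a total function. *)
Definition usection (E : set T) : forall n, set (Omega n) :=
  if pselect (exists F : forall n, set (Omega n),
      (forall n, measurable (F n)) /\ E = internal F) is left H
  then projT1 (cid H) else fun=> set0.

Arguments usection E n : clear implicits.

Lemma measurable_usection E n : measurable (usection E n).
Proof. by rewrite /usection; case: pselect => // H; case: cid => /= F []. Qed.

Definition ucontent (E : set T) : \bar R :=
  (ulim U (fun n => prb (P n) (usection E n)))%:E.

Lemma usectionE (F : forall n, set (Omega n)) : (forall n, measurable (F n)) ->
  \forall n \near FU, usection (internal F) n = F n.
Proof.
move=> mF; apply: internal_eq; rewrite /usection; case: pselect => [H|[]].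
  by case: cid => /= G [].
by exists F.
Qed.

Lemma prb_bnd n (A : set (Omega n)) : measurable A -> `|prb (P n) A| <= 1.
Proof. by move=> mA; rewrite ger0_norm ?prb_ge0// prb_le1. Qed.

Lemma ucontentE (F : forall n, set (Omega n)) : (forall n, measurable (F n)) ->
  ucontent (internal F) = (ulim U (fun n => prb (P n) (F n)))%:E.
Proof.
move=> mF; congr EFin; apply: ulim_near.
by apply: filterS (usectionE mF) => n ->.
Qed.

Let ucontent0 : ucontent set0 = 0%E.
Proof.
rewrite -internal0 ucontentE// (_ : (fun _ => _) = cst 0); first by rewrite ulim_cst.
by apply: functional_extensionality_dep => n; rewrite prb0.
Qed.

Let ucontent_ge0 E : (0 <= ucontent E)%E.
Proof.
rewrite lee_fin /ucontent; apply: (@ulim_ge _ _ _ _ 0 1); last first.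
  by apply: nearW => n; exact: prb_ge0.
by apply: nearW => n; apply: prb_bnd; exact: measurable_usection.
Qed.

Lemma ucontentU E F : measurable E -> measurable F -> [disjoint E & F] ->
  ucontent (E `|` F) = (ucontent E + ucontent F)%E.
Proof.
move=> [A mA ->] [B mB ->]; rewrite -internalU => /disj_setPS dAB.
have mAB n : measurable (A n `|` B n) by exact: measurableU.
rewrite !ucontentE// -EFinD -(@ulimD _ _ _ _ _ 1).
- congr EFin; apply: ulim_near.
  have := @internal_sub (fun n => A n `&` B n) (fun=> set0).
  rewrite internalI internal0 => /(_ dAB); apply: filterS => n ABn.
  by rewrite /prb measureU// ?fineD ?fin_num_measure// -subset0.
- by apply: nearW => n; exact: prb_bnd.
- by apply: nearW => n; exact: prb_bnd.
Qed.

Let ucontent_bigU (F : nat -> set T) k : (forall i, measurable (F i)) -> trivIset setT F ->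
  ucontent (\big[setU/set0]_(i < k) F i) = (\sum_(0 <= i < k) ucontent (F i))%E.
Proof.
move=> mF tF; elim: k => [|k IH]; first by rewrite big_ord0 big_nil ucontent0.
rewrite big_ord_recr/= big_nat_recr//= -IH ucontentU//.
  exact: bigsetU_measurable.
apply/disj_setPS => x [].
rewrite -bigcup_mkord => -[i /= ik Fi] Fk.
have := tF i k I I; move=> /(_ (ex_intro _ x (conj Fi Fk))) ik'.
by rewrite ik' ltnn in ik.
Qed.

(** By [saturation], a disjoint sequence of internal sets whose union is internal has only finitely
    many nonempty terms, so finite additivity is enough. *)
Let ucontent_sigma_additive : semi_sigma_additive ucontent.
Proof.
move=> F mF tF mUF.
have /choice[G GP] : forall i, exists G : forall n, set (Omega n), (forall n, measurable (G n)) /\ F i = internal G.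
  by move=> i; have [G mG ->] := mF i; exists G.
have [E mE UE] := mUF.
have [k Ek] : exists k, internal E `<=` \big[setU/set0]_(i < k) internal (G i).
  apply: saturation; rewrite -UE => x [i _ Fi]; exists i => //.
  by rewrite -(GP i).2.
have Fk i : (k <= i)%N -> F i = set0.
  move=> ki; rewrite -subset0 => x Fix.
  have /Ek : internal E x by rewrite -UE; exists i.
  rewrite -(bigcup_mkord k (fun i => internal (G i))) => -[j /= jk]; rewrite -(GP j).2 => Fjx.
  have := tF i j I I (ex_intro _ x (conj Fix Fjx)) => ij.
  by move: ki; rewrite ij leqNgt jk.
have -> : \bigcup_i F i = \big[setU/set0]_(i < k) F i.
  rewrite -bigcup_mkord; apply/seteqP; split=> x [i _ Fi]; exists i => //=.
  by rewrite ltnNge; apply/negP => /Fk Fi0; rewrite Fi0 in Fi.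
apply: cvg_near_cst; exists k => // n /= kn.
rewrite ucontent_bigU// (big_cat_nat _ kn)//= [X in (_ + X)%E]big_nat_cond [X in (_ + X)%E]big1 ?adde0//.
by move=> i /andP[/andP[ki _] _]; rewrite Fk.
Qed.

HB.instance Definition _ := isMeasure.Build default_measure_display T R ucontent
  ucontent0 ucontent_ge0 ucontent_sigma_additive.

Notation LT := (g_sigma_algebraType (@measurable _ T)).

Definition loeb : set LT -> \bar R := measure_extension ucontent.

HB.instance Definition _ := Measure.on loeb.

Lemma measurable_internal (F : forall n, set (Omega n)) :
  (forall n, measurable (F n)) -> measurable (internal F : set LT).
Proof. by move=> mF; apply: sub_sigma_algebra; exists F. Qed.

Let loebE' (F : forall n, set (Omega n)) : (forall n, measurable (F n)) ->
  loeb (internal F) = (ulim U (fun n => prb (P n) (F n)))%:E.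
Proof.
move=> mF; rewrite -ucontentE//; rewrite /loeb /measure_extension.
by apply: measurable_mu_extE; exists F.
Qed.

Let loeb_setT : loeb setT = 1%E.
Proof.
rewrite -internalT loebE'//; congr EFin.
by rewrite (_ : (fun n => _) = cst 1) ?ulim_cst//; apply/funext => n; rewrite prbT.
Qed.

HB.instance Definition _ := Measure_isProbability.Build _ _ _ loeb loeb_setT.

Lemma loebE (F : forall n, set (Omega n)) : (forall n, measurable (F n)) ->
  prb loeb (internal F) = ulim U (fun n => prb (P n) (F n)).
Proof. by move=> mF; rewrite /prb; have /= -> := loebE' mF. Qed.

Definition stdpart (g : forall n, Omega n -> R) : T -> R :=
  fun w => ulim U (fun n => g n (w n)).

Lemma stdpart_indic (F : forall n, set (Omega n)) (w : T) :
  \1_(internal F) w = ulim U (fun n => \1_(F n) (w n)) :> R.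
Proof.
have [Fw|Fw] := pselect (internal F w).
  rewrite indicT// -[LHS](ulim_cst (U:=U)); apply: ulim_near.
  by apply: filterS Fw => n Fn; rewrite indicT.
rewrite indicF// -[LHS](ulim_cst (U:=U)); apply: ulim_near.
have {}Fw : \forall n \near FU, ~ F n (w n) by apply/ultraE.
by apply: filterS Fw => n Fn; rewrite indicF.
Qed.

Arguments stdpart g w : clear implicits.

Lemma stdpart_bnd (g : forall n, Omega n -> R) C (w : T) : (forall n w, `|g n w| <= C) ->
  `|stdpart g w| <= C.
Proof. by move=> gC; apply: ulim_norm; apply: nearW => n; exact: gC. Qed.

(** A strict inequality for the limit leaves a margin, whereas strict inequalities along the
    sequence only give a weak one in the limit; hence the term 1/(k + 1). *)
Lemma stdpart_gtE (g : forall n, Omega n -> R) C (c : R) : (forall n w, `|g n w| <= C) ->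
  [set w | c < stdpart g w] =
  \bigcup_k internal (fun n => [set w | c + k.+1%:R^-1 < g n w]).
Proof.
move=> gC; have gw (w : T) : \forall n \near FU, `|g n (w n)| <= C by apply: nearW => n; exact: gC.
apply/seteqP; split=> [w /= cw|w [k _ kw]].
  have /ltr_add_invr[k ck] := cw.
  by exists k => //; exact: near_ulim_gt (gw w) ck.
apply: (@lt_le_trans _ _ (c + k.+1%:R^-1)); first by rewrite ltrDl invr_gt0.
apply: ulim_ge (gw w) _; apply: filterS kw => n; exact: ltW.
Qed.

Lemma measurable_stdpart (g : forall n, Omega n -> R) C (D : set (set T)) :
  (forall n w, `|g n w| <= C) -> sigma_algebra setT D ->
  (forall c, D (internal (fun n => [set w | c < g n w]))) ->
  measurable_fun [set: g_sigma_algebraType D] (stdpart g).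
Proof.
move=> gC sD Dg; apply: (measurability _ (RGenOInfty.measurableE R)) => //.
move=> _ [_ [c ->] <-]; rewrite setTI.
rewrite (_ : _ @^-1` _ = \bigcup_k internal (fun n => [set w | c + k.+1%:R^-1 < g n w])).
  by apply: bigcupT_measurable => k; apply: sub_sigma_algebra; exact: Dg.
by rewrite -(stdpart_gtE _ gC); apply/seteqP; split=> w /=; rewrite in_itv/= andbT.
Qed.

Lemma mfun_stdpart (g : forall n, Omega n -> R) C : (forall n w, `|g n w| <= C) ->
  (forall n, measurable_fun setT (g n)) -> measurable_fun [set: LT] (stdpart g).
Proof.
move=> gC mg; have := @measurable_stdpart g C (@measurable _ LT) gC.
have sD : sigma_algebra setT (@measurable _ LT).
  split; [exact: measurable0|move=> A mA; exact: measurableD|].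
  by move=> F mF; exact: bigcupT_measurable.
move=> /(_ sD) H _ B mB.
have {}H := H _ measurableT B mB.
rewrite -(sigma_algebra_id sD); apply: H => c.
apply: measurable_internal => n.
exact: (@measurable_ltR _ _ _ (cst c) (g n) (measurable_cst c) (mg n)).
Qed.

Lemma intg_stdpart (g : forall n, Omega n -> R) C : (forall n w, `|g n w| <= C) ->
  (forall n, measurable_fun setT (g n)) -> intg loeb (stdpart g).
Proof.
by move=> gC mg; apply: intg_bnd (mfun_stdpart gC mg) _ => w; exact: stdpart_bnd.
Qed.

Lemma ulim_affine N (a : nat -> nat -> R) (c D : R) : (forall k n, `|a k n| <= 1) ->
  ulim U (fun n => c * \sum_(k < N) a k n - D) = c * \sum_(k < N) ulim U (a k) - D.
Proof.
move=> a1; rewrite -(ulim_sum (U:=U) (index_enum 'I_N) (F:=fun k n => a k n) (C:=1)); last first.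
  by move=> k; apply: nearW => n; exact: a1.
apply: ulim_eq; apply: cvgB; last exact: cvg_cst.
apply: cvgMr; apply: (@ulimP _ _ _ _ N%:R); apply: nearW => n.
apply: (le_trans (ler_norm_sum _ _ _)); rewrite -[N in leRHS]card_ord -sumr_const.
by apply: ler_sum => k _; exact: a1.
Qed.

(** For indicators this is [loebE]. The staircases approximate g n within 2 D / (N + 1) for all n at
    once, so the identity passes from them to g. *)
Lemma expct_stdpart (g : forall n, Omega n -> R) C :
  (forall n, measurable_fun setT (g n)) -> (forall n w, `|g n w| <= C) ->
  expct loeb (stdpart g) = ulim U (fun n => expct (P n) (g n)).
Proof.
move=> mg gC; pose D := C + 1; have C0 : 0 <= C by exact: le_trans (gC 0%N point).
have D0 : 0 < D by rewrite ltr_wpDl.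
have gD n w : `|g n w| <= D by rewrite (le_trans (gC n w))// lerDl.
have ig n : intg (P n) (g n) by apply: intg_bnd (mg n) (gC n).
have igst := intg_stdpart gC mg.
suff key N : `|expct loeb (stdpart g) - ulim U (fun n => expct (P n) (g n))| <= 2 * (2 * D) * N.+1%:R^-1.
  apply/eqP; rewrite -subr_eq0 -normr_eq0 eq_le normr_ge0 andbT.
  apply: (ler_cvg_to (@cvg_cst _ _ _ \oo _) _ (nearW _ key)).
  by rewrite -[X in _ --> X](mulr0 (2 * (2 * D))); apply: cvgMr; exact: cvg_harmonic.
pose s n := staircase D N (g n); pose F k n := level D N (g n) k.
have mF k n : measurable (F k n).
  rewrite /F /level -[X in measurable X]setTI; apply: measurable_fun_le => //.
  by apply: measurable_funM => //; exact: measurable_funD.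
have st n : intg (P n) (s n) /\ expct (P n) (s n) = 2 * D / N.+1%:R * (\sum_(k < N.+1) prb (P n) (F k n)) - D.
  have := @expct_staircase _ _ _ (P n) D N (g n) (cst 1) (fun k => mF k n) (intg_cst _ 1).
  rewrite (_ : (fun w => _) = s n); last by apply/funext => w; rewrite /= mulr1.
  move=> [is_ ->]; split=> //; rewrite expct_cst mulr1; congr (_ * _ - _); apply: eq_bigr => k _.
  by rewrite prb_indic//; congr expct; apply/funext => w; rewrite /= mulr1.
have gs n w : `|g n w - s n w| <= 2 * D / N.+1%:R by exact: staircase_dist.
(* The standard part of the staircases, which is again a simple function because the standard part
   of an indicator is the indicator of an internal set. *)
pose S (w : LT) : R := 2 * D / N.+1%:R * (\sum_(k < N.+1) \1_(internal (F k)) w) - D.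
have iI k : intg loeb (\1_(internal (F k) : set LT)) by apply: intg_indic; exact: measurable_internal.
have iI' : intg loeb (fun w => \sum_(k < N.+1) \1_(internal (F k) : set LT) w).
  by apply: (@intg_sum _ _ _ _ _ _ (fun (k : 'I_N.+1) (w : LT) => \1_(internal (F k) : set LT) w)).
have iS : intg loeb S by apply: intgB; [exact: intgZ|exact: intg_cst].
have SE w : S w = ulim U (fun n => s n (w n)).
  rewrite [RHS](@ulim_affine _ (fun k n => \1_(F k n) (w n)) (2 * D / N.+1%:R) D); last by move=> k n; exact: norm_indic_le1.
  by congr (_ * _ - _); apply: eq_bigr => k _; rewrite stdpart_indic.
have ES : expct loeb S = ulim U (fun n => expct (P n) (s n)).
  rewrite (_ : (fun n => _) = fun n => 2 * D / N.+1%:R * (\sum_(k < N.+1) prb (P n) (F k n)) - D); last first.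
    by apply/funext => n; exact: (st n).2.
  rewrite (@ulim_affine _ (fun k n => prb (P n) (F k n))); last by move=> k n; exact: prb_bnd.
  rewrite expctB ?expctZ//; [|exact: intgZ|exact: intg_cst].
  rewrite (expct_cst loeb) (@expct_sum _ _ _ _ _ _ (fun (k : 'I_N.+1) (w : LT) => \1_(internal (F k) : set LT) w))//.
  congr (_ * _ - _); apply: eq_bigr => k _; rewrite -loebE// -prb_indic//; exact: measurable_internal.
have close (u v : nat -> R) K : (forall n, `|u n| <= K) -> (forall n, `|u n - v n| <= 2 * D / N.+1%:R) ->
    `|ulim U u - ulim U v| <= 2 * D / N.+1%:R.
  move=> uK uv; rewrite -(@ulimB _ _ _ _ _ (K + 2 * D / N.+1%:R)).
  - by apply: ulim_norm; exact: nearW.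
  - by apply: nearW => n; rewrite (le_trans (uK n))// lerDl divr_ge0// mulr_ge0// ltW.
  - apply: nearW => n; rewrite -[v n](subKr (u n)).
    by apply: (le_trans (ler_normB _ _)); apply: lerD.
have h1 : `|expct loeb (stdpart g) - expct loeb S| <= 2 * D / N.+1%:R.
  rewrite -expctB//; apply: (le_trans (expct_norm _)); first exact: intgB.
  rewrite -[leRHS](expct_cst loeb); apply: expct_le; [by apply: intg_norm; exact: intgB|exact: intg_cst|].
  by move=> w; rewrite SE; apply: (close _ _ C) => n; [exact: gC|exact: gs].
have h2 : `|ulim U (fun n => expct (P n) (g n)) - expct loeb S| <= 2 * D / N.+1%:R.
  have bnd n (X : Omega n -> R) K : intg (P n) X -> (forall w, `|X w| <= K) -> `|expct (P n) X| <= K.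
    move=> iX XK; apply: (le_trans (expct_norm iX)); rewrite -[leRHS](expct_cst (P n)).
    by apply: expct_le => //; [exact: intg_norm|exact: intg_cst].
  rewrite ES; apply: (close _ _ C) => n; first exact: bnd.
  by rewrite -expctB ?(st n).1//; apply: bnd => //; apply: intgB => //; exact: (st n).1.
rewrite -mulrA -[X in `|X|](subrKA (expct loeb S)) [X in _ <= X]mulr_natl mulr2n.
by apply: (le_trans (ler_normD _ _)); rewrite [in X in _ + X]distrC lerD.
Qed.

End loeb.
Arguments stdpart {R} U {disp Omega} g w.
Arguments internal U {disp Omega} F w.

(** * Events of the Loeb space approximated by internal events *)

Section approx.
Context (R : realType) (U : free_ultrafilter).
Context (disp : nat -> measure_display) (Omega : forall n, measurableType (disp n)).
Context (P : forall n, probability (Omega n) R).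
Notation FU := (free_sets U).
Notation T := (uprod U Omega).
Notation LT := (g_sigma_algebraType (@measurable _ T)).
Notation L := (loeb P : probability LT R).
Definition symdiff (A B : set LT) : set LT := (A `\` B) `|` (B `\` A).

(* The events on which a martingale property of the prelimit processes, for the
   filtrations F n, survives in the limit. *)
Definition uapprox (F : forall n, set (set (Omega n))) : set (set LT) := [set E | measurable E /\
  forall e : R, 0 < e -> exists2 A : forall n, set (Omega n),
    (forall n, F n (A n)) & prb L (symdiff E (internal U A)) <= e].

Let msymdiff (A B : set LT) : measurable A -> measurable B -> measurable (symdiff A B).
Proof. by move=> mA mB; apply: measurableU; exact: measurableD. Qed.

Lemma uapprox_internal (F : forall n, set (set (Omega n))) A :
  (forall n, F n `<=` measurable) -> (forall n, F n (A n)) -> uapprox F (internal U A).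
Proof.
move=> Fm FA; split.
  by apply: measurable_internal => n; exact: Fm.
by move=> e e0; exists A => //; rewrite /symdiff setDv setU0 prb0 ltW.
Qed.

(** For a countable union, half of e pays for truncating it to k sets and the other half for
    approximating these k sets. *)
Lemma sigma_algebra_uapprox (F : forall n, set (set (Omega n))) :
  (forall n, sigma_algebra setT (F n)) -> (forall n, F n `<=` measurable) ->
  sigma_algebra setT (uapprox F).
Proof.
move=> sF Fm.
have Fmeas A : (forall n, F n (A n)) -> measurable (internal U A : set LT).
  by move=> FA; apply: measurable_internal => n; exact: Fm.
split.
- rewrite -(internal0 U Omega); apply: uapprox_internal => // n.
  by have [] := sF n.
- move=> E [mE HE]; rewrite setTD; split; first exact: measurableC.
  move=> e e0; have [A FA Ae] := HE e e0; exists (fun n => ~` A n).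
    by move=> n; have [_ + _] := sF n => /(_ _ (FA n)); rewrite setTD.
  rewrite internalC (_ : symdiff _ _ = symdiff E (internal U A))//.
  by rewrite /symdiff !setDE !setCK setUC; congr (_ `|` _); rewrite setIC.
move=> E HE; have mE k : measurable (E k) by have [] := HE k.
split; first exact: bigcupT_measurable.
move=> e e0; pose UE k := \big[setU/set0]_(i < k) E i.
have mUE k : measurable (UE k) by exact: bigsetU_measurable.
have UEcvg := prb_cvg_bigcup (P := L) mE.
have [k ke] : exists k, prb L (\bigcup_i E i `\` UE k) <= e / 2.
  have [k _ /(_ k (leqnn _)) ke] : \forall k \near \oo,
      prb L (\bigcup_i E i) - e / 2 < prb L (UE k).
    by apply: (cvgr_gt _ UEcvg); rewrite ltrBlDr ltrDl divr_gt0.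
  exists k; rewrite prbD//.
  - by rewrite lerBlDr addrC -lerBlDr ltW.
  - exact: bigcupT_measurable.
  - by rewrite /UE -(bigcup_mkord k E) => x [i _ Ei]; exists i.
(* k may be 0, hence the division by k + 1. *)
have d0 : 0 < e / 2 / k.+1%:R by rewrite !divr_gt0.
have /choice[A AP] : forall i, exists A : forall n, set (Omega n), (forall n, F n (A n)) /\
    prb L (symdiff (E i) (internal U A)) <= e / 2 / k.+1%:R.
  by move=> i; have [A FA Ae] := (HE i).2 _ d0; exists A.
exists (fun n => \big[setU/set0]_(i < k) A i n).
  move=> n; rewrite -(sigma_algebra_id (sF n)).
  apply: (@bigsetU_measurable _ (g_sigma_algebraType (F n))) => i _.
  by apply: sub_sigma_algebra; exact: (AP i).1.
rewrite internal_bigU.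
have mA i : measurable (internal U (A i) : set LT) by apply: Fmeas; exact: (AP i).1.
have ms i : measurable (symdiff (E i) (internal U (A i))) by exact: msymdiff.
apply: (@le_trans _ _ (prb L ((\bigcup_i E i `\` UE k) `|`
    \big[setU/set0]_(i < k) symdiff (E i) (internal U (A i))))).
  apply: prb_le.
  - apply: msymdiff; first exact: bigcupT_measurable.
    by apply: bigsetU_measurable.
  - apply: measurableU; last exact: bigsetU_measurable.
    by apply: measurableD => //; exact: bigcupT_measurable.
  - rewrite /UE -(bigcup_mkord k E) -(bigcup_mkord k (fun i => internal U (A i) : set LT)).
    rewrite -(bigcup_mkord k (fun i => symdiff (E i) (internal U (A i)))) => w [[Ew nA]|[[i ik Aiw] nE]].
    + have [UEw|UEw] := pselect ((\bigcup_(i < k) E i) w); last by left.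
      by right; case: UEw => i ik Eiw; exists i => //; left; split => // Aiw; apply: nA; exists i.
    + by right; exists i => //; right; split=> // Eiw; apply: nE; exists i.
apply: (le_trans (prbU _ _ _)).
- by apply: measurableD => //; exact: bigcupT_measurable.
- exact: bigsetU_measurable.
rewrite [leRHS]splitr; apply: lerD => //.
apply: (le_trans (prb_bigU _ _ ms)).
apply: (@le_trans _ _ (\sum_(i < k) e / 2 / k.+1%:R)).
  by apply: ler_sum => i _; exact: (AP i).2.
rewrite sumr_const card_ord -[leLHS]mulr_natr mulrAC ler_pdivrMr//.
by rewrite ler_wpM2l ?ler_nat// divr_ge0// ltW.
Qed.

(** Replacing E by an internal event costs at most C times the probability of the symmetric
    difference. On an internal event the mean is the ultralimit of the prelimit means, which is
    0. *)
Lemma expct_uapprox_eq0 (F : forall n, set (set (Omega n))) (g : forall n, Omega n -> R) C E :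
  (forall n, F n `<=` measurable) ->
  (forall n, measurable_fun setT (g n)) -> (forall n w, `|g n w| <= C) ->
  (forall A : forall n, set (Omega n), (forall n, F n (A n)) ->
    expct (P n) (fun w => \1_(A n) w * g n w) @[n --> free_sets U] --> 0) ->
  uapprox F E -> expct L (fun w => \1_E w * stdpart U g w) = 0.
Proof.
move=> Fm mg gC gA [mE HE]; have C0 : 0 <= C by exact: le_trans (gC 0%N point).
have ig := intg_stdpart U P gC mg.
apply/eqP; rewrite -normr_eq0 eq_le normr_ge0 andbT.
apply/ler_addgt0Pl => e e0; rewrite addr0.
have d0 : 0 < e / (C + 1) by rewrite divr_gt0// ltr_wpDl.
have [A FA Ae] := HE _ d0.
have mA : measurable (internal U A : set LT) by apply: measurable_internal => n; exact: Fm.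
have mAn n : measurable (A n) by exact: Fm.
have mgA n : measurable_fun setT (fun w => \1_(A n) w * g n w).
  by apply: measurable_funM => //; exact: mfun_indic.
have gAC n w : `|\1_(A n) w * g n w| <= C.
  by rewrite normrM (le_trans _ (gC n w))// ler_piMl// norm_indic_le1.
have A0 : expct L (fun w => \1_(internal U A) w * stdpart U g w) = 0.
  transitivity (expct L (stdpart U (fun n w => \1_(A n) w * g n w))).
    rewrite /expct; congr Rintegral; apply/funext => w; rewrite stdpart_indic /stdpart -(@ulimM _ _ _ _ _ (C + 1))//.
    - by apply: nearW => n; apply: (le_trans (norm_indic_le1 _ _ _)); rewrite lerDr.
    - by apply: nearW => n; apply: (le_trans (gC _ _)); rewrite lerDl.
  by rewrite (expct_stdpart U P mgA gAC); apply: ulim_eq; exact: gA.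
rewrite -[X in `|X|]subr0 -A0 -expctB; [|exact: intg_mul1|exact: intg_mul1].
apply: (le_trans (expct_norm _)).
  by apply: intgB; exact: intg_mul1.
apply: (@le_trans _ _ (expct L (fun w => C * \1_(symdiff E (internal U A)) w))).
  apply: expct_le.
  - by apply: intg_norm; apply: intgB; exact: intg_mul1.
  - by apply: intgZ; apply: intg_indic; exact: msymdiff.
  - move=> w; rewrite -mulrBl normrM mulrC; apply: ler_pM => //; first exact: stdpart_bnd.
    have [Ew|Ew] := pselect (E w); have [Aw|Aw] := pselect (internal U A w).
    + by rewrite (indicT _ Ew) (indicT _ Aw) subrr normr0 indicE.
    + by rewrite (indicT _ Ew) (indicF _ Aw) subr0 normr1 indicT//; left.
    + by rewrite (indicF _ Ew) (indicT _ Aw) sub0r normrN normr1 indicT//; right.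
    + by rewrite (indicF _ Ew) (indicF _ Aw) subrr normr0 indicE.
rewrite expctZ; last by apply: intg_indic; exact: msymdiff.
rewrite -prb_indic; last exact: msymdiff.
apply: (@le_trans _ _ (C * (e / (C + 1)))); first exact: ler_wpM2l.
by rewrite mulrCA ler_piMr ?ltW// ltr_pdivrMr ?mul1r ?ltrDl// ltr_wpDl.
Qed.

End approx.

(** * Zeros of Bessel processes *)

Lemma measurable_sqrt (R : realType) : measurable_fun setT (@Num.sqrt R).
Proof. by apply: continuous_measurable_fun; exact: sqrt_continuous. Qed.

(** * Gaussian shifts and exponential martingales *)

Section density.
Context d (T : measurableType d) (R : realType).
Import HBNNSimple.

(** The nu-integral of a simple function below f is the mu-integral of this function times the
    density, hence at most the right-hand side; the supremum over simple functions gives the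
    bound. *)
Lemma integral_density_le (mu nu : {measure set T -> \bar R}) (f g : T -> R) :
  measurable_fun setT g -> (forall x, 0 <= g x) ->
  (forall A, measurable A -> nu A = (\int[mu]_(x in A) (g x)%:E)%E) ->
  measurable_fun setT f -> (forall x, 0 <= f x) ->
  (\int[nu]_x (f x)%:E <= \int[mu]_x (f x * g x)%:E)%E.
Proof.
move=> mg g0 nuE mf f0.
rewrite ge0_integralTE; last by move=> x; rewrite lee_fin.
apply: ge_ereal_sup => _ [h /= hf <-].
rewrite sintegralE.
have mA r : measurable (h @^-1` [set r]) by exact: measurable_funPTI.
have E r : ((range h) r -> r%:E * nu (h @^-1` [set r]) =
    \int[mu]_x (r * \1_(h @^-1` [set r]) x * g x)%:E)%E.
  move=> [x _ xr]; have r0 : 0 <= r by rewrite -xr.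
  rewrite nuE// integral_mkcond -ge0_integralZl//=; last 2 first.
  - apply/(measurable_restrictT _ _).1 => //.
    by apply/measurable_EFinP; exact: measurable_funTS.
  - by move=> y _; rewrite patchE; case: ifPn => // _; rewrite lee_fin.
  apply: eq_integral => y _; rewrite patchE indicE; case: ifPn => _.
    by rewrite mulr1 EFinM.
  by rewrite mulr0 mul0r mule0.
rewrite (eq_fsbigr (fun r => \int[mu]_x (r * \1_(h @^-1` [set r]) x * g x)%:E)%E); last first.
  by move=> r /set_mem; exact: E.
rewrite -ge0_integral_fsum//; last 2 first.
- move=> r; apply/measurable_EFinP; apply: measurable_funM => //.
  by apply: measurable_funM => //; exact: measurable_indic.
- move=> r x _; rewrite lee_fin; have [hx|hx] := pselect ((h @^-1` [set r]) x).
    by rewrite indicT// mulr1 mulr_ge0// -hx.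
  by rewrite indicF// mulr0 mul0r.
apply: ge0_le_integral => //.
- move=> x _; apply: fsume_ge0 => r _; rewrite lee_fin; have [hx|hx] := pselect ((h @^-1` [set r]) x).
    by rewrite indicT// mulr1 mulr_ge0// -hx.
  by rewrite indicF// mulr0 mul0r.
- apply: emeasurable_fsum => // r; apply/measurable_EFinP; apply: measurable_funM => //.
  by apply: measurable_funM => //; exact: measurable_indic.
- by apply/measurable_EFinP; exact: measurable_funM.
move=> x _; under eq_fsbigr do rewrite EFinM.
rewrite -ge0_mule_fsuml; last by move=> r; exact: nnfun_muleindic_ge0.
rewrite fsumEFin// -fimfunE -EFinM lee_fin ler_wpM2r//.
by rewrite -lee_fin; exact: hf.
Qed.

End density.

Section normal.
Context (R : realType).

(** Completing the square: the exponential factor moves the mean from 0 to b s^2. *)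
Lemma normal_pdf_shift (s b y : R) : s != 0 ->
  expR (b * y - b ^+ 2 * s ^+ 2 / 2) * normal_pdf 0 s y = normal_pdf (b * s ^+ 2) s y.
Proof.
move=> s0; rewrite !normal_pdfE// /normal_fun mulrCA -expRD.
congr (_ * expR _); by rewrite subr0 -mulr_natr; field.
Qed.

End normal.

Section gaussian_increments.
Context d (T : measurableType d) (R : realType) (P : probability T R).

Lemma normal_mgf_le (s b : R) : s != 0 ->
  (\int[normal_prob 0 s]_y (expR (b * y - b ^+ 2 * s ^+ 2 / 2))%:E <= 1)%E.
Proof.
move=> s0; rewrite -(integral_normal_pdf (b * s ^+ 2) s).
under [leRHS]eq_integral do rewrite -normal_pdf_shift//.
apply: integral_density_le => //.
- exact: measurable_normal_pdf.
- by move=> x; exact: normal_pdf_ge0.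
- by apply: measurableT_comp => //; apply: measurable_funB => //.
Qed.

(** The hypothesis says that the joint law of (w, Y w) agrees with a product measure on rectangles,
    hence everywhere; Tonelli's theorem concludes. The first factor is the sample space with the
    smaller sigma-algebra generated by G. *)
Lemma integral_independent (G : set (set T)) (Y : T -> R) (N : probability (measurableTypeR R) R)
   (phi : g_sigma_algebraType G * measurableTypeR R -> \bar R) :
  <<s G >> `<=` measurable -> measurable_fun setT Y ->
  (forall E, <<s G >> E -> forall V, measurable V ->
     (P (E `&` Y @^-1` V) = P E * N V)%E) ->
  measurable_fun setT phi -> (forall z, 0 <= phi z)%E ->
  (\int[P]_w phi (w, Y w) = \int[P]_w \int[N]_y phi (w, y))%E.
Proof.
move=> Gm mY ind mphi phi0.
pose idG : T -> g_sigma_algebraType G := id.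
have mid : measurable_fun setT idG by move=> _ B mB; rewrite setTI; exact: Gm.
pose pr : T -> (g_sigma_algebraType G * measurableTypeR R)%type := fun w => (w, Y w).
have mpr : measurable_fun setT pr by apply/measurable_fun_pairP; split.
pose PG := law P mid; pose PY := law P mpr.
transitivity (\int[PY]_z phi z)%E; first by rewrite (ge0_integral_law P mpr mphi phi0).
transitivity (\int[PG \x N]_z phi z)%E.
  apply: eq_measure_integral => A mA _; apply/esym.
  apply: product_measure_unique => // B C mB mC.
  exact: (ind B mB C mC).
rewrite fubini_tonelli1// ge0_integral_law//.
- exact: measurable_fun_fubini_tonelli_F.
- by move=> w; apply: integral_ge0 => y _.
Qed.

End gaussian_increments.

Section exponential_martingale.
Context d (T : measurableType d) (R : realType) (P : probability T R).
Context (F : R -> set (set T)).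
Hypothesis Ffil : filtration F.
Notation GT t := (g_sigma_algebraType (F t)).

Lemma filtration_id t : 0 <= t -> <<s F t >> = F t.
Proof. by move=> t0; apply: sigma_algebra_id; case: Ffil => + _ _; exact. Qed.

Lemma filtration_sub t : 0 <= t -> <<s F t >> `<=` measurable.
Proof. by move=> t0; rewrite filtration_id//; case: Ffil => _ + _; exact. Qed.

Lemma measurable_fun_filtration (s t : R) (h : T -> R) : 0 <= s -> s <= t ->
  measurable_fun [set: GT s] h -> measurable_fun [set: GT t] h.
Proof.
move=> s0 st mh _ B mB; have := mh measurableT B mB.
rewrite /measurable/= !filtration_id//; last exact: le_trans st.
by case: Ffil => _ _; exact.
Qed.

Lemma adapted_measurable (X : T -> R -> R) t : 0 <= t -> adapted F X ->
  measurable_fun [set: GT t] (X ^~ t).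
Proof.
move=> t0 aX _ B mB; rewrite setTI /measurable/= filtration_id//.
exact: aX.
Qed.

(** Given F (u n), the last increment of B is normal with variance u (n+1) - u n, and half the
    variance of the exponent is subtracted, so the last factor has conditional mean at most 1.
    Induction removes the factors one by one; working with integrals of nonnegative functions allows
    H to be unbounded. *)
Lemma exponential_martingale_le1 (B : T -> R -> R) (u c : nat -> R) (H : nat -> T -> R) n :
  brownian_motion P F B -> 0 <= u 0%N -> (forall k, u k < u k.+1) ->
  (forall k, measurable_fun [set: GT (u k)] (H k)) ->
  (\int[P]_w (expR (\sum_(k < n) (c k * H k w * (B w (u k.+1) - B w (u k)) -
     (c k * H k w) ^+ 2 * (u k.+1 - u k) / 2)))%:E <= 1)%E.
Proof.
move=> [B0 _ aB indB] u0 uS mH.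
have umono : {homo u : i j / (i <= j)%N >-> i <= j}.
  apply: homo_leq => [x|x y z|i]; [exact: lexx|exact: le_trans|exact/ltW/uS].
have un0 k : 0 <= u k by exact: le_trans (umono 0%N k _).
elim: n => [|n IH].
  under eq_integral do rewrite big_ord0 expR0.
  by rewrite integral_cst//= probability_setT mule1.
pose b w := c n * H n w; pose s := Num.sqrt (u n.+1 - u n).
pose D w := expR (\sum_(k < n) (c k * H k w * (B w (u k.+1) - B w (u k)) -
     (c k * H k w) ^+ 2 * (u k.+1 - u k) / 2)).
have dn0 : 0 < u n.+1 - u n by rewrite subr_gt0.
have s0 : s != 0 by rewrite gt_eqF// sqrtr_gt0.
have s2 : s ^+ 2 = u n.+1 - u n by rewrite sqr_sqrtr// ltW.
have mB k t : u k <= t -> measurable_fun [set: GT t] (B ^~ (u k)).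
  by move=> ukt; apply: (@measurable_fun_filtration (u k)) => //; exact: adapted_measurable.
have mD : measurable_fun [set: GT (u n)] D.
  apply: measurableT_comp => //.
  apply: (@measurable_sum _ (GT (u n)) _ _ _ _ (fun (k : 'I_n) w => c k * H k w * (B w (u k.+1) - B w (u k)) -
     (c k * H k w) ^+ 2 * (u k.+1 - u k) / 2)) => k.
  have mHk : measurable_fun [set: GT (u n)] (fun w => c k * H k w).
    apply: measurable_funM => //; apply: (@measurable_fun_filtration (u k)) => //.
    exact/umono/ltnW.
  apply: measurable_funB; last first.
    by apply: measurable_funM => //; apply: measurable_funM => //; exact: measurable_funX.
  apply: measurable_funM => //; apply: measurable_funB; apply: mB; apply: umono => //.
  exact: ltnW.
have mb : measurable_fun [set: GT (u n)] b by exact: measurable_funM.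
(* The first variable carries what is known at time u n, the second one the last Brownian
   increment. *)
pose phi (z : GT (u n) * measurableTypeR R) : \bar R :=
  (D z.1 * expR (b z.1 * z.2 - b z.1 ^+ 2 * s ^+ 2 / 2))%:E.
have mphi : measurable_fun setT phi.
  apply/measurable_EFinP; apply: measurable_funM.
    exact: measurableT_comp.
  have mb1 : measurable_fun setT (fun z : GT (u n) * measurableTypeR R => b z.1).
    exact: measurableT_comp.
  apply: measurableT_comp => //; apply: measurable_funB.
    by apply: measurable_funM => //; exact: measurable_snd.
  apply: measurable_funM => //; apply: measurable_funM => //.
  exact: measurable_funX.
have phi0 z : (0 <= phi z)%E by rewrite lee_fin mulr_ge0// expR_ge0.
pose Y w := B w (u n.+1) - B w (u n).
have mY : measurable_fun setT Y.
  by apply: measurable_funB; apply: (mfun_sub (filtration_sub (un0 n.+1))); apply: mB; exact: umono.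
apply: le_trans IH; rewrite (eq_integral (fun w => phi (w, Y w))); last first.
  move=> w _; rewrite /phi/= -expRD big_ord_recr/=; congr (expR (_ + (_ - _)))%:E.
  by rewrite s2 /b.
rewrite (@integral_independent _ _ _ P (F (u n)) Y (normal_prob 0 s) phi)//; last 2 first.
- exact: filtration_sub.
- move=> E; rewrite filtration_id// => FE V mV.
  exact: (indB (u n) (u n.+1)).
apply: ge0_le_integral => //.
- by move=> w _; apply: integral_ge0 => y _.
- apply: (@measurable_funS _ _ _ _ setT) => //.
  have := @measurable_fun_fubini_tonelli_F _ _ (GT (u n)) (measurableTypeR R) R (normal_prob 0 s) phi mphi phi0.
  move=> mf _ A mA; apply: (filtration_sub (un0 n)); exact: mf.
- apply/measurable_EFinP; exact: (mfun_sub (filtration_sub (un0 n)) mD).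
- move=> w _; rewrite /phi/=; under eq_integral do rewrite EFinM.
  rewrite ge0_integralZl//; last 2 first.
  + apply/measurable_EFinP; apply: measurableT_comp => //.
    by apply: measurable_funB => //; exact: measurable_funM.
  + by rewrite lee_fin expR_ge0.
  rewrite -[leRHS]mule1; apply: lee_wpmul2l; first by rewrite lee_fin expR_ge0.
  exact: normal_mgf_le.
Qed.

End exponential_martingale.

(** * A discrete Riccati inequality *)

Section riccati.
Context (R : realType).

Lemma big_ord_mul (m l : nat) (a : nat -> R) :
  \sum_(k < m * l) a k = \sum_(j < m) \sum_(i < l) a (j * l + i)%N.
Proof.
elim: m => [|m IH]; first by rewrite mul0n !big_ord0.
by rewrite mulSnr big_split_ord/= IH big_ord_recr.
Qed.

(* [g] samples the solution of [g' = 2 g^2] that blows up at time [t + eta]. *)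
Lemma riccati_sum_ge (t eta Del delta : R) (m : nat) (X g : nat -> R) :
  (forall j, g j = (2 * (t + eta - j%:R * Del))^-1) -> 0 < eta -> 0 < Del -> m%:R * Del = t -> Del <= eta -> 0 < delta ->
  (forall j, 0 <= X j) -> X m = 0 ->
  delta / 2 * ln (t / (2 * eta)) <=
  \sum_(j < m) (- g j * (X j.+1 - X j - delta * Del) - 2 * g j ^+ 2 * Del * X j.+1).
Proof.
move=> gE eta0 Del0 mt Deleta delta0 X0 Xm.
pose a (j : nat) : R := t + eta - j%:R * Del.
have aS j : a j.+1 = a j - Del by rewrite /a -natr1 mulrDl mul1r opprD addrA.
have a_gt j : (j <= m)%N -> eta <= a j.
  move=> jm; rewrite /a addrAC lerDr subr_ge0 -mt ler_wpM2r ?ler_nat//.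
  exact: ltW.
have a_gt0 j : (j <= m)%N -> 0 < a j by move=> /a_gt; exact: lt_le_trans.
(* Summation by parts with boundary term g J * X J. The discrete Riccati inequality [h1], g J + 2 (g
   J)^2 Del <= g (J + 1), absorbs the terms in X. The logarithms are shifted by Del so that their
   increments, ln (a J + Del) - ln (a J), are at most Del / a J by [h2]. *)
have key J : (J <= m)%N ->
  delta / 2 * (ln (a 0%N + Del) - ln (a J + Del)) - g J * X J <=
  \sum_(j < J) (- g j * (X j.+1 - X j - delta * Del) - 2 * g j ^+ 2 * Del * X j.+1).
  elim: J => [_|J IH Jm].
    by rewrite big_ord0 subrr mulr0 sub0r oppr_le0 mulr_ge0// gE invr_ge0 mulr_ge0// ltW//; exact: a_gt0.
  rewrite big_ord_recr/=; have := IH (ltnW Jm) => {}IH.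
  have aJ0 := a_gt0 _ (ltnW Jm); have aJ1 := a_gt0 _ Jm.
  have gJ : g J = (2 * a J)^-1 by rewrite gE.
  have gJ1 : g J.+1 = (2 * a J.+1)^-1 by rewrite gE.
  have h1 : g J + 2 * g J ^+ 2 * Del <= g J.+1.
    rewrite gJ gJ1 aS.
    have -> : (2 * a J)^-1 + 2 * (2 * a J)^-1 ^+ 2 * Del = (2 * a J)^-1 * (1 + Del / a J).
      by field; rewrite gt_eqF.
    rewrite !invfM -mulrA ler_pM2l ?invr_gt0// -aS.
    rewrite -[leRHS]mul1r ler_pdivlMr// aS.
    have -> : (a J)^-1 * (1 + Del / a J) * (a J - Del) = 1 - (Del / a J) ^+ 2.
      by field; rewrite gt_eqF.
    by rewrite gerBl sqr_ge0.
  have h2 : ln (a J + Del) - ln (a J) <= Del / a J.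
    have e1 : (a J + Del) / a J = 1 + Del / a J by rewrite mulrDl divff ?gt_eqF.
    have q1 : a J + Del \is Num.pos by rewrite posrE addr_gt0.
    have q2 : a J \is Num.pos by rewrite posrE.
    rewrite -(ln_div q1 q2) e1; apply: le_ln1Dx; apply: (lt_le_trans (ltrN10 _)).
    by rewrite divr_ge0 ?ltW.
  have h3 : delta / 2 * (ln (a J + Del) - ln (a J.+1 + Del)) <= g J * (delta * Del).
    rewrite aS subrK; apply: (@le_trans _ _ (delta / 2 * (Del / a J))).
      by rewrite ler_pM2l// divr_gt0.
    by rewrite gJ le_eqVlt; apply/orP; left; apply/eqP; field; rewrite gt_eqF.
  have h4 : (g J + 2 * g J ^+ 2 * Del) * X J.+1 <= g J.+1 * X J.+1.
    by rewrite ler_wpM2r.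
  move: IH h3 h4; rewrite !mulrDl !mulrBr !mulNr.
  set s := \sum_(_ < _) _; set A := delta / 2 * _; set B := delta / 2 * _.
  set C := delta / 2 * _; lra.
have := key m (leqnn m); rewrite Xm mulr0 subr0; apply: le_trans.
have -> : a 0%N + Del = t + eta + Del by rewrite /a mul0r subr0.
have -> : a m + Del = eta + Del by rewrite /a mt [t + eta]addrC addrK.
rewrite ler_pM2l ?divr_gt0//.
have t0 : 0 <= t by rewrite -mt mulr_ge0// ltW.
have q0 : 0 < eta + Del by rewrite addr_gt0.
have q1 : t + eta + Del \is Num.pos by rewrite posrE -addrA ltr_wpDl.
have q2 : eta + Del \is Num.pos by rewrite posrE.
rewrite -(ln_div q1 q2).
have [->|tn0] := eqVneq t 0.
  by rewrite mul0r ln0// add0r divff ?ln1// gt_eqF.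
have tp : 0 < t by rewrite lt_neqAle eq_sym tn0.
have e20 : 0 < 2 * eta by rewrite mulr_gt0.
have q3 : t / (2 * eta) \is Num.pos by rewrite posrE divr_gt0.
have q4 : (t + eta + Del) / (eta + Del) \is Num.pos by rewrite posrE divr_gt0.
(* (t + eta + Del) / (eta + Del) >= t / (2 eta), because Del <= eta. *)
rewrite ler_ln//; apply: ler_pM; rewrite ?invr_ge0// ?(ltW e20)//.
  by rewrite -addrA lerDl ltW.
have q5 : 2 * eta \is Num.pos by rewrite posrE.
by rewrite lef_pV2// mulr2n mulrDl mul1r lerD2l.
Qed.

End riccati.

Section bessel.
Context d (T : measurableType d) (R : realType) (P : probability T R).

Lemma cvg_prob0_prb (Y : nat -> T -> R) (e : R) : 0 < e ->
  (forall n, mfun (Y n)) ->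
  cvg_prob0 (fun _ : nat => P) (fun n w => (Y n w)%:E) ->
  prb P [set w | e < `|Y n w|] @[n --> \oo] --> 0.
Proof.
move=> e0 mY /(_ _ e0) H.
have mA n : measurable [set w | e < `|Y n w|].
  exact/measurable_gt_cst/mfun_norm/mY.
have : P [set w | (e%:E < `|(Y n w)%:E|)%E] @[n --> \oo] --> 0%:E by [].
rewrite (_ : (fun n => _) = EFin \o (fun n => prb P [set w | e < `|Y n w|])).
  by move/fine_cvgP => [_].
by apply/funext => n /=; rewrite -prb_fin.
Qed.

(** If X vanished at t with probability p > 0, consider the exponential martingale with integrand -2
    g sqrt(X). After integrating g dX by parts, g' = 2 g^2 cancels the terms in X ds, and the
    exponent is g_0 X_0 - g_t X_t + delta times the integral of g. Where X_t = 0 it is at least this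
    last term, which is arbitrarily large if g blows up soon after t, against a mean of at most
    1. *)
Lemma squared_bessel_neq0 (delta t : R) (X : T -> R -> R) :
  0 < delta -> 0 < t -> squared_bessel P delta X ->
  measurable [set w | X w t = 0] /\ prb P [set w | X w t = 0] = 0.
Proof.
move=> delta0 t0 [X0 cX [F [B [Ffil BM aX ito]]]].
have mX s : 0 <= s -> mfun (X ^~ s).
  by move=> s0; apply: (mfun_sub (filtration_sub Ffil s0)); exact: adapted_measurable.
have [_ _ aB _] := BM.
have mB s : 0 <= s -> mfun (B ^~ s).
  by move=> s0; apply: (mfun_sub (filtration_sub Ffil s0)); exact: adapted_measurable.
set A0 := [set w | _].
have mA0 : measurable A0.
  rewrite (_ : A0 = [set w | X w t <= 0]); first exact/measurable_le_cst/mX/ltW.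
  apply/seteqP; split=> w /=; rewrite /A0/=; first by move=> ->.
  by move=> h; apply/eqP; rewrite eq_le h X0// ltW.
split=> //; apply/eqP/negPn/negP => pn0.
have p0 : 0 < prb P A0 by rewrite lt_neqAle eq_sym pn0 prb_ge0.
set p := prb P A0 in p0 *.
(* Then exp (M - 2) * (p / 4) = 2, which contradicts the bound 1; the subtracted 2 is the budget for
   discretisation errors. The choice of [eta] makes the lower bound of [riccati_sum_ge] equal to
   M. *)
pose M := 2 + ln (8 / p).
pose eta := t / 2 * expR (- (2 * M / delta)).
have eta0 : 0 < eta by rewrite mulr_gt0 ?expR_gt0// divr_gt0.
have etaM : delta / 2 * ln (t / (2 * eta)) = M.
  have -> : t / (2 * eta) = expR (2 * M / delta).
    by rewrite /eta expRN; field; rewrite !gt_eqF// expR_gt0.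
  by rewrite expRK; field; rewrite gt_eqF.
pose gm := (2 * eta)^-1.
have gm0 : 0 < gm by rewrite invr_gt0 mulr_gt0.
(* [gm] bounds g. Replacing X at fine times by X at the right end of a coarse interval, up to e1,
   costs 2 gm^2 t e1 = 1 in total. The tolerance [e2] below for the Riemann sums costs 2 gm (m + 1)
   e2 = 1. *)
pose e1 := (2 * gm ^+ 2 * t)^-1.
have e10 : 0 < e1 by rewrite invr_gt0 mulr_gt0// mulr_gt0// exprn_gt0.
pose Del (m : nat) : R := t / m.+1%:R.
have Del0 m : 0 < Del m by rewrite divr_gt0.
pose tile (m : nat) (jil : nat * nat * nat) : set T := [set w |
  X w (jil.1.1%:R * Del m + jil.1.2%:R * (Del m / jil.2.+1%:R)) <= X w (jil.1.1.+1%:R * Del m) + e1].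
have mtile m jil : measurable (tile m jil).
  apply: measurable_leR; first by apply: mX; rewrite addr_ge0// mulr_ge0// ?divr_ge0// ltW.
  by apply: measurable_funD => //; apply: mX; rewrite mulr_ge0// ltW.
(* The triples (j, i, l) are enumerated by [pickle], so this is a countable intersection. It
   controls the fine partitions for all l at once, because l is chosen only after m. *)
pose good m : set T := A0 `&` \bigcap_(n in [set: nat]) (if unpickle n is Some jil then
   (if (jil.1.1 <= m)%N && (jil.1.2 <= jil.2)%N then tile m jil else setT) else setT).
have mgood m : measurable (good m).
  apply: measurableI => //; apply: bigcapT_measurable => n.
  by case: unpickle => // jil; case: ifP.
have goodP m w j i l : good m w -> (j <= m)%N -> (i <= l)%N ->
    X w (j%:R * Del m + i%:R * (Del m / l.+1%:R)) <= X w (j.+1%:R * Del m) + e1.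
  move=> [_ /(_ (pickle (j, i, l)) I)]; rewrite pickleK/= => + jm il.
  by rewrite jm il.
have good_ev w : A0 w -> exists N, forall m, (N <= m)%N -> good m w.
  move=> Aw; have [del del0 Hdel] := @heine R R _ (fun s : R => X w (Num.max s 0)) e1 (@segment_compact R 0 t) (continuous_max0 (cX w)) e10.
  exists (Num.truncn (t / del)) => m Nm; split=> // n _.
  case: unpickle => // -[[j i] l]; case: ifP => //= /andP[jm il]; rewrite /tile/=.
  have dm : Del m < del.
    rewrite /Del ltr_pdivrMr// mulrC -ltr_pdivrMr//.
    by apply: truncn_lt.
  set x := j%:R * _ + _; set y := j.+1%:R * _.
  have x0 : 0 <= x by rewrite addr_ge0// mulr_ge0// ?divr_ge0// ltW.
  have y0 : 0 <= y by rewrite mulr_ge0// ltW.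
  have xyE : y - x = Del m * (1 - i%:R / l.+1%:R).
    by rewrite /x /y -natr1; field; rewrite addrC natr1 pnatr_eq0.
  have il1 : (i%:R / l.+1%:R : R) <= 1 by rewrite ler_pdivrMr// mul1r ler_nat leqW.
  have xy : x <= y.
    by rewrite -subr_ge0 xyE mulr_ge0 ?subr_ge0// ltW.
  have yt : y <= t.
    by rewrite /y /Del mulrA ler_pdivrMr// mulrC ler_pM2l// ler_nat.
  have := Hdel x y; rewrite /= in_itv/= x0 (le_trans xy yt) => /(_ isT).
  rewrite !max_l// ger0_norm ?subr_ge0// xyE => H.
  have {H} : `|X w y - X w x| < e1.
    by apply: H; apply: le_lt_trans dm; rewrite ler_piMr// ?(ltW (Del0 _))// gerBl.
  by rewrite ltr_norml => /andP[+ _]; rewrite ltrBrDr addrC ltrBlDr => /ltW.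
(* By continuity of paths, each point of [A0] is good for all large m. Hence these events exhaust
   [A0], and some m yields a good event of probability above p / 2. *)
pose UG N : set T := \bigcap_(m in [set m | (N <= m)%N]) good m.
have mUG N : measurable (UG N) by apply: bigcap_measurable => //; exists N => /=.
have UUG : \bigcup_N UG N = A0.
  apply/seteqP; split=> [w [N _ /(_ N (leqnn N))] []//|w /good_ev[N HN]].
  by exists N => // m /=; exact: HN.
have := prb_cvg_bigcup (P := P) mUG; rewrite UUG => cvgUG.
have [kk _ /(_ kk (leqnn kk)) kp] : \forall k \near \oo, p / 2 < prb P (\big[setU/set0]_(i < k) UG i).
  by apply: (cvgr_gt _ cvgUG); rewrite ltr_pdivrMr// ltr_pMr// ltr1n.
pose m := maxn kk (Num.truncn (t / eta)).
have mp : p / 2 < prb P (good m).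
  apply: lt_le_trans kp _; apply: prb_le => //; first exact: bigsetU_measurable.
  rewrite -(bigcup_mkord kk UG) => w [i /= ik /(_ m)]; apply.
  by rewrite /= (leq_trans (ltnW ik))// leq_maxl.
have Dm : Del m <= eta.
  rewrite /Del ler_pdivrMr// mulrC -ler_pdivrMr//.
  apply: (le_trans (ltW (truncnS_gt _))); rewrite ler_nat ltnS leq_maxr//.
set D := Del m in Dm; have D0 : 0 < D by exact: Del0.
have mD : m.+1%:R * D = t by rewrite /D /Del mulrC divfK.
pose g (j : nat) := (2 * (t + eta - j%:R * D))^-1.
have jDt j : (j <= m.+1)%N -> j%:R * D <= t by move=> jm; rewrite -mD ler_pM2r// ler_nat.
have g0 j : (j <= m.+1)%N -> 0 < g j.
  by move=> /jDt h; rewrite invr_gt0 mulr_gt0// addrAC ltr_wpDl// subr_ge0.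
have ggm j : (j <= m.+1)%N -> g j <= gm.
  move=> jm; have q1 : 2 * eta \is Num.pos by rewrite posrE mulr_gt0.
  have q2 : 2 * (t + eta - j%:R * D) \is Num.pos.
    by rewrite posrE -invr_gt0; exact: g0.
  rewrite /gm /g lef_pV2// ler_pM2l// addrAC lerDr subr_ge0; exact: jDt.
pose e2 := (2 * gm * m.+1%:R)^-1.
have e20 : 0 < e2 by rewrite invr_gt0 !mulr_gt0.
pose u l (i : nat) : R := i%:R * (D / l.+1%:R).
have u0 l i : 0 <= u l i by rewrite mulr_ge0// divr_ge0// ltW.
pose H w s := 2 * Num.sqrt (X w s).
pose dB l w (i : nat) := H w (u l i) * (B w (u l i.+1) - B w (u l i)).
pose S l (j : nat) w := \sum_(i < j * l.+1) dB l w i.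
pose I w s := X w s - X w 0 - delta * s.
have mH s : 0 <= s -> mfun (H ^~ s).
  by move=> s0; apply: measurable_funM => //; apply: measurableT_comp; [exact: measurable_sqrt|exact: mX].
have mS l j : mfun (S l j).
  apply: (@measurable_sum _ _ _ _ _ _ (fun (i : 'I_(j * l.+1)) w => dB l w i)) => i.
  by apply: measurable_funM; [exact: mH|apply: measurable_funB; exact: mB].
have mI s : 0 <= s -> mfun (I ^~ s).
  by move=> s0; apply: measurable_funB => //; apply: measurable_funB; exact: mX.
have Scvg j : (0 < j)%N -> prb P [set w | e2 < `|S l j w - I w (j%:R * D)|] @[l --> \oo] --> 0.
  move=> j0; have jD0 : 0 <= j%:R * D by rewrite mulr_ge0// ltW.
  pose Y n w := \sum_(k < n) H w (k%:R * (j%:R * D) / n%:R) *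
    (B w (k.+1%:R * (j%:R * D) / n%:R) - B w (k%:R * (j%:R * D) / n%:R)) - I w (j%:R * D).
  have mY n : mfun (Y n).
    apply: measurable_funB; last exact: mI.
    apply: (@measurable_sum _ _ _ _ _ _ (fun (i : 'I_n) w => H w (i%:R * (j%:R * D) / n%:R) *
    (B w (i.+1%:R * (j%:R * D) / n%:R) - B w (i%:R * (j%:R * D) / n%:R)))) => i.
    have kk0 (k' : nat) : 0 <= k'%:R * (j%:R * D) / n%:R by rewrite divr_ge0// mulr_ge0.
    by apply: measurable_funM; [exact: mH|apply: measurable_funB; exact: mB].
  (* The hypothesis at time j D is used along partitions into j (l + 1) intervals, whose mesh D / (l
     + 1) is the same for every j. *)
  have := cvg_prob0_prb e20 mY (ito _ jD0) => Ycvg.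
  apply/cvgrPdist_lt => e e0; move/cvgrPdist_lt/(_ _ e0) : Ycvg => [N _ HN].
  exists N => // l /= Nl.
  have /= := HN (j * l.+1)%N (leq_trans Nl (leq_trans (leqnSn l) (leq_pmull _ j0))).
  congr (`| _ - prb P _| < e); apply/seteqP.
  have E w : Y (j * l.+1)%N w = S l j w - I w (j%:R * D).
    congr (_ - _); apply: eq_bigr => i _.
    have uE (k' : nat) : k'%:R * (j%:R * D) / (j * l.+1)%:R = u l k'.
      rewrite /u natrM; field; rewrite addrC natr1 !pnatr_eq0/= -lt0n j0//.
    by rewrite /dB !uE.
  by split=> w /=; rewrite E.
have S0 l w : S l 0%N w = I w (0%:R * D).
  by rewrite /S mul0n big_ord0 mul0r /I subrr mulr0 subr0.
have mBad l (j : nat) : measurable [set w | e2 < `|S l j w - I w (j%:R * D)|].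
  apply: measurable_gt_cst; apply: mfun_norm; apply: measurable_funB; first exact: mS.
  by apply: mI; rewrite mulr_ge0// ltW.
have q0 : 0 < p / 4 / m.+2%:R by rewrite !divr_gt0.
(* One l serves all m + 2 coarse times. The exceptional events have total probability at most p / 4,
   which leaves p / 4 of the good event. *)
have [l Hl] : exists l, forall j, (j < m.+2)%N ->
    prb P [set w | e2 < `|S l j w - I w (j%:R * D)|] <= p / 4 / m.+2%:R.
  have /choice[N HN] : forall j, exists N, forall l, (N <= l)%N ->
      prb P [set w | e2 < `|S l j w - I w (j%:R * D)|] <= p / 4 / m.+2%:R.
    case=> [|j].
      exists 0%N => l _; rewrite (_ : [set w | _] = set0) ?prb0 ?ltW//.
      by apply/seteqP; split=> w //=; rewrite S0 subrr normr0 ltNge (ltW e20).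
    have /cvgrPdist_lt/(_ _ q0)[N _ HN] := Scvg j.+1 isT.
    exists N => l Nl; have /ltW := HN l Nl; rewrite sub0r normrN ger0_norm//.
    exact: prb_ge0.
  exists (\max_(j < m.+2) N j) => j jm; apply: HN.
  exact: (@leq_bigmax _ (fun j : 'I_m.+2 => N j) (Ordinal jm)).
pose Bad : set T := \big[setU/set0]_(j < m.+2) [set w | e2 < `|S l j w - I w (j%:R * D)|].
have mBadU : measurable Bad by exact: bigsetU_measurable.
pose Gd := good m `\` Bad.
have mGd : measurable Gd by exact: measurableD.
have Gp : p / 4 <= prb P Gd.
  have h1 : prb P (good m) <= prb P Gd + prb P Bad.
    apply: le_trans (prbU P mGd mBadU); apply: prb_le => //; first exact: measurableU.
    by move=> w gw; have [|] := pselect (Bad w); [right|left].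
  have h2 : prb P Bad <= p / 4.
    apply: (le_trans (prb_bigU P _ (mBad l))).
    apply: (@le_trans _ _ (\sum_(j < m.+2) p / 4 / m.+2%:R)).
      by apply: ler_sum => j _; exact: Hl.
    by rewrite sumr_const card_ord -[leLHS]mulr_natr divfK.
  by move: mp h1 h2; lra.
(* The coefficient is constant on coarse intervals: k %/ l.+1 is the coarse index of the fine step
   k. *)
pose c (k : nat) := - g (k %/ l.+1)%N.
pose V w := \sum_(k < m.+1 * l.+1) (c k * H w (u l k) * (B w (u l k.+1) - B w (u l k)) -
     (c k * H w (u l k)) ^+ 2 * (u l k.+1 - u l k) / 2).
have du k : u l k.+1 - u l k = D / l.+1%:R by rewrite /u -mulrBl -natr1 addrAC subrr add0r mul1r.
have EV : (\int[P]_w (expR (V w))%:E <= 1)%E.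
  apply: (@exponential_martingale_le1 _ _ _ P F Ffil B (u l) c (fun i w => H w (u l i)) _ BM).
  - exact: u0.
  - by move=> i; rewrite -subr_gt0 du divr_gt0.
  - move=> i; apply: measurable_funM => //; apply: measurableT_comp; first exact: measurable_sqrt.
    exact: adapted_measurable.
have VM w : Gd w -> M - 2 <= V w.
  move=> [gw nBad].
  have SI (j : nat) : (j < m.+2)%N -> `|S l j w - I w (j%:R * D)| <= e2.
    move=> jm; rewrite leNgt; apply/negP => h; apply: nBad.
    by rewrite /Bad -(bigcup_mkord m.+2 (fun j => [set w | e2 < `|S l j w - I w (j%:R * D)|])); exists j.
  have XmE : X w (m.+1%:R * D) = 0 by rewrite mD; case: gw.
  have := @riccati_sum_ge R t eta D delta m.+1 (fun j => X w (j%:R * D)) g (fun=> erefl) eta0 D0 mD Dm delta0.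
  move=> /(_ (fun j => X0 w _ (mulr_ge0 (ler0n _ j) (ltW D0))) XmE).
  rewrite etaM lerBlDr => /le_trans; apply.
  have two : 2 = \sum_(j < m.+1) (gm * (2 * e2) + 2 * gm ^+ 2 * D * e1).
    rewrite sumr_const card_ord -[RHS]mulr_natr.
    have -> : (gm * (2 * e2) + 2 * gm ^+ 2 * D * e1) * m.+1%:R =
       2 * gm * m.+1%:R * e2 + 2 * gm ^+ 2 * (m.+1%:R * D) * e1 by ring.
    by rewrite mD /e2 /e1 !divff// ?gt_eqF ?mulr_gt0 ?exprn_gt0.
  have VE := @big_ord_mul R m.+1 l.+1 (fun k => c k * H w (u l k) * (B w (u l k.+1) - B w (u l k)) -
     (c k * H w (u l k)) ^+ 2 * (u l k.+1 - u l k) / 2).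
  rewrite [X in V w + X]two [V w]VE -big_split/=; apply: ler_sum => j _.
  have jm := ltn_ord j.
  have gj0 := g0 _ (ltnW jm); have gjm := ggm _ (ltnW jm).
  have blk : \sum_(i < l.+1) dB l w (j * l.+1 + i)%N = S l j.+1 w - S l j w.
    by rewrite /S mulSnr big_split_ord/= addrAC subrr add0r.
  (* Half the square of the integrand is g^2 (2 sqrt X)^2 / 2 = 2 g^2 X; being a good point bounds X
     at the fine times by its value at the right end of the coarse interval plus e1. *)
  have low : - g j * (S l j.+1 w - S l j w) - 2 * g j ^+ 2 * D * (X w (j.+1%:R * D) + e1) <=
    \sum_(i < l.+1) (c (j * l.+1 + i)%N * H w (u l (j * l.+1 + i)%N) *
       (B w (u l (j * l.+1 + i).+1) - B w (u l (j * l.+1 + i)%N)) -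
     (c (j * l.+1 + i)%N * H w (u l (j * l.+1 + i)%N)) ^+ 2 * (u l (j * l.+1 + i).+1 - u l (j * l.+1 + i)%N) / 2).
    rewrite -blk mulr_sumr.
    have -> : 2 * g j ^+ 2 * D * (X w (j.+1%:R * D) + e1) =
       \sum_(i < l.+1) 2 * g j ^+ 2 * (D / l.+1%:R) * (X w (j.+1%:R * D) + e1).
      by rewrite sumr_const card_ord -[RHS]mulr_natr; field; rewrite addrC natr1 pnatr_eq0.
    rewrite -sumrB; apply: ler_sum => i _.
    rewrite du /c divnMDl// divn_small// addn0 /dB mulrA lerD2l lerN2.
    have uE : u l (j * l.+1 + i)%N = j%:R * D + i%:R * (D / l.+1%:R).
      by rewrite /u natrD natrM; field; rewrite addrC natr1 pnatr_eq0.
    have XH : H w (u l (j * l.+1 + i)%N) ^+ 2 = 4 * X w (u l (j * l.+1 + i)%N).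
      by rewrite /H exprMn sqr_sqrtr ?X0//; ring.
    rewrite exprMn sqrrN XH.
    have -> : g j ^+ 2 * (4 * X w (u l (j * l.+1 + i)%N)) * (D / l.+1%:R) / 2 =
       2 * g j ^+ 2 * (D / l.+1%:R) * X w (u l (j * l.+1 + i)%N).
      by field; rewrite addrC natr1 pnatr_eq0.
    apply: ler_wpM2l.
      apply: mulr_ge0; first by rewrite mulr_ge0// sqr_ge0.
      by rewrite divr_ge0// ltW.
    rewrite uE; apply: (goodP m) => //; exact: (ltn_ord i).
  apply: (@le_trans _ _ (- g j * (S l j.+1 w - S l j w) - 2 * g j ^+ 2 * D * (X w (j.+1%:R * D) + e1) +
     (gm * (2 * e2) + 2 * gm ^+ 2 * D * e1))); last by rewrite lerD2r.
  have s1 := SI j (leqW jm); have s2 := SI j.+1 jm.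
  have IE : I w (j.+1%:R * D) - I w (j%:R * D) = X w (j.+1%:R * D) - X w (j%:R * D) - delta * D.
    by rewrite /I -natr1; ring.
  have h1 : g j * (S l j.+1 w - S l j w - (X w (j.+1%:R * D) - X w (j%:R * D) - delta * D)) <= gm * (2 * e2).
    rewrite -IE; apply: (@le_trans _ _ (g j * (2 * e2))); last first.
      by rewrite ler_wpM2r// mulr_ge0// ltW.
    rewrite ler_wpM2l ?(ltW gj0)// (_ : _ - _ = (S l j.+1 w - I w (j.+1%:R * D)) - (S l j w - I w (j%:R * D))); last by ring.
    by apply: le_trans (ler_norm _) (le_trans (ler_normB _ _) _); rewrite [leRHS]mulr_natl mulr2n lerD.
  have h2 : 2 * g j ^+ 2 * D * e1 <= 2 * gm ^+ 2 * D * e1.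
    rewrite ler_wpM2r ?(ltW e10)// ler_wpM2r ?(ltW D0)// ler_wpM2l//.
    by rewrite ler_sqr ?nnegrE ?(ltW gj0) ?(ltW gm0).
  rewrite -subr_ge0; apply: le_trans (_ : 0 <= (gm * (2 * e2) - g j * (S l j.+1 w - S l j w - (X w (j.+1%:R * D) - X w (j%:R * D) - delta * D))) + (2 * gm ^+ 2 * D * e1 - 2 * g j ^+ 2 * D * e1)) _.
    by rewrite addr_ge0// subr_ge0.
  by rewrite le_eqVlt; apply/orP; left; apply/eqP; ring.
have : ((expR (M - 2) * (p / 4))%:E <= 1%:E)%E.
  apply: le_trans EV; rewrite EFinM.
  apply: (@le_trans _ _ ((expR (M - 2))%:E * P Gd)%E).
    by apply: lee_wpmul2l; [rewrite lee_fin expR_ge0|rewrite prb_fin// lee_fin].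
  have -> : ((expR (M - 2))%:E * P Gd = \int[P]_(w in Gd) (expR (M - 2))%:E)%E.
    by rewrite integral_cst.
  have mV : mfun V.
    apply: (@measurable_sum _ _ _ _ _ _ (fun (i : 'I_(m.+1 * l.+1)) w => c i * H w (u l i) * (B w (u l i.+1) - B w (u l i)) -
     (c i * H w (u l i)) ^+ 2 * (u l i.+1 - u l i) / 2)) => i.
    have mcH : mfun (fun w => c i * H w (u l i)) by apply: measurable_funM => //; exact: mH.
    apply: measurable_funB.
      by apply: measurable_funM => //; apply: measurable_funB; exact: mB.
    by apply: measurable_funM => //; apply: measurable_funM => //; exact: measurable_funX.
  have meV : measurable_fun setT (fun w => (expR (V w))%:E).
    by apply/measurable_EFinP; exact: measurableT_comp.
  apply: (@le_trans _ _ (\int[P]_(w in Gd) (expR (V w))%:E)%E).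
    apply: ge0_le_integral => //.
    - exact: measurable_funS meV.
    - by move=> w Gw; rewrite lee_fin ler_expR; exact: VM.
  by apply: ge0_subset_integral => // w _; rewrite lee_fin expR_ge0.
rewrite lee_fin /M addrAC subrr add0r lnK ?posrE ?divr_gt0//.
have -> : 8 / p * (p / 4) = 2 by field; rewrite gt_eqF.
by rewrite leNgt ltr1n.
Qed.

Lemma bessel_neq0 (delta t : R) (rho : T -> R -> R) :
  0 < delta -> 0 < t -> bessel P delta rho ->
  measurable [set w | rho w t = 0] /\ prb P [set w | rho w t = 0] = 0.
Proof.
move=> delta0 t0 [X sX rhoE]; have := squared_bessel_neq0 delta0 t0 sX.
have [X0 _ _] := sX.
rewrite (_ : [set w | X w t = 0] = [set w | rho w t = 0])//.
apply/seteqP; split=> w /=; rewrite rhoE ?(ltW t0)//; first by move=> ->; rewrite sqrtr0.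
by move=> /eqP; rewrite sqrtr_eq0 => h; apply/eqP; rewrite eq_le h X0// ltW.
Qed.

Lemma bessel_measurable (delta t : R) (rho : T -> R -> R) :
  0 <= t -> bessel P delta rho -> mfun (rho ^~ t).
Proof.
move=> t0 [X [X0 cX [F [B [Ffil BM aX ito]]]] rhoE].
rewrite /mfun (_ : rho ^~ t = fun w => Num.sqrt (X w t)); last by apply/funext => w; exact: rhoE.
apply: measurableT_comp; first exact: measurable_sqrt.
by apply: (mfun_sub (filtration_sub Ffil t0)); exact: adapted_measurable.
Qed.

Lemma bessel_continuous (delta : R) (rho : T -> R -> R) w :
  bessel P delta rho -> continuous (fun t : R => rho w (Num.max t 0)).
Proof.
move=> [X [X0 cX _] rhoE] t.
rewrite (_ : (fun t => rho _ _) = (fun t : R => Num.sqrt (X w (Num.max t 0)))).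
  apply: (@continuous_comp _ _ _ (fun t : R => X w (Num.max t 0)) Num.sqrt).
    exact: continuous_max0.
  exact: sqrt_continuous.
by apply/funext => s; rewrite rhoE// le_max lexx orbT.
Qed.

End bessel.

(** * Convergence of the norms *)

Section rational_bigops.
Context d (T : measurableType d) (D : set rat) (F : rat -> set T).
Hypothesis mF : forall q, D q -> measurable (F q).

Lemma bigcup_rat_measurable : measurable (\bigcup_(q in D) F q).
Proof.
rewrite bigcup_mkcond; apply: bigcupT_measurable_rat => q.
by case: ifPn => // /set_mem/mF.
Qed.

End rational_bigops.

Section borel.
Context d (T : measurableType d) (R : realType).

Lemma mfun_gt (f : T -> R) : (forall c, measurable [set w | c < f w]) -> mfun f.
Proof.
move=> H; rewrite /mfun => mD; apply: (measurability _ (RGenOInfty.measurableE R)) => //.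
move=> /= _ [_ [x ->] <-]; rewrite setTI preimage_itvoy.
by rewrite (_ : [set y | _] = [set w | x < f w])//; apply/seteqP; split=> w.
Qed.

Lemma mfun_borel (U : ptopologicalType) (f : U -> R) (X : T -> U) :
  continuous f -> measurable_fun setT (X : T -> borel U) -> mfun (f \o X).
Proof.
move=> cf mX; apply: mfun_gt => c.
have := mX measurableT [set u | c < f u]; rewrite setTI; apply.
apply: sub_sigma_algebra; apply: open_comp (@open_gt R c).
by move=> u _; exact: cf.
Qed.

End borel.

Section cadlag.
Context (R : realType) (V : pseudoMetricNormedZmodType R).
Implicit Types x : R -> V.

Lemma cadlag_right x t e : cadlag x -> 0 < e ->
  exists2 del, 0 < del & forall s, t <= s < t + del -> `|x s - x t| < e.
Proof.
move=> [_ /(_ t) xr _] e0; move/cvgrPdist_lt : xr => /(_ e e0).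
rewrite /at_right near_withinE => /nbhs_ballP[del /= del0 H].
exists del => // s /andP[ts std].
move: ts; rewrite le_eqVlt => /predU1P[<-|ts]; first by rewrite subrr normr0.
rewrite distrC; apply: H => //.
by rewrite /ball/= ltr_distlC ltrBlDr (lt_le_trans ts)/= ?lerDl ?(ltW del0).
Qed.

Lemma cadlag_left x t e : cadlag x -> 0 < e ->
  exists2 del, 0 < del & forall s, t - del < s < t -> `|x s - left_limit x t| < e.
Proof.
move=> [_ _ /(_ t) xl] e0; move/cvgrPdist_lt : xl => /(_ e e0).
rewrite /at_left near_withinE => /nbhs_ballP[del /= del0 H].
exists del => // s /andP[ts std].
rewrite distrC; apply: H => //.
by rewrite /ball/= ltr_distlC ts/= (lt_trans std)// ltrDl.
Qed.

Lemma cadlag_rat x t u e : cadlag x -> t < u -> 0 < e ->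
  exists q : rat, t < ratr q < u /\ `|x (ratr q) - x t| < e.
Proof.
move=> cx tu e0; have [del del0 H] := cadlag_right t cx e0.
have [|q] := @rat_in_itvoo R t (Num.min u (t + del)).
  by rewrite lt_min tu ltrDl.
rewrite in_itv/= lt_min => /and3P[tq qu qd]; exists q; rewrite tq qu; split=> //.
by apply: H; rewrite (ltW tq).
Qed.

End cadlag.

Section sup_functional.
Context (R : realType) (g : R -> R -> R) (T : R).
Hypothesis g01 : forall t u, 0 <= g t u <= 1.
Hypothesis gT : forall t u, T <= t -> g t u = 0.
Hypothesis guc : forall e, 0 < e -> exists2 del, 0 < del &
  forall t t' u u', `|t - t'| < del -> `|u - u'| < del -> `|g t u - g t' u'| < e.

(** A test function for weak convergence. With g uniformly continuous and zero after time T it is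
    continuous for J1, which evaluation at a fixed time is not. *)
Definition sup_path (x : R -> R) : R := sup [set g t (x t) | t in [set t | 0 <= t]].

Lemma sup_path_ge x t : 0 <= t -> g t (x t) <= sup_path x.
Proof.
move=> t0; apply: ub_le_sup; last by exists t.
by exists 1 => _ [s _ <-]; case/andP: (g01 s (x s)).
Qed.

Lemma sup_path_le x c : (forall t, 0 <= t -> g t (x t) <= c) -> sup_path x <= c.
Proof.
move=> H; apply: ge_sup; first by exists (g 0 (x 0)), 0 => /=.
by move=> _ [t t0 <-]; exact: H.
Qed.

Lemma sup_path_gt x c : (c < sup_path x) <-> (exists2 t, 0 <= t & c < g t (x t)).
Proof.
split=> [h|[t t0 h]]; last exact: lt_le_trans h (sup_path_ge x t0).
apply: contrapT => nE; move: h; rewrite ltNge => /negP; apply.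
apply: sup_path_le => t t0; rewrite leNgt; apply/negP => h; apply: nE.
by exists t.
Qed.

Lemma sup_path01 x : 0 <= sup_path x <= 1.
Proof.
apply/andP; split; last by apply: sup_path_le => t _; case/andP: (g01 t (x t)).
apply: (@le_trans _ _ (g 0 (x 0))); last exact: sup_path_ge.
by case/andP: (g01 0 (x 0)).
Qed.

Lemma sup_path_continuous : continuous (fun x : skorokhod R => sup_path x).
Proof.
move=> x A /nbhs_ballP[e /= e0 HA].
have e20 : 0 < e / 2 by rewrite divr_gt0.
have [del del0 Hdel] := guc e20; pose r := Num.min del 1.
have r0 : 0 < r by rewrite lt_min del0/=.
have rd : r <= del by rewrite ge_min lexx.
have r1 : r <= 1 by rewrite ge_min lexx orbT.
(* The extra unit of time absorbs the time change: as r <= 1, every nonnegative time before T has a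
   preimage under [lam] before max T 0 + 1. *)
exists (Num.max T 0 + 1, r) => //= y [lam [lam0 laminc lamsurj] H] /=.
apply: HA; rewrite /ball/=.
have T0 : 0 <= Num.max T 0 by rewrite le_max lexx orbT.
suff: `|sup_path x - sup_path y| <= e / 2.
  by move=> h; apply: le_lt_trans h _; rewrite ltr_pdivrMr// ltr_pMr// ltr1n.
have close t : 0 <= t <= Num.max T 0 + 1 -> `|g t (y t) - g (lam t) (x (lam t))| < e / 2.
  move=> /H[h1 h2]; apply: Hdel; first by rewrite distrC (lt_le_trans h1).
  exact: lt_le_trans h2 rd.
rewrite ler_distl; apply/andP; split.
- rewrite lerBlDr; apply: sup_path_le => t t0.
  have [tT|Tt] := leP T t.
    rewrite gT//; apply: addr_ge0; last exact: ltW.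
    by case/andP: (sup_path01 x).
  have /close : 0 <= t <= Num.max T 0 + 1.
    rewrite t0/=; apply: ltW; apply: lt_le_trans Tt _.
    by apply: le_trans (_ : Num.max T 0 <= _); rewrite ?lerDl// le_max lexx.
  rewrite ltr_distl => /andP[_ /ltW h]; apply: le_trans h _; rewrite lerD2r.
  apply: sup_path_ge; move: t0; rewrite le_eqVlt => /predU1P[<-|t0]; first by rewrite lam0.
  by rewrite -lam0 ltW// laminc.
- apply: sup_path_le => s s0.
  have [Ts|sT] := leP T s.
    rewrite gT//; apply: addr_ge0; last exact: ltW.
    by case/andP: (sup_path01 y).
  have [t ts] := lamsurj s.
  have t0 : 0 <= t.
    rewrite leNgt; apply/negP => /laminc; rewrite lam0 ts => h.
    by move: (lt_le_trans h s0); rewrite ltxx.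
  have tT : t <= Num.max T 0 + 1.
    rewrite leNgt; apply/negP => /laminc; rewrite ts => h.
    have [|h1 _] := H (Num.max T 0 + 1).
      by rewrite lexx andbT addr_ge0.
    move: h1; rewrite ltr_distl => /andP[h1 _].
    have : Num.max T 0 < s.
      apply: lt_trans h; apply: le_lt_trans h1; rewrite lerBrDr lerD2l//.
    by rewrite ltNge le_max (ltW sT).
  have /close : 0 <= t <= Num.max T 0 + 1 by rewrite t0.
  rewrite distrC ltr_distl ts => /andP[_ /ltW h]; apply: le_trans h _; rewrite lerD2r.
  exact: sup_path_ge.
Qed.

Lemma sup_path_rat (x : skorokhod R) c : (c < sup_path x) <->
  exists q : rat, 0 <= ratr q :> R /\ c < g (ratr q) (x (ratr q)).
Proof.
rewrite sup_path_gt; split=> [[t t0 h]|[q [q0 h]]]; last by exists (ratr q).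
have e0 : 0 < g t (x t) - c by rewrite subr_gt0.
have [del del0 Hdel] := guc e0.
have tdel : t < t + del by rewrite ltrDl.
have [q [/andP[tq qd] xq]] := cadlag_rat (path_cadlag x) tdel del0.
exists q; split; first by rewrite (le_trans t0)// ltW.
have : `|g (ratr q) (x (ratr q)) - g t (x t)| < g t (x t) - c.
  by apply: Hdel => //; rewrite ltr_distl (lt_trans _ tq) ?ltrBlDr ?ltrDl.
by rewrite ltr_distl opprB addrC subrK => /andP[].
Qed.

Lemma sup_path_mfun d (O : measurableType d) (X : O -> skorokhod R) :
  (forall t, 0 <= t -> mfun (fun w => X w t)) -> mfun (fun w => sup_path (X w)).
Proof.
move=> mX; apply: mfun_gt => c.
rewrite (_ : [set w | _] = \bigcup_(q in [set q : rat | 0 <= ratr q :> R])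
   [set w | c < g (ratr q) (X w (ratr q))]); last first.
  apply/seteqP; split=> w /=; rewrite sup_path_rat; first by move=> [q [q0 h]]; exists q.
  by move=> [q q0 h]; exists q.
apply: bigcup_rat_measurable => q q0; apply: measurable_gt_cst.
have cg : continuous (g (ratr q)).
  move=> u; apply/cvgrPdist_lt => e e0; have [del del0 Hdel] := guc e0.
  apply/nbhs_ballP; exists del => //= v uv; apply: Hdel => //.
  by rewrite subrr normr0.
by apply: measurableT_comp; [exact: continuous_measurable_fun|exact: mX].
Qed.

End sup_functional.

Section clamp.
Context (R : realType).

Definition clamp (x : R) : R := Num.max 0 (Num.min 1 x).

Lemma clamp01 x : 0 <= clamp x <= 1.
Proof. by rewrite /clamp le_max lexx/= ge_max ler01 ge_min lexx. Qed.

Lemma clamp_eq0 x : x <= 0 -> clamp x = 0.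
Proof.
move=> x0; rewrite /clamp min_r; last exact: le_trans x0 ler01.
by rewrite max_l.
Qed.

Lemma clamp_eq1 x : 1 <= x -> clamp x = 1.
Proof. by move=> x1; rewrite /clamp min_l// max_r. Qed.

Lemma clamp_lip x y : `|clamp x - clamp y| <= `|x - y|.
Proof.
have c z : [\/ z <= 0 /\ clamp z = 0, [/\ 0 <= z, z <= 1 & clamp z = z] | 1 <= z /\ clamp z = 1].
  have [z0|z0] := leP z 0; first by constructor 1; rewrite clamp_eq0.
  have [z1|z1] := leP 1 z; first by constructor 3; rewrite clamp_eq1.
  by constructor 2; split; rewrite ?ltW// /clamp min_r ?max_r// ltW.
have h1 := ler_norm (x - y); have h2 := ler_norm (y - x); rewrite distrC in h2.
rewrite ler_norml; case: (c x) => [[? ->]|[? ? ->]|[? ->]];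
  case: (c y) => [[? ->]|[? ? ->]|[? ->]]; apply/andP; split; lra.
Qed.

Lemma clamp_ge x : x <= 1 -> x <= clamp x.
Proof. by move=> x1; rewrite /clamp min_r// le_max lexx orbT. Qed.

Context (p q : R -> R) (L : R).
Hypotheses (L0 : 0 < L) (pL : forall t t', `|p t - p t'| <= L * `|t - t'|)
  (qL : forall t t', `|q t - q t'| <= L * `|t - t'|).

Lemma clamp_mul_uc e : 0 < e -> exists2 del, 0 < del &
  forall t t' u u', `|t - t'| < del -> `|u - u'| < del ->
    `|clamp (p t) * clamp (q u) - clamp (p t') * clamp (q u')| < e.
Proof.
move=> e0; exists (e / 2 / L); first by rewrite !divr_gt0.
move=> t t' u u' tt uu.
have -> : clamp (p t) * clamp (q u) - clamp (p t') * clamp (q u') =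
  clamp (p t) * (clamp (q u) - clamp (q u')) + (clamp (p t) - clamp (p t')) * clamp (q u') by ring.
have h (f : R -> R) (s s' : R) : (forall t t', `|f t - f t'| <= L * `|t - t'|) ->
    `|s - s'| < e / 2 / L -> `|clamp (f s) - clamp (f s')| < e / 2.
  move=> fL ss; apply: le_lt_trans (clamp_lip _ _) _; apply: le_lt_trans (fL _ _) _.
  by rewrite mulrC -ltr_pdivlMr.
have n1 y : `|clamp y| <= 1.
  by have /andP[y0 y1] := clamp01 y; rewrite ger0_norm.
apply: le_lt_trans (ler_normD _ _) _; rewrite !normrM [e]splitr.
apply: ltrD; first by apply: le_lt_trans (h _ _ _ qL uu); rewrite ler_piMl.
by apply: le_lt_trans (h _ _ _ pL tt); rewrite ler_piMr.
Qed.

End clamp.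

Section norm_limits.
Context (R : realType) (d : nat).
Context (disp : nat -> measure_display) (Omega : forall n, measurableType (disp n))
  (P : forall n, probability (Omega n) R)
  (Z : forall n, Omega n -> skorokhod 'rV[R]_d)
  (Z_meas : forall n, measurable_process (fun w t => Z n w t))
  (delta : R) (delta_gt0 : 0 < delta)
  (disp' : measure_display) (Omega' : measurableType disp')
  (P' : probability Omega' R) (rho : Omega' -> skorokhod R)
  (rho_bessel : bessel P' delta (fun w t => rho w t))
  (norm_cvg : weak_cvg P (fun n w => enorm_path (Z n w)) P' rho).

Arguments Z : clear implicits.

Lemma enorm_ge0 (x : 'rV[R]_d) : 0 <= enorm x.
Proof. exact: sqrtr_ge0. Qed.

Lemma mfun_enorm n t : 0 <= t -> mfun (fun w => enorm (Z n w t)).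
Proof. by move=> t0; apply: (mfun_borel (@enorm_continuous R d)); exact: Z_meas. Qed.

Section functional.
Context (g : R -> R -> R) (T : R).
Hypothesis g01 : forall t u, 0 <= g t u <= 1.
Hypothesis gT : forall t u, T <= t -> g t u = 0.
Hypothesis guc : forall e, 0 < e -> exists2 del, 0 < del &
  forall t t' u u', `|t - t'| < del -> `|u - u'| < del -> `|g t u - g t' u'| < e.

Lemma sup_norm_mfun n : mfun (fun w => sup_path g (enorm_path (Z n w))).
Proof. by apply: (sup_path_mfun g01 guc) => t t0; exact: mfun_enorm. Qed.

Lemma sup_rho_mfun : mfun (fun w => sup_path g (rho w)).
Proof. by apply: (sup_path_mfun g01 guc) => t t0; exact: bessel_measurable t0 rho_bessel. Qed.

Lemma sup_path_norm_le1 x : `|sup_path g x| <= 1.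
Proof. by have /andP[h0 h1] := sup_path01 g01 x; rewrite ger0_norm. Qed.

Lemma sup_norm_cvg : expct (P n) (fun w => sup_path g (enorm_path (Z n w))) @[n --> \oo] -->
  expct P' (fun w => sup_path g (rho w)).
Proof.
have := norm_cvg (sup_path_continuous g01 gT guc).
have i1 n : intg (P n) (fun w => sup_path g (enorm_path (Z n w))).
  by apply: (@intg_bnd _ _ _ _ _ 1); [exact: sup_norm_mfun|move=> w; exact: sup_path_norm_le1].
have i2 : intg P' (fun w => sup_path g (rho w)).
  by apply: (@intg_bnd _ _ _ _ _ 1); [exact: sup_rho_mfun|move=> w; exact: sup_path_norm_le1].
have b : exists C, forall x : skorokhod R, `|sup_path g x| <= C.
  by exists 1 => x; exact: sup_path_norm_le1.
move=> /(_ b); rewrite -(EFin_expct i2) (_ : (fun n => _) =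
  EFin \o (fun n => expct (P n) (fun w => sup_path g (enorm_path (Z n w))))).
  by move/fine_cvgP => [_].
by apply/funext => n /=; rewrite EFin_expct.
Qed.

End functional.

(** The index k is fixed first, so that the mean under the limit law is below c eta. Weak
    convergence carries this to all large n, and Markov's inequality concludes. *)
Lemma sup_norm_small (g : nat -> R -> R -> R) (T : R) (c eta : R) (E : nat -> forall n, set (Omega n)) :
  (forall k t u, 0 <= g k t u <= 1) -> (forall k t u, T <= t -> g k t u = 0) ->
  (forall k e, 0 < e -> exists2 del, 0 < del &
    forall t t' u u', `|t - t'| < del -> `|u - u'| < del -> `|g k t u - g k t' u'| < e) ->
  prb P' [set w | ~ (sup_path (g k) (rho w) @[k --> \oo] --> 0)] = 0 ->
  measurable [set w | ~ (sup_path (g k) (rho w) @[k --> \oo] --> 0)] ->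
  0 < c -> 0 < eta -> (forall k n, measurable (E k n)) ->
  (forall k n w, E k n w -> c <= sup_path (g k) (enorm_path (Z n w))) ->
  exists k, \forall n \near \oo, prb (P n) (E k n) <= eta.
Proof.
move=> g01 gT guc p0 mN c0 eta0 mE EP; set N := [set w | _] in p0 mN.
have mg k := sup_rho_mfun (g01 k) (guc k).
(* The null event where convergence fails is cut out, so that the functions converge at every
   point. *)
pose f k w : R := \1_(~` N) w * sup_path (g k) (rho w).
have mf k : mfun (f k).
  by apply: measurable_funM; [exact: mfun_indic (measurableC mN)|exact: mg].
have fcvg w : f k w @[k --> \oo] --> cst 0 w.
  have [Nw|nNw] := pselect (N w).
    rewrite (_ : (fun k => _) = fun=> 0); first exact: cvg_cst.
    by apply/funext => k; rewrite /f indicF ?mul0r//; apply.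
  rewrite (_ : (fun k => _) = (fun k => sup_path (g k) (rho w))).
    by apply: contrapT.
  by apply/funext => k; rewrite /f indicT ?mul1r.
have fb k w : `|f k w| <= cst 1 w.
  rewrite /f normrM -[leRHS]mulr1; apply: ler_pM => //; first exact: norm_indic_le1.
  exact: sup_path_norm_le1.
have := expct_dct mf fcvg (intg_cst P' 1) fb; rewrite expct_cst => H.
have ce0 : 0 < c * eta by rewrite mulr_gt0.
have [k _ Hk] : \forall k \near \oo, expct P' (f k) < c * eta by exact: (cvgr_lt _ H).
exists k; have {Hk} Hk := Hk k (leqnn k).
have fE : expct P' (f k) = expct P' (fun w => sup_path (g k) (rho w)).
  have i1 : intg P' (f k) by apply: (@intg_bnd _ _ _ _ _ 1); [exact: mf|exact: fb].
  have i2 : intg P' (fun w => sup_path (g k) (rho w)).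
    by apply: (@intg_bnd _ _ _ _ _ 1); [exact: mg|move=> w; exact: sup_path_norm_le1].
  apply/eqP; rewrite eq_le; apply/andP; split.
    apply: expct_le => // w; rewrite /f; have [s0 _] := andP (sup_path01 (g01 k) (rho w)).
    have [nw|nw] := pselect ((~` N) w); first by rewrite indicT// mul1r.
    by rewrite indicF// mul0r.
  rewrite -subr_le0 -expctB// -p0 prb_indic//; apply: expct_le.
  - exact: intgB.
  - exact: intg_indic.
  move=> w; rewrite /f; have [Nw|nNw] := pselect (N w).
    have NN : ~ (~` N) w by [].
    rewrite (indicT R Nw) (indicF R NN) mul0r subr0.
    by case/andP: (sup_path01 (g01 k) (rho w)).
  have NN : (~` N) w by [].
  by rewrite (indicF R nNw) (indicT R NN) mul1r subrr.
have := sup_norm_cvg (g01 k) (gT k) (guc k); rewrite -fE => Hn.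
have : \forall n \near \oo, expct (P n) (fun w => sup_path (g k) (enorm_path (Z n w))) < c * eta.
  exact: (cvgr_lt _ Hn).
apply: filterS => n h; have i1 : intg (P n) (fun w => sup_path (g k) (enorm_path (Z n w))).
  by apply: (@intg_bnd _ _ _ _ _ 1); [exact: sup_norm_mfun (g01 k) (guc k) n|move=> w; exact: sup_path_norm_le1].
rewrite -(ler_pM2l c0); apply: le_trans (ltW h).
rewrite prb_indic// -expctZ; last exact: intg_indic.
apply: expct_le => //; first exact/intgZ/intg_indic.
move=> w; have [Ew|nEw] := pselect (E k n w); first by rewrite indicT// mulr1; exact: EP.
by rewrite indicF// mulr0; case/andP: (sup_path01 (g01 k) (enorm_path (Z n w))).
Qed.

(** The time factor is 1 up to T and 0 after max T 0 + 2; the space factor is 0 below k and 1 above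
    k + 1. A path of rho is continuous, hence bounded on the time window, so the functional vanishes
    on it for large k. *)
Lemma norm_containment T eta : 0 < eta ->
  exists K : nat, (0 < K)%N /\ \forall n \near \oo,
    prb (P n) [set w | exists2 t, 0 <= t <= T & K%:R < enorm (Z n w t)] <= eta.
Proof.
move=> eta0; pose p (t : R) := Num.max T 0 + 2 - t.
pose q (k : nat) (u : R) := u - k%:R.
pose g k t u := clamp (p t) * clamp (q k u).
have g01 k t u : 0 <= g k t u <= 1.
  have /andP[a0 a1] := clamp01 (p t); have /andP[b0 b1] := clamp01 (q k u).
  by rewrite /g mulr_ge0//= mulr_ile1.
have gT k t u : Num.max T 0 + 2 <= t -> g k t u = 0.
  by move=> tT; rewrite /g clamp_eq0 ?mul0r// subr_le0.
have guc k e : 0 < e -> exists2 del, 0 < del &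
    forall t t' u u', `|t - t'| < del -> `|u - u'| < del -> `|g k t u - g k t' u'| < e.
  apply: (@clamp_mul_uc _ _ _ 1) => // t t'; rewrite mul1r /p /q.
    by rewrite opprB addrC addrA subrK distrC.
  by rewrite opprB addrA subrK.
pose E (k : nat) n : set (Omega n) := [set w | exists2 t, 0 <= t <= T & k.+1%:R < enorm (Z n w t)].
have mE k n : measurable (E k n).
  have -> : E k n = ([set w : Omega n | 0 <= T /\ k.+1%:R < enorm (Z n w T)] `|`
    \bigcup_(q in [set q : rat | 0 <= ratr q :> R /\ ratr q < T]) [set w : Omega n | k.+1%:R < enorm (Z n w (ratr q))])%classic.
    apply/seteqP; split=> w /=.
      move=> [t /andP[t0]]; rewrite le_eqVlt => /predU1P[<-|tT h]; first by left.
      right; have e0 : 0 < enorm (Z n w t) - k.+1%:R by rewrite subr_gt0.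
      have [q0 [/andP[tq qT] zq]] := cadlag_rat (path_cadlag (enorm_path (Z n w))) tT e0.
      exists q0 => /=; first by split; rewrite ?(le_trans t0)// ltW.
      by move: zq; rewrite /= ltr_distl opprB addrC subrK => /andP[].
    move=> [[T0 h]|[q0 /= [q00 qT] h]]; first by exists T => //; rewrite T0 lexx.
    by exists (ratr q0) => //; rewrite q00 ltW.
  apply: measurableU.
    have [T0|T0] := leP 0 T; last first.
      by rewrite (_ : [set w | _] = set0)//; apply/seteqP; split=> w // [].
    rewrite (_ : [set w | _] = [set w | k.+1%:R < enorm (Z n w T)]).
      exact/measurable_gt_cst/mfun_enorm.
    by apply/seteqP; split=> w /= => [[]|].
  by apply: bigcup_rat_measurable => r /= [r0 _]; exact/measurable_gt_cst/mfun_enorm.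
have N0 : [set w | ~ (sup_path (g k) (rho w) @[k --> \oo] --> 0)] = set0.
  apply/seteqP; split=> w //=; apply.
  have cr := bessel_continuous (w := w) rho_bessel.
  have T20 : 0 <= Num.max T 0 + 2 by rewrite addr_ge0// le_max lexx orbT.
  have [c _ Hc] := @EVT_max R (fun t : R => rho w (Num.max t 0)) 0 (Num.max T 0 + 2) T20 (continuous_subspaceT cr).
  apply/cvgrPdist_lt => e e0.
  exists (Num.truncn (rho w (Num.max c 0))).+1 => // k /= km.
  rewrite sub0r normrN (_ : sup_path _ _ = 0) ?normr0//.
  apply/eqP; rewrite eq_le; have /andP[-> _] := sup_path01 (g01 k) (rho w).
  rewrite andbT; apply: sup_path_le => t t0.
  have [Tt|tT] := leP (Num.max T 0 + 2) t; first by rewrite gT.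
  rewrite /g [X in _ * X]clamp_eq0 ?mulr0// subr_le0.
  have := Hc t; rewrite in_itv/= t0 (ltW tT) => /(_ isT).
  rewrite max_l// => h; apply: (le_trans h); apply: (le_trans (ltW (truncnS_gt _))).
  by rewrite ler_nat.
have [|||k Hk] := @sup_norm_small g (Num.max T 0 + 2) 1 eta E g01 gT guc _ _ ltr01 eta0 mE.
- by rewrite N0 prb0.
- by rewrite N0.
- move=> k n w [t /andP[t0 tT] h]; apply: le_trans (sup_path_ge (g01 k) _ t0).
  rewrite /g/= !clamp_eq1 ?mulr1//.
    by rewrite /q lerBrDr addrC natr1 ltW.
  rewrite /p lerBrDr; apply: le_trans (_ : T + 1 <= _); first by rewrite addrC lerD2r.
  by rewrite lerD ?le_max ?lexx// ler1n.
by exists k.+1.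
Qed.

(** The norm at time t is tested through a window of width 1/(k + 1) around (t, 0). If rho does not
    vanish at t, it stays away from 0 near t and the functional is 0 for large k; by [bessel_neq0]
    this is the almost sure case. *)
Lemma norm_nonzero t eta : 0 < t -> 0 < eta ->
  exists2 e, 0 < e & \forall n \near \oo, prb (P n) [set w | enorm (Z n w t) <= e] <= eta.
Proof.
move=> t0 eta0; have [mR R0] := bessel_neq0 delta_gt0 t0 rho_bessel.
pose p (k : nat) (s : R) := 1 - k.+1%:R * `|s - t|.
pose q (k : nat) (u : R) := 1 - k.+1%:R * `|u|.
pose g k s u := clamp (p k s) * clamp (q k u).
have g01 k s u : 0 <= g k s u <= 1.
  have /andP[a0 a1] := clamp01 (p k s); have /andP[b0 b1] := clamp01 (q k u).
  by rewrite /g mulr_ge0//= mulr_ile1.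
have gT k s u : t + 1 <= s -> g k s u = 0.
  move=> tT; rewrite /g clamp_eq0 ?mul0r// subr_le0.
  have h : 1 <= s - t by rewrite lerBrDr addrC.
  rewrite -[leLHS]mulr1; apply: ler_pM => //; first by rewrite ler1n.
  exact: le_trans h (ler_norm _).
have guc k e : 0 < e -> exists2 del, 0 < del &
    forall t t' u u', `|t - t'| < del -> `|u - u'| < del -> `|g k t u - g k t' u'| < e.
  have lip (c s s' : R) : `|1 - k.+1%:R * `|s - c| - (1 - k.+1%:R * `|s' - c|)| <= k.+1%:R * `|s - s'|.
    have -> : 1 - k.+1%:R * `|s - c| - (1 - k.+1%:R * `|s' - c|) = k.+1%:R * (`|s' - c| - `|s - c|) :> R by ring.
    rewrite normrM ger0_norm// ler_pM2l// [leRHS]distrC.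
    by apply: le_trans (ler_dist_dist _ _) _; rewrite opprB addrA subrK.
  apply: (@clamp_mul_uc _ _ _ k.+1%:R) => // s s'; first exact: lip.
  by rewrite /q; have := lip 0 s s'; rewrite !subr0.
(* At half the width of the window the space factor is still at least 1/2, and the time factor is 1
   at t. *)
pose E (k : nat) n : set (Omega n) := [set w | enorm (Z n w t) <= (2 * k.+1%:R)^-1].
have mE k n : measurable (E k n) by exact/measurable_le_cst/mfun_enorm/ltW.
have NE : [set w | ~ (sup_path (g k) (rho w) @[k --> \oo] --> 0)] `<=` [set w | rho w t = 0].
  move=> w /= nw; apply: contrapT => /eqP rt; apply: nw.
  have cr := bessel_continuous (w := w) rho_bessel.
  have : (fun s => `|rho w (Num.max s 0)|) s @[s --> t] --> `|rho w (Num.max t 0)|.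
    by apply: cvg_norm; exact: cr.
  rewrite max_l ?(ltW t0)// => crt.
  have a0 : 0 < `|rho w t| / 2 by rewrite divr_gt0// normr_gt0.
  have /nbhs_ballP[del /= del0 Hdel] : \forall s \near t, `|rho w t| / 2 < `|rho w (Num.max s 0)|.
    apply: (cvgr_gt _ crt); rewrite ltr_pdivrMr// ltr_pMr ?ltr1n// normr_gt0//.
  apply/cvgrPdist_lt => e e0.
  exists (Num.truncn (Num.max del^-1 (`|rho w t| / 2)^-1)).+1 => // k /= km.
  have bnd (c : R) : 0 < c -> c^-1 <= Num.max del^-1 (`|rho w t| / 2)^-1 -> 1 <= k.+1%:R * c.
    move=> c0 h; rewrite -ler_pdivrMr// div1r; apply: (le_trans h).
    apply: (le_trans (ltW (truncnS_gt _))); rewrite ler_nat; exact: leqW.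
  rewrite sub0r normrN (_ : sup_path _ _ = 0) ?normr0//.
  apply/eqP; rewrite eq_le; have /andP[-> _] := sup_path01 (g01 k) (rho w).
  rewrite andbT; apply: sup_path_le => s s0.
  have [ds|sd] := leP del `|s - t|.
    rewrite /g clamp_eq0 ?mul0r// subr_le0; apply: le_trans (bnd _ del0 _) _.
      by rewrite le_max lexx.
    by rewrite ler_pM2l.
  rewrite /g [X in _ * X]clamp_eq0 ?mulr0// subr_le0.
  apply: le_trans (bnd _ a0 _) _; first by rewrite le_max lexx orbT.
  rewrite ler_pM2l//; have /= := Hdel s; rewrite max_l// => h; apply/ltW/h.
  by rewrite /ball/= distrC.
have N1 : [set w | ~ (sup_path (g k) (rho w) @[k --> \oo] --> 0)] = [set w | rho w t = 0].
  apply/seteqP; split=> // w /= rw0 h.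
  have h1 k : sup_path (g k) (rho w) = 1.
    apply/eqP; rewrite eq_le; have /andP[_ ->] := sup_path01 (g01 k) (rho w) => /=.
    apply: le_trans (sup_path_ge (g01 k) _ (ltW t0)); rewrite rw0 /g /p /q subrr normr0 mulr0 subr0.
    by rewrite clamp_eq1// mulr1.
  move: h; rewrite (_ : (fun k => _) = fun=> 1); last by apply/funext => k; exact: h1.
  by move/(cvg_lim (@Rhausdorff R)); rewrite lim_cst// => /eqP; rewrite oner_eq0.
have c0 : 0 < 1 / 2 :> R by rewrite divr_gt0.
have [|||k Hk] := @sup_norm_small g (t + 1) (1 / 2) eta E g01 gT guc _ _ c0 eta0 mE.
- by rewrite N1.
- by rewrite N1.
- move=> k n w h; apply: le_trans (sup_path_ge (g01 k) _ (ltW t0)).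
  have e1 : clamp (p k t) = 1 by rewrite clamp_eq1// /p subrr normr0 mulr0 subr0.
  rewrite /g e1 [leRHS]mul1r.
  have q1 : q k (enorm (Z n w t)) <= 1 by rewrite gerBl mulr_ge0.
  apply: le_trans (clamp_ge q1).
  rewrite /q ger0_norm ?enorm_ge0// lerBrDr -lerBrDl.
  have -> : 1 - 1 / 2 = k.+1%:R * (2 * k.+1%:R)^-1 :> R by field; rewrite addrC natr1 pnatr_eq0.
  by rewrite ler_pM2l.
by exists (2 * k.+1%:R)^-1 => //; rewrite invr_gt0 mulr_gt0.
Qed.

End norm_limits.

(** * Optional stopping for local martingales *)

Section expct_extra.
Context d (T : measurableType d) (R : realType) (P : probability T R).

Lemma integral_indicE (E : set T) (f : T -> R) : measurable E -> intg P f ->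
  (\int[P]_(w in E) (f w)%:E)%E = (expct P (fun w => \1_E w * f w))%:E.
Proof.
move=> mE fi; rewrite EFin_expct; last exact: intg_mul1.
rewrite integral_mkcond; apply: eq_integral => w _; rewrite patchE indicE.
by case: ifPn => _; rewrite ?mul1r ?mul0r.
Qed.

Lemma expct_null (N : set T) (f : T -> R) : measurable N -> prb P N = 0 -> intg P f ->
  expct P (fun w => \1_N w * f w) = 0.
Proof.
move=> mN N0 fi; have := integral_indicE mN fi; rewrite null_set_integral//.
- by case.
- by apply/measurable_EFinP; apply: measurable_funTS; exact: intg_meas fi.
- by rewrite [LHS]prb_fin// N0.
Qed.

End expct_extra.

Section truncation.
Context (R : realType).

Definition clip (c x : R) : R := Num.max (- c) (Num.min c x).
(** The cost of clipping at c. It is convex in x, so its mean increases along a martingale, and it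
    tends to 0 in mean as c grows; it takes the place of uniform integrability below. *)
Definition excess (c x : R) : R := Num.max 0 (`|x| - c).

Lemma excess_ge0 c x : 0 <= excess c x.
Proof. by rewrite /excess le_max lexx. Qed.

Lemma excess_le c x : 0 <= c -> excess c x <= `|x|.
Proof. by move=> c0; rewrite /excess ge_max normr_ge0 gerBl. Qed.

Lemma clip_le c x : 0 <= c -> `|clip c x| <= c.
Proof.
move=> c0; rewrite /clip ler_norml le_max lexx/= ge_max ge_min lexx/= andbT.
by lra.
Qed.

Lemma clip_id c x : `|x| <= c -> clip c x = x.
Proof. by rewrite ler_norml => /andP[h1 h2]; rewrite /clip min_r// max_r. Qed.

Lemma clip_excess c x : 0 <= c -> `|x - clip c x| = excess c x.
Proof.
move=> c0; rewrite /excess; have [xc|cx] := leP `|x| c.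
  by rewrite clip_id// subrr normr0 max_l// subr_le0.
rewrite max_r ?subr_ge0 ?(ltW cx)//; rewrite /clip.
have [x0|x0] := leP 0 x.
  have xE : `|x| = x by rewrite ger0_norm.
  rewrite xE in cx *; rewrite min_l ?(ltW cx)// max_r; last by lra.
  by rewrite ger0_norm// subr_ge0 ltW.
have xE : `|x| = - x by rewrite ltr0_norm.
rewrite xE in cx *; rewrite min_r; last by lra.
rewrite max_l; last by lra.
by rewrite ler0_norm; lra.
Qed.

Lemma clip_norm c x : 0 <= c -> `|clip c x| <= `|x|.
Proof.
move=> c0; have [xc|cx] := leP `|x| c; first by rewrite clip_id.
exact: le_trans (clip_le _ c0) (ltW cx).
Qed.

Lemma clip_continuous c : continuous (clip c).
Proof.
move=> x; apply: (@continuous_max _ _ (cst (- c)) (fun x => Num.min c x) x); first exact: cvg_cst.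
by apply: (@continuous_min _ _ (cst c) id x); [exact: cvg_cst|exact: cvg_id].
Qed.

Lemma excessE c x : 0 <= c -> excess c x = Num.max 0 (x - c) + Num.max 0 (- x - c).
Proof.
move=> c0; rewrite /excess; have [x0|x0] := leP 0 x.
  have -> : Num.max 0 (- x - c) = 0 by apply/max_l; lra.
  by rewrite ger0_norm// addr0.
have -> : Num.max 0 (x - c) = 0 by apply/max_l; lra.
by rewrite ltr0_norm// add0r.
Qed.

End truncation.

Section right_continuous.
Context (R : realType).

Definition rcont (x : R -> R) := forall t e, 0 <= t -> 0 < e ->
  exists2 del, 0 < del & forall s, t <= s < t + del -> `|x s - x t| < e.

Lemma rcont_stopped (T : Type) (M : T -> R -> R) (tau : T -> \bar R) w :
  (0 <= tau w)%E -> rcont (M w) -> rcont (stopped M tau w).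
Proof.
move=> tau0 rM t e t0 e0; rewrite /stopped.
pose f s := fine (Order.min s%:E (tau w)).
have fE s : 0 <= s -> f s = if (tau w == +oo)%E then s else Num.min s (fine (tau w)).
  move=> s0; rewrite /f; case: (tau w) tau0 => [r| |] //= r0.
    by rewrite -EFin_min.
  by rewrite minEle leey.
have f0 : 0 <= f t.
  rewrite fE//; case: ifPn => // _; rewrite le_min t0/=; exact: fine_ge0.
have [del del0 H] := rM (f t) e f0 e0; exists del => // s /andP[ts std].
have s0 : 0 <= s := le_trans t0 ts.
apply: H; rewrite -/(f s) !fE//.
case: ifPn => _; first by rewrite ts.
set r := fine _; case: (leP t r) => tr; case: (leP s r) => sr; apply/andP; split; lra.
Qed.

End right_continuous.

Section stopped_sums.
Context (R : realType).

(** A switch that stays off once it is off stops the telescoping sum at the index where it turns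
    off. *)
Lemma stop_sum (b : nat -> bool) (a : nat -> R) m : (forall k, b k.+1 -> b k) ->
  exists j, [/\ (j <= m)%N, (forall k, (k < j)%N -> b k), ((j < m)%N -> ~~ b j) &
    \sum_(k < m) (b k)%:R * (a k.+1 - a k) = a j - a 0%N].
Proof.
move=> bS; elim: m => [|m [j [jm bj nbj sj]]].
  by exists 0%N; split=> //; rewrite big_ord0 subrr.
rewrite big_ord_recr/= sj; move: jm; rewrite leq_eqVlt => /predU1P[jm|jm].
  have [bm|nbm] := boolP (b m).
    exists m.+1; split=> //; last by rewrite jm mul1r addrC addrA subrK.
      by move=> k; rewrite ltnS leq_eqVlt => /predU1P[->|]//; rewrite -jm; exact: bj.
    by rewrite ltnn.
  by exists m; rewrite -jm mul0r addr0; split=> // _; rewrite jm.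
have nbm : ~~ b m.
  apply/negP => bm; move/negP: (nbj jm); apply.
  have H k : b (j + k)%N -> b j.
    by elim: k => [|k IH]; [rewrite addn0|rewrite addnS => /bS].
  by apply: (H (m - j)%N); rewrite subnKC// ltnW.
exists j; split=> //; first exact: ltnW (leq_trans jm _).
  by move=> _; exact: nbj.
by rewrite (negbTE nbm) mul0r addr0.
Qed.

Context (x : R -> R) (sig s t : R).
Hypotheses (rx : rcont x) (s0 : 0 <= s) (st : s < t).

Definition mesh (m k : nat) : R := s + k%:R * ((t - s) / m.+1%:R).

Lemma mesh0 m : mesh m 0 = s.
Proof. by rewrite /mesh mul0r addr0. Qed.

Lemma meshS m : mesh m m.+1 = t.
Proof. by rewrite /mesh mulrC divfK// addrC subrK. Qed.

Lemma mesh_gt0 m : 0 < (t - s) / m.+1%:R.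
Proof. by rewrite divr_gt0// subr_gt0. Qed.

Lemma mesh_lt m k : mesh m k < mesh m k.+1.
Proof. by rewrite /mesh ltrD2l ltr_pM2r ?mesh_gt0// ltr_nat. Qed.

Lemma mesh_ge m k : s <= mesh m k.
Proof. by rewrite /mesh lerDl mulr_ge0// ltW// mesh_gt0. Qed.

Lemma mesh_le m k l : (k <= l)%N -> mesh m k <= mesh m l.
Proof. by move=> kl; rewrite /mesh lerD2l ler_pM2r ?mesh_gt0// ler_nat. Qed.

(** This is x at the first mesh point beyond [sig], or at t if there is none, so the stopped value
    is approached from the right. The events used are complements of {sig < mesh point}: it suffices
    that {sig < u} belongs to F u for every u. *)
Definition stop_approx m : R :=
  x s + \sum_(k < m.+1) (mesh m k <= sig)%R%:R * (x (mesh m k.+1) - x (mesh m k)).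

Lemma stop_approx_cvg : stop_approx m @[m --> \oo] --> x (Num.max s (Num.min t sig)).
Proof.
have monb m k : mesh m k.+1 <= sig -> mesh m k <= sig.
  by move=> h; apply: le_trans h; rewrite ltW// mesh_lt.
have [sigs|ssig] := ltP sig s.
  rewrite (_ : stop_approx = fun=> x s); last first.
    apply/funext => m; rewrite /stop_approx big1 ?addr0// => k _.
    by rewrite leNgt (lt_le_trans sigs (mesh_ge m k)) mul0r.
  rewrite max_l; first exact: cvg_cst.
  by rewrite ge_min (ltW sigs) orbT.
have [tsig|sigt] := leP t sig.
  rewrite max_r ?(ltW st)// (_ : stop_approx = fun=> x t); first exact: cvg_cst.
  apply/funext => m; rewrite /stop_approx.
  have [j [jm bj nbj ->]] := @stop_sum (fun k => mesh m k <= sig) (fun k => x (mesh m k)) m.+1 (monb m).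
  have -> : j = m.+1.
    apply/eqP; rewrite eqn_leq jm/= leqNgt; apply/negP => jm1.
    move: (nbj jm1); rewrite -ltNge => h.
    have := le_lt_trans tsig h; rewrite -(meshS m) ltNge mesh_le//.
  by rewrite meshS mesh0 addrC subrK.
rewrite max_r//; apply/cvgrPdist_lt => e e0.
have [del del0 H] := rx (le_trans s0 ssig) e0.
exists (Num.truncn ((t - s) / del)) => // m /= mN.
have [j [jm bj nbj E]] := @stop_sum (fun k => mesh m k <= sig) (fun k => x (mesh m k)) m.+1 (monb m).
have -> : stop_approx m = x (mesh m j).
  by rewrite /stop_approx E mesh0 [x s + _]addrC subrK.
rewrite distrC; apply: H.
have sj : sig < mesh m j.
  move: jm; rewrite leq_eqVlt => /predU1P[->|/nbj]; first by rewrite meshS.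
  by rewrite -ltNge.
rewrite (ltW sj)/=; case: j jm bj sj {nbj E} => [|j] jm bj sj.
  by move: sj; rewrite mesh0 ltNge ssig.
have := bj j (leqnn _) => h; apply: (@le_lt_trans _ _ (sig + (t - s) / m.+1%:R)).
  by rewrite /mesh -natr1 mulrDl mul1r addrA lerD2r.
rewrite ltrD2l ltr_pdivrMr// mulrC -ltr_pdivrMr//.
by apply: truncn_lt.
Qed.

End stopped_sums.

Section optional_stopping.
Context d (T : measurableType d) (R : realType) (P : probability T R).
Context (F : R -> set (set T)).
Hypothesis Ffil : filtration F.
Notation GT t := (g_sigma_algebraType (F t)).

Lemma filtration_meas t E : 0 <= t -> F t E -> measurable E.
Proof. by move=> t0; case: Ffil => _ + _; exact. Qed.

Lemma filtration_le s t E : 0 <= s -> s <= t -> F s E -> F t E.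
Proof. by case: Ffil => _ _ H s0 st; exact: H. Qed.

Lemma filtrationI t A B : 0 <= t -> F t A -> F t B -> F t (A `&` B).
Proof.
move=> t0; rewrite -(filtration_id Ffil t0) => FA FB.
exact: (@measurableI _ (GT t) _ _ FA FB).
Qed.

Lemma filtrationC t A : 0 <= t -> F t A -> F t (~` A).
Proof.
move=> t0; rewrite -(filtration_id Ffil t0) => FA.
exact: (@measurableC _ (GT t) _ FA).
Qed.

Lemma martingale_indic N s t E : martingale P F N -> 0 <= s -> s <= t -> F s E ->
  expct P (fun w => \1_E w * N w t) = expct P (fun w => \1_E w * N w s).
Proof.
move=> [_ Ni NE] s0 st FE; have t0 := le_trans s0 st.
have mE := filtration_meas s0 FE.
have := NE s t s0 st E FE.
by rewrite !integral_indicE//; [case|exact: Ni|exact: Ni].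
Qed.

Lemma mfun_max0 (f : T -> R) : mfun f -> mfun (fun w => Num.max 0 (f w)).
Proof. by move=> mf; exact: measurable_maxr. Qed.

Lemma excess_mfun c (f : T -> R) : mfun f -> mfun (fun w => excess c (f w)).
Proof. by move=> mf; apply: mfun_max0; apply: measurable_funB => //; exact: mfun_norm. Qed.

Lemma excess_intg c (f : T -> R) : 0 <= c -> intg P f -> intg P (fun w => excess c (f w)).
Proof.
move=> c0 fi; apply: (intg_le _ fi); first exact: excess_mfun (intg_meas fi).
by move=> w; rewrite ger0_norm ?excess_ge0// excess_le.
Qed.

(** Conditional Jensen inequality for the positive part: with G the part of E where f is positive at
    time s, the left side is the mean of f at time t on G, which is at most that of its positive
    part on E. *)
Lemma submartingale_max (N : T -> R -> R) (f : T -> R -> R) s t E :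
  (forall E, F s E -> expct P (fun w => \1_E w * f w t) = expct P (fun w => \1_E w * f w s)) ->
  adapted F f -> intg P (f ^~ s) -> intg P (f ^~ t) -> 0 <= s -> F s E ->
  expct P (fun w => \1_E w * Num.max 0 (f w s)) <= expct P (fun w => \1_E w * Num.max 0 (f w t)).
Proof.
move=> H af fs ft s0 FE.
pose G : set T := E `&` [set w | 0 < f w s].
have FG : F s G.
  apply: filtrationI => //; have := af s s0 `]0, +oo[%classic (measurable_itv _).
  by congr F; apply/seteqP; split=> w /=; rewrite in_itv/= andbT.
have mE := filtration_meas s0 FE; have mG := filtration_meas s0 FG.
have imax h : intg P h -> intg P (fun w => Num.max 0 (h w)).
  move=> hi; apply: (intg_le _ hi); first exact: mfun_max0 (intg_meas hi).
  by move=> w; rewrite ger0_norm ?le_max ?lexx// ge_max normr_ge0 ler_norm.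
apply: (@le_trans _ _ (expct P (fun w => \1_G w * f w t))); last first.
  apply: expct_le; [exact: intg_mul1|exact/intg_mul1/imax|move=> w].
  have [Gw|nGw] := pselect (G w).
    have [Ew _] := Gw; by rewrite (indicT R Gw) (indicT R Ew) !mul1r le_max lexx orbT.
  rewrite (indicF R nGw) mul0r mulr_ge0// ?le_max ?lexx//.
rewrite H// le_eqVlt; apply/orP; left; apply/eqP; congr expct; apply/funext => w.
have [Ew|nEw] := pselect (E w); last first.
  have nG : ~ G w by case.
  by rewrite (indicF R nEw) (indicF R nG) !mul0r.
rewrite (indicT R Ew) mul1r; have [f0|f0] := ltP 0 (f w s).
  have Gw : G w by split.
  by rewrite (indicT R Gw) mul1r.
have nG : ~ G w by case=> _ /=; rewrite ltNge f0.
by rewrite (indicF R nG) mul0r.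
Qed.

Lemma martingale_excess (N : T -> R -> R) c s t E : martingale P F N -> 0 <= c -> 0 <= s -> s <= t -> F s E ->
  expct P (fun w => \1_E w * excess c (N w s)) <= expct P (fun w => \1_E w * excess c (N w t)).
Proof.
move=> mN c0 s0 st FE; have [aN Ni _] := mN; have t0 := le_trans s0 st.
have mE := filtration_meas s0 FE.
have Nsi : intg P (N ^~ s) by exact: Ni.
have Nti : intg P (N ^~ t) by exact: Ni.
have ind (G : set T) (e : R) u : F s G -> intg P (N ^~ u) ->
    expct P (fun w => \1_G w * (e * N w u - c)) = e * expct P (fun w => \1_G w * N w u) - expct P (fun w => \1_G w * c).
  move=> FG Nui; have mG := filtration_meas s0 FG.
  rewrite -expctZ; last exact: intg_mul1.
  rewrite -expctB; [|exact/intgZ/intg_mul1|exact/intg_mul1/intg_cst].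
  by congr expct; apply/funext => w; ring.
have key (e : R) : expct P (fun w => \1_E w * Num.max 0 (e * N w s - c)) <=
    expct P (fun w => \1_E w * Num.max 0 (e * N w t - c)).
  apply: (@submartingale_max N (fun w u => e * N w u - c)) => //.
  - by move=> G FG; rewrite !ind//; congr (_ * _ - _); exact: martingale_indic.
  - move=> u u0 B mB; have mf : measurable_fun [set: GT u] (fun w => e * N w u - c).
      by apply: measurable_funB => //; apply: measurable_funM => //; exact: (adapted_measurable Ffil u0 aN).
    have := mf measurableT B mB; rewrite setTI /measurable/= filtration_id//.
  - by apply: intgB; [exact: intgZ|exact: intg_cst].
  - by apply: intgB; [exact: intgZ|exact: intg_cst].
have E1 u : intg P (N ^~ u) -> expct P (fun w => \1_E w * excess c (N w u)) =
    expct P (fun w => \1_E w * Num.max 0 (1 * N w u - c)) + expct P (fun w => \1_E w * Num.max 0 (-1 * N w u - c)).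
  move=> Nui; have im (e : R) : intg P (fun w => \1_E w * Num.max 0 (e * N w u - c)).
    apply: intg_mul1 => //; apply: (@intg_le _ _ _ _ _ (fun w => `|e * N w u - c|)).
    - apply: mfun_max0; apply: measurable_funB => //; apply: measurable_funM => //; exact: intg_meas Nui.
    - by apply: intg_norm; apply: intgB; [exact: intgZ|exact: intg_cst].
    - by move=> w; rewrite normr_id ger0_norm ?le_max ?lexx// ge_max normr_ge0 ler_norm.
  rewrite -expctD//; congr expct; apply/funext => w.
  by rewrite -mulrDr excessE// mul1r mulN1r.
by rewrite !E1//; apply: lerD.
Qed.

Context (sig : T -> R).
Hypothesis sig_lt : forall u, 0 <= u -> F u [set w | sig w < u].

Lemma sig_ge u : 0 <= u -> F u [set w | u <= sig w].
Proof.
move=> u0; rewrite (_ : [set w | _] = ~` [set w | sig w < u]).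
  exact/filtrationC/sig_lt.
by apply/seteqP; split=> w /=; rewrite leNgt => /negP.
Qed.

Lemma natr_indic (b : T -> bool) w : (b w)%:R = \1_[set w | b w] w :> R.
Proof.
have [bw|nbw] := boolP (b w); first by rewrite (indicT R (A := [set w | b w])).
by rewrite (indicF R (A := [set w | b w]))//; exact/negP.
Qed.

Lemma stop_approx_measurable (M : T -> R -> R) s t m : 0 <= s -> s < t -> adapted F M ->
  measurable_fun [set: GT t] (fun w => stop_approx (M w) (sig w) s t m).
Proof.
move=> s0 st aM; have u0 k : 0 <= mesh s t m k by exact: le_trans (mesh_ge st m k).
have mMt u : 0 <= u -> u <= t -> measurable_fun [set: GT t] (M ^~ u).
  by move=> h1 h2; apply: (measurable_fun_filtration Ffil h1 h2); exact: (adapted_measurable Ffil h1 aM).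
apply: measurable_funD; first exact: mMt s0 (ltW st).
apply: (@measurable_sum _ (GT t) _ _ _ _ (fun (k : 'I_m.+1) w =>
   (mesh s t m k <= sig w)%R%:R * (M w (mesh s t m k.+1) - M w (mesh s t m k)))) => k.
have kt (l : nat) : (l <= m.+1)%N -> mesh s t m l <= t.
  by move=> lm; rewrite -[leRHS](meshS s t m) mesh_le.
apply: measurable_funM; last by apply: measurable_funB; apply: mMt => //; apply: kt => //; exact: ltnW.
rewrite (_ : (fun w => _) = \1_[set w | mesh s t m k <= sig w]); last first.
  by apply/funext => w; rewrite (natr_indic (fun w => mesh s t m k <= sig w)).
apply: measurable_indic; rewrite /measurable/= filtration_id//; last exact: ltW (le_lt_trans s0 st).
apply: (filtration_le (u0 k)); first by apply: kt; exact: ltnW.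
exact: sig_ge.
Qed.

Hypothesis sig0 : forall w, 0 <= sig w.

Lemma stopped_measurable (M : T -> R -> R) t : 0 <= t -> adapted F M -> (forall w, rcont (M w)) ->
  measurable_fun [set: GT t] (fun w => M w (Num.min t (sig w))).
Proof.
move=> t0 aM rM; move: t0; rewrite le_eqVlt => /predU1P[<-|t0].
  rewrite (_ : (fun w => _) = M ^~ 0); first exact: (adapted_measurable Ffil (lexx 0) aM).
  by apply/funext => w; rewrite min_l.
apply: (@measurable_fun_cvg _ (GT t) _ _ (fun m w => stop_approx (M w) (sig w) 0 t m)).
  by move=> m; exact: stop_approx_measurable.
move=> w _; have := stop_approx_cvg (sig := sig w) (rM w) (lexx 0) t0.
by rewrite max_r// le_min (ltW t0) sig0.
Qed.

Section martingale_stop.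
Context (N : T -> R -> R) (s t : R).
Hypotheses (mN : martingale P F N) (rN : forall w, rcont (N w)) (s0 : 0 <= s) (st : s < t).

Let u m k := mesh s t m k.
Let u0 m k : 0 <= u m k. Proof. exact: le_trans (mesh_ge st m k). Qed.
Let S m k w : R := N w s + \sum_(l < k) (u m l <= sig w)%R%:R * (N w (u m l.+1) - N w (u m l)).

Let Ni v : 0 <= v -> intg P (N ^~ v).
Proof. by case: mN => _ H _; exact: H. Qed.

Let incrE m l : (fun w => (u m l <= sig w)%R%:R * (N w (u m l.+1) - N w (u m l))) =
  (fun w => \1_[set w | u m l <= sig w] w * (N w (u m l.+1) - N w (u m l))).
Proof. by apply/funext => w; rewrite (natr_indic (fun w => u m l <= sig w)). Qed.

Let incr_intg m l : intg P (fun w => (u m l <= sig w)%R%:R * (N w (u m l.+1) - N w (u m l))).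
Proof.
rewrite incrE; apply: intg_mul1; first exact: filtration_meas (u0 m l) (sig_ge (u0 m l)).
by apply: intgB; exact: Ni.
Qed.

Let S_intg m k : intg P (S m k).
Proof. by apply: intgD; [exact: Ni|apply: (@intg_sum _ _ _ P 'I_k) => l; exact: incr_intg]. Qed.

Let S_mean m E : F s E -> expct P (fun w => \1_E w * S m m.+1 w) = expct P (fun w => \1_E w * N w s).
Proof.
move=> FE; have mE := filtration_meas s0 FE.
rewrite (_ : (fun w => \1_E w * S m m.+1 w) = (fun w => \1_E w * N w s +
   \sum_(l < m.+1) \1_E w * ((u m l <= sig w)%R%:R * (N w (u m l.+1) - N w (u m l))))); last first.
  by apply/funext => w; rewrite /S mulrDr mulr_sumr.
have i1 l : intg P (fun w => \1_E w * ((u m l <= sig w)%R%:R * (N w (u m l.+1) - N w (u m l)))).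
  exact: intg_mul1 mE (incr_intg m l).
rewrite expctD; [|exact/intg_mul1/Ni|exact: (@intg_sum _ _ _ P 'I_m.+1)].
rewrite (@expct_sum _ _ _ P 'I_m.+1)// big1 ?addr0// => l _.
pose G : set T := E `&` [set w | u m l <= sig w].
have FG : F (u m l) G.
  apply: filtrationI => //; last exact: sig_ge.
  exact: filtration_le (mesh_ge st m l) FE.
have mG := filtration_meas (u0 m l) FG.
rewrite (_ : (fun w => _) = (fun w => \1_G w * N w (u m l.+1) - \1_G w * N w (u m l))); last first.
  apply/funext => w; rewrite (natr_indic (fun w => u m l <= sig w)) mulrA -mulrBr; congr (_ * _).
  by rewrite /G indicI.
rewrite expctB; [|exact/intg_mul1/Ni|exact/intg_mul1/Ni].
rewrite (martingale_indic mN (u0 m l) _ FG) ?subrr//.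
exact/ltW/mesh_lt.
Qed.

Let S_after m k w : u m k <= sig w -> S m k w = N w (u m k).
Proof.
move=> h; rewrite /S (eq_bigr (fun l : 'I_k => N w (u m l.+1) - N w (u m l))); last first.
  move=> l _; rewrite (_ : (_ <= _) = true) ?mul1r//.
  by apply: le_trans h; apply: mesh_le => //; exact: ltnW.
by rewrite -(big_mkord xpredT (fun l => N w (u m l.+1) - N w (u m l))) telescope_sumr// /u mesh0 addrC subrK.
Qed.

Let S_after1 m k w : u m k <= sig w -> S m k.+1 w = N w (u m k.+1).
Proof.
move=> h; have := S_after h; rewrite /S big_ord_recr/= addrA => ->.
by rewrite h mul1r addrC subrK.
Qed.

Let S_before m k w : sig w < u m k -> S m k.+1 w = S m k w.
Proof. by move=> h; rewrite /S big_ord_recr/= leNgt h mul0r addr0. Qed.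

(** On paths already stopped, S no longer changes while the mean excess of N can only grow; on paths
    stopped in the current step, S equals N at the next mesh point. *)
Let S_excess_before m k c : 0 <= c ->
  expct P (fun w => \1_[set w | sig w < u m k] w * excess c (S m k w)) <=
  expct P (fun w => \1_[set w | sig w < u m k] w * excess c (N w (u m k))).
Proof.
move=> c0; elim: k => [|k IH].
  by rewrite le_eqVlt; apply/orP; left; apply/eqP; congr expct; apply/funext => w; rewrite /S big_ord0 addr0 /u mesh0.
have mlt l : measurable [set w | sig w < u m l] by exact: filtration_meas (u0 m l) (sig_lt (u0 m l)).
pose G : set T := [set w | sig w < u m k.+1] `&` [set w | u m k <= sig w].
have mG : measurable G.
  by apply: measurableI => //; exact: filtration_meas (u0 m k) (sig_ge (u0 m k)).
have split f : intg P f -> expct P (fun w => \1_[set w | sig w < u m k.+1] w * f w) =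
    expct P (fun w => \1_[set w | sig w < u m k] w * f w) + expct P (fun w => \1_G w * f w).
  move=> fi; rewrite -expctD; [|exact: intg_mul1|exact: intg_mul1].
  congr expct; apply/funext => w; rewrite -mulrDl; congr (_ * _).
  rewrite /G indicI/=; have [h1|h1] := ltP (sig w) (u m k).
    have h2 : sig w < u m k.+1 by apply: lt_trans h1 _; exact: mesh_lt.
    rewrite (indicT R (A := [set w | sig w < u m k.+1]))// (indicT R (A := [set w | sig w < u m k]))//.
    by rewrite (indicF R (A := [set w | u m k <= sig w])) ?mulr0 ?addr0//= leNgt h1.
  rewrite (indicF R (A := [set w | sig w < u m k])) ?add0r; last by rewrite /= ltNge h1.
  by rewrite (indicT R (A := [set w | u m k <= sig w]))// mulr1.
rewrite split; last exact: excess_intg.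
rewrite split; last exact/excess_intg/Ni.
apply: lerD; last first.
  rewrite le_eqVlt; apply/orP; left; apply/eqP; congr expct; apply/funext => w.
  have [Gw|nGw] := pselect (G w); last by rewrite (indicF R nGw) !mul0r.
  by rewrite (indicT R Gw) !mul1r S_after1//; case: Gw.
apply: le_trans (martingale_excess mN c0 (u0 m k) _ (sig_lt (u0 m k))); last exact/ltW/mesh_lt.
apply: le_trans IH; rewrite le_eqVlt; apply/orP; left; apply/eqP; congr expct; apply/funext => w.
have [h|h] := pselect ([set w | sig w < u m k] w); last by rewrite (indicF R h) !mul0r.
by rewrite (indicT R h) !mul1r S_before.
Qed.

Let S_excess m c : 0 <= c -> expct P (fun w => excess c (S m m.+1 w)) <= expct P (fun w => excess c (N w t)).
Proof.
move=> c0; have := @S_excess_before m m.+1 c c0; rewrite /u meshS => H.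
have mlt : measurable [set w | sig w < t].
  by apply: filtration_meas (sig_lt _); exact: le_trans (ltW st).
have split f : intg P f -> expct P f = expct P (fun w => \1_[set w | sig w < t] w * f w) +
    expct P (fun w => \1_(~` [set w | sig w < t]) w * f w).
  move=> fi; rewrite -expctD; [|exact: intg_mul1|exact: intg_mul1 (measurableC mlt) fi].
  congr expct; apply/funext => w; rewrite -mulrDl.
  have [h|h] := pselect ([set w | sig w < t] w).
    by rewrite (indicT R h) (indicF R (A := ~` _)) ?addr0 ?mul1r//; apply.
  by rewrite (indicF R h) (indicT R (A := ~` _))// add0r mul1r.
have tt0 : 0 <= t := le_trans s0 (ltW st).
rewrite split; last exact: excess_intg.
rewrite [leRHS]split; last exact/excess_intg/Ni.
apply: lerD => //; rewrite le_eqVlt; apply/orP; left; apply/eqP; congr expct; apply/funext => w.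
have [h|h] := pselect ((~` [set w | sig w < t]) w); last by rewrite (indicF R h) !mul0r.
have h' : u m m.+1 <= sig w by rewrite /u meshS; move/negP: h; rewrite -leNgt.
by rewrite (indicT R h) !mul1r S_after// /u meshS.
Qed.

(** The discrete sums S have the right mean, and clipping them at c changes it by at most the mean
    of [excess c] of N at t, whatever the mesh. So the mesh limit is taken for clipped variables and
    c is sent to infinity afterwards, h dominating the limit on E. *)
Lemma martingale_optional_stopping (E : set T) (h : T -> R) : F s E -> intg P h ->
  (forall w, E w -> `|N w (Num.max s (Num.min t (sig w)))| <= h w) ->
  expct P (fun w => \1_E w * N w (Num.max s (Num.min t (sig w)))) = expct P (fun w => \1_E w * N w s).
Proof.
move=> FE hi Nh; have mE := filtration_meas s0 FE.
have t0 : 0 <= t := le_trans s0 (ltW st).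
pose L w := N w (Num.max s (Num.min t (sig w))).
have ScvgL w : S m m.+1 w @[m --> \oo] --> L w by exact: stop_approx_cvg.
have mS m : mfun (S m m.+1) by exact/intg_meas/S_intg.
have mL : mfun L.
  by apply: (@measurable_fun_cvg _ _ _ _ (fun m => S m m.+1)) => // w _; exact: ScvgL.
have mclip c f : mfun f -> mfun (fun w => clip c (f w)).
  by move=> mf; apply: measurableT_comp => //; apply: continuous_measurable_fun; exact: clip_continuous.
have step1 c : 0 <= c -> `|expct P (fun w => \1_E w * clip c (L w)) - expct P (fun w => \1_E w * N w s)|
    <= expct P (fun w => excess c (N w t)).
  move=> c0.
  have cv : expct P (fun w => \1_E w * clip c (S m m.+1 w)) @[m --> \oo] --> expct P (fun w => \1_E w * clip c (L w)).
    apply: (expct_dct (g := cst c)).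
    - by move=> m; apply: measurable_funM; [exact: mfun_indic|exact: mclip].
    - move=> w; apply: cvgM; first exact: cvg_cst.
      by apply: (cvg_comp _ _ (ScvgL w)); exact: clip_continuous.
    - exact: intg_cst.
    - move=> m w; rewrite normrM; apply: le_trans (clip_le (S m m.+1 w) c0).
      by rewrite ler_piMl// norm_indic_le1.
  apply: (ler_cvg_to (cvg_norm (cvgB cv (@cvg_cst _ (expct P (fun w => \1_E w * N w s)) _ \oo _))) (@cvg_cst _ (expct P (fun w => excess c (N w t))) _ \oo _)).
  apply: nearW => m; change (`|expct P (fun w => \1_E w * clip c (S m m.+1 w)) - expct P (fun w => \1_E w * N w s)| <= expct P (fun w => excess c (N w t))).
  apply: le_trans (S_excess m c0).
  have i1 : intg P (fun w => \1_E w * clip c (S m m.+1 w)).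
    apply: intg_mul1 => //; apply: (@intg_bnd _ _ _ _ _ c); first exact: mclip.
    by move=> w; exact: clip_le.
  rewrite -(S_mean m FE) -expctB//; last exact: intg_mul1.
  apply: le_trans (expct_norm _) _; first by apply: intgB => //; exact: intg_mul1.
  apply: expct_le; first by apply: intg_norm; apply: intgB => //; exact: intg_mul1.
    exact: excess_intg.
  move=> w; rewrite -mulrBr normrM distrC clip_excess// ler_piMl ?excess_ge0//.
  exact: norm_indic_le1.
have c1 : expct P (fun w => \1_E w * clip n%:R (L w)) @[n --> \oo] --> expct P (fun w => \1_E w * L w).
  apply: (expct_dct (g := fun w => `|h w|)).
  - by move=> m; apply: measurable_funM; [exact: mfun_indic|exact: mclip].
  - move=> w; apply: cvgM; first exact: cvg_cst.
    apply/cvgrPdist_lt => e e0; exists (Num.truncn `|L w|).+1 => // m /= mL'.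
    rewrite clip_id ?subrr ?normr0//; apply: (le_trans (ltW (truncnS_gt _))).
    by rewrite ler_nat.
  - exact: intg_norm.
  - move=> m w; have [Ew|nEw] := pselect (E w); last by rewrite (indicF R nEw) mul0r normr0.
    rewrite (indicT R Ew) mul1r; apply: le_trans (clip_norm _ _) _ => //.
    exact: le_trans (Nh w Ew) (ler_norm _).
have c2 : expct P (fun w => excess n%:R (N w t)) @[n --> \oo] --> 0.
  rewrite -(expct_cst P 0); apply: (expct_dct (g := fun w => `|N w t|)).
  - by move=> m; apply: excess_mfun; exact/intg_meas/Ni.
  - move=> w; apply/cvgrPdist_lt => e e0; exists (Num.truncn `|N w t|).+1 => // m /= mL'.
    rewrite /excess max_l ?subrr ?normr0// subr_le0; apply: (le_trans (ltW (truncnS_gt _))).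
    by rewrite ler_nat.
  - exact/intg_norm/Ni.
  - by move=> m w; rewrite ger0_norm ?excess_ge0// excess_le.
apply/eqP; rewrite -subr_eq0 -normr_le0.
apply: (ler_cvg_to (cvg_norm (cvgB c1 (@cvg_cst _ (expct P (fun w => \1_E w * N w s)) _ \oo _))) c2).
by apply: nearW => n; exact: step1.
Qed.

End martingale_stop.

(** The previous result is applied to the localised martingales; as a localising time only shortens
    the time interval, g dominates them all on E, and dominated convergence removes the
    localisation. *)
Lemma optional_stopping (M : T -> R -> R) (g : T -> R) s t (E : set T) :
  local_martingale P F M -> (forall w, rcont (M w)) -> 0 <= s -> s <= t -> F s E -> intg P g ->
  (forall w u, E w -> 0 <= u <= t -> `|M w (Num.min u (sig w))| <= g w) ->
  expct P (fun w => \1_E w * (M w (Num.min t (sig w)) - M w (Num.min s (sig w)))) = 0.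
Proof.
move=> [aM [tau [tauS tauI tauoo Mtau]]] rM s0 st FE gi Mg.
move: st; rewrite le_eqVlt => /predU1P[<-|st].
  rewrite (_ : (fun w => _) = cst 0); first exact: expct_cst.
  by apply/funext => w; rewrite subrr mulr0.
have t0 : 0 <= t := le_trans s0 (ltW st).
have mE := filtration_meas s0 FE.
pose v k w u : R := fine (Order.min u%:E (tau k w)).
have vE k w u : 0 <= u -> v k w u = if (tau k w == +oo)%E then u else Num.min u (fine (tau k w)).
  move=> u0; have [/(_ w) tau0 _] := tauS k; rewrite /v; case: (tau k w) tau0 => [r| |] //= r0.
    by rewrite -EFin_min.
  by rewrite minEle leey.
have v0 k w u : 0 <= u -> 0 <= v k w u.
  move=> u0; rewrite vE//; case: ifPn => // _; rewrite le_min u0/=; apply: fine_ge0.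
  by have [/(_ w)] := tauS k.
have vmin k w u : 0 <= u -> v k w (Num.min u (sig w)) = Num.min (v k w u) (sig w).
  move=> u0; rewrite !vE//; last by rewrite le_min u0 sig0.
  by case: ifPn => // _; rewrite minAC.
have vle k w u : 0 <= u -> v k w u <= u.
  by move=> u0; rewrite vE//; case: ifPn => // _; rewrite ge_min lexx.
have rNk k w : rcont (stopped M (tau k) w).
  by apply: rcont_stopped => //; have [/(_ w)] := tauS k.
pose D k w := stopped M (tau k) w (Num.min t (sig w)) - stopped M (tau k) w (Num.min s (sig w)).
have Nb k w u : E w -> 0 <= u <= t -> `|stopped M (tau k) w (Num.min u (sig w))| <= g w.
  move=> Ew /andP[u0 ut]; rewrite /stopped -/(v k w _) vmin//; apply: Mg => //.
  by rewrite v0// (le_trans (vle k w u u0)).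
have maxE (x : R -> R) w : x (Num.max s (Num.min t (sig w))) - x s = x (Num.min t (sig w)) - x (Num.min s (sig w)).
  have [h|h] := leP s (sig w).
    by rewrite max_r// le_min (ltW st) h.
  rewrite max_l; last by rewrite ge_min (ltW h) orbT.
  by rewrite min_r ?(ltW (lt_trans h st))// !subrr.
have aN k : adapted F (stopped M (tau k)) by have [] := Mtau k.
have mNs k u : 0 <= u -> mfun (fun w => stopped M (tau k) w (Num.min u (sig w))).
  move=> u0; apply: (mfun_sub (filtration_sub Ffil u0)).
  by apply: stopped_measurable => //; exact: aN.
have D0 k : expct P (fun w => \1_E w * D k w) = 0.
  have [_ Ni _] := Mtau k.
  have Nsi : intg P (fun w => stopped M (tau k) w s) by exact: Ni.
  (* When sig < s, the stopped value is the one at time s, which g does not bound; it is therefore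
     added to the dominating function. *)
  pose h w := `|g w| + `|g w| + `|stopped M (tau k) w s|.
  have hi : intg P h by apply: intgD; [apply: intgD; exact: intg_norm|exact: intg_norm].
  have Lh w : E w -> `|stopped M (tau k) w (Num.max s (Num.min t (sig w)))| <= h w.
    move=> Ew; rewrite -[X in `|X|](subrK (stopped M (tau k) w s)) maxE.
    apply: le_trans (ler_normD _ _) _; rewrite lerD2r; apply: le_trans (ler_normB _ _) _.
    have gg := ler_norm (g w).
    apply: lerD; apply: le_trans gg; apply: Nb => //; first by rewrite t0 lexx.
    by rewrite s0 ltW.
  have mL : mfun (fun w => stopped M (tau k) w (Num.max s (Num.min t (sig w)))).
    rewrite /mfun (_ : (fun w => _) = (fun w => (stopped M (tau k) w (Num.min t (sig w)) - stopped M (tau k) w (Num.min s (sig w))) + stopped M (tau k) w s)).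
      apply: measurable_funD; last exact: intg_meas Nsi.
      by apply: measurable_funB; exact: mNs.
    by apply/funext => w; rewrite -maxE subrK.
  have iL : intg P (fun w => \1_E w * stopped M (tau k) w (Num.max s (Num.min t (sig w)))).
    apply: (intg_le _ hi); first by apply: measurable_funM => //; exact: mfun_indic.
    move=> w; have [Ew|nEw] := pselect (E w); last by rewrite (indicF R nEw) mul0r normr0.
    rewrite (indicT R Ew) mul1r; apply: le_trans (Lh w Ew) (ler_norm _).
  have := martingale_optional_stopping (Mtau k) (rNk k) s0 st FE hi Lh.
  move/eqP; rewrite -subr_eq0 -expctB//; last exact: intg_mul1.
  by move/eqP => <-; congr expct; apply/funext => w; rewrite -mulrBr maxE.
have mM u : 0 <= u -> mfun (fun w => M w (Num.min u (sig w))).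
  by move=> u0; apply: (mfun_sub (filtration_sub Ffil u0)); exact: stopped_measurable.
have gg w : g w <= `|g w| by exact: ler_norm.
have bnd (x y : R) w : `|x| <= g w -> `|y| <= g w -> `|x - y| <= `|g w| + `|g w|.
  move=> hx hy; apply: le_trans (ler_normB _ _) _.
  by apply: lerD; apply: le_trans (gg w).
have cv : expct P (fun w => \1_E w * D k w) @[k --> \oo] -->
    expct P (fun w => \1_E w * (M w (Num.min t (sig w)) - M w (Num.min s (sig w)))).
  apply: (@expct_dct_ae _ _ _ P _ _ (fun w => `|g w| + `|g w|)) => //.
  - move=> k; apply: measurable_funM; first exact: mfun_indic.
    by apply: measurable_funB; exact: mNs.
  - apply: measurable_funM; first exact: mfun_indic.
    by apply: measurable_funB; exact: mM.
  - apply: filterS tauoo => w /cvgeyPge/(_ t)[K _ HK]; apply/cvgrPdist_lt => e e0; exists K => // k /= Kk.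
    have tk := HK k Kk.
    have vid u : u <= t -> v k w u = u.
      by move=> ut; rewrite /v min_l// (le_trans _ tk)// lee_fin.
    rewrite /D /stopped -!/(v k w _) !vid ?subrr ?normr0// ge_min ?lexx//.
    by rewrite (ltW st).
  - by apply: intgD; exact: intg_norm.
  - move=> k w; have [Ew|nEw] := pselect (E w); last by rewrite (indicF R nEw) mul0r normr0 addr_ge0.
    by rewrite (indicT R Ew) mul1r; apply: bnd; apply: Nb; rewrite ?t0 ?s0 ?lexx ?(ltW st).
have cv0 : expct P (fun w => \1_E w * D k w) @[k --> \oo] --> 0.
  rewrite (_ : (fun k => _) = fun=> 0); first exact: cvg_cst.
  by apply/funext => k; exact: D0.
exact: (cvg_unique _ cv cv0).
Qed.

End optional_stopping.

(** * The stopped system *)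

Notation Z_jump z T r := (sup_upto (Order.min T%:E (exit_time z r))
  (fun t => (enorm (z t - left_limit z t) ^+ 2)%R)) (only parsing).
Notation A_jump z al i j T r := (sup_upto (Order.min T%:E (exit_time z r))
  (fun t => `|al t i j - left_limit (fun s => al s i j) t|%R)) (only parsing).

Section left_limits.
Context (R : realType).

Lemma left_limit_comp (V W : pseudoMetricNormedZmodType R) (g : V -> W) (x : R -> V) t :
  continuous g -> cadlag x -> left_limit (g \o x) t = g (left_limit x t).
Proof.
move=> cg [_ _ /(_ t) xl]; apply: cvg_lim; first exact: norm_hausdorff.
exact: (cvg_comp _ _ xl (cg _)).
Qed.

Lemma left_limit_le (x : R -> R) t c : cadlag x -> (forall s, s < t -> x s <= c) ->
  left_limit x t <= c.
Proof.
move=> cx H; apply/ler_addgt0Pr => e e0; have [del del0 Hd] := cadlag_left t cx e0.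
have h : t - del / 2 < t by rewrite gtrBl divr_gt0.
have := Hd (t - del / 2); rewrite h andbT ltrD2l ltrN2 ltr_pdivrMr// ltr_pMr// ltr1n => /(_ isT).
rewrite ltr_distl => /andP[h1 _]; have := H _ h; move: h1; lra.
Qed.

Lemma left_limit0 (V : pseudoMetricNormedZmodType R) (x : R -> V) :
  cadlag x -> left_limit x 0 = x 0.
Proof.
move=> [xneg _ _]; apply: cvg_lim; first exact: norm_hausdorff.
apply: cvg_near_cst; near=> s; apply/esym/esym/xneg; near: s.
exact: nbhs_left_lt.
Unshelve. all: by end_near. Qed.

Lemma cadlag_rcont (x : R -> R) : cadlag x -> rcont x.
Proof. by move=> cx t e _ e0; exact: cadlag_right. Qed.

End left_limits.

Section matrices.
Context (R : realType) (d : nat).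

Lemma quadratic_form2 (M : 'M[R]_d) i j (c : R) :
  (((delta_mx 0 i : 'rV[R]_d) + c *: delta_mx 0 j) *m M *m ((delta_mx 0 i : 'rV[R]_d) + c *: delta_mx 0 j)^T) 0 0 =
  M i i + c * M i j + c * M j i + c ^+ 2 * M j j :> R.
Proof.
have row1 k : (delta_mx 0 k : 'rV[R]_d) *m M = row k M by rewrite -rowE.
have col1 k (v : 'rV[R]_d) : (v *m (delta_mx 0 k : 'rV[R]_d)^T) 0 0 = v 0 k.
  by rewrite trmx_delta -colE mxE.
rewrite linearD/= linearZ/= mulmxDr -scalemxAr mxE [X in _ + X = _]mxE !col1.
rewrite mulmxDl -scalemxAl !row1 !mxE; ring.
Qed.

Lemma nonneg_diag (M : 'M[R]_d) i : nonneg_def M -> 0 <= M i i.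
Proof.
move=> /(_ (delta_mx 0 i + 0 *: delta_mx 0 i)); rewrite quadratic_form2.
by rewrite !mul0r expr0n/= mul0r !addr0.
Qed.

(** The quadratic form at e_i + e_j and at e_i - e_j. *)
Lemma nonneg_entry (M : 'M[R]_d) i j : symmetric_mx M -> nonneg_def M ->
  `|M i j| <= (M i i + M j j) / 2.
Proof.
move=> Ms Mn; have E : M j i = M i j by rewrite -{1}Ms mxE.
have h1 := Mn (delta_mx 0 i + 1 *: delta_mx 0 j).
have h2 := Mn (delta_mx 0 i + (-1) *: delta_mx 0 j).
move: h1 h2; rewrite !quadratic_form2 E sqrrN expr1n !mul1r !mulN1r => h1 h2.
by rewrite ler_norml; apply/andP; split; lra.
Qed.

Lemma nonneg_entry_trace (M : 'M[R]_d) i j : symmetric_mx M -> nonneg_def M ->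
  `|M i j| <= \tr M.
Proof.
move=> Ms Mn; apply: (le_trans (nonneg_entry i j Ms Mn)).
have le1 k : M k k <= \tr M.
  by rewrite /mxtrace (bigD1 k)//= lerDl sumr_ge0// => l _; exact: nonneg_diag.
by have := le1 i; have := le1 j; lra.
Qed.

Lemma enorm_sqr (x : 'rV[R]_d) : enorm x ^+ 2 = \sum_(i < d) x 0 i ^+ 2.
Proof. by rewrite sqr_sqrtr// sumr_ge0// => i _; exact: sqr_ge0. Qed.

Lemma coord_enorm (x : 'rV[R]_d) i : `|x 0 i| <= enorm x.
Proof.
rewrite -ler_sqr ?nnegrE ?enorm_ge0// enorm_sqr real_normK ?num_real//.
by rewrite (bigD1 i)//= lerDl sumr_ge0// => j _; exact: sqr_ge0.
Qed.

Lemma enorm_sqrD (x y : 'rV[R]_d) : enorm x ^+ 2 <= 2 * enorm y ^+ 2 + 2 * enorm (x - y) ^+ 2.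
Proof.
rewrite !enorm_sqr !mulr_sumr -big_split/=; apply: ler_sum => i _.
rewrite !mxE -subr_ge0.
have -> : 2 * y 0 i ^+ 2 + 2 * (x 0 i - y 0 i) ^+ 2 - x 0 i ^+ 2 = (2 * y 0 i - x 0 i) ^+ 2 by ring.
exact: sqr_ge0.
Qed.

End matrices.

Section stop_time.
Context (R : realType) (d : nat) (r K T : R) (z : skorokhod 'rV[R]_d) (al : R -> 'M[R]_d).

Definition overrun t := r < enorm (z t) \/ exists i, K < al t i i.
(** Including T makes the infimum finite and at most T. The levels are exceeded strictly, so by
    right-continuity an overrun persists at nearby rational times; this makes {stop_time < u} a
    countable union over times before u. *)
Definition stop_time : R := inf [set t | t = T \/ (0 <= t <= T /\ overrun t)].

Hypotheses (T0 : 0 <= T) (K0 : 0 <= K).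
Hypothesis al_cadlag : forall i j, cadlag (fun t => al t i j).
Hypothesis al0 : al 0 = 0.

Let S := [set t | t = T \/ (0 <= t <= T /\ overrun t)].
Let S_lb : lbound S 0.
Proof. by move=> t [->//|[/andP[]]]. Qed.
Let S_ne : S !=set0. Proof. by exists T; left. Qed.

Lemma stop_time_ge0 : 0 <= stop_time.
Proof. exact: lb_le_inf. Qed.

Lemma stop_time_le : stop_time <= T.
Proof. by apply: ge_inf; [exists 0|left]. Qed.

Lemma stop_time_before t : 0 <= t -> t < stop_time -> ~ overrun t.
Proof.
move=> t0 ts ot; have tT : t <= T := ltW (lt_le_trans ts stop_time_le).
have : stop_time <= t by apply: ge_inf; [exists 0|right; rewrite t0 tT].
by rewrite leNgt ts.
Qed.

Let neg_path (V : ptopologicalType) (x : R -> V) t : cadlag x -> t <= 0 -> x t = x 0.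
Proof. by move=> [xneg _ _]; rewrite le_eqVlt => /predU1P[->//|/xneg]. Qed.

Lemma stop_time_norm t : t < stop_time -> 0 < stop_time -> enorm (z t) <= r.
Proof.
move=> ts s0; rewrite leNgt; apply/negP => h.
have [t0|t0] := leP 0 t; first by apply: (stop_time_before t0 ts); left.
apply: (stop_time_before (lexx 0) s0); left.
by rewrite -(neg_path (path_cadlag z) (ltW t0)).
Qed.

Lemma stop_time_diag t i : t < stop_time -> 0 < stop_time -> al t i i <= K.
Proof.
move=> ts s0; rewrite leNgt; apply/negP => h.
have [t0|t0] := leP 0 t; first by apply: (stop_time_before t0 ts); right; exists i.
move: h; rewrite (neg_path (al_cadlag i i) (ltW t0)) al0 mxE ltNge K0//.
Qed.

Lemma left_limit_enorm t : left_limit (enorm_path z) t = enorm (left_limit z t).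
Proof. exact: left_limit_comp (@enorm_continuous R d) (path_cadlag z). Qed.

Lemma stop_time_left_norm t : t <= stop_time -> 0 < stop_time -> enorm (left_limit z t) <= r.
Proof.
move=> ts s0; rewrite -left_limit_enorm; apply: left_limit_le (path_cadlag (enorm_path z)) _ => s st.
by apply: stop_time_norm => //; exact: lt_le_trans ts.
Qed.

Lemma stop_time_left_diag t i : t <= stop_time -> 0 < stop_time ->
  left_limit (fun s => al s i i) t <= K.
Proof.
move=> ts s0; apply: left_limit_le => // s st.
by apply: stop_time_diag => //; exact: lt_le_trans ts.
Qed.

(** Level r + 1 leaves room: before the stopping time, values and left limits have norm at most r,
    so r + 1 is not reached there. The hypotheses up to the exit time for r + 1 therefore cover the
    jump at the stopping time. *)
Lemma stop_time_exit : (stop_time%:E <= Order.min T%:E (exit_time z (r + 1)))%E.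
Proof.
rewrite le_min lee_fin stop_time_le/=; apply: le_ereal_inf_tmp => _ [t [t0 H] <-].
rewrite lee_fin leNgt; apply/negP => ts.
have s0 : 0 < stop_time by exact: le_lt_trans ts.
have r1 : r < r + 1 by rewrite ltrDl.
by case: H => h; have := lt_le_trans r1 h; rewrite ltNge ?stop_time_norm ?stop_time_left_norm// ltW.
Qed.

Lemma sup_upto_ge (tau : \bar R) (g : R -> R) t : 0 <= t -> (t%:E <= tau)%E ->
  ((g t)%:E <= sup_upto tau g)%E.
Proof. by move=> t0 tt; apply: ereal_sup_ubound; exists t. Qed.

(** The left limit still has norm at most r, and the square of a sum is at most twice the sum of the
    squares. If the stopping time is 0, there is no jump and the bound on the starting point takes
    over. *)
Lemma stop_time_overshoot : enorm (z 0) <= r ->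
  ((Num.max 0 (enorm (z stop_time) ^+ 2 - 2 * r ^+ 2) / 2)%:E <=
    Z_jump z T (r + 1))%E.
Proof.
move=> z0; have r0 : 0 <= r := le_trans (enorm_ge0 _) z0.
apply: (@le_trans _ _ (enorm (z stop_time - left_limit z stop_time) ^+ 2)%:E); last first.
  by apply: (sup_upto_ge (fun t => enorm (z t - left_limit z t) ^+ 2)); [exact: stop_time_ge0|exact: stop_time_exit].
rewrite lee_fin ler_pdivrMr// ge_max mulr_ge0 ?sqr_ge0//=.
have [s0|s0] := ltP 0 stop_time.
  have h : enorm (left_limit z stop_time) ^+ 2 <= r ^+ 2.
    by rewrite ler_sqr ?nnegrE ?enorm_ge0//; exact: stop_time_left_norm.
  by have := enorm_sqrD (z stop_time) (left_limit z stop_time); move: h; lra.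
have -> : stop_time = 0 by apply/eqP; rewrite eq_le s0 stop_time_ge0.
have : enorm (z 0) ^+ 2 <= r ^+ 2 by rewrite ler_sqr ?nnegrE ?enorm_ge0.
have := sqr_ge0 (enorm (z 0 - left_limit z 0)); have := sqr_ge0 r; lra.
Qed.

Lemma stop_time_diag_overshoot i :
  ((Num.max 0 (al stop_time i i - K))%:E <=
    A_jump z al i i T (r + 1))%E.
Proof.
apply: (@le_trans _ _ (`|al stop_time i i - left_limit (fun s => al s i i) stop_time|)%:E); last first.
  by apply: (sup_upto_ge (fun t => `|al t i i - left_limit (fun s => al s i i) t|)); [exact: stop_time_ge0|exact: stop_time_exit].
rewrite lee_fin ge_max normr_ge0/=.
have [s0|s0] := ltP 0 stop_time.
  by apply: le_trans (ler_norm _); rewrite lerD2l lerN2 stop_time_left_diag.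
have -> : stop_time = 0 by apply/eqP; rewrite eq_le s0 stop_time_ge0.
by apply: le_trans (normr_ge0 _); rewrite al0 mxE sub0r oppr_le0.
Qed.

Lemma overrun_rat t u : t < u -> overrun t -> exists q : rat, t < ratr q < u /\ overrun (ratr q).
Proof.
move=> tu [h|[i h]].
- have e0 : 0 < enorm (z t) - r by rewrite subr_gt0.
  have [q [tqu zq]] := cadlag_rat (path_cadlag (enorm_path z)) tu e0.
  exists q; split=> //; left; move: zq; rewrite /= ltr_distl opprB addrC subrK => /andP[//].
- have e0 : 0 < al t i i - K by rewrite subr_gt0.
  have [q [tqu zq]] := cadlag_rat (al_cadlag i i) tu e0.
  exists q; split=> //; right; exists i; move: zq; rewrite ltr_distl opprB addrC subrK => /andP[//].
Qed.

Lemma stop_time_lt u : u <= T ->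
  stop_time < u <-> exists q : rat, [/\ 0 <= ratr q :> R, ratr q < u & overrun (ratr q)].
Proof.
move=> uT; split=> [su|[q [q0 qu oq]]]; last first.
  apply: le_lt_trans (qu); apply: ge_inf; first by exists 0.
  by right; split=> //; rewrite q0 (ltW (lt_le_trans qu uT)).
have [t St tu] := inf_lt S_ne su; case: St => [tT|[/andP[t0 tT] ot]].
  by move: tu; rewrite tT ltNge uT.
have [q [/andP[tq qu] oq]] := overrun_rat tu ot.
by exists q; split=> //; exact: le_trans t0 (ltW tq).
Qed.

End stop_time.

Record regular_system (R : realType) (d : nat) (dd : measure_display) (Om : measurableType dd)
  (P : probability Om R) (Z : Om -> skorokhod 'rV[R]_d) (A : Om -> R -> 'M[R]_d) : Prop := RegularSystem {
  sys_Z_meas : measurable_process (fun w t => Z w t);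
  sys_A_meas : measurable_process A;
  sys_A_sym : forall w t, 0 <= t -> symmetric_mx (A w t);
  sys_A_start : forall w, A w 0 = 0;
  sys_A_cadlag : forall w i j, cadlag (fun t => A w t i j);
  sys_A_incr : forall w s t, 0 <= s -> s < t -> nonneg_def (A w t - A w s);
  sys_Z_mart : forall i, local_martingale P (joint_filtration (fun w s => Z w s) A) (fun w t => Z w t 0 i);
  sys_ZZ_mart : forall i j, local_martingale P (joint_filtration (fun w s => Z w s) A)
    (fun w t => Z w t 0 i * Z w t 0 j - A w t i j) }.

Section stopped_system.
Context (R : realType) (d : nat) (dd : measure_display) (Om : measurableType dd)
  (P : probability Om R) (Z : Om -> skorokhod 'rV[R]_d) (A : Om -> R -> 'M[R]_d).
Hypothesis sys : regular_system P Z A.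
Let Z_meas := sys_Z_meas sys.
Let A_meas := sys_A_meas sys.
Let A_sym := sys_A_sym sys.
Let A_start := sys_A_start sys.
Let A_cadlag := sys_A_cadlag sys.
Let A_incr := sys_A_incr sys.

Notation F := (joint_filtration (fun w s => Z w s) A).
Notation GT t := (g_sigma_algebraType (F t)).

Lemma joint_filtration_filtration : filtration F.
Proof.
split=> [t t0|t t0|s t s0 st].
- exact: smallest_sigma_algebra.
- apply: smallest_sub; first exact: sigma_algebra_measurable.
  move=> E [|] [s /andP[s0 _] [B sB ->]].
    by have := Z_meas s0 measurableT sB; rewrite setTI.
  by have := A_meas s0 measurableT sB; rewrite setTI.
- apply: sub_sigma_algebra2 => E [] [u /andP[u0 us] [B sB ->]]; [left|right];
    by exists u; rewrite ?u0 ?(le_trans us)//; exists B.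
Qed.
Let Ffil := joint_filtration_filtration.

Lemma past_Z_measurable (g : 'rV[R]_d -> R) s t : continuous g -> 0 <= s -> s <= t ->
  measurable_fun [set: GT t] (fun w => g (Z w s)).
Proof.
move=> cg s0 st; apply: mfun_gt => c; apply: sub_sigma_algebra; apply: sub_sigma_algebra.
left; exists s; first by rewrite s0.
exists [set x | c < g x] => //; apply: sub_sigma_algebra.
by apply: open_comp (@open_gt R c) => x _; exact: cg.
Qed.

Lemma past_A_measurable (g : 'M[R]_d -> R) s t : continuous g -> 0 <= s -> s <= t ->
  measurable_fun [set: GT t] (fun w => g (A w s)).
Proof.
move=> cg s0 st; apply: mfun_gt => c; apply: sub_sigma_algebra; apply: sub_sigma_algebra.
right; exists s; first by rewrite s0.
exists [set x | c < g x] => //; apply: sub_sigma_algebra.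
by apply: open_comp (@open_gt R c) => x _; exact: cg.
Qed.

Lemma measurable_GT t (E : set Om) : 0 <= t -> @measurable _ (GT t) E -> F t E.
Proof. by move=> t0; rewrite {1}/measurable/= filtration_id. Qed.

Lemma adapted_GT (X : Om -> R -> R) : (forall t, 0 <= t -> measurable_fun [set: GT t] (X ^~ t)) ->
  adapted F X.
Proof.
move=> H t t0 B mB; apply: measurable_GT => //.
by have := H t t0 measurableT B mB; rewrite setTI.
Qed.

Lemma Z_coord_adapted i : adapted F (fun w t => Z w t 0 i).
Proof.
by apply: adapted_GT => t t0; apply: (past_Z_measurable (g := fun x => x 0 i)) => //; exact: coord_continuous.
Qed.

Lemma A_coord_adapted i j : adapted F (fun w t => A w t i j).
Proof.
by apply: adapted_GT => t t0; apply: (past_A_measurable (g := fun x => x i j)) => //; exact: coord_continuous.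
Qed.

Lemma Z_coord_rcont w i : rcont (fun t => Z w t 0 i).
Proof.
apply: cadlag_rcont; apply: (cadlag_comp (g := fun x : 'rV[R]_d => x 0 i) _ (path_cadlag (Z w))).
exact: coord_continuous.
Qed.

Context (r K T : R).
Hypotheses (r0 : 0 <= r) (K0 : 0 <= K) (T0 : 0 <= T).

Definition halt w := stop_time r K T (Z w) (A w).
Notation sg := halt.

Lemma halt_ge0 w : 0 <= sg w. Proof. exact: stop_time_ge0. Qed.
Lemma halt_le w : sg w <= T. Proof. exact: stop_time_le. Qed.

(** Whether {halt <= u} occurs may depend on the path just after u; the strict event is decided by
    rational times before u, whence the use of strict events throughout. *)
Lemma halt_past u : 0 <= u -> F u [set w | sg w < u].
Proof.
move=> u0; have [uT|Tu] := leP u T; last first.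
  rewrite (_ : [set w | _] = setT); last by apply/seteqP; split=> w //= _; exact: le_lt_trans (halt_le w) Tu.
  by apply: measurable_GT.
rewrite (_ : [set w | _] = \bigcup_(q in [set q : rat | 0 <= ratr q :> R /\ ratr q < u :> R])
  ([set w | r < enorm (Z w (ratr q))] `|` \bigcup_(i in [set: 'I_d]) [set w | K < A w (ratr q) i i])%classic); last first.
  apply/seteqP; split=> w /=.
    rewrite /halt (stop_time_lt r K (Z w) T0 (A_cadlag w) uT) => -[q [q0 qu]].
    by case=> [h|[i h]]; exists q; [|left| |right; exists i].
  move=> [q [q0 qu] h]; rewrite /halt (stop_time_lt r K (Z w) T0 (A_cadlag w) uT).
  exists q; split=> //; case: h => [h|[i _ h]]; [left|right] => //.
  by exists i.
apply: measurable_GT => //; apply: bigcup_rat_measurable => q [q0 qu].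
apply: measurableU.
  by apply: measurable_gt_cst; apply: past_Z_measurable; [exact: enorm_continuous| |exact: ltW].
apply: fin_bigcup_measurable => // i _.
by apply: measurable_gt_cst; apply: (past_A_measurable (g := fun x => x i i)); [exact: coord_continuous| |exact: ltW].
Qed.

Definition inside : set Om := [set w | enorm (Z w 0) <= r].
Notation start := inside.

Lemma inside_past s : 0 <= s -> F s start.
Proof.
move=> s0; apply: measurable_GT => //; apply: measurable_le_cst.
exact: past_Z_measurable (@enorm_continuous R d) _ _.
Qed.

Lemma inside_measurable : measurable start.
Proof. by have h := inside_past (lexx 0); exact: (filtration_meas Ffil (lexx 0) h). Qed.

(** Off [inside] the process is halted at time 0 in a position that no jump controls. The indicator
    discards these paths and, being known at time 0, preserves the martingale identities. *)
Definition stopped_Z i t w : R := \1_start w * Z w (Num.min t (sg w)) 0 i.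
Notation Y := stopped_Z.
Definition stopped_A i j t w : R := \1_start w * A w (Num.min t (sg w)) i j.
Notation B := stopped_A.

Lemma inside_indic_past t : 0 <= t -> measurable_fun [set: GT t] (\1_start : GT t -> R).
Proof.
move=> t0; apply: measurable_indic; rewrite /measurable/= filtration_id//.
exact: inside_past.
Qed.

Lemma stopped_Z_past i t : 0 <= t -> measurable_fun [set: GT t] (Y i t).
Proof.
move=> t0; apply: measurable_funM; first exact: inside_indic_past.
apply: (stopped_measurable Ffil halt_past halt_ge0 (M := fun w t => Z w t 0 i)) => //.
  exact: Z_coord_adapted.
by move=> w; exact: Z_coord_rcont.
Qed.

Lemma stopped_A_past i j t : 0 <= t -> measurable_fun [set: GT t] (B i j t).
Proof.
move=> t0; apply: measurable_funM; first exact: inside_indic_past.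
apply: (stopped_measurable Ffil halt_past halt_ge0 (M := fun w t => A w t i j)) => //.
  exact: A_coord_adapted.
by move=> w; exact: cadlag_rcont.
Qed.

Lemma stopped_Z_mfun i t : 0 <= t -> mfun (Y i t).
Proof. by move=> t0; apply: (mfun_sub (filtration_sub Ffil t0)); exact: stopped_Z_past. Qed.

Lemma stopped_A_mfun i j t : 0 <= t -> mfun (B i j t).
Proof. by move=> t0; apply: (mfun_sub (filtration_sub Ffil t0)); exact: stopped_A_past. Qed.

(* Before [halt], |Z| <= r and A_ii <= K, so the overshoots are controlled by
   the jumps of Z and A at [halt]. *)
Definition overshoot_Z w : R := Num.max 0 (\sum_(i < d) Y i T w ^+ 2 - 2 * r ^+ 2) / 2.
Notation Jz := overshoot_Z.
Definition overshoot_A i w : R := Num.max 0 (B i i T w - K).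
Notation Ja := overshoot_A.

Lemma halt_horizon w : Num.min T (sg w) = sg w.
Proof. by rewrite min_r// halt_le. Qed.

Lemma stopped_Z_sqr w t : start w -> \sum_(i < d) Y i t w ^+ 2 = enorm (Z w (Num.min t (sg w))) ^+ 2.
Proof. by move=> sw; rewrite enorm_sqr; apply: eq_bigr => i _; rewrite /stopped_Z indicT// mul1r. Qed.

Lemma overshoot_Z_ge0 w : 0 <= Jz w.
Proof. by rewrite divr_ge0// le_max lexx. Qed.

Lemma overshoot_A_ge0 i w : 0 <= Ja i w.
Proof. by rewrite le_max lexx. Qed.

Lemma stopped_Z_bound t w : 0 <= t <= T -> \sum_(i < d) Y i t w ^+ 2 <= 2 * r ^+ 2 + 2 * Jz w.
Proof.
move=> /andP[t0 tT]; have J0 := overshoot_Z_ge0 w; have rr := sqr_ge0 r.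
have [sw|nsw] := pselect (start w); last first.
  rewrite big1; first by lra.
  by move=> i _; rewrite /stopped_Z indicF// mul0r expr0n.
have [st|ts] := leP (sg w) t.
  rewrite /overshoot_Z !stopped_Z_sqr// halt_horizon (min_r st) [X in _ + X]mulrC divfK//.
  by rewrite -lerBlDl le_max lexx orbT.
rewrite stopped_Z_sqr// (min_l (ltW ts)).
have s0 : 0 < sg w by exact: le_lt_trans ts.
have h := stop_time_norm T0 ts s0.
have : enorm (Z w t) ^+ 2 <= r ^+ 2 by rewrite ler_sqr ?nnegrE ?enorm_ge0.
move: J0; lra.
Qed.

Lemma A_nonneg w t : 0 <= t -> nonneg_def (A w t).
Proof.
rewrite le_eqVlt => /predU1P[<-|t0]; first by move=> u; rewrite A_start mulmx0 mul0mx mxE.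
by have := A_incr w (lexx 0) t0; rewrite A_start subr0.
Qed.

Lemma A_diag_mono w i s t : 0 <= s -> s <= t -> A w s i i <= A w t i i.
Proof.
move=> s0; rewrite le_eqVlt => /predU1P[<-//|st].
by have := nonneg_diag i (A_incr w s0 st); rewrite !mxE subr_ge0.
Qed.

Lemma stopped_A_bound i j t w : 0 <= t <= T -> `|B i j t w| <= d%:R * K + \sum_(k < d) Ja k w.
Proof.
move=> /andP[t0 tT].
have R0 : 0 <= d%:R * K + \sum_(k < d) Ja k w.
  by rewrite addr_ge0 ?mulr_ge0// sumr_ge0// => k _; exact: overshoot_A_ge0.
have [sw|nsw] := pselect (start w); last by rewrite /stopped_A indicF// mul0r normr0.
rewrite /stopped_A indicT// mul1r; have m0 : 0 <= Num.min t (sg w) by rewrite le_min t0 halt_ge0.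
apply: (le_trans (nonneg_entry_trace i j (A_sym w m0) (A_nonneg w m0))).
have -> : d%:R * K = \sum_(k < d) K by rewrite sumr_const card_ord -[RHS]mulr_natl.
rewrite -big_split/=; apply: ler_sum => k _.
apply: (@le_trans _ _ (A w (sg w) k k)); first by apply: A_diag_mono => //; rewrite ge_min lexx orbT.
by rewrite -lerBlDl /overshoot_A /stopped_A halt_horizon indicT// mul1r le_max lexx orbT.
Qed.

Hypothesis Z_jump_fin : (\int[P]_w Z_jump (Z w) T (r + 1) < +oo)%E.
Hypothesis A_jump_fin : forall i j, (\int[P]_w A_jump (Z w) (A w) i j T (r + 1) < +oo)%E.

Lemma sup_upto_ge0 w (g : R -> R) : (forall t, 0 <= g t) ->
  (0 <= sup_upto (Order.min T%:E (exit_time (Z w) (r + 1))) g)%E.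
Proof.
move=> g0; apply: (@le_trans _ _ (g 0)%:E); first by rewrite lee_fin.
apply: sup_upto_ge => //; rewrite le_min lee_fin T0/=.
by apply: le_ereal_inf_tmp => _ [t [t0 _] <-]; rewrite lee_fin.
Qed.

Lemma mfun_maxr0 (f : Om -> R) c : mfun f -> mfun (fun w => Num.max 0 (f w - c)).
Proof. by move=> mf; apply: measurable_maxr => //; exact: measurable_funB. Qed.

(* The integral of a nonnegative function that may fail to be measurable is its
   lower integral, which is monotone. *)
Lemma le_lower_integral (f : Om -> R) (h : Om -> \bar R) : mfun f -> (forall w, 0 <= f w) ->
  (forall w, (f w)%:E <= h w)%E -> (\int[P]_w h w < +oo)%E ->
  intg P f /\ ((expct P f)%:E <= \int[P]_w h w)%E.
Proof.
move=> mf f0 fh hfin.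
have le : (\int[P]_w (f w)%:E <= \int[P]_w h w)%E.
  rewrite !ge0_integralTE//; last by move=> w; apply: le_trans (fh w); rewrite lee_fin.
  by apply: le_ereal_sup => _ [g /= gf <-]; exists g => //= w; exact: le_trans (gf w) (fh w).
have fi : intg P f.
  apply/integrableP; split; first exact/measurable_EFinP.
  apply: le_lt_trans hfin; apply: le_trans le.
  rewrite le_eqVlt; apply/orP; left; apply/eqP; apply: eq_integral => w _.
  by rewrite gee0_abs// lee_fin.
by split=> //; rewrite EFin_expct.
Qed.

Lemma overshoot_Z_intg : intg P Jz /\ ((expct P Jz)%:E <=
  \int[P]_w Z_jump (Z w) T (r + 1))%E.
Proof.
apply: le_lower_integral => //.
- apply: measurable_funM => //; apply: mfun_maxr0.
  apply: (@measurable_sum _ Om _ _ _ _ (fun (i : 'I_d) w => Y i T w ^+ 2)) => i.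
  by apply: measurable_funX; exact: stopped_Z_mfun.
- exact: overshoot_Z_ge0.
- move=> w; have [sw|nsw] := pselect (start w); last first.
    rewrite /overshoot_Z big1 ?sub0r; last by move=> i _; rewrite /stopped_Z indicF// mul0r expr0n.
    rewrite max_l ?mul0r; last by rewrite oppr_le0 mulr_ge0// sqr_ge0.
    by apply: sup_upto_ge0 => t; exact: sqr_ge0.
  rewrite /overshoot_Z stopped_Z_sqr// halt_horizon.
  by apply: stop_time_overshoot => //; exact: A_cadlag.
Qed.

Lemma overshoot_A_intg i : intg P (Ja i) /\ ((expct P (Ja i))%:E <=
  \int[P]_w A_jump (Z w) (A w) i i T (r + 1))%E.
Proof.
apply: le_lower_integral => //.
- exact/mfun_maxr0/stopped_A_mfun.
- exact: overshoot_A_ge0.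
- move=> w; have [sw|nsw] := pselect (start w); last first.
    rewrite /overshoot_A /stopped_A indicF// mul0r max_l; last by rewrite sub0r oppr_le0.
    by apply: sup_upto_ge0 => t; exact: normr_ge0.
  rewrite /overshoot_A /stopped_A indicT// mul1r halt_horizon.
  by apply: stop_time_diag_overshoot => //; exact: A_cadlag.
Qed.

Let g w : R := (1 + 2 * r ^+ 2 + 2 * Jz w) + (d%:R * K + \sum_(k < d) Ja k w).

Let g_intg : intg P g.
Proof.
apply: intgD; first by apply: intgD; [exact: intg_cst|apply: intgZ; case: overshoot_Z_intg].
apply: intgD; first exact: intg_cst.
by apply: (@intg_sum _ _ _ P 'I_d) => k; case: (overshoot_A_intg k).
Qed.

Lemma stopped_Z_norm i t w : 0 <= t <= T -> `|Y i t w| <= 1 + 2 * r ^+ 2 + 2 * Jz w.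
Proof.
move=> tT; have := stopped_Z_bound w tT => h.
have h2 : Y i t w ^+ 2 <= 2 * r ^+ 2 + 2 * Jz w.
  by apply: le_trans h; rewrite (bigD1 i)//= lerDl sumr_ge0// => j _; exact: sqr_ge0.
have : 0 <= (`|Y i t w| - 1) ^+ 2 by exact: sqr_ge0.
rewrite sqrrB1 real_normK ?num_real// -mulr_natl; have := normr_ge0 (Y i t w); move: h2; lra.
Qed.

Lemma stopped_ZZ_norm i j t w : 0 <= t <= T -> `|Y i t w * Y j t w| <= 2 * r ^+ 2 + 2 * Jz w.
Proof.
move=> tT; apply: le_trans (stopped_Z_bound w tT).
have hi : Y i t w ^+ 2 <= \sum_(i < d) Y i t w ^+ 2.
  by rewrite (bigD1 i)//= lerDl sumr_ge0// => k _; exact: sqr_ge0.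
have hj : Y j t w ^+ 2 <= \sum_(i < d) Y i t w ^+ 2.
  by rewrite (bigD1 j)//= lerDl sumr_ge0// => k _; exact: sqr_ge0.
have h1 : 0 <= (Y i t w - Y j t w) ^+ 2 by exact: sqr_ge0.
have h2 : 0 <= (Y i t w + Y j t w) ^+ 2 by exact: sqr_ge0.
move: h1 h2; rewrite sqrrB sqrrD -mulr_natl => h1 h2.
by rewrite ler_norml; apply/andP; split; lra.
Qed.

Lemma stopped_A_intg i j t : 0 <= t <= T -> intg P (B i j t).
Proof.
move=> tT; have /andP[t0 _] := tT; apply: (intg_le (stopped_A_mfun i j t0) g_intg) => w.
apply: le_trans (ler_norm _); apply: (le_trans (stopped_A_bound i j w tT)).
have J0 := overshoot_Z_ge0 w; have rr := sqr_ge0 r; rewrite /g; lra.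
Qed.

Lemma stopped_Z_mean i s t E :
  local_martingale P F (fun w t => Z w t 0 i) ->
  0 <= s -> s <= t -> t <= T -> F s E -> expct P (fun w => \1_E w * (Y i t w - Y i s w)) = 0.
Proof.
move=> mZ s0 st tT FE; have FED : F s (E `&` start) by exact: (filtrationI Ffil s0 FE (inside_past s0)).
rewrite -(optional_stopping Ffil halt_past halt_ge0 mZ _ s0 st FED g_intg).
- congr expct; apply/funext => w; rewrite indicI/= /stopped_Z -mulrBr mulrA; congr (_ * _).
- by move=> w; exact: Z_coord_rcont.
- move=> w u [Ew sw] /andP[u0 ut].
  have uT : 0 <= u <= T by rewrite u0 (le_trans ut tT).
  have := stopped_Z_norm i w uT; rewrite /stopped_Z indicT// mul1r => h; apply: (le_trans h).
  by rewrite lerDl addr_ge0 ?mulr_ge0// sumr_ge0// => k _; exact: overshoot_A_ge0.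
Qed.

Lemma stopped_ZZ_mean i j s t E :
  local_martingale P F (fun w t => Z w t 0 i * Z w t 0 j - A w t i j) ->
  0 <= s -> s <= t -> t <= T -> F s E ->
  expct P (fun w => \1_E w * (Y i t w * Y j t w - Y i s w * Y j s w - (B i j t w - B i j s w))) = 0.
Proof.
move=> mZ s0 st tT FE; have FED : F s (E `&` start) by exact: (filtrationI Ffil s0 FE (inside_past s0)).
rewrite -(optional_stopping Ffil halt_past halt_ge0 mZ _ s0 st FED g_intg).
- congr expct; apply/funext => w; rewrite indicI/= /stopped_Z /stopped_A.
  have [sw|sw] := pselect (start w); first by rewrite !(indicT R sw); ring.
  by rewrite !(indicF R sw); ring.
- move=> w; apply: cadlag_rcont.
  have cZ k : cadlag (fun t => Z w t 0 k).
    apply: (cadlag_comp (g := fun x : 'rV[R]_d => x 0 k) _ (path_cadlag (Z w))).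
    exact: coord_continuous.
  have [ni ri li] := cZ i; have [nj rj lj] := cZ j; have [na ra la] := A_cadlag w i j.
  split=> [u u0|u|u].
  + by rewrite ni// nj// na.
  + by apply: cvgB => //; apply: cvgM.
  + by apply: is_cvgB => //; apply: is_cvgM.
- move=> w u [Ew sw] /andP[u0 ut].
  have uT : 0 <= u <= T by rewrite u0 (le_trans ut tT).
  have h1 := stopped_ZZ_norm i j w uT; have h2 := stopped_A_bound i j w uT.
  move: h1 h2; rewrite /stopped_Z /stopped_A !(indicT R sw) !mul1r => h1 h2.
  apply: (le_trans (ler_normB _ _)); apply: lerD => //; apply: (le_trans h1).
  by rewrite -addrA lerDr.
Qed.

End stopped_system.

(** * Time integrals along paths *)

Section time_integral.
Context (R : realType).
Notation lam := (@lebesgue_measure R).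

Definition tint (t : R) (f : R -> R) : R := \int[lam]_(s in `[0, t]) f s.

Lemma bounded_integrable_itv (f : R -> R) C (b : bool) (s t : R) : measurable_fun setT f ->
  (forall x, `|f x| <= C) -> lam.-integrable [set` Interval (BSide b s) (BRight t)] (EFin \o f).
Proof.
move=> mf fC; apply: measurable_bounded_integrable => //.
- rewrite [X in (X < _)%E]lebesgue_measure_itv/=.
  by case: ifPn => // _; rewrite -EFinB ltry.
- exact: measurable_funTS.
- exists C; split; first exact: num_real.
  by move=> y Cy x _; apply: le_trans (ltW Cy).
Qed.

Lemma tint_increment (f : R -> R) C s t : measurable_fun setT f -> (forall x, `|f x| <= C) ->
  0 <= s -> s <= t -> `|tint t f - tint s f| <= C * (t - s).
Proof.
move=> mf fC s0 st; have C0 : 0 <= C := le_trans (normr_ge0 _) (fC 0).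
rewrite /tint Rintegral_itvB; last 3 first.
- exact: bounded_integrable_itv mf fC.
- by rewrite bnd_simp.
- by rewrite bnd_simp.
apply: (@le_trans _ _ (\int[lam]_(x in `]s, t]) `|f x|)).
  by apply: le_normr_Rintegral => //; exact: bounded_integrable_itv mf fC.
apply: (@le_trans _ _ (\int[lam]_(x in `]s, t]) C)).
  apply: le_Rintegral => //.
- by apply: (@bounded_integrable_itv _ C) => [|x]; [exact: mfun_norm|rewrite normr_id].
- by apply: (@bounded_integrable_itv _ C) => [|x]; [exact: measurable_cst|rewrite ger0_norm].
rewrite Rintegral_cst//.
rewrite ler_wpM2l// [X in fine X]lebesgue_measure_itv/= lte_fin.
by case: ifPn => _; rewrite ?subr_ge0.
Qed.

Lemma increment_bound (u g : R -> R) c0 cg s t : measurable_fun setT g -> (forall v, `|u v| <= c0) ->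
  (forall v, `|g v| <= cg) -> 0 <= s -> s <= t -> `|u t - u s - (tint t g - tint s g)| <= 2 * c0 + cg * t.
Proof.
move=> mg uc gc s0 st; apply: le_trans (ler_normB _ _) _; apply: lerD.
  exact: ler_normB2.
apply: le_trans (tint_increment mg gc s0 st) _.
by rewrite ler_wpM2l ?gerBl//; exact: le_trans (gc 0).
Qed.

Lemma tint0 (f : R -> R) : tint 0 f = 0.
Proof. by rewrite /tint set_itv1 Rintegral_set1. Qed.

Lemma tint_rcont (f : R -> R) C : measurable_fun setT f -> (forall x, `|f x| <= C) ->
  rcont (tint ^~ f).
Proof.
move=> mf fC t e t0 e0; have C0 : 0 <= C := le_trans (normr_ge0 _) (fC 0).
exists (e / (C + 1)); first by rewrite divr_gt0// ltr_wpDl.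
move=> s /andP[ts std]; apply: le_lt_trans (tint_increment mf fC t0 ts) _.
have : s - t < e / (C + 1) by rewrite ltrBlDl.
rewrite ltr_pdivlMr ?ltr_wpDl// => h; apply: le_lt_trans h.
by rewrite mulrC ler_wpM2l ?subr_ge0// lerDl.
Qed.

Lemma tint_dist_le (f g : R -> R) C t : measurable_fun setT f -> measurable_fun setT g ->
  (forall x, `|f x| <= C) -> (forall x, `|g x| <= C) ->
  `|tint t f - tint t g| <= tint t (fun s => `|f s - g s|).
Proof.
move=> mf mg fC gC; rewrite /tint -RintegralB; last 3 first.
- exact: measurable_itv.
- exact: bounded_integrable_itv mf fC.
- exact: bounded_integrable_itv mg gC.
apply: le_normr_Rintegral => //.
apply: (@bounded_integrable_itv _ (C + C)); first exact: measurable_funB.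
by move=> x; apply: le_trans (ler_normB _ _) _; exact: lerD.
Qed.

End time_integral.

Section joint_measurability.
Context d (T : measurableType d) (R : realType).

Definition jmeas (X : T -> R -> R) := measurable_fun [set: T * measurableTypeR R] (fun p => X p.1 p.2).

Lemma jmeas_path X w : jmeas X -> measurable_fun setT (X w).
Proof.
move=> mX; rewrite (_ : X w = (fun p : T * measurableTypeR R => X p.1 p.2) \o pair w)//.
apply: measurableT_comp => //; exact: pair1_measurable.
Qed.

Lemma jmeas_lim (X_ : nat -> T -> R -> R) X : (forall k, jmeas (X_ k)) ->
  (forall w t, X_ k w t @[k --> \oo] --> X w t) -> jmeas X.
Proof.
move=> mX XX; apply: (@measurable_fun_cvg _ _ _ _ (fun k (p : T * measurableTypeR R) => X_ k p.1 p.2)) => // -[w t] _.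
Qed.

Lemma mfun_pieces d' (U : measurableType d') (q : U -> nat) (phi : nat -> U -> R) :
  (forall k, measurable (q @^-1` [set k])) -> (forall k, mfun (phi k)) ->
  mfun (fun x => phi (q x) x).
Proof.
move=> mq mphi _ B mB; rewrite setTI.
rewrite (_ : _ @^-1` B = \bigcup_k ((q @^-1` [set k]) `&` (phi k @^-1` B))).
  apply: bigcupT_measurable => k; apply: measurableI => //.
  by rewrite -[X in measurable X]setTI; exact: mphi.
apply/seteqP; split=> x /=; first by move=> Bx; exists (q x).
by move=> [k _ [/= <-]].
Qed.

Lemma measurable_truncn (c : R) (k : nat) : measurable [set s : measurableTypeR R | Num.truncn (c * Num.max 0 s) = k].
Proof.
have mf : measurable_fun setT (fun s : measurableTypeR R => (Num.truncn (c * Num.max 0 s))%:R : R).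
  apply: (@measurableT_comp _ _ _ _ _ _ (fun y : R => (Num.truncn y)%:R : R)).
    apply: nondecreasing_measurable => // x y xy; rewrite ler_nat; exact: le_truncn.
  by apply: measurable_funM => //; exact: measurable_maxr.
rewrite (_ : [set s | _] = (fun s : R => (Num.truncn (c * Num.max 0 s))%:R : R) @^-1` [set k%:R]).
  by rewrite -[X in measurable X]setTI; exact: mf.
apply/seteqP; split=> s /=; first by move=> ->.
by move/eqP; rewrite eqr_nat => /eqP.
Qed.

(** Time is replaced by the right end (q + 1)/(m + 1) of its cell, a point strictly to its right, so
    right-continuity gives convergence; on each cell the sampled function depends on w alone. *)
Lemma jmeas_cadlag (X : T -> R -> R) : (forall t, 0 <= t -> mfun (X ^~ t)) ->
  (forall w, cadlag (X w)) -> jmeas X.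
Proof.
move=> mX cX.
pose q (m : nat) (s : R) : nat := Num.truncn (m.+1%:R * Num.max 0 s).
apply: (@jmeas_lim (fun m w s => X w ((q m s).+1%:R / m.+1%:R))).
  move=> m; apply: (@mfun_pieces _ _ (fun p : T * measurableTypeR R => q m p.2) (fun k p => X p.1 (k.+1%:R / m.+1%:R))).
    move=> k; rewrite -[X in measurable X]setTI.
    exact: (@measurable_snd _ _ T (measurableTypeR R) measurableT _ (measurable_truncn m.+1%:R k)).
  move=> k; apply: (@measurableT_comp _ _ _ _ _ _ (X ^~ (k.+1%:R / m.+1%:R))) => //.
  by apply: mX; rewrite divr_ge0.
move=> w t; rewrite (_ : X w t = X w (Num.max 0 t)); last first.
  have [t0|t0] := leP 0 t; first by [].
  by have [neg _ _] := cX w; rewrite neg.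
have t0 : 0 <= Num.max 0 t by rewrite le_max lexx.
apply/cvgrPdist_lt => e e0; have [del del0 H] := cadlag_right (Num.max 0 t) (cX w) e0.
exists (Num.truncn del^-1) => // m /= Nm; rewrite distrC; apply: H.
have /truncn_itv/andP[h1 h2] : 0 <= m.+1%:R * Num.max 0 t by rewrite mulr_ge0.
rewrite -/(q m t) in h1 h2; apply/andP; split.
  by rewrite ler_pdivlMr// mulrC ltW.
rewrite ltr_pdivrMr// mulrDl -natr1 mulrC ler_ltD// mulrC -ltr_pdivrMr// div1r.
by apply: truncn_lt.
Qed.

Lemma mfun_tint (X : T -> R -> R) C t : 0 <= t -> jmeas X -> (forall w s, `|X w s| <= C) ->
  mfun (fun w => tint t (X w)).
Proof.
move=> t0 mX XC; have mt : measurable `[0, t]%classic by exact: measurable_itv.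
(* Adding C makes the integrand nonnegative, as Tonelli's theorem requires. *)
pose phi (p : T * measurableTypeR R) : \bar R := (\1_`[0, t] p.2 * (X p.1 p.2 + C))%:E.
have phi0 p : (0 <= phi p)%E.
  rewrite lee_fin mulr_ge0// -lerBlDr sub0r.
  by have := XC p.1 p.2; rewrite ler_norml => /andP[].
have mphi : measurable_fun setT phi.
  apply/measurable_EFinP; apply: measurable_funM; last exact: measurable_funD.
  by apply: measurableT_comp => //; exact: measurable_indic.
have mG := @measurable_fun_fubini_tonelli_F _ _ T (measurableTypeR R) R lebesgue_measure phi mphi phi0.
rewrite /mfun (_ : (fun w => _) = (fun w => fine (fubini_F lebesgue_measure phi w) - C * t)).
  by apply: measurable_funB => //; exact: measurableT_comp.
apply/funext => w; have mXw := jmeas_path w mX.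
have cC x : `|cst C x| <= C.
  by rewrite /= ger0_norm// (le_trans (normr_ge0 _) (XC w 0)).
have -> : tint t (X w) = tint t (fun s => X w s + C - cst C s).
  by congr tint; apply/funext => s; rewrite /= addrK.
rewrite /tint RintegralB; last 3 first.
- exact: measurable_itv.
- apply: (@bounded_integrable_itv _ _ (C + C)); first exact: measurable_funD.
  by move=> x; apply: (le_trans (ler_normD _ _)); apply: lerD; [exact: XC|exact: (cC _ x)].
- by apply: (@bounded_integrable_itv _ _ C).
congr (_ - _); last first.
  rewrite Rintegral_cst// [X in fine X]lebesgue_measure_itv/= lte_fin.
  by move: t0; rewrite le_eqVlt => /predU1P[<-|->] /=; rewrite ?ltxx ?subr0// mulr0.
rewrite /Rintegral integral_mkcond /fubini_F; congr fine; apply: eq_integral => s _.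
by rewrite patchE /phi/= indicE; case: ifPn => _; rewrite ?mul1r ?mul0r.
Qed.

End joint_measurability.

Section continuous_off_zero.
Context (R : realType) (V : normedModType R) (g : V -> R) (C : R).
Hypotheses (gC : forall x, `|g x| <= C) (cg : forall x, x != 0 -> {for x, continuous g}).

(* [g] may be discontinuous at 0; [smoothen k] is continuous and differs from
   [g] only at points of norm less than 1/(k+1). *)
Definition damp (k : nat) (x : V) : R := Num.min 1 (k.+1%:R * `|x|).
Definition smoothen (k : nat) (x : V) : R := g x * damp k x + g 0 * (1 - damp k x).

Lemma damp01 k x : 0 <= damp k x <= 1.
Proof. by rewrite /damp le_min ler01 mulr_ge0//= ge_min lexx. Qed.

Lemma damp_continuous k : continuous (damp k).
Proof.
move=> x; apply: (@continuous_min _ _ (cst 1) (fun x => k.+1%:R * `|x|) x); first exact: cvg_cst.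
by apply: cvgM; [exact: cvg_cst|exact: norm_continuous].
Qed.

Lemma smoothen_bound k x : `|smoothen k x| <= C.
Proof.
have /andP[h0 h1] := damp01 k x; apply: le_trans (ler_normD _ _) _; rewrite !normrM.
rewrite (ger0_norm h0) (@ger0_norm _ (1 - _)) ?subr_ge0//.
have -> : C = C * damp k x + C * (1 - damp k x) by ring.
by apply: lerD; apply: ler_wpM2r => //; rewrite subr_ge0.
Qed.

Lemma smoothen_continuous k : continuous (smoothen k).
Proof.
move=> x; have [->|x0] := eqVneq x 0.
  have E y : smoothen k y = g 0 + (g y - g 0) * damp k y by rewrite /smoothen; ring.
  apply/cvgrPdist_le => e e0.
  have C0 : 0 <= C := le_trans (normr_ge0 _) (gC 0).
  have c0 : 0 < (C + C + 1) * k.+1%:R by rewrite mulr_gt0// ltr_wpDl// addr_ge0.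
  near=> y; rewrite !E; have -> : damp k 0 = 0.
    by rewrite /damp normr0 mulr0 min_r.
  rewrite mulr0 addr0 opprD addrA subrr add0r normrN normrM.
  have /andP[h0 h1] := damp01 k y; rewrite (ger0_norm h0).
  apply: (@le_trans _ _ ((C + C + 1) * (k.+1%:R * `|y|))).
    apply: ler_pM => //; last by rewrite /damp ge_min lexx orbT.
    apply: le_trans (ler_normB _ _) _; apply: le_trans (lerD (gC y) (gC 0)) _.
    by rewrite lerDl.
  rewrite mulrA mulrC -ler_pdivlMr//; near: y.
  apply/nbhs_ballP; exists (e / ((C + C + 1) * k.+1%:R)) => /=; first exact: divr_gt0.
  by move=> y; rewrite -ball_normE /ball_/= sub0r normrN => /ltW.
have cgx : g y @[y --> x] --> g x := cg x0.
have cd : damp k y @[y --> x] --> damp k x := @damp_continuous k x.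
rewrite /smoothen; apply: cvgD; first exact: cvgM.
by apply: cvgM; [exact: cvg_cst|apply: cvgB; [exact: cvg_cst|exact: cd]].
Unshelve. all: by end_near. Qed.

Lemma smoothen_cvg x : smoothen k x @[k --> \oo] --> g x.
Proof.
have [->|x0] := eqVneq x 0.
  rewrite (_ : (fun k => _) = fun=> g 0); first exact: cvg_cst.
  by apply/funext => k; rewrite /smoothen; ring.
have n0 : 0 < `|x| by rewrite normr_gt0.
apply/cvgrPdist_lt => e e0; exists (Num.truncn `|x|^-1) => // k /= Nk.
rewrite (_ : smoothen k x = g x) ?subrr ?normr0//.
have -> : smoothen k x = g x + (g 0 - g x) * (1 - damp k x) by rewrite /smoothen; ring.
suff -> : damp k x = 1 by rewrite subrr mulr0 addr0.
rewrite /damp min_l// -ler_pdivrMr// div1r.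
by apply/ltW/truncn_lt.
Qed.

End continuous_off_zero.

(** * Measurability of exit times and of suprema along paths *)

Section path_functionals.
Context d (T : measurableType d) (R : realType) (m : nat) (Z : T -> skorokhod 'rV[R]_m).
Hypothesis Z_meas : forall (g : 'rV[R]_m -> R) t, continuous g -> 0 <= t -> mfun (fun w => g (Z w t)).

Lemma jmeas_continuous (g : 'rV[R]_m -> R) : continuous g -> jmeas (fun w s => g (Z w s)).
Proof.
move=> cg; apply: jmeas_cadlag => [t t0|w]; first exact: Z_meas.
exact: (cadlag_comp cg (path_cadlag (Z w))).
Qed.

Lemma jmeas_off_zero (g : 'rV[R]_m -> R) C : (forall x, `|g x| <= C) ->
  (forall x, x != 0 -> {for x, continuous g}) -> jmeas (fun w s => g (Z w s)).
Proof.
move=> gC cg; apply: (@jmeas_lim _ _ _ (fun k w s => smoothen g k (Z w s))).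
  by move=> k; apply: jmeas_continuous; exact: smoothen_continuous gC cg _.
by move=> w t; exact: smoothen_cvg.
Qed.

(** If neither f nor its left limit reached c on [0, p], each point would have a neighbourhood where
    f stays below c by a margin, coming from the one-sided limit on either side; compactness would
    make the margin uniform. *)
Lemma exit_approx (f : R -> R) (p c : R) : cadlag f ->
  (forall k : nat, exists2 t, 0 <= t <= p & c - k.+1%:R^-1 < f t) ->
  exists2 t, 0 <= t <= p & c <= f t \/ c <= left_limit f t.
Proof.
move=> cf H; apply: contrapT => nE.
have lt t : 0 <= t <= p -> f t < c /\ left_limit f t < c.
  move=> tp; split; rewrite ltNge; apply/negP => h; apply: nE; exists t => //; by [left|right].
have L : forall x, [set` `[0, p]] x -> \forall x' \near x & k \near \oo, f x' <= c - k.+1%:R^-1.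
  move=> x /=; rewrite in_itv/= => /lt[h1 h2].
  have [e e0 [e1 e2]] : exists2 e, 0 < e & f x + e + e <= c /\ left_limit f x + e + e <= c.
    exists (Num.min (c - f x) (c - left_limit f x) / 2).
      by rewrite divr_gt0// lt_min !subr_gt0 h1.
    by split; rewrite -addrA -splitr -lerBrDl ge_min lexx ?orbT.
  have [d1 d10 H1] := cadlag_right x cf e0; have [d2 d20 H2] := cadlag_left x cf e0.
  exists (ball x (Num.min d1 d2), [set k | (Num.truncn e^-1 <= k)%N]).
    by split; [apply: nbhsx_ballx; rewrite lt_min d10|exists (Num.truncn e^-1)].
  move=> [y k] /= [xy Nk].
  have ke : k.+1%:R^-1 <= e.
    rewrite -[e]invrK lef_pV2 ?posrE ?invr_gt0//.
    by apply/ltW/truncn_lt.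
  move: xy; rewrite /ball/= lt_min => /andP[xy1 xy2].
  have [xley|yltx] := leP x y.
    have : `|f y - f x| < e.
      by apply: H1; rewrite xley/= -ltrBlDl; apply: le_lt_trans xy1; rewrite distrC ler_norm.
    rewrite ltr_distl => /andP[_ /ltW h]; rewrite lerBrDr; exact: le_trans (lerD h ke) e1.
  have : `|f y - left_limit f x| < e.
    by apply: H2; rewrite yltx andbT ltrBlDl -ltrBlDr; apply: le_lt_trans xy2; rewrite ler_norm.
  rewrite ltr_distl => /andP[_ /ltW h]; rewrite lerBrDr; exact: le_trans (lerD h ke) e2.
have [N _ HN] : \forall k \near \oo, [set` `[0, p]] `<=` (fun t => f t <= c - k.+1%:R^-1).
  exact: (iffLR (compact_near_coveringP _) (@segment_compact R 0 p) _ \oo (fun k t => f t <= c - k.+1%:R^-1) _ L).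
have [t tp ft] := H N.
have := HN N (leqnn N) t; rewrite /= in_itv/= => /(_ tp).
by rewrite leNgt ft.
Qed.

(** By [exit_approx], approaching r along rational times up to p is the same as reaching r by a
    value or a left limit. The left limit in [exit_time] is thus what gives a description by
    countably many coordinates. *)
Lemma exit_time_lt (z : skorokhod 'rV[R]_m) (r u : R) :
  (exit_time z r < u%:E)%E <-> exists p : rat, [/\ 0 <= ratr p :> R, ratr p < u &
    forall k : nat, exists q : rat, [/\ 0 <= ratr q :> R, ratr q <= ratr p :> R & r - k.+1%:R^-1 < enorm (z (ratr q))]].
Proof.
have cz := path_cadlag (enorm_path z).
split=> [h|[p [p0 pu H]]]; last first.
  have [|t /andP[t0 tp] Ht] := @exit_approx (enorm_path z) (ratr p) r cz.
    by move=> k; have [q [q0 qp rq]] := H k; exists (ratr q); rewrite ?q0.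
  apply: le_lt_trans (_ : (t%:E < u%:E)%E); last by rewrite lte_fin (le_lt_trans tp).
  apply: ereal_inf_lbound; exists t => //; split=> //.
  by move: Ht; rewrite left_limit_enorm.
have [_ [t [t0 Ht] <-]] := ereal_inf_lt h; rewrite lte_fin => tu.
have [p] := rat_in_itvoo tu; rewrite in_itv/= => /andP[tp pu].
exists p; split=> //; first exact: le_trans (ltW tp).
move=> k; have k0 : 0 < k.+1%:R^-1 :> R by rewrite invr_gt0.
have R1 : r <= enorm (z t) -> exists q : rat, [/\ 0 <= ratr q :> R, ratr q <= ratr p :> R & r - k.+1%:R^-1 < enorm (z (ratr q))].
  move=> rz; have [q [/andP[tq qp] zq]] := cadlag_rat cz tp k0.
  exists q; split; rewrite ?(ltW (le_lt_trans t0 tq)) ?(ltW qp)//.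
  move: zq; rewrite /= ltr_distl => /andP[+ _]; apply: le_lt_trans; by rewrite lerD2r.
case: Ht => [/R1//|]; rewrite -left_limit_enorm => rz.
move: t0; rewrite le_eqVlt => /predU1P[t0|t0].
  by apply: R1; move: rz; rewrite -t0 left_limit0.
have [del del0 Hd] := cadlag_left t cz k0.
have [|q] := @rat_in_itvoo R (Num.max 0 (t - del)) t; first by rewrite gt_max t0/= gtrBl.
rewrite in_itv/= gt_max => /andP[/andP[q0 qd] qt]; exists q.
split; rewrite ?(ltW q0) ?(ltW (lt_trans qt tp))//.
have := Hd (ratr q); rewrite qd qt => /(_ isT); rewrite ltr_distl => /andP[+ _].
by apply: le_lt_trans; rewrite lerD2r.
Qed.

Lemma exit_time_measurable r u : measurable [set w | (exit_time (Z w) r < u%:E)%E].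
Proof.
rewrite (_ : [set w | _] = \bigcup_(p in [set p : rat | 0 <= ratr p :> R /\ ratr p < u :> R])
   \bigcap_(k in [set: nat]) \bigcup_(q in [set q : rat | 0 <= ratr q :> R /\ ratr q <= ratr p :> R])
     [set w | r - k.+1%:R^-1 < enorm (Z w (ratr q))]); last first.
  apply/seteqP; split=> w /=; rewrite exit_time_lt.
    move=> [p [p0 pu H]]; exists p => //= k _; have [q [q0 qp rq]] := H k.
    by exists q.
  move=> [p [p0 pu] H]; exists p; split=> // k.
  by have [q [q0 qp] rq] := H k I; exists q.
apply: bigcup_rat_measurable => p _; apply: bigcapT_measurable => k.
apply: bigcup_rat_measurable => q /= [q0 _]; apply: measurable_gt_cst.
by apply: Z_meas => //; exact: enorm_continuous.
Qed.

(** Right-continuity reduces the supremum to the rational times strictly before [tau] together with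
    [tau] itself. *)
Lemma sup_event_measurable (X : T -> R -> R) (tau : T -> R) (S e : R) : 0 <= S ->
  (forall t, 0 <= t -> mfun (X ^~ t)) -> (forall w, rcont (X w)) -> (forall w t, 0 <= X w t) ->
  (forall w, 0 <= tau w <= S) -> (forall u, measurable [set w | tau w < u]) ->
  measurable [set w | (e%:E < `|sup_upto (tau w)%:E (X w)|)%E].
Proof.
move=> S0 mX rX X0 tau0 mtau.
have tau_ge w : 0 <= tau w by case/andP: (tau0 w).
(* With the constant filtration of all measurable events, evaluation at the random time [tau]
   becomes an instance of [stopped_measurable]. *)
have fil : filtration (fun _ : R => [set E : set T | measurable E]).
  by split=> [t _|t _|s t _ _] //; exact: sigma_algebra_measurable.
have aX : adapted (fun _ : R => [set E : set T | measurable E]) X.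
  by move=> t t0 B mB; have := mX t t0 measurableT B mB; rewrite setTI.
have mXtau : mfun (fun w => X w (tau w)).
  have := stopped_measurable fil (fun u _ => mtau u) tau_ge S0 aX rX.
  move=> /(mfun_sub (filtration_sub fil S0)).
  rewrite (_ : (fun w => X w (Num.min S (tau w))) = (fun w => X w (tau w)))//.
  by apply/funext => w; rewrite min_r//; case/andP: (tau0 w).
rewrite (_ : [set w | _] = ([set w | e < X w (tau w)] `|`
   \bigcup_(q in [set q : rat | 0 <= ratr q :> R]) ([set w | e < X w (ratr q)] `&` ~` [set w | tau w <= ratr q]))%classic); last first.
  apply/seteqP; split=> w /=.
    rewrite gee0_abs; last first.
      by apply: le_trans (sup_upto_ge (X w) (lexx 0) _); rewrite lee_fin.
    move=> /ereal_sup_gt[_ [t [t0 tt] <-]]; rewrite lte_fin => h.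
    move: tt; rewrite lee_fin le_eqVlt => /predU1P[<-|tt]; first by left.
    right; have e0 : 0 < X w t - e by rewrite subr_gt0.
    have [del del0 Hd] := rX w t _ t0 e0.
    have [|q] := @rat_in_itvoo R t (Num.min (tau w) (t + del)); first by rewrite lt_min tt ltrDl.
    rewrite in_itv/= lt_min => /and3P[tq qt qd]; exists q; first exact: le_trans (ltW tq).
    split; last by apply/negP; rewrite -ltNge.
    have := Hd (ratr q); rewrite (ltW tq) qd => /(_ isT).
    by rewrite ltr_distl opprB addrC subrK => /andP[].
  rewrite gee0_abs; last first.
    by apply: le_trans (sup_upto_ge (X w) (lexx 0) _); rewrite lee_fin.
  move=> [h|[q q0 [h /negP]]].
    by apply: lt_le_trans (sup_upto_ge (X w) (tau_ge w) (lexx _)); rewrite lte_fin.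
  rewrite -ltNge => /ltW qt; apply: (@lt_le_trans _ _ (X w (ratr q))%:E); first by rewrite lte_fin.
  by apply: sup_upto_ge; rewrite ?lee_fin.
apply: measurableU; first exact: measurable_gt_cst.
apply: bigcup_rat_measurable => q q0; apply: measurableI; first exact/measurable_gt_cst/mX.
apply: measurableC; rewrite (_ : [set w | _] = \bigcap_k [set w | tau w < ratr q + k.+1%:R^-1]).
  exact: bigcapT_measurable.
apply/seteqP; split=> w /=.
  by move=> h k _ /=; apply: le_lt_trans h _; rewrite ltrDl invr_gt0.
move=> H; apply/ler_addgt0Pr => e1 e10.
have := H (Num.truncn e1^-1) I => /= /ltW h; apply: (le_trans h); rewrite lerD2l.
rewrite -[leRHS]invrK lef_pV2 ?posrE ?invr_gt0//; exact: ltW (truncnS_gt _).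
Qed.

End path_functionals.

(** * A maximal inequality on time blocks *)

Section square_domination.
Context d (T : measurableType d) (R : realType) (P : probability T R).

Lemma intg_mul_sqr (f g q : T -> R) c1 c2 : mfun f -> mfun g -> intg P q ->
  (forall w, f w ^+ 2 <= c1 * q w) -> (forall w, g w ^+ 2 <= c2 * q w) ->
  intg P (fun w => f w * g w).
Proof.
move=> mf mg qi fq gq.
apply: (@intg_le _ _ _ _ _ (fun w => (c1 + c2) / 2 * q w)); first exact: measurable_funM.
  exact: intgZ.
move=> w; apply: le_trans (ler_norm _); have := fq w; have := gq w.
have h1 : 0 <= (f w - g w) ^+ 2 by exact: sqr_ge0.
have h2 : 0 <= (f w + g w) ^+ 2 by exact: sqr_ge0.
move: h1 h2; rewrite sqrrB sqrrD -mulr_natl ler_norml => h1 h2 h3 h4; apply/andP; split; lra.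
Qed.

Lemma intg_sqr (f q : T -> R) c : mfun f -> intg P q -> (forall w, f w ^+ 2 <= c * q w) ->
  intg P (fun w => f w ^+ 2).
Proof.
by move=> mf qi fq; under eq_fun do rewrite expr2; exact: (intg_mul_sqr mf mf qi fq fq).
Qed.

Lemma indic_mul_sqr_le (E : set T) (x : R) w : (\1_E w * x) ^+ 2 <= x ^+ 2.
Proof. by rewrite indicE; case: (w \in E); rewrite ?mul1r// mul0r expr0n sqr_ge0. Qed.

End square_domination.

Section kolmogorov.
Context d (T : measurableType d) (R : realType) (P : probability T R).
Context (F : R -> set (set T)) (Ffil : filtration F) (u : nat -> R).
Hypotheses (u0 : forall k, 0 <= u k) (uS : forall k, u k <= u k.+1).
Notation GT k := (g_sigma_algebraType (F (u k))).
Context (Y b : nat -> T -> R) (q : T -> R).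
Hypotheses (Y_GT : forall k, measurable_fun [set: GT k] (Y k)) (b_intg : forall k, intg P (b k))
  (q_intg : intg P q) (Yq : forall k w, Y k w ^+ 2 <= q w)
  (Y_mart : forall k E, F (u k) E -> expct P (fun w => \1_E w * (Y k.+1 w - Y k w)) = 0)
  (YY_mart : forall k E, F (u k) E ->
    expct P (fun w => \1_E w * (Y k.+1 w ^+ 2 - Y k w ^+ 2 - (b k.+1 w - b k w))) = 0).

Let mfun_GT k (f : T -> R) : measurable_fun [set: GT k] f -> mfun f.
Proof. exact: (mfun_sub (filtration_sub Ffil (u0 k))). Qed.

Let GT_le k l (f : T -> R) : (k <= l)%N -> measurable_fun [set: GT k] f -> measurable_fun [set: GT l] f.
Proof.
move=> kl; apply: (measurable_fun_filtration Ffil (u0 k)).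
by apply: (homo_leq (r := fun x y => x <= y) _ _ uS) => // x y z; exact: le_trans.
Qed.

Let F_meas k E : F (u k) E -> measurable E.
Proof. exact: filtration_meas. Qed.

Let GT_F k (E : set T) : @measurable _ (GT k) E -> F (u k) E.
Proof. by rewrite {1}/measurable/= filtration_id. Qed.

Let F_GT k (E : set T) : F (u k) E -> @measurable _ (GT k) E.
Proof. by rewrite {1}/measurable/= filtration_id. Qed.

Let Y_mfun k : mfun (Y k). Proof. exact: (@mfun_GT k). Qed.

Let Y_sqr_intg k : intg P (fun w => Y k w ^+ 2).
Proof. by apply: (@intg_sqr _ _ _ _ _ q 1) => // w; rewrite mul1r. Qed.

Let Y_prod_intg k l : intg P (fun w => Y k w * Y l w).
Proof. by apply: (@intg_mul_sqr _ _ _ _ _ _ q 1 1) => // w; rewrite mul1r. Qed.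

Let Y_intg k : intg P (Y k).
Proof.
apply: (@intg_le _ _ _ _ _ (fun w => 1 + Y k w ^+ 2)) => //.
  by apply: intgD => //; exact: intg_cst.
move=> w; apply: le_trans (ler_norm _).
have : 0 <= (`|Y k w| - 1) ^+ 2 by exact: sqr_ge0.
rewrite sqrrB1 real_normK ?num_real// -mulr_natl; have := normr_ge0 (Y k w); lra.
Qed.

Let dY k w := Y k.+1 w - Y k w.

Let dY_sqr k w : dY k w ^+ 2 <= 4 * q w.
Proof.
have h : 0 <= (Y k.+1 w + Y k w) ^+ 2 by exact: sqr_ge0.
have := Yq k.+1 w; have := Yq k w; move: h; rewrite /dY sqrrB sqrrD -mulr_natl; lra.
Qed.

Let dY_mfun k : mfun (dY k). Proof. by apply: measurable_funB; exact: Y_mfun. Qed.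

Context (H : nat -> set T).
Hypothesis HF : forall k, F (u k) (H k).

(** A martingale transform. For increasing H it is the displacement of Y since H first occurred; for
    H constantly the whole space it is Y - Y 0. *)
Definition started k w : R := \sum_(l < k) \1_(H l) w * (Y l.+1 w - Y l w).
Let W := started.

Let W_GT k : measurable_fun [set: GT k] (W k).
Proof.
apply: (@measurable_sum _ (GT k) _ _ _ _ (fun (l : 'I_k) w => \1_(H l) w * (Y l.+1 w - Y l w))) => l.
apply: measurable_funM.
  by apply: (@GT_le l); [exact: ltnW|apply: measurable_indic; exact: F_GT].
by apply: measurable_funB; [exact: (@GT_le l.+1)|apply: (@GT_le l) => //; exact: ltnW].
Qed.

Let W_sqr k : exists2 c, 0 <= c & forall w, W k w ^+ 2 <= c * q w.
Proof.
elim: k => [|k [c c0 IH]].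
  exists 0 => // w; rewrite /W /started big_ord0 expr0n/= mul0r//.
exists (2 * c + 8); first by rewrite addr_ge0// mulr_ge0.
move=> w; rewrite /W /started big_ord_recr/= -/(started k w).
have h1 : (\1_(H k) w * (Y k.+1 w - Y k w)) ^+ 2 <= 4 * q w.
  exact: le_trans (indic_mul_sqr_le _ _ _) (dY_sqr k w).
have := IH w; set x := \1_ _ w * _ in h1 *.
have h2 : 0 <= (started k w - x) ^+ 2 by exact: sqr_ge0.
move: h1 h2; rewrite /W sqrrB sqrrD -mulr_natl; lra.
Qed.

Let W_sqr_intg k : intg P (fun w => W k w ^+ 2).
Proof. by have [c c0 Hc] := W_sqr k; apply: (intg_sqr _ q_intg Hc); exact: mfun_GT. Qed.

Let dY_sqr_intg k : intg P (fun w => dY k w ^+ 2).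
Proof. exact: (intg_sqr (dY_mfun k) q_intg (dY_sqr k)). Qed.

Let dY_mean k (h : T -> R) c : measurable_fun [set: GT k] h -> (forall w, h w ^+ 2 <= c * q w) ->
  expct P (fun w => h w * dY k w) = 0.
Proof.
move=> mh hq; apply: (@expct_mul_eq0 _ _ _ P (F (u k))).
- exact: filtration_sub.
- exact: intgB.
- by move=> E; rewrite filtration_id// => FE; exact: Y_mart.
- exact: mh.
- apply: (intg_mul_sqr _ _ q_intg hq (dY_sqr k)) => //; exact: (@mfun_GT k _ mh).
Qed.

Let indic_sqr_le (E : set T) (f : T -> R) c w : (f w ^+ 2 <= c * q w) -> (\1_E w * f w) ^+ 2 <= c * q w.
Proof.
by move=> h; apply: le_trans h; exact: indic_mul_sqr_le.
Qed.

Let dY_second k E : F (u k) E ->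
  expct P (fun w => \1_E w * dY k w ^+ 2) = expct P (fun w => \1_E w * (b k.+1 w - b k w)).
Proof.
move=> FE; have mE := F_meas FE.
have i1 : intg P (fun w => \1_E w * (Y k.+1 w ^+ 2 - Y k w ^+ 2 - (b k.+1 w - b k w))).
  by apply: intg_mul1 => //; apply: intgB; exact: intgB.
have i2 : intg P (fun w => \1_E w * (b k.+1 w - b k w)) by apply: intg_mul1 => //; exact: intgB.
have i3 : intg P (fun w => \1_E w * Y k w * dY k w).
  have hm : mfun (fun w => \1_E w * Y k w) by apply: measurable_funM; [exact: mfun_indic|exact: Y_mfun].
  have hs w : (\1_E w * Y k w) ^+ 2 <= 1 * q w by apply: indic_sqr_le; rewrite mul1r.
  exact: (intg_mul_sqr hm (dY_mfun k) q_intg hs (dY_sqr k)).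
rewrite (_ : (fun w => \1_E w * dY k w ^+ 2) = (fun w =>
  \1_E w * (Y k.+1 w ^+ 2 - Y k w ^+ 2 - (b k.+1 w - b k w)) +
  (\1_E w * (b k.+1 w - b k w) - 2 * (\1_E w * Y k w * dY k w)))); last first.
  by apply/funext => w; rewrite /dY; ring.
rewrite expctD//; last by apply: intgB => //; exact: intgZ.
rewrite YY_mart// add0r expctB//; last exact: intgZ.
rewrite expctZ// (@dY_mean k _ 1) ?mulr0 ?subr0//.
- by apply: measurable_funM => //; apply: measurable_indic; exact: F_GT.
- by move=> w; apply: indic_sqr_le; rewrite mul1r.
Qed.

Let W_second k E : F (u k) E -> expct P (fun w => \1_E w * W k.+1 w ^+ 2) =
  expct P (fun w => \1_E w * W k w ^+ 2) + expct P (fun w => \1_(E `&` H k) w * (b k.+1 w - b k w)).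
Proof.
move=> FE; have FEH : F (u k) (E `&` H k) by exact: (filtrationI Ffil).
have mE := F_meas FE; have mEH := F_meas FEH.
have [c c0 Hc] := W_sqr k.
have mh : measurable_fun [set: GT k] (fun w => \1_(E `&` H k) w * W k w).
  by apply: measurable_funM; [apply: measurable_indic; exact: F_GT|exact: W_GT].
have hq w : (\1_(E `&` H k) w * W k w) ^+ 2 <= c * q w by apply: indic_sqr_le; exact: Hc.
rewrite -(dY_second FEH).
rewrite (_ : (fun w => \1_E w * W k.+1 w ^+ 2) = (fun w => \1_E w * W k w ^+ 2 +
  (2 * (\1_(E `&` H k) w * W k w * dY k w) + \1_(E `&` H k) w * dY k w ^+ 2))); last first.
  apply/funext => w; rewrite /W /started big_ord_recr/= -/(started k w) -/(dY k w) indicI/=.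
  have [h|h] := pselect (H k w); first by rewrite (indicT R h); ring.
  by rewrite (indicF R h); ring.
have i1 : intg P (fun w => \1_(E `&` H k) w * W k w * dY k w).
  by apply: (intg_mul_sqr _ _ q_intg hq (dY_sqr k)) => //; exact: (@mfun_GT k _ mh).
have i2 : intg P (fun w => \1_(E `&` H k) w * dY k w ^+ 2) by exact: intg_mul1.
rewrite expctD; [|exact: intg_mul1|by apply: intgD => //; exact: intgZ].
by rewrite expctD//; [rewrite expctZ// (dY_mean mh hq) mulr0 add0r|exact: intgZ].
Qed.

Let W_mono k E : F (u k) E ->
  expct P (fun w => \1_E w * W k w ^+ 2) <= expct P (fun w => \1_E w * W k.+1 w ^+ 2).
Proof.
move=> FE; have FEH : F (u k) (E `&` H k) by exact: (filtrationI Ffil).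
rewrite W_second// lerDl -(dY_second FEH); apply: expct_ge0 => w.
by rewrite mulr_ge0// ?sqr_ge0// indicE.
Qed.

Lemma started_second m : expct P (fun w => W m w ^+ 2) =
  expct P (fun w => \sum_(l < m) \1_(H l) w * (b l.+1 w - b l w)).
Proof.
have FT k : F (u k) setT by apply: GT_F.
elim: m => [|m IH].
  by congr expct; apply/funext => w; rewrite /W /started !big_ord0 expr0n.
have E1 k : (fun w => W k w ^+ 2) = (fun w => \1_[set: T] w * W k w ^+ 2).
  by apply/funext => w; rewrite indicT// mul1r.
rewrite (E1 m.+1) (W_second (FT m)) -E1 IH setTI -expctD.
- by congr expct; apply/funext => w; rewrite big_ord_recr.
- apply: (@intg_sum _ _ _ P 'I_m) => l; apply: intg_mul1; first exact: F_meas (HF l).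
  exact: intgB.
- by apply: intg_mul1; [exact: F_meas (HF m)|exact: intgB].
Qed.

(** Doob's argument: the event is split by the first index at which |W| exceeds a, and on the part
    already reached the mean of W^2 cannot decrease. *)
Lemma started_max (a : R) m : 0 < a ->
  a ^+ 2 * prb P [set w | exists2 k, (k <= m)%N & a < `|W k w|] <=
  expct P (fun w => \sum_(l < m) \1_(H l) w * (b l.+1 w - b l w)).
Proof.
move=> a0; pose M k : set T := [set w | exists2 l, (l <= k)%N & a < `|W l w|].
have MS k : M k.+1 = (M k `|` ([set w | a < `|W k.+1 w|] `&` ~` M k))%classic.
  apply/seteqP; split=> w /=.
    move=> [l]; rewrite leq_eqVlt => /predU1P[->|lk] h; last by left; exists l.
    by have [h'|h'] := pselect (M k w); [left|right].
  by move=> [[l lk h]|[h _]]; [exists l => //; exact: leqW|exists k.+1].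
have mW k c : @measurable _ (GT k) [set w | c < `|W k w|].
  by apply: measurable_gt_cst; apply: mfun_norm; exact: W_GT.
have Fle k E : F (u k) E -> F (u k.+1) E by exact: (filtration_le Ffil (u0 k) (uS k)).
have MF k : F (u k) (M k).
  elim: k => [|k IH].
    apply: GT_F; rewrite (_ : M 0%N = [set w | a < `|W 0%N w|]); first exact: mW.
    apply/seteqP; split=> w /=; first by move=> [l]; rewrite leqn0 => /eqP ->.
    by move=> h; exists 0%N.
  apply: GT_F; rewrite MS; apply: measurableU; first exact: (F_GT (Fle _ _ IH)).
  by apply: measurableI; [exact: mW|apply: measurableC; exact: (F_GT (Fle _ _ IH))].
have key k : a ^+ 2 * prb P (M k) <= expct P (fun w => \1_(M k) w * W k w ^+ 2).
  have piece k' (E : set T) : measurable E -> E `<=` [set w | a < `|W k' w|] ->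
      a ^+ 2 * prb P E <= expct P (fun w => \1_E w * W k' w ^+ 2).
    move=> mE EW; rewrite prb_indic// -expctZ; last exact: intg_indic.
    apply: expct_le; [exact/intgZ/intg_indic|exact: intg_mul1|move=> w].
    have [Ew|nEw] := pselect (E w); last by rewrite (indicF R nEw) mulr0 mul0r.
    rewrite (indicT R Ew) mulr1 mul1r -[leRHS]real_normK ?num_real//.
    rewrite ler_sqr ?nnegrE ?(ltW a0)//; exact/ltW/EW.
  elim: k => [|k IH].
    apply: piece; first exact: F_meas (MF 0%N).
    by move=> w [l]; rewrite leqn0 => /eqP ->.
  pose G : set T := [set w | a < `|W k.+1 w|] `&` ~` M k.
  have mM := F_meas (MF k); have mG : measurable G.
    by apply: measurableI; [exact: (F_meas (GT_F (mW k.+1 a)))|exact: measurableC].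
  have h1 : prb P (M k.+1) <= prb P (M k) + prb P G by rewrite MS; exact: prbU.
  have h2 : expct P (fun w => \1_(M k.+1) w * W k.+1 w ^+ 2) =
      expct P (fun w => \1_(M k) w * W k.+1 w ^+ 2) + expct P (fun w => \1_G w * W k.+1 w ^+ 2).
    rewrite -expctD; [|exact: intg_mul1|exact: intg_mul1].
    congr expct; apply/funext => w; rewrite -mulrDl; congr (_ * _).
    have [h|h] := pselect (M k w).
      have hS : M k.+1 w by rewrite MS; left.
      have nG : ~ G w by case.
      by rewrite (indicT R h) (indicT R hS) (indicF R nG) addr0.
    have [g|g] := pselect (G w).
      have hS : M k.+1 w by rewrite MS; right.
      by rewrite (indicF R h) (indicT R hS) (indicT R g) add0r.
    have hS : ~ M k.+1 w by rewrite MS => -[].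
    by rewrite (indicF R h) (indicF R hS) (indicF R g) add0r.
  rewrite h2; apply: le_trans (ler_wpM2l (sqr_ge0 a) h1) _; rewrite mulrDr; apply: lerD.
    exact: le_trans IH (W_mono (MF k)).
  by apply: piece => // w [].
apply: le_trans (key m) _; rewrite -started_second.
apply: expct_le => //; first by apply: intg_mul1 => //; exact: F_meas (MF m).
by move=> w; rewrite ler_piMl ?sqr_ge0// indicE; case: (w \in _).
Qed.

End kolmogorov.

Section two_stage.
Context d (T : measurableType d) (R : realType) (P : probability T R).
Context (F : R -> set (set T)) (Ffil : filtration F) (u : nat -> R).
Hypotheses (u0 : forall k, 0 <= u k) (uS : forall k, u k <= u k.+1).
Notation GT k := (g_sigma_algebraType (F (u k))).
Context (Y b : nat -> T -> R) (q : T -> R).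
Hypotheses (Y_GT : forall k, measurable_fun [set: GT k] (Y k)) (b_intg : forall k, intg P (b k))
  (q_intg : intg P q) (Yq : forall k w, Y k w ^+ 2 <= q w)
  (Y_mart : forall k E, F (u k) E -> expct P (fun w => \1_E w * (Y k.+1 w - Y k w)) = 0)
  (YY_mart : forall k E, F (u k) E ->
    expct P (fun w => \1_E w * (Y k.+1 w ^+ 2 - Y k w ^+ 2 - (b k.+1 w - b k w))) = 0).
Context (m : nat) (c : R) (xi : T -> R).
Hypotheses (c0 : 0 <= c) (xi0 : forall w, 0 <= xi w) (xi_intg : intg P xi)
  (b_incr : forall l w, (l <= m)%N -> b m w - b l w <= c + xi w).

(** The counterpart of [stop_sum]: a switch that stays on once it is on collects the increments of v
    from that moment. *)
Lemma sum_from_first (H : nat -> bool) (v : nat -> R) (C : R) : (forall k, H k -> H k.+1) -> 0 <= C ->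
  (forall l, (l <= m)%N -> v m - v l <= C) ->
  \sum_(l < m) (H l)%:R * (v l.+1 - v l) <= (H m)%:R * C.
Proof.
move=> HS C0 vC.
have HS' k : ~~ H k.+1 -> ~~ H k by apply: contra => /HS.
have [j [jm bj nbj sj]] := stop_sum v m HS'.
have -> : \sum_(l < m) (H l)%:R * (v l.+1 - v l) = v m - v j.
  have -> : v m - v j = (v m - v 0%N) - (v j - v 0%N) by ring.
  rewrite -sj -(telescope_sumr v (leq0n m)) big_mkord -sumrB; apply: eq_bigr => l _.
  by case: (H l); rewrite ?mul1r ?mul0r ?subr0 ?subrr.
move: jm; rewrite leq_eqVlt => /predU1P[->|jm].
  by rewrite subrr mulr_ge0.
have Hj : H j by have := nbj jm; rewrite negbK.
have Hjk k : H (j + k)%N by elim: k => [|k IH]; rewrite ?addn0// addnS; exact: HS.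
have := Hjk (m - j)%N; rewrite (subnKC (ltnW jm)) => ->; rewrite mul1r.
exact/vC/ltnW.
Qed.

Let D (a : R) k : set T := [set w | exists2 l, (l <= k)%N & a < `|Y l w - Y 0%N w|].

Let DF a k : F (u k) (D a k).
Proof.
rewrite -(filtration_id Ffil (u0 k)) (_ : D a k = \bigcup_(l in `I_k.+1) [set w | a < `|Y l w - Y 0%N w|]); last first.
  by apply/seteqP; split=> w /= [l lk h]; exists l => //=; rewrite ?ltnS// -ltnS.
apply: (@fin_bigcup_measurable _ (GT k)) => // l /= lk.
have mle l' : (l' <= k)%N -> measurable_fun [set: GT k] (Y l').
  move=> lk'; apply: (measurable_fun_filtration Ffil (u0 l')) => //.
  by apply: (homo_leq (r := fun x y => x <= y) _ _ uS) => // x y z; exact: le_trans.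
by apply: measurable_gt_cst; apply: mfun_norm; apply: measurable_funB; apply: mle.
Qed.

Let D_meas a k : measurable (D a k).
Proof. exact: filtration_meas (DF a k). Qed.

Lemma block_first a : 0 < a -> a ^+ 2 * prb P (D a m) <= c + expct P xi.
Proof.
move=> a0; have HF k : F (u k) setT.
  by rewrite -(filtration_id Ffil (u0 k)); exact: (@measurableT _ (GT k)).
have := @started_max _ _ _ P F Ffil u u0 uS Y b q Y_GT b_intg q_intg Yq Y_mart YY_mart (fun=> setT) HF a m a0.
have E k w : started Y (fun=> setT) k w = Y k w - Y 0%N w.
  rewrite /started -(telescope_sumr (Y ^~ w) (leq0n k)) big_mkord.
  by apply: eq_bigr => l _; rewrite indicT// mul1r.
rewrite (_ : [set w | _] = D a m); last first.
  by apply/seteqP; split=> w /= [k km h]; exists k => //; move: h; rewrite E.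
move=> h; apply: (le_trans h).
rewrite -(expct_cst P c) -expctD//; last exact: intg_cst.
apply: expct_le.
- apply: (@intg_sum _ _ _ P 'I_m) => l; apply: intg_mul1 => //; exact: intgB.
- by apply: intgD => //; exact: intg_cst.
move=> w; rewrite (eq_bigr (fun l : 'I_m => b l.+1 w - b l w)); last by move=> l _; rewrite indicT// mul1r.
by rewrite -(big_mkord xpredT (fun l => b l.+1 w - b l w)) telescope_sumr//; exact: b_incr.
Qed.

(** A single maximal inequality gives a bound linear in c, the length scale of the block, which is
    too weak to be summed over all blocks. Here it is applied once more to the displacement after
    the first passage beyond a: with steps of at most a/2, reaching 2a requires a further
    displacement of more than a/2. The result is quadratic in c, up to the mean of xi. *)
Lemma block_oscillation a : 0 < a ->
  prb P (D (2 * a) m `&` [set w | forall k, (k < m)%N -> `|Y k.+1 w - Y k w| <= a / 2]) <=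
  4 / a ^+ 2 * (c * ((c + expct P xi) / a ^+ 2) + expct P xi).
Proof.
move=> a0; have a20 : 0 < a ^+ 2 by rewrite exprn_gt0.
have ah0 : 0 < a / 2 by rewrite divr_gt0.
have := @started_max _ _ _ P F Ffil u u0 uS Y b q Y_GT b_intg q_intg Yq Y_mart YY_mart (D a) (DF a) (a / 2) m ah0.
set W := started Y (D a); set M := [set w | exists2 k, _ & _] => H1.
have DS k w : D a k w -> D a k.+1 w by move=> [l lk h]; exists l => //; exact: leqW.
pose S : set T := [set w | forall k, (k < m)%N -> `|Y k.+1 w - Y k w| <= a / 2].
have mYk k : mfun (Y k) by apply: (mfun_sub (filtration_sub Ffil (u0 k))).
have mS : measurable S.
  rewrite (_ : S = \bigcap_(k in `I_m) [set w | `|Y k.+1 w - Y k w| <= a / 2]); last first.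
    by apply/seteqP; split=> w /= h k; apply: h.
  apply: fin_bigcap_measurable => // k _; apply: measurable_le_cst; apply: mfun_norm.
  by apply: measurable_funB; exact: mYk.
have mM : measurable M.
  rewrite (_ : M = \bigcup_(k in `I_m.+1) [set w | a / 2 < `|W k w|]); last first.
    by apply/seteqP; split=> w /= [k km h]; exists k => //=; rewrite ?ltnS// -ltnS.
  apply: fin_bigcup_measurable => // k _; apply: measurable_gt_cst; apply: mfun_norm.
  apply: (@measurable_sum _ T _ _ _ _ (fun (l : 'I_k) w => \1_(D a l) w * (Y l.+1 w - Y l w))) => l.
  by apply: measurable_funM; [exact: mfun_indic|apply: measurable_funB; exact: mYk].
(* Until |Y - Y_0| first exceeds a, W = 0; at that time |Y - Y_0| <= 3a/2, and
   afterwards W records the further displacement. *)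
have path w : S w -> forall k, (k <= m)%N ->
   (~ D a k w -> W k w = 0 /\ `|Y k w - Y 0%N w| <= a) /\
   (D a k w -> `|Y k w - Y 0%N w - W k w| <= a + a / 2).
  move=> Sw; elim=> [_|k IH km].
    have nD : ~ D a 0%N w.
      by move=> [l]; rewrite leqn0 => /eqP->; rewrite subrr normr0 ltNge (ltW a0).
    by split=> // _; rewrite /W /started big_ord0 subrr normr0; split=> //; exact: ltW.
  have [IH1 IH2] := IH (ltnW km).
  have WS : W k.+1 w = W k w + \1_(D a k) w * (Y k.+1 w - Y k w).
    by rewrite /W /started big_ord_recr.
  have [Dk|nDk] := pselect (D a k w).
    split=> [|_]; first by move=> /(_ (DS _ _ Dk)).
    rewrite WS (indicT R Dk) mul1r.
    have -> : Y k.+1 w - Y 0%N w - (W k w + (Y k.+1 w - Y k w)) = Y k w - Y 0%N w - W k w by ring.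
    exact: IH2.
  have [W0 Ya] := IH1 nDk; rewrite WS (indicF R nDk) mul0r addr0 W0 subr0; split.
    move=> nD; split=> //; rewrite leNgt; apply/negP => h; apply: nD.
    by exists k.+1.
  move=> _; have -> : Y k.+1 w - Y 0%N w = (Y k w - Y 0%N w) + (Y k.+1 w - Y k w) by ring.
  by apply: le_trans (ler_normD _ _) _; apply: lerD => //; exact: Sw.
have sub : D (2 * a) m `&` S `<=` M.
  move=> w [[k km h] Sw]; exists k => //.
  have [H1' H2'] := path w Sw k km.
  have [Dk|nDk] := pselect (D a k w); last first.
    have [_ h'] := H1' nDk; have := lt_le_trans h h'.
    by rewrite -subr_gt0 mulr2n mulrDl mul1r opprD addrA subrr sub0r oppr_gt0 ltNge (ltW a0).
  have h2 := H2' Dk.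
  have : 2 * a < `|Y k w - Y 0%N w - W k w| + `|W k w|.
    apply: lt_le_trans h _; rewrite -{1}[X in `|X|](subrK (W k w)); exact: ler_normD.
  move: h2; lra.
have H2 : prb P (D (2 * a) m `&` S) <= prb P M by apply: prb_le => //; exact: measurableI.
have H3 : expct P (fun w => \sum_(l < m) \1_(D a l) w * (b l.+1 w - b l w)) <= c * prb P (D a m) + expct P xi.
  rewrite prb_indic// -expctZ; last exact: intg_indic.
  rewrite -expctD//; last exact/intgZ/intg_indic.
  apply: expct_le.
  - apply: (@intg_sum _ _ _ P 'I_m) => l; apply: intg_mul1 => //; exact: intgB.
  - by apply: intgD => //; exact/intgZ/intg_indic.
  move=> w; have := @sum_from_first (fun l => w \in D a l) (b ^~ w) (c + xi w).
  move=> /(_ (fun k h => mem_set (DS _ _ (set_mem h))) (addr_ge0 c0 (xi0 w)) (fun l lm => b_incr w lm)).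
  rewrite (eq_bigr (fun l : 'I_m => \1_(D a l) w * (b l.+1 w - b l w))); last by move=> l _; rewrite indicE.
  move=> h; apply: (le_trans h); rewrite -indicE mulrDr [c * _]mulrC lerD2l.
  by rewrite ler_piMl// indicE; case: (w \in _).
have H4 := block_first a0.
have H5 : prb P (D a m) <= (c + expct P xi) / a ^+ 2 by rewrite ler_pdivlMr// mulrC.
apply: (le_trans H2).
have H6 : (a / 2) ^+ 2 * prb P M <= c * ((c + expct P xi) / a ^+ 2) + expct P xi.
  apply: (le_trans H1); apply: (le_trans H3); rewrite lerD2r ler_wpM2l//.
have -> : prb P M = 4 / a ^+ 2 * ((a / 2) ^+ 2 * prb P M) by field; rewrite gt_eqF.
by rewrite ler_wpM2l// divr_ge0// ltW.
Qed.

End two_stage.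

(** * Oscillation of one system *)

Section uniform_jumps.
Context (R : realType).

(** Near t, values on the same side of t are within 2 eta = e - c of each other, and values on
    opposite sides differ in addition by the jump at t; compactness makes the scale uniform. *)
Lemma cadlag_small_jumps (x : R -> R) (p c e : R) : cadlag x -> c < e ->
  (forall t, 0 <= t <= p -> `|x t - left_limit x t| <= c) ->
  exists2 del, 0 < del & forall s t, 0 <= s <= p -> `|s - t| < del -> `|x s - x t| <= e.
Proof.
move=> cx ce jx; pose eta := (e - c) / 2.
have eta0 : 0 < eta by rewrite divr_gt0// subr_gt0.
have L : forall t, [set` `[0, p]] t -> \forall t' \near t & k \near \oo,
    (fun (k : nat) s => forall s', `|s - s'| < k.+1%:R^-1 -> `|x s - x s'| <= e) k t'.
  move=> t /=; rewrite in_itv/= => tp.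
  have [d1 d10 H1] := cadlag_right t cx eta0; have [d2 d20 H2] := cadlag_left t cx eta0.
  pose del := Num.min d1 d2; have del0 : 0 < del by rewrite lt_min d10.
  exists (ball t (del / 2), [set k | (Num.truncn (del / 2)^-1 <= k)%N]).
    by split; [apply: nbhsx_ballx; rewrite divr_gt0|exists (Num.truncn (del / 2)^-1)].
  move=> [s k] /= [ts Nk] s' ss'.
  have kd : k.+1%:R^-1 <= del / 2.
    rewrite -[leRHS]invrK lef_pV2 ?posrE ?invr_gt0 ?divr_gt0//.
    by apply/ltW/truncn_lt.
  have near y : `|t - y| < del -> `|x y - x t| < eta \/ `|x y - left_limit x t| < eta.
    rewrite /del lt_min => /andP[ty1 ty2]; have [ty|yt] := leP t y.
      by left; apply: H1; rewrite ty/= -ltrBlDl; apply: le_lt_trans ty1; rewrite distrC ler_norm.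
    right; apply: H2; rewrite yt andbT ltrBlDl -ltrBlDr.
    by apply: le_lt_trans ty2; rewrite ler_norm.
  have ns : `|t - s| < del by apply: lt_trans ts _; rewrite ltr_pdivrMr// ltr_pMr// ltr1n.
  have ns' : `|t - s'| < del.
    rewrite -(subrKA s); apply: le_lt_trans (ler_normD _ _) _; rewrite [ltRHS]splitr.
    by apply: ltrD => //; exact: lt_le_trans ss' kd.
  have j := jx t tp.
  have ee : eta + eta = e - c by rewrite -splitr.
  have tri (y y' z z' : R) : `|y - z| < eta -> `|y' - z'| < eta -> `|z - z'| <= c -> `|y - y'| <= e.
    rewrite !ltr_distl => /andP[a1 a2] /andP[b1 b2]; rewrite !ler_norml => /andP[c1 c2].
    by apply/andP; split; lra.
  have c0 : 0 <= c := le_trans (normr_ge0 _) j.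
  by case: (near _ ns) => h1; case: (near _ ns') => h2; apply: tri h1 h2 _;
    rewrite ?subrr ?normr0// distrC.
have [N _ HN] : \forall k \near \oo, [set` `[0, p]] `<=` (fun s => forall s', `|s - s'| < k.+1%:R^-1 -> `|x s - x s'| <= e).
  exact: (iffLR (compact_near_coveringP _) (@segment_compact R 0 p) _ \oo (fun (k : nat) s => forall s', `|s - s'| < k.+1%:R^-1 -> `|x s - x s'| <= e) _ L).
exists N.+1%:R^-1; first by rewrite invr_gt0.
by move=> s t sp; apply: (HN N (leqnn N)); rewrite /= in_itv.
Qed.

End uniform_jumps.

Section liminf_bound.
Context d (T : measurableType d) (R : realType) (P : probability T R).

(** Fatou's lemma for events: E lies in the lower limit of the sequence. *)
Lemma prb_liminf_le (E : set T) (E_ : nat -> set T) c : measurable E -> (forall m, measurable (E_ m)) ->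
  (forall m, prb P (E_ m) <= c) -> (forall w, E w -> exists N, forall m, (N <= m)%N -> E_ m w) ->
  prb P E <= c.
Proof.
move=> mE mE_ Ec H.
have cv : expct P (fun w => \1_E w * \1_(E_ m) w) @[m --> \oo] --> expct P \1_E.
  apply: (expct_dct (g := cst 1)).
  - by move=> m; apply: measurable_funM; exact: mfun_indic.
  - move=> w; have [Ew|nEw] := pselect (E w); last first.
      by rewrite (indicF R nEw); under eq_fun do rewrite mul0r; exact: cvg_cst.
    rewrite (indicT R Ew); have [N HN] := H w Ew; apply: cvg_near_cst.
    by exists N => // m /= Nm; rewrite (indicT R (HN m Nm)) mul1r.
  - exact: intg_cst.
  - by move=> m w; rewrite normrM mulr_ile1// norm_indic_le1.
rewrite prb_indic//; apply: (ler_cvg_to cv (@cvg_cst _ c _ \oo _)).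
apply: nearW => m; apply: le_trans (Ec m); rewrite prb_indic//; apply: expct_le.
- by apply: intg_mul1 => //; exact: intg_indic.
- exact: intg_indic.
- by move=> w; rewrite ler_piMl// indicE; case: (w \in E).
Qed.

End liminf_bound.

Section fixed_system.
Context (R : realType) (d : nat) (dd : measure_display) (Om : measurableType dd)
  (P : probability Om R) (Z : Om -> skorokhod 'rV[R]_d) (A : Om -> R -> 'M[R]_d).
Hypothesis sys : regular_system P Z A.
Notation F := (joint_filtration (fun w s => Z w s) A).
Notation GT t := (g_sigma_algebraType (F t)).
Let Ffil := joint_filtration_filtration sys.

Context (a : 'rV[R]_d -> 'M[R]_d) (C : R).
Hypotheses (aC : forall x i j, `|a x i j| <= C) (C0 : 0 <= C)
  (a_continuous : forall x, x != 0 -> {for x, continuous a}).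
Context (r K T : R).
Hypotheses (r0 : 0 <= r) (K0 : 0 <= K) (T0 : 0 <= T).

Notation tau w := (Order.min T%:E (exit_time (Z w) (r + 1))).
Notation Y := (stopped_Z Z A r K T).
Notation B := (stopped_A Z A r K T).
Notation sg := (halt Z A r K T).
Notation start := (inside Z r).
Notation Jz := (overshoot_Z Z A r K T).
Notation Ja := (overshoot_A Z A r K T).

Lemma Z_mfun (g : 'rV[R]_d -> R) t : continuous g -> 0 <= t -> mfun (fun w => g (Z w t)).
Proof. by move=> cg t0; apply: (mfun_borel cg); exact: (sys_Z_meas sys). Qed.

Lemma entry_off_zero i j x : x != 0 -> {for x, continuous (fun x => a x i j)}.
Proof.
move=> x0; apply: (@continuous_comp _ _ _ a (fun M : 'M[R]_d => M i j) x); first exact: a_continuous.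
exact: coord_continuous.
Qed.

Lemma a_jmeas i j : jmeas (fun w s => a (Z w s) i j).
Proof.
apply: (jmeas_off_zero Z_mfun (g := fun x => a x i j) (C := C)) => // x x0.
exact: entry_off_zero.
Qed.

Lemma a_path_meas w i j : measurable_fun setT (fun s => a (Z w s) i j).
Proof. exact: jmeas_path (a_jmeas i j). Qed.

Definition compensator_gap i j t w : R := `|A w t i j - tint t (fun s => a (Z w s) i j)|.

Definition gap_event i j (e : R) : set Om :=
  [set w | (e%:E < `|sup_upto (tau w) (fun t => compensator_gap i j t w)|)%E].

Lemma tau_real w : tau w = (fine (tau w))%:E /\ 0 <= fine (tau w) <= T.
Proof.
have e0 : (0 <= exit_time (Z w) (r + 1))%E.
  by apply: le_ereal_inf_tmp => _ [t [t0 _] <-]; rewrite lee_fin.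
have t0 : (0 <= tau w)%E by rewrite le_min lee_fin T0.
have tT : (tau w <= T%:E)%E by rewrite ge_min lexx.
have fin : tau w \is a fin_num by rewrite ge0_fin_numE// (le_lt_trans tT)// ltry.
by split; [rewrite fineK|rewrite fine_ge0// -lee_fin fineK].
Qed.

Lemma gap_event_measurable i j e : measurable (gap_event i j e).
Proof.
have mA t : 0 <= t -> mfun (fun w => A w t i j).
  move=> t0; apply: (mfun_borel (f := fun M : 'M[R]_d => M i j)); first exact: coord_continuous.
  exact: (sys_A_meas sys).
have := @sup_event_measurable _ Om R (fun w t => compensator_gap i j t w) (fun w => fine (tau w)) T e T0.
have E : [set w | (e%:E < `|sup_upto (fine (tau w))%:E (fun t => compensator_gap i j t w)|)%E] = gap_event i j e.
  by apply/seteqP; split=> w /=; rewrite /gap_event/=; have [<- _] := tau_real w.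
rewrite E; apply=> //.
- move=> t t0; apply: mfun_norm; apply: measurable_funB; first exact: mA.
  by apply: (mfun_tint t0 (a_jmeas i j) (C := C)) => w s; exact: aC.
- move=> w t e1 t0 e10; have e20 : 0 < e1 / 2 by rewrite divr_gt0.
  have [d1 d10 H1] := cadlag_rcont (sys_A_cadlag sys w i j) t0 e20.
  have [d2 d20 H2] := tint_rcont (a_path_meas w i j) (fun s => aC (Z w s) i j) t0 e20.
  exists (Num.min d1 d2); first by rewrite lt_min d10.
  move=> s /andP[ts]; rewrite -ltrBlDl lt_min !ltrBlDl => /andP[s1 s2].
  have h1 := H1 s; have h2 := H2 s; rewrite ts s1 in h1; rewrite ts s2 in h2.
  apply: le_lt_trans (ler_dist_dist _ _) _.
  rewrite (_ : _ - _ - _ = (A w s i j - A w t i j) - (tint s (fun s => a (Z w s) i j) - tint t (fun s => a (Z w s) i j))); last by ring.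
  by apply: le_lt_trans (ler_normB _ _) _; rewrite [ltRHS]splitr ltrD ?h1 ?h2.
- by move=> w t; exact: normr_ge0.
- by move=> w; have [_] := tau_real w.
- move=> u; rewrite (_ : [set w | _] = [set w | T < u] `|` [set w | (exit_time (Z w) (r + 1) < u%:E)%E])%classic.
    apply: measurableU; last exact: exit_time_measurable Z_mfun _ _.
    have [Tu|uT] := ltP T u; first by rewrite (_ : [set w | _] = setT)//; apply/seteqP; split.
    by rewrite (_ : [set w | _] = set0)//; apply/seteqP; split.
  have E2 w : (fine (tau w) < u) = (T < u) || (exit_time (Z w) (r + 1) < u%:E)%E.
    by rewrite -lte_fin -(tau_real w).1 gt_min lte_fin.
  by apply/seteqP; split=> w /=; rewrite E2 => /orP.
Qed.

Lemma gap_small i j e w t : ~ gap_event i j e w -> 0 <= t -> t <= sg w ->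
  compensator_gap i j t w <= e.
Proof.
move=> /negP; rewrite -leNgt => H t0 ts.
have tt : (t%:E <= tau w)%E.
  by apply: le_trans (stop_time_exit r K (Z w) (A w) T0); rewrite lee_fin.
rewrite -lee_fin; apply: le_trans H.
apply: le_trans (sup_upto_ge (fun t => compensator_gap i j t w) t0 tt) _.
exact: lee_abs.
Qed.

Lemma stopped_le w t : 0 <= t -> 0 <= Num.min t (sg w) /\ Num.min t (sg w) <= sg w.
Proof. by move=> t0; rewrite le_min t0 halt_ge0// ge_min lexx orbT. Qed.

Lemma min_increment (s t x : R) : s <= t -> 0 <= Num.min t x - Num.min s x <= t - s.
Proof. by move=> st; case: (leP t x) => tx; case: (leP s x) => sx; apply/andP; split; lra. Qed.

Lemma stopped_A_increment i j e w s t : 0 <= e -> ~ gap_event i j e w -> 0 <= s -> s <= t ->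
  `|B i j t w - B i j s w| <= C * (t - s) + 2 * e.
Proof.
move=> e0 nD s0 st; have t0 := le_trans s0 st.
have [sw|nsw] := pselect (start w); last first.
  rewrite /stopped_A !(indicF R nsw) !mul0r subrr normr0.
  by rewrite addr_ge0 ?mulr_ge0// subr_ge0.
rewrite /stopped_A !(indicT R sw) !mul1r.
have [m0 mle] := stopped_le w s0; have [M0 Mle] := stopped_le w t0.
have h1 := gap_small nD m0 mle; have h2 := gap_small nD M0 Mle.
have /andP[inc0 inc1] := min_increment (sg w) st; rewrite subr_ge0 in inc0.
have h3 := tint_increment (a_path_meas w i j) (fun s => aC (Z w s) i j) m0 inc0.
have h4 : C * (Num.min t (sg w) - Num.min s (sg w)) <= C * (t - s) by rewrite ler_wpM2l.
move: h1 h2 h3; rewrite /compensator_gap.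
set x := A w _ i j; set y := A w _ i j; set p := tint _ _; set q := tint _ _.
rewrite !ler_norml => /andP[a1 a2] /andP[b1 b2] /andP[c1 c2].
by apply/andP; split; move: h4; lra.
Qed.

Lemma stopped_A_diag_ge0 i t w : 0 <= t -> 0 <= B i i t w.
Proof.
move=> t0; rewrite mulr_ge0//.
by apply: nonneg_diag; apply: (A_nonneg sys) => //; rewrite le_min t0 halt_ge0.
Qed.

(** Bounds the excess of an increment of a diagonal entry over C times its length. Off the gap event
    it is 2 e; on it, the increment is at most the final value, hence at most K plus the
    overshoot. *)
Definition xi i e w : R := 2 * e + K * \1_(gap_event i i e) w + Ja i w.

Lemma xi_ge0 i e w : 0 <= e -> 0 <= xi i e w.
Proof. by move=> e0; rewrite !addr_ge0 ?mulr_ge0// ?overshoot_A_ge0// indicE. Qed.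

Lemma stopped_A_diag_increment i e w s t : 0 <= e -> 0 <= s -> s <= t -> t <= T ->
  B i i t w - B i i s w <= C * (t - s) + xi i e w.
Proof.
move=> e0 s0 st tT; have J0 := overshoot_A_ge0 Z A r K T i w.
have cst0 : 0 <= C * (t - s) by rewrite mulr_ge0// subr_ge0.
have [D|nD] := pselect (gap_event i i e w).
  rewrite /xi (indicT R D) mulr1.
  have h1 := stopped_A_diag_ge0 i w s0.
  have h2 : B i i t w <= B i i T w.
    rewrite /stopped_A; have [sw|nsw] := pselect (start w); last by rewrite !(indicF R nsw) !mul0r.
    rewrite !(indicT R sw) !mul1r; apply: (A_diag_mono sys) => //.
      by rewrite le_min (le_trans s0 st) halt_ge0.
    by have /andP[+ _] := min_increment (sg w) tT; rewrite subr_ge0.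
  have h3 : B i i T w <= K + Ja i w by rewrite -lerBlDl le_max lexx orbT.
  by move: h1 h2 h3; lra.
have := stopped_A_increment e0 nD s0 st; rewrite ler_norml => /andP[_ h].
by rewrite /xi (indicF R nD) mulr0; move: h; lra.
Qed.

(** Paths that start in the ball and are not halted before T; on them the stopped processes coincide
    with Z and A up to T. *)
Definition good : set Om := [set w | T <= sg w] `&` start.

Lemma good_measurable : measurable good.
Proof.
apply: measurableI; last exact: inside_measurable sys r.
apply: (filtration_meas Ffil T0); apply: (sig_ge Ffil _ T0) => u u0.
exact: (halt_past sys r K T0).
Qed.

Lemma good_stopped_Z w i t : good w -> t <= T -> Y i t w = Z w t 0 i.
Proof.
move=> [Tw sw] tT; rewrite /stopped_Z (indicT R sw) mul1r min_l//.
exact: le_trans tT Tw.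
Qed.

Lemma good_stopped_A w i j t : good w -> t <= T -> B i j t w = A w t i j.
Proof.
move=> [Tw sw] tT; rewrite /stopped_A (indicT R sw) mul1r min_l//.
exact: le_trans tT Tw.
Qed.

Lemma good_exit w : good w -> (T%:E <= tau w)%E.
Proof.
move=> [Tw _]; apply: le_trans (stop_time_exit r K (Z w) (A w) T0).
by rewrite lee_fin.
Qed.

Context (EJ : R).
Hypothesis Z_jump_le : (\int[P]_w Z_jump (Z w) T (r + 1) <= EJ%:E)%E.
Hypothesis A_jump_fin : forall i j, (\int[P]_w A_jump (Z w) (A w) i j T (r + 1) < +oo)%E.
Let Z_jump_fin : (\int[P]_w Z_jump (Z w) T (r + 1) < +oo)%E.
Proof. by apply: le_lt_trans Z_jump_le _; rewrite ltry. Qed.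

Lemma overshoot_Z_le : intg P Jz /\ expct P Jz <= EJ.
Proof.
have [i1 h] := overshoot_Z_intg sys K T0 Z_jump_fin.
by split=> //; rewrite -lee_fin; exact: le_trans h Z_jump_le.
Qed.

Lemma overshoot_A_finite i : intg P (Ja i).
Proof. by have [] := overshoot_A_intg sys K0 T0 A_jump_fin i. Qed.

Lemma xi_int i e : intg P (xi i e).
Proof.
apply: intgD; last exact: overshoot_A_finite.
by apply: intgD; [exact: intg_cst|apply: intgZ; apply: intg_indic; exact: gap_event_measurable].
Qed.

Lemma xi_expct i e : expct P (xi i e) = 2 * e + K * prb P (gap_event i i e) + expct P (Ja i).
Proof.
have mD := gap_event_measurable i i e.
rewrite expctD; [|by apply: intgD; [exact: intg_cst|exact/intgZ/intg_indic]|exact: overshoot_A_finite].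
rewrite expctD; [|exact: intg_cst|exact/intgZ/intg_indic].
by rewrite expct_cst expctZ ?prb_indic//; exact: intg_indic.
Qed.

Section block.
Context (i : 'I_d) (al be aa e : R).
Hypotheses (al0 : 0 <= al) (albe : al < be) (beT : be <= T) (aa0 : 0 < aa) (e0 : 0 <= e).

(** The maximal inequality asks for an infinite sequence of times; capping at [be] keeps all of them
    below T. *)
Let u m k := Num.min be (mesh al be m k).

Let u0 m k : 0 <= u m k.
Proof. by rewrite le_min (le_trans al0 (ltW albe)) (le_trans al0)// mesh_ge. Qed.

Let uS m k : u m k <= u m k.+1.
Proof. by have /andP[+ _] := min_increment be (ltW (mesh_lt albe m k)); rewrite subr_ge0 /u minC [in leRHS]minC. Qed.

Let uT m k : u m k <= T.
Proof. by rewrite ge_min beT. Qed.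

Let uE m k : (k <= m.+1)%N -> u m k = mesh al be m k.
Proof. by move=> km; rewrite /u min_r// -[leRHS](meshS al be m) mesh_le. Qed.

Let D m : set Om := [set w | exists2 l, (l <= m.+1)%N & 2 * aa < `|Y i (u m l) w - Y i (u m 0) w|].
Let S m : set Om := [set w | forall k, (k < m.+1)%N -> `|Y i (u m k.+1) w - Y i (u m k) w| <= aa / 2].

Let Yu_mfun m k : mfun (Y i (u m k)).
Proof. exact: (stopped_Z_mfun sys r K T0). Qed.

Let D_meas m : measurable (D m).
Proof.
rewrite (_ : D m = \bigcup_(l in `I_m.+2) [set w | 2 * aa < `|Y i (u m l) w - Y i (u m 0) w|]); last first.
  by apply/seteqP; split=> w /= [k km h]; exists k.
apply: fin_bigcup_measurable => // k _; apply: measurable_gt_cst; apply: mfun_norm.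
by apply: measurable_funB; exact: Yu_mfun.
Qed.

Let S_meas m : measurable (S m).
Proof.
rewrite (_ : S m = \bigcap_(k in `I_m.+1) [set w | `|Y i (u m k.+1) w - Y i (u m k) w| <= aa / 2]); last first.
  by apply/seteqP; split=> w /= h k; apply: h.
apply: fin_bigcap_measurable => // k _; apply: measurable_le_cst; apply: mfun_norm.
by apply: measurable_funB; exact: Yu_mfun.
Qed.

(** The bound of [block_oscillation] with c = C (be - al): quadratic in the length of the block, up
    to the mean of [xi]. *)
Definition block_bound : R := 4 / aa ^+ 2 *
  (C * (be - al) * ((C * (be - al) + expct P (xi i e)) / aa ^+ 2) + expct P (xi i e)).

Let grid_bound m : prb P (D m `&` S m) <= block_bound.
Proof.
have [Jzi _] := overshoot_Z_le.
apply: (@block_oscillation _ _ _ P F Ffil (u m) (u0 m) (uS m) (fun k => Y i (u m k)) (fun k => B i i (u m k))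
  (fun w => 2 * r ^+ 2 + 2 * Jz w) _ _ _ _ _ _ m.+1 (C * (be - al)) (xi i e)) => //.
- by move=> k; exact: (stopped_Z_past sys r K T0).
- move=> k; apply: (stopped_A_intg sys K0 T0 Z_jump_fin A_jump_fin).
  by rewrite u0 uT.
- by apply: intgD; [exact: intg_cst|exact: intgZ].
- move=> k w; have uu : 0 <= u m k <= T by rewrite u0 uT.
  have yb : \sum_(i < d) Y i (u m k) w ^+ 2 <= 2 * r ^+ 2 + 2 * Jz w by apply: stopped_Z_bound.
  apply: le_trans yb.
  by rewrite (bigD1 i)//= lerDl sumr_ge0// => l _; exact: sqr_ge0.
- move=> k E FE.
  apply: (stopped_Z_mean sys r0 K0 T0 Z_jump_fin A_jump_fin (sys_Z_mart sys i) _ _ _ FE) => //.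
- move=> k E FE.
  have := stopped_ZZ_mean sys r0 K0 T0 Z_jump_fin A_jump_fin (sys_ZZ_mart sys i i) (u0 m k) (uS m k) (uT m k.+1) FE.
  by under eq_fun do rewrite -!expr2.
- by rewrite mulr_ge0// subr_ge0 ltW.
- by move=> w; exact: xi_ge0.
- exact: xi_int.
- move=> l w lm; have ul : u m l <= u m m.+1 by apply: (homo_leq (r := fun x y => x <= y) _ _ (uS m)) => // x y z; exact: le_trans.
  apply: le_trans (stopped_A_diag_increment _ _ e0 (u0 m l) ul (uT m m.+1)) _.
  rewrite lerD2r ler_wpM2l// lerB//; first by rewrite ge_min lexx.
  by rewrite uE// mesh_ge.
Qed.

Definition osc : set Om := [set w | exists2 t, al <= t <= be & 2 * aa < `|Z w t 0 i - Z w al 0 i|].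

Let Zi_cadlag w : cadlag (fun t => Z w t 0 i).
Proof.
apply: (cadlag_comp (g := fun x : 'rV[R]_d => x 0 i) _ (path_cadlag (Z w))).
exact: coord_continuous.
Qed.

Lemma osc_measurable : measurable osc.
Proof.
have mZ t : 0 <= t -> mfun (fun w => Z w t 0 i).
  by move=> t0; apply: (Z_mfun (g := fun x => x 0 i)) => //; exact: coord_continuous.
have -> : osc = ([set w : Om | 2 * aa < `|Z w be 0 i - Z w al 0 i|] `|`
    \bigcup_(q in [set q : rat | al <= ratr q :> R /\ ratr q < be :> R])
      [set w : Om | 2 * aa < `|Z w (ratr q) 0 i - Z w al 0 i|])%classic.
  apply/seteqP; split=> w /=.
    move=> [t /andP[t0]]; rewrite le_eqVlt => /predU1P[<-|tT h]; first by left.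
    right; have h0 : 0 < `|Z w t 0 i - Z w al 0 i| - 2 * aa by rewrite subr_gt0.
    have [q0 [/andP[tq qT] zq]] := cadlag_rat (Zi_cadlag w) tT h0.
    exists q0 => /=; first by split; rewrite ?(le_trans t0)// ltW.
    have : `|Z w t 0 i - Z w al 0 i| <= `|Z w (ratr q0) 0 i - Z w al 0 i| + `|Z w (ratr q0) 0 i - Z w t 0 i|.
      rewrite [`|Z w (ratr q0) 0 i - Z w t 0 i|]distrC; apply: le_trans (ler_normD _ _).
      by rewrite [X in _ <= `|X|]addrC subrKA.
    by move: zq => /=; lra.
  move=> [h|[q [q0 qb] h]]; first by exists be => //; rewrite lexx ltW.
  by exists (ratr q) => //; rewrite q0 ltW.
apply: measurableU.
  apply: measurable_gt_cst; apply: mfun_norm; apply: measurable_funB; apply: mZ => //.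
  exact: le_trans al0 (ltW albe).
apply: bigcup_rat_measurable => q [q0 _]; apply: measurable_gt_cst; apply: mfun_norm.
by apply: measurable_funB; apply: mZ => //; exact: le_trans q0.
Qed.

(** Good paths whose grid increments exceed aa / 2 on infinitely many meshes. Jumps of at most aa /
    4 would exclude this by [cadlag_small_jumps], so some jump is larger; Markov's inequality for
    its square gives the factor 16 / aa^2. *)
Let Lbad : set Om := good `&` \bigcap_N \bigcup_(m in [set m | (N <= m)%N]) ~` S m.

Let Lbad_meas : measurable Lbad.
Proof.
apply: measurableI; first exact: good_measurable.
apply: bigcapT_measurable => N; apply: bigcup_measurable => m _; exact: measurableC.
Qed.

Let mesh_small (x : R) : 0 < x -> exists N, forall m, (N <= m)%N -> (be - al) / m.+1%:R < x.
Proof.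
move=> x0; exists (Num.truncn ((be - al) / x)) => m Nm.
rewrite ltr_pdivrMr// mulrC -ltr_pdivrMr//.
by apply: truncn_lt.
Qed.

Let Lbad_jump w : Lbad w -> (((aa / 4) ^+ 2)%:E <= Z_jump (Z w) T (r + 1))%E.
Proof.
move=> [gw Lw]; rewrite leNgt; apply/negP => Jlt.
have jump t : 0 <= t <= T -> `|Z w t 0 i - left_limit (fun t => Z w t 0 i) t| <= aa / 4.
  move=> /andP[t0 tT].
  rewrite (left_limit_comp (g := fun x : 'rV[R]_d => x 0 i) t _ (path_cadlag (Z w))); last exact: coord_continuous.
  have -> : Z w t 0 i - left_limit (Z w) t 0 i = (Z w t - left_limit (Z w) t) 0 i by rewrite !mxE.
  apply: le_trans (coord_enorm _ i) _.
  have a40 : 0 <= aa / 4 by rewrite divr_ge0// ltW.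
  rewrite -ler_sqr ?nnegrE ?enorm_ge0// -lee_fin; apply: le_trans (ltW Jlt).
  apply: (sup_upto_ge (fun t => enorm (Z w t - left_limit (Z w) t) ^+ 2)) => //.
  by apply: le_trans (good_exit gw); rewrite lee_fin.
have a42 : aa / 4 < aa / 2 by rewrite ltr_pM2l// ltf_pV2 ?posrE// ltr_nat.
have [del del0 Hdel] := cadlag_small_jumps (Zi_cadlag w) a42 jump.
have [N HN] := mesh_small del0.
have [m /= Nm] := Lw N I; apply=> k km.
rewrite !(good_stopped_Z _ gw)//.
have -> : u m k.+1 = mesh al be m k.+1 by rewrite uE.
have -> : u m k = mesh al be m k by rewrite uE// ltnW.
apply: Hdel.
  by rewrite -uE// u0 uT.
rewrite /mesh -natr1 mulrDl mul1r opprD addrACA subrr add0r addrAC subrr add0r.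
by rewrite ger0_norm; [exact: HN|rewrite divr_ge0// subr_ge0 ltW].
Qed.

Let Lbad_prb : prb P Lbad <= 16 / aa ^+ 2 * EJ.
Proof.
have a42 : 0 < (aa / 4) ^+ 2 by rewrite exprn_gt0// divr_gt0.
have [] := @le_lower_integral R _ Om P (fun w => (aa / 4) ^+ 2 * \1_Lbad w) (fun w => Z_jump (Z w) T (r + 1)).
- by apply: measurable_funM => //; exact: mfun_indic.
- by move=> w; rewrite mulr_ge0 ?sqr_ge0// indicE.
- move=> w; have [Lw|nLw] := pselect (Lbad w).
    by rewrite (indicT R Lw) mulr1; exact: Lbad_jump.
  rewrite (indicF R nLw) mulr0; by apply: sup_upto_ge0 => // t; exact: sqr_ge0.
- exact: Z_jump_fin.
rewrite expctZ; last exact: intg_indic.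
rewrite -prb_indic// => _ h; have : ((aa / 4) ^+ 2 * prb P Lbad <= EJ) by rewrite -lee_fin; exact: le_trans h Z_jump_le.
move=> h'; have -> : prb P Lbad = 16 / aa ^+ 2 * ((aa / 4) ^+ 2 * prb P Lbad) by field; rewrite gt_eqF.
by rewrite ler_wpM2l// divr_ge0// sqr_ge0.
Qed.

(** Off [Lbad], right-continuity moves an oscillation at time t to the grid for every fine mesh. The
    event thus lies in the lower limit of the grid events, whose bound does not depend on the
    mesh. *)
Lemma osc_bound : prb P (osc `&` good) <= 16 / aa ^+ 2 * EJ + block_bound.
Proof.
have mO := osc_measurable; have mG := good_measurable.
pose E : set Om := (osc `&` good) `\` Lbad.
have mE : measurable E by apply: measurableD => //; exact: measurableI.
have h1 : prb P (osc `&` good) <= prb P Lbad + prb P E.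
  apply: le_trans (prbU P Lbad_meas mE); apply: prb_le.
  - exact: measurableI.
  - exact: measurableU.
  - by move=> w h; have [L|L] := pselect (Lbad w); [left|right].
apply: (le_trans h1); apply: lerD; first exact: Lbad_prb.
apply: (@prb_liminf_le _ _ _ P E (fun m => D m `&` S m)) => //.
- by move=> m; exact: measurableI.
move=> w [[[t /andP[alt tbe] ht] gw] nL].
have [N1 HN1] : exists N, forall m, (N <= m)%N -> S m w.
  apply: contrapT => nN; apply: nL; split=> // N _; apply: contrapT => nm; apply: nN.
  by exists N => m Nm; apply: contrapT => nS; apply: nm; exists m.
suff [N2 HN2] : exists N, forall m, (N <= m)%N -> D m w.
  exists (maxn N1 N2) => m; rewrite geq_max => /andP[m1 m2]; split; [exact: HN2|exact: HN1].
have Dm m k : (k <= m.+1)%N -> 2 * aa < `|Z w (mesh al be m k) 0 i - Z w al 0 i| -> D m w.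
  move=> km h; exists k => //; rewrite !(good_stopped_Z _ gw)// !uE// mesh0//.
move: tbe; rewrite le_eqVlt => /predU1P[tE|tbe].
  by exists 0%N => m _; apply: (Dm m m.+1) => //; rewrite meshS -tE.
have h0 : 0 < `|Z w t 0 i - Z w al 0 i| - 2 * aa by rewrite subr_gt0.
have [del del0 Hd] := cadlag_right t (Zi_cadlag w) h0.
have dd0 : 0 < Num.min del (be - t) by rewrite lt_min del0 subr_gt0.
have [N HN] := mesh_small dd0; exists N => m Nm.
have := HN m Nm; set h := (be - al) / m.+1%:R; rewrite lt_min => /andP[hd hb].
have h_gt0 : 0 < h by exact: mesh_gt0.
(* The first grid point after t; as h < be - t, it still lies in the block. *)
pose k := (Num.truncn ((t - al) / h)).+1.
have /truncn_itv/andP[k1 k2] : 0 <= (t - al) / h by rewrite divr_ge0 ?subr_ge0// ltW.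
have tk : t < mesh al be m k by rewrite /mesh -/h -ltrBlDl -ltr_pdivrMr.
have kt : mesh al be m k <= t + h.
  rewrite /mesh -/h /k -natr1 mulrDl mul1r addrA lerD2r -lerBrDl -ler_pdivlMr//.
have km : (k <= m.+1)%N.
  rewrite -(ler_nat R) -(ler_pM2r h_gt0).
  have -> : m.+1%:R * h = be - al by rewrite /h mulrC divfK.
  by rewrite lerBrDl; apply: (le_trans kt); rewrite -lerBrDl ltW.
apply: (Dm m k km).
have := Hd (mesh al be m k); rewrite (ltW tk)/= => /(_ (le_lt_trans kt _)).
rewrite ltrD2l => /(_ hd) zq.
have : `|Z w t 0 i - Z w al 0 i| <= `|Z w (mesh al be m k) 0 i - Z w al 0 i| + `|Z w (mesh al be m k) 0 i - Z w t 0 i|.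
  rewrite [`|Z w (mesh al be m k) 0 i - Z w t 0 i|]distrC; apply: le_trans (ler_normD _ _).
  by rewrite [X in _ <= `|X|]addrC subrKA.
by move: zq; lra.
Qed.

End block.

End fixed_system.

(** * Tightness *)

Section finite_covers.

Lemma near_fintype (T : Type) (F : set_system T) (I : finType) (Q : I -> T -> Prop) : Filter F ->
  (forall i, \forall n \near F, Q i n) -> \forall n \near F, forall i, Q i n.
Proof.
move=> FF H; have : \forall n \near F, forall i, i \in enum I -> Q i n.
  elim: (enum I) => [|i s IH]; first by apply: nearW.
  apply: filterS2 (H i) IH => n h1 h2 j; rewrite in_cons => /predU1P[->//|]; exact: h2.
by apply: filterS => n h i; apply: h; rewrite mem_enum.
Qed.

Lemma prb_cover d (T : measurableType d) (R : realType) (P : probability T R) (I : finType)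
    (E : set T) (F : I -> set T) : measurable E -> (forall i, measurable (F i)) ->
  (forall w, E w -> exists i, F i w) -> prb P E <= \sum_i prb P (F i).
Proof.
move=> mE mF EF; rewrite prb_indic//.
under eq_bigr do rewrite prb_indic//.
rewrite -expct_sum; last by move=> i; exact: intg_indic.
apply: expct_le; [exact: intg_indic|by apply: intg_sum => i; exact: intg_indic|move=> w].
have [Ew|nEw] := pselect (E w); last first.
  by rewrite (indicF R nEw) sumr_ge0// => i _; rewrite indicE.
have [i Fi] := EF w Ew; rewrite (indicT R Ew) (bigD1 i)//= (indicT R Fi) lerDl.
by rewrite sumr_ge0// => j _; rewrite indicE.
Qed.

End finite_covers.

Section sequence.
Context (R : realType) (d : nat).
Context (disp : nat -> measure_display) (Omega : forall n, measurableType (disp n))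
  (P : forall n, probability (Omega n) R)
  (Z : forall n, Omega n -> skorokhod 'rV[R]_d) (A : forall n, Omega n -> R -> 'M[R]_d).
Arguments Z : clear implicits.
Arguments A : clear implicits.
Context (sys : forall n, regular_system (P n) (Z n) (A n)).
Context (a : 'rV[R]_d -> 'M[R]_d) (C : R).
Hypotheses (aC : forall x i j, `|a x i j| <= C) (C0 : 0 <= C)
  (a_continuous : forall x, x != 0 -> {for x, continuous a}).
Hypotheses
    (Z_jumps : forall r T, 0 < r -> 0 < T ->
       (\int[P n]_w Z_jump (Z n w) T r)%E
         @[n --> \oo] --> 0%E)
    (A_jumps : forall r T i j, 0 < r -> 0 < T ->
       (\int[P n]_w A_jump (Z n w) (A n w) i j T r)%E
         @[n --> \oo] --> 0%E)
    (A_limit : forall r T i j, 0 < r -> 0 < T ->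
       cvg_prob0 P (fun n w => sup_upto (Order.min T%:E (exit_time (Z n w) r))
         (fun t => `|A n w t i j -
            \int[lebesgue_measure]_(s in `[0, t]) a (Z n w s) i j|))).
Hypothesis containment : forall T eta, 0 < eta ->
  exists K : nat, (0 < K)%N /\ \forall n \near \oo,
    prb (P n) [set w | exists2 t, 0 <= t <= T & K%:R < enorm (Z n w t)] <= eta.

Lemma cvge0_le (h : nat -> \bar R) (e : R) : 0 < e -> h n @[n --> \oo] --> 0%E ->
  \forall n \near \oo, (h n <= e%:E)%E.
Proof.
move=> e0 H; have : \forall n \near \oo, (h n < e%:E)%E by exact: H _ (@nbhs_open_ereal_lt R 0 (fun=> e) e0).
by apply: filterS => n /ltW.
Qed.

Section horizon.
Context (T r : R) (T0 : 0 < T) (r0 : 0 < r).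
(* The compensator is at most C T, so A exceeds this level only if it is far
   from the compensator. *)
Definition ceiling : R := C * T + 1.
Notation K := ceiling.

Lemma ceiling_ge0 : 0 <= K.
Proof. by rewrite addr_ge0// mulr_ge0// ltW. Qed.
Let K0 := ceiling_ge0.
Let T_ge0 := ltW T0.
Let r10 : 0 < r + 1 := addr_gt0 r0 ltr01.

Notation gap n := (gap_event (Z n) (A n) a r T).
Notation gd n := (good (Z n) (A n) r K T).
Notation Y n := (stopped_Z (Z n) (A n) r K T).
Notation B n := (stopped_A (Z n) (A n) r K T).
Notation F n := (joint_filtration (fun w s => Z n w s) (A n)).
Notation JI n := (\int[P n]_w Z_jump (Z n w) T (r + 1))%E.

Lemma Z_jump_le e : 0 < e -> \forall n \near \oo, (JI n <= e%:E)%E.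
Proof. by move=> e0; apply: cvge0_le => //; exact: Z_jumps. Qed.

Lemma A_jump_le e : 0 < e -> \forall n \near \oo, forall ij : 'I_d * 'I_d,
  (\int[P n]_w A_jump (Z n w) (A n w) ij.1 ij.2 T (r + 1) <= e%:E)%E.
Proof. by move=> e0; apply: near_fintype => ij; apply: cvge0_le => //; exact: A_jumps. Qed.

Lemma A_jump_finite n e : (forall ij : 'I_d * 'I_d,
  (\int[P n]_w A_jump (Z n w) (A n w) ij.1 ij.2 T (r + 1) <= e%:E)%E) ->
  forall i j, (\int[P n]_w A_jump (Z n w) (A n w) i j T (r + 1) < +oo)%E.
Proof. by move=> H i j; apply: le_lt_trans (H (i, j)) _; rewrite ltry. Qed.

Lemma gap_measurable n i j e : measurable (gap n i j e).
Proof. exact: (gap_event_measurable (sys n) aC a_continuous r T_ge0). Qed.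

Lemma gap_small_prb e eta : 0 < e -> 0 < eta ->
  \forall n \near \oo, forall ij : 'I_d * 'I_d, prb (P n) (gap n ij.1 ij.2 e) <= eta.
Proof.
move=> e0 eta0; apply: near_fintype => ij.
have := cvge0_le eta0 (A_limit ij.1 ij.2 r10 T0 e0).
apply: filterS => n h; rewrite -lee_fin -prb_fin; last exact: gap_measurable.
exact: h.
Qed.

Lemma overshoot_A_small e : 0 < e -> \forall n \near \oo, forall i,
  intg (P n) (overshoot_A (Z n) (A n) r K T i) /\ expct (P n) (overshoot_A (Z n) (A n) r K T i) <= e.
Proof.
move=> e0; have := A_jump_le e0; apply: filterS => n H i.
have s := sys n.
have [ji jle] := overshoot_A_intg s K0 T_ge0 (A_jump_finite H) i.
by split=> //; rewrite -lee_fin; apply: le_trans jle _; exact: (H (i, i)).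
Qed.

(** If Z stays in the ball, halting before T is due to a diagonal entry above C T + 1 at some
    rational time, while its compensator is at most C T there. *)
Lemma not_good n w : ~ gd n w ->
  (exists2 t, 0 <= t <= T & r < enorm (Z n w t)) \/ exists i, gap n i i 1 w.
Proof.
move=> ng; have [|nE] := pselect (exists2 t, 0 <= t <= T & r < enorm (Z n w t)); first by left.
right; have s := sys n.
have Zr t : t <= T -> enorm (Z n w t) <= r.
  move=> tT; rewrite leNgt; apply/negP => h; apply: nE.
  have [t0|t0] := leP 0 t; first by exists t; rewrite ?t0.
  exists 0; first by rewrite lexx.
  by have [neg _ _] := path_cadlag (Z n w); rewrite -(neg _ t0).
have haltT : halt (Z n) (A n) r K T w < T.
  rewrite ltNge; apply/negP => h; apply: ng; split=> //; exact: Zr.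
move: haltT; rewrite /halt (stop_time_lt r K (Z n w) T_ge0 (sys_A_cadlag s w) (lexx T)).
move=> [q [q0 qT [h|[i h]]]]; first by have := Zr _ (ltW qT); rewrite leNgt h.
exists i; apply: contrapT => /negP; rewrite -leNgt => H.
have qtau : ((ratr q)%:E <= Order.min T%:E (exit_time (Z n w) (r + 1)))%E.
  rewrite le_min lee_fin (ltW qT)/=; apply: le_ereal_inf_tmp => _ [t [t0 Ht] <-].
  rewrite lee_fin leNgt; apply/negP => tq.
  have r1 : r < r + 1 by rewrite ltrDl.
  have tT : t <= T := ltW (lt_trans tq qT).
  case: Ht => h'; first by have := lt_le_trans r1 h'; rewrite ltNge Zr.
  move: h'; rewrite -left_limit_enorm => h'.
  have : left_limit (enorm_path (Z n w)) t <= r.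
    by apply: left_limit_le (path_cadlag (enorm_path (Z n w))) _ => u ut; apply: Zr; rewrite (le_trans (ltW ut)).
  by move=> h2; have := lt_le_trans r1 (le_trans h' h2); rewrite ltxx.
have : compensator_gap (Z n) (A n) a i i (ratr q) w <= 1.
  rewrite -lee_fin; apply: le_trans H.
  apply: le_trans (sup_upto_ge (fun t => compensator_gap (Z n) (A n) a i i t w) q0 qtau) _.
  exact: lee_abs.
rewrite /compensator_gap ler_norml => /andP[_].
have mpath := a_path_meas s aC a_continuous w i i.
have := tint_increment mpath (fun s => aC (Z n w s) i i) (lexx 0) q0.
rewrite tint0 !subr0 => /(le_trans (ler_norm _)).
have : C * ratr q <= C * T by rewrite ler_wpM2l// ltW.
by move: h; rewrite /ceiling; lra.
Qed.

End horizon.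

Notation gap n r T := (gap_event (Z n) (A n) a r T).
Notation gd n r T := (good (Z n) (A n) r (ceiling T) T).

Lemma good_meas n r T : 0 < T -> measurable (gd n r T).
Proof. by move=> T0; exact: (good_measurable (sys n) r (ceiling T) (ltW T0)). Qed.

(** Half of eta pays for leaving the ball of radius K; by [not_good] the other half is shared by d
    gap events. The divisor d + 1 covers d = 0. *)
Lemma good_likely T eta : 0 < T -> 0 < eta -> exists r : R, 0 < r /\
  \forall n \near \oo, prb (P n) (~` gd n r T) <= eta.
Proof.
move=> T0 eta0; have e20 : 0 < eta / 2 by rewrite divr_gt0.
have [K [K0 HK]] := containment T e20; exists K%:R; split; first by rewrite ltr0n.
have K0' : 0 < K%:R :> R by rewrite ltr0n.
have e3 : 0 < eta / 2 / d.+1%:R by rewrite divr_gt0.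
have HG := gap_small_prb T0 K0' ltr01 e3.
apply: filterS2 HK HG => n hK hG.
have mG i : measurable (gap n K%:R T i i 1) by exact: gap_measurable.
have mN := measurableC (good_meas n K%:R T0).
pose V : set (Omega n) := [set w | exists2 t, 0 <= t <= T & K%:R < enorm (Z n w t)].
pose U : set (Omega n) := \bigcup_(i in [set: 'I_d]) gap n K%:R T i i 1.
have mU : measurable U by apply: fin_bigcup_measurable => // i _; exact: mG.
have E1 : prb (P n) U <= eta / 2.
  apply: (@le_trans _ _ (\sum_(i < d) prb (P n) (gap n K%:R T i i 1))).
    by apply: prb_cover => // w [i _ h]; exists i.
  apply: (@le_trans _ _ (\sum_(i < d) eta / 2 / d.+1%:R)).
    by apply: ler_sum => i _; exact: (hG (i, i)).
  rewrite sumr_const card_ord -[leLHS]mulr_natr -mulrA ler_piMr ?(ltW e20)//.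
  by rewrite mulrC ler_pdivrMr// mul1r ler_nat.
have NV : ~` gd n K%:R T `&` ~` U `<=` V.
  move=> w [ng nU]; have [//|[i gi]] := not_good T0 ng.
  by exfalso; apply: nU; exists i.
have mV : measurable V.
  rewrite (_ : V = [set w : Omega n | K%:R < enorm (Z n w T)] `|`
    \bigcup_(q in [set q : rat | 0 <= ratr q :> R /\ ratr q < T]) [set w : Omega n | K%:R < enorm (Z n w (ratr q))])%classic.
    have mz t : 0 <= t -> mfun (fun w => enorm (Z n w t)).
      by move=> t0; apply: (Z_mfun (sys n) (@enorm_continuous R d)).
    apply: measurableU; first exact/measurable_gt_cst/mz/ltW.
    by apply: bigcup_rat_measurable => q [q0 _]; exact/measurable_gt_cst/mz.
  apply/seteqP; split=> w /=.
    move=> [t /andP[t0]]; rewrite le_eqVlt => /predU1P[<-|tT h]; first by left.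
    right; have h0 : 0 < enorm (Z n w t) - K%:R by rewrite subr_gt0.
    have [q [/andP[tq qT] zq]] := cadlag_rat (path_cadlag (enorm_path (Z n w))) tT h0.
    exists q => /=; first by split; rewrite ?(le_trans t0)// ltW.
    by move: zq; rewrite /= ltr_distl opprB addrC subrK => /andP[].
  move=> [h|[q [q0 qT] h]]; first by exists T => //; rewrite lexx ltW.
  by exists (ratr q) => //; rewrite q0 ltW.
have E2 : prb (P n) (~` gd n K%:R T) <= prb (P n) U + prb (P n) V.
  apply: le_trans (prbU (P n) mU mV); apply: prb_le => //; first exact: measurableU.
  by move=> w ng; have [Uw|nU] := pselect (U w); [left|right; apply: NV].
by move: E1 E2 hK; rewrite -/V [eta in _ <= eta]splitr; lra.
Qed.

Definition block_osc n (T : R) (N : nat) (aa : R) : set (Omega n) :=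
  [set w | exists ji : 'I_N * 'I_d,
     osc (Z n) ji.2 (ji.1%:R * (T / N%:R)) (ji.1.+1%:R * (T / N%:R)) aa w].

Lemma block_pos (T : R) (N : nat) (j : 'I_N) : 0 < T ->
  [/\ 0 <= j%:R * (T / N%:R) :> R, j%:R * (T / N%:R) < j.+1%:R * (T / N%:R) :> R & j.+1%:R * (T / N%:R) <= T :> R].
Proof.
move=> T0; have N0 : 0 < N%:R :> R by rewrite ltr0n; case: N j => // -[].
have h0 : 0 < T / N%:R by rewrite divr_gt0.
split; first by rewrite mulr_ge0// ltW.
  by rewrite ltr_pM2r// ltr_nat.
by rewrite mulrA ler_pdivrMr// mulrC ler_pM2l// ler_nat.
Qed.

Lemma block_osc_measurable n T N aa : 0 < T -> measurable (@block_osc n T N aa).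
Proof.
move=> T0; rewrite (_ : @block_osc n T N aa = \bigcup_(ji in [set: 'I_N * 'I_d])
    osc (Z n) ji.2 (ji.1%:R * (T / N%:R)) (ji.1.+1%:R * (T / N%:R)) aa); last first.
  by apply/seteqP; split=> w /= => [[ji h]|[ji _ h]]; exists ji.
apply: fin_bigcup_measurable => // ji _.
by have [h1 h2 h3] := block_pos ji.1 T0; exact: (osc_measurable (sys n)).
Qed.

(** The leading term for a block of length T/N is of order 1/N^2 by the two-stage inequality, and
    the other errors are at most 1/N^2 for large n. With N d pairs of a block and a coordinate the
    total is at most d M / N. The number N is fixed before n. *)
Lemma osc_good_small T r aa eta : 0 < T -> 0 < r -> 0 < aa -> 0 < eta ->
  exists N : nat, (0 < N)%N /\ \forall n \near \oo,
    prb (P n) (@block_osc n T N aa `&` gd n r T) <= eta.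
Proof.
move=> T0 r0 aa0 eta0.
have K0 := ceiling_ge0 T0.
pose M := 16 / aa ^+ 2 + 4 / aa ^+ 2 * ((C * T * (C * T + 1)) / aa ^+ 2 + 1).
have M0 : 0 < M.
  rewrite addr_gt0 ?divr_gt0 ?exprn_gt0// mulr_gt0 ?divr_gt0 ?exprn_gt0//.
  by rewrite ltr_wpDl// divr_ge0 ?sqr_ge0// !mulr_ge0 ?addr_ge0 ?mulr_ge0// ltW.
pose N := (Num.truncn (d%:R * M / eta)).+1.
have NM : d%:R * M <= eta * N%:R.
  by rewrite [leRHS]mulrC -ler_pdivrMr//; exact: ltW (truncnS_gt _).
exists N; split=> //.
have N0 : 0 < N%:R :> R by rewrite ltr0n.
(* The target size of the errors that vanish with n. In the mean of [xi], each of the three terms 2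
   (th / 8), the gap term and the overshoot is at most th / 4. *)
pose th : R := (N%:R ^+ 2)^-1.
have th0 : 0 < th by rewrite invr_gt0 exprn_gt0.
have th4 : 0 < th / 4 by rewrite divr_gt0.
have thK : 0 < th / 4 / (ceiling T + 1) by rewrite divr_gt0// ltr_wpDl.
have th8 : 0 < th / 8 by rewrite divr_gt0.
apply: (filterS2 _ _ (filterI (Z_jump_le T0 r0 th0) (A_jump_le T0 r0 th0)) (filterI (overshoot_A_small T0 r0 th4) (gap_small_prb T0 r0 th8 thK))).
move=> n [hZ hA] [hJ hG].
have s := sys n.
have Exi i : expct (P n) (xi (Z n) (A n) a r (ceiling T) T i (th / 8)) <= th.
  rewrite (xi_expct s aC a_continuous K0 (ltW T0) (A_jump_finite hA)).
  have [_ h1] := hJ i; have h2 := hG (i, i).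
  have h3 : ceiling T * prb (P n) (gap n r T i i (th / 8)) <= th / 4.
    apply: (@le_trans _ _ ((ceiling T + 1) * (th / 4 / (ceiling T + 1)))).
      by apply: ler_pM => //; [exact: prb_ge0|rewrite lerDl].
    by rewrite mulrC divfK// gt_eqF// ltr_wpDl.
  by move: h1 h3 th0; lra.
have Exi0 i : 0 <= expct (P n) (xi (Z n) (A n) a r (ceiling T) T i (th / 8)).
  by apply: expct_ge0 => w; apply: xi_ge0 => //; rewrite ltW.
pose h := T / N%:R.
have h0 : 0 < h by rewrite divr_gt0.
have hN : N%:R * h = T by rewrite /h mulrC divfK// gt_eqF.
have hT : h <= T by rewrite /h ler_pdivrMr// ler_peMr ?(ltW T0)// ler1n.
have th1 : th <= 1 by rewrite invf_le1 ?exprn_gt0// exprn_ege1// ler1n.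
have one (ji : 'I_N * 'I_d) : prb (P n) (osc (Z n) ji.2 (ji.1%:R * (T / N%:R)) (ji.1.+1%:R * (T / N%:R)) aa `&` gd n r T) <= th * M.
  have [b1 b2 b3] := @block_pos T N ji.1 T0.
  have eps0 : 0 <= th / 8 by rewrite ltW.
  have := osc_bound s aC C0 a_continuous (ltW r0) K0 (ltW T0) hZ (A_jump_finite hA) ji.2 b1 b2 b3 aa0 eps0.
  move=> H; apply: (le_trans H); rewrite /block_bound.
  have -> : ji.1.+1%:R * (T / N%:R) - ji.1%:R * (T / N%:R) = h by rewrite -mulrBl -natr1 addrAC subrr add0r mul1r.
  set E := expct _ _; have E1 : E <= th by exact: Exi.
  have E0 : 0 <= E by exact: Exi0.
  have aa2 : 0 < aa ^+ 2 by rewrite exprn_gt0.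
  have key : C * h * ((C * h + E) / aa ^+ 2) <= th * (C * T * (C * T + 1) / aa ^+ 2).
    have -> : C * h * ((C * h + E) / aa ^+ 2) = (C * h * (C * h + E)) / aa ^+ 2 by rewrite mulrA.
    rewrite mulrA ler_pM2r ?invr_gt0//.
    have hth : h = T * N%:R * th by rewrite /h /th; field; rewrite gt_eqF.
    have Ch0 : 0 <= C * h by rewrite mulr_ge0// ltW.
    have h2 : C * h * (C * h) = th * (C * T * (C * T)).
      by rewrite /h /th; field; rewrite gt_eqF.
    have h3 : C * h * E <= th * (C * T).
      rewrite mulrC; apply: ler_pM => //; by rewrite ler_wpM2l.
    by rewrite !mulrDr mulr1 h2 lerD2l mulrA [X in _ <= X](_ : _ = th * (C * T))//; rewrite ?mulrA.
  rewrite /M [th * (_ + _)]mulrDr; apply: lerD; first by rewrite mulrC ler_wpM2r// divr_ge0// ltW.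
  rewrite [leRHS]mulrCA ler_wpM2l ?divr_ge0 ?(ltW aa2)// mulrDr mulr1.
  exact: lerD.
have mO (ji : 'I_N * 'I_d) : measurable (osc (Z n) ji.2 (ji.1%:R * (T / N%:R)) (ji.1.+1%:R * (T / N%:R)) aa `&` gd n r T).
  have [b1 b2 b3] := @block_pos T N ji.1 T0.
  apply: measurableI; last exact: good_meas.
  exact: (osc_measurable s).
apply: (@le_trans _ _ (\sum_(ji : 'I_N * 'I_d) prb (P n) (osc (Z n) ji.2 (ji.1%:R * (T / N%:R)) (ji.1.+1%:R * (T / N%:R)) aa `&` gd n r T))).
  apply: prb_cover => //.
    by apply: measurableI; [exact: block_osc_measurable|exact: good_meas].
  by move=> w [[ji hj] gw]; exists ji.
apply: (@le_trans _ _ (\sum_(ji : 'I_N * 'I_d) th * M)); first by apply: ler_sum.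
rewrite sumr_const card_prod !card_ord -[leLHS]mulr_natr natrM.
have -> : th * M * (N%:R * d%:R) = d%:R * M / N%:R by rewrite /th; field; rewrite gt_eqF.
by rewrite ler_pdivrMr.
Qed.

Lemma osc_small T aa eta : 0 < T -> 0 < aa -> 0 < eta ->
  exists N : nat, (0 < N)%N /\ \forall n \near \oo, prb (P n) (@block_osc n T N aa) <= eta.
Proof.
move=> T0 aa0 eta0; have e20 : 0 < eta / 2 by rewrite divr_gt0.
have [r [r0 Hr]] := good_likely T0 e20.
have [N [N0 HN]] := osc_good_small T0 r0 aa0 e20.
exists N; split=> //; apply: filterS2 Hr HN => n h1 h2.
have mG := good_meas n r T0; have mO := @block_osc_measurable n T N aa T0.
rewrite [leRHS]splitr; apply: le_trans (lerD h2 h1).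
apply: le_trans (prbU (P n) (measurableI _ _ mO mG) (measurableC mG)).
apply: prb_le => //; first by apply: measurableU; [exact: measurableI|exact: measurableC].
by move=> w Ow; have [g|g] := pselect (gd n r T w); [left|right].
Qed.

End sequence.

(** * Test functions *)

Lemma row_norm_le (R : realType) n (v : 'rV[R]_n) c : 0 <= c -> (forall i, `|v 0 i| <= c) -> `|v| <= c.
Proof.
move=> c0 vc; rewrite [X in X <= _]mx_normrE; apply: (big_ind (fun x => x <= c)) => //.
  by move=> x y xc yc; rewrite ge_max xc.
by move=> [l i] _ /=; rewrite (ord1 l).
Qed.

Lemma row_norm_ge (R : realType) n (v : 'rV[R]_n) i : `|v 0 i| <= `|v|.
Proof. by rewrite [X in _ <= X]mx_normrE; exact: (le_bigmax _ (fun ij : 'I_1 * 'I_n => `|v ij.1 ij.2|) (0, i)). Qed.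

Section mean_value.
Context (R : realType).

Lemma mean_value_le (psi dpsi : R -> R) (h M : R) : (forall u : R, is_derive u (1 : R) psi (dpsi u)) ->
  (forall u, `|u| <= `|h| -> `|dpsi u| <= M) -> `|psi h - psi 0| <= M * `|h|.
Proof.
move=> dp hM; have cp (p q : R) : {within `[p, q], continuous psi}.
  by apply: derivable_within_continuous => u _; by case: (dp u).
have [h0|h0] := leP 0 h.
  have [c] := MVT_segment h0 (fun u _ => dp u) (cp 0 h).
  rewrite in_itv/= => /andP[c0 ch] ->; rewrite subr0 normrM ler_wpM2r// hM//.
  by rewrite !ger0_norm.
have [c] := MVT_segment (ltW h0) (fun u _ => dp u) (cp h 0).
rewrite in_itv/= => /andP[ch c0] E; rewrite distrC E sub0r normrM normrN ler_wpM2r// hM//.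
by rewrite !ler0_norm// ?lerN2// ltW.
Qed.

End mean_value.

Section taylor.
Context (R : realType) (d : nat).
Implicit Types (f g : 'rV[R]_d -> R) (y D : 'rV[R]_d) (s : seq 'I_d).
Notation e_ i := (delta_mx 0 i : 'rV[R]_d).

Lemma is_derive_line g i x : (forall z, derivable g z (e_ i)) ->
  forall u : R, is_derive u (1 : R) (fun u => g (x + u *: e_ i)) (partial i g (x + u *: e_ i)).
Proof.
move=> dg u; have E : (fun h : R => h^-1 *: (g (x + (h *: (1 : R) + u) *: e_ i) - g (x + u *: e_ i))) =
    (fun h : R => h^-1 *: (g (h *: e_ i + (x + u *: e_ i)) - g (x + u *: e_ i))).
  by apply/funext => h; congr (_ *: (g _ - _)); rewrite scalerDl /GRing.scale/= mulr1 addrCA.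
apply: DeriveDef; first by rewrite /derivable/= E; exact: dg.
by rewrite /partial /derive/= E.
Qed.

Lemma slope_bound g i x (h c om : R) : (forall z, derivable g z (e_ i)) ->
  (forall u, `|u| <= `|h| -> `|partial i g (x + u *: e_ i) - c| <= om) ->
  `|g (x + h *: e_ i) - g x - c * h| <= om * `|h|.
Proof.
move=> dg gc.
have := @mean_value_le R (fun u => g (x + u *: e_ i) - c * u) (fun u => partial i g (x + u *: e_ i) - c) h om.
rewrite scale0r addr0 mulr0 subr0 [_ - c * h - _]addrAC; apply => // u.
apply: is_deriveB; first exact: is_derive_line.
by apply: (is_derive_eq (is_deriveZ c (is_derive_id u (1:R)))); rewrite /= /GRing.scale/= mulr1.
Qed.

Lemma curvature_bound f i x (h q om : R) : (forall z, derivable f z (e_ i)) ->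
  (forall z, derivable (partial i f) z (e_ i)) ->
  (forall u, `|u| <= `|h| -> `|partial i (partial i f) (x + u *: e_ i) - q| <= om) ->
  `|f (x + h *: e_ i) - f x - partial i f x * h - q / 2 * h ^+ 2| <= om * h ^+ 2.
Proof.
move=> df ddf fq; rewrite -[h ^+ 2 in leRHS]real_normK ?num_real//.
have -> : om * `|h| ^+ 2 = om * `|h| * `|h| by rewrite expr2 mulrA.
have := @mean_value_le R (fun u => f (x + u *: e_ i) - (partial i f x * u + q / 2 * u ^+ 2))
  (fun u => partial i f (x + u *: e_ i) - (partial i f x + q * u)) h (om * `|h|).
rewrite scale0r addr0 mulr0 expr0n/= mulr0 addr0 subr0.
rewrite (_ : _ - _ - f x = f (x + h *: e_ i) - f x - partial i f x * h - q / 2 * h ^+ 2); last by ring.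
apply=> [u|u uh].
  apply: is_deriveB; first exact: is_derive_line.
  apply: is_deriveD.
    by apply: (is_derive_eq (is_deriveZ (partial i f x) (is_derive_id u (1:R)))); rewrite /= /GRing.scale/= mulr1.
  apply: (is_derive_eq (is_deriveZ (q / 2) (is_deriveX 2 (is_derive_id u (1:R))))).
  by rewrite /= /GRing.scale/= mulr1 expr1; field.
have := @slope_bound (partial i f) i x u q om ddf (fun v vu => fq v (le_trans vu uh)).
rewrite opprD addrA => H; apply: (le_trans H).
by rewrite ler_wpM2l//; apply: le_trans (fq 0 _); rewrite ?normr0.
Qed.

Section box.
Context (f : 'rV[R]_d -> R) (y D : 'rV[R]_d) (q : 'I_d -> 'I_d -> R) (om : R).
Hypotheses (df : forall i z, derivable f z (e_ i))
  (ddf : forall i l z, derivable (partial i f) z (e_ l))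
  (fq : forall z : 'rV[R]_d, (forall l, `|z 0 l - y 0 l| <= `|D 0 l|) ->
    forall l i, `|partial l (partial i f) z - q l i| <= om).

Let move s : 'rV[R]_d := \row_l (y 0 l + (l \in s)%:R * D 0 l).

Let move0 : move [::] = y.
Proof. by apply/rowP => l; rewrite mxE mul0r addr0. Qed.

Let move_cons i s : i \notin s -> move (i :: s) = move s + D 0 i *: e_ i.
Proof.
move=> nis; apply/rowP => l; rewrite !mxE !in_cons eqxx/= -addrA; congr (_ + _).
have [->|li] := eqVneq l i; first by rewrite (negbTE nis) mul0r add0r mul1r mulr1.
by rewrite mulr0 addr0.
Qed.

Let move_box i s (u : R) : i \notin s -> `|u| <= `|D 0 i| ->
  forall l, `|(move s + u *: e_ i) 0 l - y 0 l| <= `|D 0 l|.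
Proof.
move=> nis uD l; rewrite !mxE eqxx/=.
rewrite (_ : _ - y 0 l = (l \in s)%:R * D 0 l + u * (l == i)%:R); last by ring.
have [->|li] := eqVneq l i; first by rewrite (negbTE nis) mul0r add0r mulr1.
by rewrite mulr0 addr0; case: (l \in s); rewrite ?mul1r// mul0r normr0.
Qed.

Let move_slope i s : uniq s ->
  `|partial i f (move s) - partial i f y - \sum_(l <- s) q l i * D 0 l| <= om * \sum_(l <- s) `|D 0 l|.
Proof.
elim: s => [|l s IH]; first by rewrite move0 !big_nil subrr subr0 normr0 mulr0.
move=> /= /andP[nls us]; rewrite !big_cons move_cons//.
have := @slope_bound (partial i f) l (move s) (D 0 l) (q l i) om (@ddf i l) (fun u uD => fq (move_box nls uD) l i).
move: (IH us); set a1 := partial i f _; set a2 := partial i f _; set a3 := partial i f _.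
set S := \sum_(_ <- _) _; set S' := \sum_(_ <- _) _ => h1 h2.
rewrite (_ : a3 - a2 - (q l i * D 0 l + S) = (a3 - a1 - q l i * D 0 l) + (a1 - a2 - S)); last by ring.
by apply: le_trans (ler_normD _ _) _; rewrite mulrDr lerD.
Qed.

(* The list is visited from its end, so the mixed derivative of a pair is
   taken in the order opposite to that of the list. *)
Let Fixpoint cross s : R := if s is i :: s' then (\sum_(l <- s') q l i * D 0 l) * D 0 i + cross s' else 0.

Let cross_rcons s i : cross (rcons s i) = cross s + D 0 i * \sum_(l <- s) q i l * D 0 l.
Proof.
elim: s => [|l s IH] /=; first by rewrite !big_nil mul0r mulr0 addr0.
by rewrite IH -cats1 big_cat big_seq1 big_cons /=; ring.
Qed.

(** Each pair of distinct positions occurs once in s and once in its reverse, in opposite orders;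
    together with the diagonal this fills the square array. *)
Let cross_rev s : cross s + cross (rev s) + \sum_(i <- s) q i i * D 0 i ^+ 2 =
  \sum_(i <- s) \sum_(l <- s) q i l * D 0 i * D 0 l.
Proof.
elim: s => [|i s IH]; first by rewrite !big_nil /= !addr0.
rewrite rev_cons cross_rcons /= !big_cons.
under [X in _ = _ + X]eq_bigr do rewrite big_cons.
rewrite big_split /= -IH.
have -> : \sum_(l <- rev s) q i l * D 0 l = \sum_(l <- s) q i l * D 0 l.
  by apply: perm_big; rewrite perm_rev.
have -> : \sum_(l <- s) q l i * D 0 l * D 0 i = (\sum_(l <- s) q l i * D 0 l) * D 0 i by rewrite mulr_suml.
have -> : \sum_(l <- s) q i l * D 0 i * D 0 l = D 0 i * \sum_(l <- s) q i l * D 0 l.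
  by rewrite mulr_sumr; apply: eq_bigr => l _; ring.
ring.
Qed.

Let move_taylor s : uniq s ->
  `|f (move s) - f y - \sum_(i <- s) partial i f y * D 0 i - 2^-1 * (\sum_(i <- s) q i i * D 0 i ^+ 2)
      - cross s| <= om * (\sum_(l <- s) `|D 0 l|) ^+ 2.
Proof.
elim: s => [|i s IH].
  by move=> _; rewrite move0 !big_nil /= mulr0 !subr0 subrr normr0 expr0n mulr0.
move=> /= /andP[nis us]; rewrite !big_cons move_cons//.
have h1 := @curvature_bound f i (move s) (D 0 i) (q i i) om (@df i) (@ddf i i) (fun u uD => fq (move_box nis uD) i i).
have h2 := move_slope i us.
have om0 : 0 <= om.
  have bx l : `|y 0 l - y 0 l| <= `|D 0 l| by rewrite subrr normr0.
  exact: le_trans (fq bx i i).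
move: (IH us) h1 h2; set f1 := f _; set f2 := f _; set f3 := f _.
set p1 := partial i f _; set p2 := partial i f y.
set S1 := \sum_(_ <- _) _; set S2 := \sum_(_ <- _) _; set S3 := \sum_(_ <- _) _; set S4 := \sum_(_ <- _) _.
move=> h0 h1 h2.
have S30 : 0 <= S3 by rewrite sumr_ge0.
rewrite (_ : _ - _ = (f1 - f2 - S1 - 2^-1 * S2 - cross s) + (f3 - f1 - p1 * D 0 i - q i i / 2 * D 0 i ^+ 2)
   + (p1 - p2 - S4) * D 0 i); last by field.
apply: le_trans (ler_normD _ _) _; rewrite normrM.
apply: (@le_trans _ _ (om * S3 ^+ 2 + om * D 0 i ^+ 2 + om * S3 * `|D 0 i|)).
  apply: lerD; last by rewrite ler_wpM2r.
  by apply: le_trans (ler_normD _ _) _; exact: lerD.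
rewrite -[D 0 i ^+ 2]real_normK ?num_real//.
have : 0 <= om * S3 * `|D 0 i| by rewrite !mulr_ge0.
by rewrite sqrrD -mulr_natl !mulrDr; set u := om * S3 * _; rewrite (_ : om * (2%:R * (`|D 0 i| * S3)) = 2 * u); [lra|rewrite /u; ring].
Qed.

Let move_all s : s =i predT -> move s = y + D.
Proof. by move=> sT; apply/rowP => l; rewrite !mxE sT mul1r. Qed.

(** Moving one coordinate after the other takes each mixed derivative in one order only. The mean of
    the expansions along a list of the coordinates and along its reverse contains both orders with
    equal weight. The factor d bounds the square of the l1 norm by the squared Euclidean norm. *)
Lemma taylor_box : `|f (y + D) - f y - \sum_i partial i f y * D 0 i
    - 2^-1 * (\sum_i \sum_l q i l * D 0 i * D 0 l)| <= om * (d%:R * \sum_i D 0 i ^+ 2).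
Proof.
have U := index_enum_uniq 'I_d.
have UR : uniq (rev (index_enum 'I_d)) by rewrite rev_uniq.
have := move_taylor U; have := move_taylor UR.
rewrite !move_all; [|by move=> l; rewrite mem_index_enum|by move=> l; rewrite mem_rev mem_index_enum].
have rv (G : 'I_d -> R) : \sum_(i <- rev (index_enum 'I_d)) G i = \sum_i G i.
  by apply: perm_big; rewrite perm_rev.
rewrite !rv -(cross_rev (index_enum 'I_d)).
set S1 := \sum_i partial _ _ _ * _; set S2 := \sum_i q _ _ * _; set S3 := \sum_i `|_|.
set c1 := cross _; set c2 := cross _ => h1 h2.
(* For d = 0 nothing forces om to be nonnegative, but then all sums are empty. *)
have om0 : 0 <= om \/ S3 = 0.
  case: (posnP d) => [d0|d0].
    by right; rewrite /S3 big1// => i; exfalso; have := ltn_ord i; rewrite [X in (_ < X)%N]d0.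
  left; have bx l : `|y 0 l - y 0 l| <= `|D 0 l| by rewrite subrr normr0.
  exact: le_trans (fq bx (Ordinal d0) (Ordinal d0)).
apply: (@le_trans _ _ (om * S3 ^+ 2)).
  rewrite (_ : _ - _ = 2^-1 * ((f (y + D) - f y - S1 - 2^-1 * S2 - c1) + (f (y + D) - f y - S1 - 2^-1 * S2 - c2))); last by field.
  rewrite normrM ger0_norm ?invr_ge0// mulrC ler_pdivrMr// mulr_natr mulr2n.
  by apply: le_trans (ler_normD _ _) _; exact: lerD.
case: om0 => [om0|S0]; last first.
  have D0 i : D 0 i = 0.
    apply/normr0_eq0/eqP; move/eqP: S0; rewrite psumr_eq0// => /allP/(_ i); apply.
    by rewrite mem_index_enum.
  rewrite S0 expr0n/= mulr0 big1 ?mulr0// => i _; by rewrite D0 expr0n.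
rewrite ler_wpM2l// expr2 /S3 mulr_suml.
under eq_bigr do rewrite mulr_sumr.
have le2 i j : `|D 0 i| * `|D 0 j| <= 2^-1 * D 0 i ^+ 2 + 2^-1 * D 0 j ^+ 2.
  rewrite -[D 0 i ^+ 2]real_normK ?num_real// -[D 0 j ^+ 2]real_normK ?num_real//.
  have := sqr_ge0 (`|D 0 i| - `|D 0 j|); rewrite sqrrB -mulr_natl; lra.
apply: (@le_trans _ _ (\sum_(i < d) \sum_(j < d) (2^-1 * D 0 i ^+ 2 + 2^-1 * D 0 j ^+ 2))).
  by apply: ler_sum => i _; apply: ler_sum => j _.
under eq_bigr do rewrite big_split /= sumr_const card_ord -mulr_sumr.
rewrite big_split /= sumr_const card_ord -[X in _ + X <= _]mulr_natl.
set S := \sum_(_ < _) D 0 _ ^+ 2.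
have -> : \sum_(i < d) (2^-1 * D 0 i ^+ 2 *+ d) = d%:R * (2^-1 * S).
  by rewrite /S !mulr_sumr; apply: eq_bigr => i _; rewrite mulr_natl.
by have -> : d%:R * (2^-1 * S) + d%:R * (2^-1 * S) = d%:R * S by field.
Qed.

End box.

End taylor.

(** * Smooth functions with compact support *)

Section compact_support.
Context (R : realType) (d : nat).

Lemma partial_off (K : set 'rV[R]_d) (g : 'rV[R]_d -> R) i : closed K ->
  (forall x, ~ K x -> g x = 0) -> forall x, ~ K x -> partial i g x = 0.
Proof.
move=> cK g0 x nKx; rewrite /partial.
have oK : open (~` K) by exact: closed_openC.
have nx : \forall z \near x, g z = (cst 0 : _ -> R) z.
  by apply: filterS (open_nbhs_nbhs (conj oK nKx)) => z; exact: g0.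
have H : is_derive x (delta_mx 0 i : 'rV[R]_d) g 0.
  apply: near_eq_is_derive (is_derive_cst 0 x _).
  by apply: filterS nx => z ->.
exact: derive_val.
Qed.

Lemma compact_vanish_bounded (K : set 'rV[R]_d) (g : 'rV[R]_d -> R) : compact K -> continuous g ->
  (forall x, ~ K x -> g x = 0) -> exists2 c, 0 <= c & forall x, `|g x| <= c.
Proof.
move=> cK cg g0; have cgK : compact (g @` K).
  by apply: continuous_compact => //; exact: continuous_subspaceT.
have [M [Mr HM]] := compact_bounded cgK.
exists (`|M| + 1); first by rewrite addr_ge0.
move=> x; have [Kx|nKx] := pselect (K x); last by rewrite g0// normr0 addr_ge0.
by apply: HM; [rewrite (le_lt_trans (ler_norm M))// ltrDl|exists x].
Qed.

Lemma compact_vanish_uniform (K : set 'rV[R]_d) (g : 'rV[R]_d -> R) e : compact K -> continuous g ->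
  (forall x, ~ K x -> g x = 0) -> 0 < e ->
  exists2 del : R, 0 < del & forall x y : 'rV[R]_d, (forall i, `|x 0 i - y 0 i| <= del) -> `|g x - g y| <= e.
Proof.
move=> cK cg g0 e0; have [del del0 H] := heine cK cg e0.
have H' (x y : 'rV[R]_d) : K x -> (forall i, `|x 0 i - y 0 i| <= del / 2) -> `|g x - g y| <= e.
  move=> Kx xy; rewrite distrC; apply/ltW/H => //; apply: (@le_lt_trans _ _ (del / 2)).
    by apply: row_norm_le => [|i]; [rewrite divr_ge0// ltW|rewrite !mxE distrC].
  by rewrite ltr_pdivrMr// ltr_pMr// ltr1n.
exists (del / 2); first by rewrite divr_gt0.
move=> x y xy; have [Kx|nKx] := pselect (K x); first exact: H'.
have [Ky|nKy] := pselect (K y); last by rewrite !g0// subrr normr0 ltW.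
by rewrite distrC; apply: H' => // i; rewrite distrC.
Qed.

End compact_support.

Lemma continuous_sum_at (R : realType) (V : topologicalType) (m : nat) (F : 'I_m -> V -> R) (x : V) :
  (forall i, {for x, continuous (F i)}) -> {for x, continuous (fun y => \sum_(i < m) F i y)}.
Proof.
move=> cF; apply: (@cvg_big R _ _ _ _ _ _ (nbhs x)) => [|i _]; first exact: add_continuous.
exact: cF.
Qed.

Section test_functions.
Context (R : realType) (d : nat) (f : 'rV[R]_d -> R) (fs : smooth f) (fc : compactly_supported f).
Let K := closure [set x | f x != 0].

Let f_off x : ~ K x -> f x = 0.
Proof. by move=> nK; apply/eqP; apply: contra_notT nK => fx; exact: subset_closure. Qed.

Lemma iter_partial_off s x : ~ K x -> iter_partial s f x = 0.
Proof.
elim: s x => [|i s IH] x; first exact: f_off.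
by apply: (@partial_off R d K) => //; exact: closed_closure.
Qed.

Lemma iter_partial_continuous s : continuous (iter_partial s f).
Proof. by have [] := fs s. Qed.

Lemma iter_partial_bounded s : exists2 c, 0 <= c & forall x, `|iter_partial s f x| <= c.
Proof. exact: compact_vanish_bounded fc (@iter_partial_continuous s) (@iter_partial_off s). Qed.

Lemma iter_partial_uniform s e : 0 < e ->
  exists2 del : R, 0 < del & forall x y : 'rV[R]_d, (forall i, `|x 0 i - y 0 i| <= del) ->
    `|iter_partial s f x - iter_partial s f y| <= e.
Proof. exact: compact_vanish_uniform fc (@iter_partial_continuous s) (@iter_partial_off s). Qed.

Lemma second_partial_bounded : exists2 c, 0 <= c & forall i j x, `|partial i (partial j f) x| <= c.
Proof.
have /choice[c cP] : forall ij : 'I_d * 'I_d, exists c : R, forall x, `|partial ij.1 (partial ij.2 f) x| <= c.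
  move=> ij.
  by have [c _ h] := iter_partial_bounded [:: ij.1; ij.2]; exists c.
exists (\sum_ij `|c ij|); first by rewrite sumr_ge0.
move=> i j x; apply: le_trans (cP (i, j) x) _; apply: le_trans (ler_norm _) _.
by rewrite (bigD1 (i, j))//= lerDl sumr_ge0.
Qed.

Lemma second_partial_uniform e : 0 < e ->
  exists2 del : R, 0 < del & forall x y : 'rV[R]_d, (forall i, `|x 0 i - y 0 i| <= del) ->
    forall i j, `|partial i (partial j f) x - partial i (partial j f) y| <= e.
Proof.
move=> e0; pose p (ij : 'I_d * 'I_d) := partial ij.1 (partial ij.2 f).
have /choice[c cP] : forall ij : 'I_d * 'I_d, exists c : R, 0 < c /\
    forall x y : 'rV[R]_d, (forall i, `|x 0 i - y 0 i| <= c) -> `|p ij x - p ij y| <= e.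
  move=> ij.
  by have [c c0 h] := iter_partial_uniform [:: ij.1; ij.2] e0; exists c.
exists (\big[Num.min/1]_ij c ij).
  by apply: (big_ind (fun x => 0 < x)) => // [x y x0 y0|ij _]; [rewrite lt_min x0|exact: (cP ij).1].
move=> x y xy i j; apply: (cP (i, j)).2 => l; apply: (le_trans (xy l)).
exact: bigmin_le_cond.
Qed.

Lemma taylor_expansion (y D : 'rV[R]_d) om :
  (forall z : 'rV[R]_d, (forall l, `|z 0 l - y 0 l| <= `|D 0 l|) ->
    forall i j, `|partial i (partial j f) z - partial i (partial j f) y| <= om) ->
  `|f (y + D) - f y - \sum_i partial i f y * D 0 i
    - 2^-1 * (\sum_i \sum_j partial i (partial j f) y * D 0 i * D 0 j)| <= om * (d%:R * \sum_i D 0 i ^+ 2).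
Proof.
move=> H; apply: (@taylor_box R d f y D (fun i j => partial i (partial j f) y) om) => //.
- by move=> i z; exact: (fs [::]).2.
- by move=> i j z; exact: (fs [:: i]).2.
Qed.

Lemma generator_bound (a : 'rV[R]_d -> 'M[R]_d) C : (forall x i j, `|a x i j| <= C) -> 0 <= C ->
  exists2 c, 0 <= c & forall x, `|generator a f x| <= c.
Proof.
move=> aC C0; have [c c0 fc2] := second_partial_bounded.
exists (2^-1 * \sum_(i < d) \sum_(j < d) C * c).
  by rewrite mulr_ge0 ?invr_ge0//; apply: sumr_ge0 => i _; apply: sumr_ge0 => j _; exact: mulr_ge0.
move=> x; rewrite normrM [X in X * _]ger0_norm ?invr_ge0// ler_wpM2l ?invr_ge0//.
apply: ler_norm_sumr => i.
apply: ler_norm_sumr => j.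
by rewrite normrM ler_pM.
Qed.

Lemma generator_off_zero (a : 'rV[R]_d -> 'M[R]_d) : (forall x, x != 0 -> {for x, continuous a}) ->
  forall x, x != 0 -> {for x, continuous (generator a f)}.
Proof.
move=> ac x x0; apply: (@continuousM R _ (fun=> 2^-1) (fun x => \sum_(i < d) \sum_(j < d) a x i j * partial i (partial j f) x) x).
  exact: cst_continuous.
apply: continuous_sum_at => i; apply: continuous_sum_at => j.
apply: (@continuousM R _ (fun x => a x i j) (fun x => partial i (partial j f) x) x); last exact: (fs [:: i; j]).1.
apply: (@continuous_comp _ _ _ a (fun M : 'M[R]_d => M i j) x); first exact: ac.
exact: coord_continuous.
Qed.

End test_functions.

(** * The discrete Ito formula *)

Lemma telescope_ord (V : zmodType) (g : nat -> V) n : \sum_(k < n) (g k.+1 - g k) = g n - g 0%N.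
Proof. by rewrite -(big_mkord xpredT (fun k => g k.+1 - g k)) telescope_sumr. Qed.

Lemma sum_const2 (R : pzRingType) (m : nat) (x : R) : \sum_(i < m) \sum_(j < m) x = m%:R ^+ 2 * x.
Proof. by rewrite !sumr_const !card_ord -mulrnA mulnn -[LHS]mulr_natl natrX. Qed.

Section discrete_ito.
Context (R : realType) (dd : measure_display) (Om : measurableType dd) (P : probability Om R)
  (F : R -> set (set Om)) (Ffil : filtration F) (d : nat).
Notation GT t := (g_sigma_algebraType (F t)).
Context (u : nat -> R) (u0 : forall k, 0 <= u k) (uS : forall k, u k <= u k.+1)
  (V : nat -> Om -> 'rV[R]_d) (B : 'I_d -> 'I_d -> nat -> Om -> R) (q : Om -> R).
Hypotheses (V_GT : forall (g : 'rV[R]_d -> R) k, continuous g -> measurable_fun [set: GT (u k)] (fun w => g (V k w)))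
  (stopped_A_intg : forall i j k, intg P (B i j k))
  (q_intg : intg P q) (Vq : forall k w, \sum_i V k w 0 i ^+ 2 <= q w)
  (V_mart : forall i k E, F (u k) E -> expct P (fun w => \1_E w * (V k.+1 w 0 i - V k w 0 i)) = 0)
  (VV_mart : forall i j k E, F (u k) E -> expct P (fun w => \1_E w *
     (V k.+1 w 0 i * V k.+1 w 0 j - V k w 0 i * V k w 0 j - (B i j k.+1 w - B i j k w))) = 0).
Context (f : 'rV[R]_d -> R) (fs : smooth f) (fc : compactly_supported f) (c2 b om : R).
Hypotheses (om0 : 0 <= om) (c20 : 0 <= c2) (fc2 : forall i j x, `|partial i (partial j f) x| <= c2)
  (fom : forall x y : 'rV[R]_d, (forall i, `|x 0 i - y 0 i| <= b) ->
    forall i j, `|partial i (partial j f) x - partial i (partial j f) y| <= om).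

Definition increment k w : 'rV[R]_d := V k.+1 w - V k w.
Notation D := increment.

(** Decided at time u k, since only the increments before step k enter; increment k itself may still
    be large. *)
Definition tame k : set Om := [set w | forall j, (j < k)%N -> forall i, `|D j w 0 i| <= b].

(** Differs from [remainder] by martingale differences: the first-order term, and the second-order
    term with products of increments compensated by increments of B. *)
Definition ito_defect k w : R := f (V k.+1 w) - f (V k w)
  - 2^-1 * \sum_i \sum_j partial i (partial j f) (V k w) * (B i j k.+1 w - B i j k w).

Definition remainder k w : R := f (V k.+1 w) - f (V k w) - \sum_i partial i f (V k w) * D k w 0 i
  - 2^-1 * \sum_i \sum_j partial i (partial j f) (V k w) * D k w 0 i * D k w 0 j.

Let q_ge0 w : 0 <= q w.
Proof. by apply: le_trans (Vq 0 w); rewrite sumr_ge0// => i _; exact: sqr_ge0. Qed.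

Let V_sqr k i w : V k w 0 i ^+ 2 <= q w.
Proof.
by apply: le_trans (Vq k w); rewrite (bigD1 i)//= lerDl sumr_ge0// => j _; exact: sqr_ge0.
Qed.

Let D_sqr k w : \sum_i D k w 0 i ^+ 2 <= 4 * q w.
Proof.
have h1 := Vq k w; have h2 := Vq k.+1 w.
apply: (@le_trans _ _ (2 * (\sum_i V k.+1 w 0 i ^+ 2) + 2 * (\sum_i V k w 0 i ^+ 2))); last by lra.
rewrite !mulr_sumr -big_split /=; apply: ler_sum => i _; rewrite !mxE.
rewrite -subr_ge0; have := sqr_ge0 (V k.+1 w 0 i + V k w 0 i).
by congr (_ <= _); ring.
Qed.

Let D_sqr1 k i w : D k w 0 i ^+ 2 <= 4 * q w.
Proof.
by apply: le_trans (D_sqr k w); rewrite (bigD1 i)//= lerDl sumr_ge0// => j _; exact: sqr_ge0.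
Qed.

Let GT_mfun k (h : Om -> R) : measurable_fun [set: GT (u k)] h -> mfun h.
Proof. by move=> mh; apply: (mfun_sub (filtration_sub Ffil (u0 k))). Qed.

Let GT_mono k l (h : Om -> R) : (k <= l)%N -> measurable_fun [set: GT (u k)] h -> measurable_fun [set: GT (u l)] h.
Proof.
move=> kl mh _ C mC; have := mh measurableT C mC; rewrite !setTI /measurable/= !filtration_id//.
apply: (filtration_le Ffil) => //.
by apply: (homo_leq (r := fun x y => x <= y) _ _ uS) => // x y z; exact: le_trans.
Qed.

Let coordV_GT k i : measurable_fun [set: GT (u k)] (fun w => V k w 0 i).
Proof. exact: (@V_GT (fun x => x 0 i) k (@coord_continuous _ _ _ 0 i)). Qed.

Let fV_mfun k (g : 'rV[R]_d -> R) : continuous g -> mfun (fun w => g (V k w)).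
Proof. by move=> cg; exact: (@GT_mfun k _ (@V_GT g k cg)). Qed.

Let DE k i w : D k w 0 i = V k.+1 w 0 i - V k w 0 i.
Proof. by rewrite !mxE. Qed.

Let D_GT k i : measurable_fun [set: GT (u k.+1)] (fun w => D k w 0 i).
Proof.
under eq_fun do rewrite DE; apply: measurable_funB => //.
exact: (@GT_mono k _ _ (leqnSn k) (@coordV_GT k i)).
Qed.

Let D_mfun k i : mfun (fun w => D k w 0 i).
Proof. exact: (@GT_mfun k.+1 _ (@D_GT k i)). Qed.

Let sqr_bnd (x c p : R) : 0 <= p -> x ^+ 2 <= c * p -> `|x| <= 1 + `|c| * p.
Proof.
move=> p0 xp; have h : x ^+ 2 <= `|c| * p by apply: (le_trans xp); rewrite ler_wpM2r// ler_norm.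
have : 0 <= (`|x| - 1) ^+ 2 by exact: sqr_ge0.
rewrite sqrrB1 real_normK ?num_real// -mulr_natl; have := normr_ge0 x; lra.
Qed.

Let D_intg k i : intg P (fun w => D k w 0 i).
Proof.
apply: (@intg_le _ _ _ _ _ (fun w => 1 + `|4 : R| * q w)); first exact: D_mfun.
  by apply: intgD; [exact: intg_cst|exact: intgZ].
by move=> w; apply: le_trans (ler_norm _); exact: sqr_bnd (D_sqr1 k i w).
Qed.

Let DD_intg k i j : intg P (fun w => D k w 0 i * D k w 0 j).
Proof. exact: (intg_mul_sqr (D_mfun k i) (D_mfun k j) q_intg (D_sqr1 k i) (D_sqr1 k j)). Qed.

Let VV_intg k l i j : intg P (fun w => V k w 0 i * V l w 0 j).
Proof.
by apply: (@intg_mul_sqr _ _ _ _ _ _ q 1 1) => //; try (by apply: (fV_mfun _ (g := fun x => x 0 _)); exact: coord_continuous);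
  move=> w; rewrite mul1r.
Qed.

Let D_mean k i (h : Om -> R) c : measurable_fun [set: GT (u k)] h -> (forall w, h w ^+ 2 <= c * q w) ->
  expct P (fun w => h w * D k w 0 i) = 0.
Proof.
move=> mh hq; apply: (@expct_mul_eq0 _ _ _ P (F (u k))).
- exact: filtration_sub.
- exact: D_intg.
- by move=> E; rewrite filtration_id// => FE; under eq_fun do rewrite DE; exact: V_mart.
- exact: mh.
- exact: (intg_mul_sqr (@GT_mfun k _ mh) (D_mfun k i) q_intg hq (D_sqr1 k i)).
Qed.

Let D_mean_bnd k i (h : Om -> R) c : measurable_fun [set: GT (u k)] h -> (forall w, `|h w| <= c) ->
  expct P (fun w => h w * D k w 0 i) = 0.
Proof.
move=> mh hc; apply: (@expct_mul_bnd_eq0 _ _ _ P (F (u k)) _ _ h c) => //.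
- exact: filtration_sub.
- by move=> E; rewrite filtration_id// => FE; under eq_fun do rewrite DE; exact: V_mart.
Qed.

Let dB k i j w := B i j k.+1 w - B i j k w.

Let dB_intg k i j : intg P (dB k i j).
Proof. exact: intgB. Qed.

Let DD_mean k i j E : F (u k) E -> expct P (fun w => \1_E w * (D k w 0 i * D k w 0 j - dB k i j w)) = 0.
Proof.
move=> FE; have mE : measurable E := filtration_meas Ffil (u0 k) FE.
have mEG : measurable_fun [set: GT (u k)] (\1_E : GT (u k) -> R).
  by apply: measurable_indic; rewrite /measurable/= filtration_id.
have pc i' j' : expct P (fun w => \1_E w * V k w 0 i' * D k w 0 j') = 0.
  apply: (@D_mean k j' (fun w => \1_E w * V k w 0 i') 1) => [|w]; first by apply: measurable_funM.
  by rewrite mul1r; apply: le_trans (V_sqr k i' w); exact: indic_mul_sqr_le.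
have V1 := VV_intg k.+1 k.+1 i j; have V0 := VV_intg k k i j.
have VD i' j' : intg P (fun w => \1_E w * V k w 0 i' * D k w 0 j').
  under eq_fun do rewrite -mulrA; apply: intg_mul1 => //.
  by under eq_fun do rewrite DE mulrBr; apply: intgB; exact: VV_intg.
transitivity (expct P (fun w => \1_E w * (V k.+1 w 0 i * V k.+1 w 0 j - V k w 0 i * V k w 0 j - dB k i j w)
   - (\1_E w * V k w 0 i * D k w 0 j + \1_E w * V k w 0 j * D k w 0 i))).
  by congr expct; apply/funext => w; rewrite !DE; ring.
rewrite expctB; last by exact: intgD.
  by rewrite VV_mart// expctD// !pc addr0 subr0.
by apply: intg_mul1 => //; apply: intgB => //; exact: intgB.
Qed.

Let DD_mean_bnd k i j (h : Om -> R) c : measurable_fun [set: GT (u k)] h -> (forall w, `|h w| <= c) ->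
  expct P (fun w => h w * (D k w 0 i * D k w 0 j - dB k i j w)) = 0.
Proof.
move=> mh hc; apply: (@expct_mul_bnd_eq0 _ _ _ P (F (u k)) _ _ h c) => //.
- exact: filtration_sub.
- exact: intgB.
- by move=> E; rewrite filtration_id// => FE; exact: DD_mean.
Qed.

Let tame_meas k l : (k <= l)%N -> @measurable _ (GT (u l)) (tame k).
Proof.
move=> kl; rewrite (_ : tame k = \bigcap_(j in `I_k) \bigcap_(i in [set: 'I_d]) [set w | `|D j w 0 i| <= b]).
  apply: fin_bigcap_measurable => // j /= jk; apply: fin_bigcap_measurable => // i _.
  apply: measurable_le_cst; apply: measurableT_comp => //.
  by apply: (@GT_mono j.+1); [exact: leq_trans kl|exact: D_GT].
by apply/seteqP; split=> w /= => [h j jk i _|h j jk i]; exact: h.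
Qed.

Lemma tame_measurable k : measurable (tame k).
Proof.
have := @tame_meas k k (leqnn k); rewrite {1}/measurable/= filtration_id//.
exact: (filtration_meas Ffil).
Qed.

Let tameS k w : tame k.+1 w -> tame k w.
Proof. by move=> h j jk; exact: h (ltnW jk). Qed.

Let remainder_le k w : `|remainder k w| <= 8 * c2 * d%:R * q w.
Proof.
have := @taylor_expansion R d f fs (V k w) (D k w) (2 * c2) _.
have -> : V k w + D k w = V k.+1 w by rewrite addrC subrK.
move=> H; apply: (le_trans (H _)).
  move=> z _ i j; apply: le_trans (ler_normB _ _) _.
  by rewrite mulr_natl mulr2n lerD.
have -> : 8 * c2 * d%:R * q w = 2 * c2 * (d%:R * (4 * q w)) by ring.
by rewrite ler_wpM2l ?mulr_ge0// ler_wpM2l//; exact: D_sqr.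
Qed.

Let remainder_small k w : tame k.+1 w -> `|remainder k w| <= om * d%:R * \sum_i D k w 0 i ^+ 2.
Proof.
move=> tw; have := @taylor_expansion R d f fs (V k w) (D k w) om _.
have -> : V k w + D k w = V k.+1 w by rewrite addrC subrK.
rewrite -mulrA; apply => z zD i j; apply: fom => l.
by apply: (le_trans (zD l)); exact: (tw k (ltnSn k)).
Qed.

(** The weights let through at most one increment beyond b, namely the first; its crude bound is
    charged to the complement of [tame N]. The factor 8 c2 d is the oscillation 2 c2 of the second
    derivatives, times d, times 4 from |D|^2 <= 4 q. *)
Let remainder_sum N w : \sum_(k < N) \1_(tame k) w * `|remainder k w| <=
  om * d%:R * (\sum_(k < N) \sum_i D k w 0 i ^+ 2) + 8 * c2 * d%:R * (\1_(~` tame N) w * q w).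
Proof.
have c0 : 0 <= 8 * c2 * d%:R by rewrite !mulr_ge0.
elim: N => [|N IH].
  by rewrite !big_ord0 mulr0 add0r !mulr_ge0// indicE.
have s0 : 0 <= \sum_i D N w 0 i ^+ 2 by apply: sumr_ge0 => i _; exact: sqr_ge0.
have od0 : 0 <= om * d%:R by rewrite mulr_ge0.
rewrite !big_ord_recr /= [om * _ * (_ + _)]mulrDr.
have [tN1|ntN1] := pselect (tame N.+1 w).
  have tN := tameS tN1; move: IH.
  rewrite !(indicF R (A := ~` tame _))//; try by apply.
  rewrite (indicT R tN) !mul0r !mulr0 !addr0 mul1r => IH; apply: lerD => //.
  exact: remainder_small.
rewrite (indicT R (A := ~` tame N.+1))// mul1r.
have [tN|ntN] := pselect (tame N w); last first.
  move: IH; rewrite (indicT R (A := ~` tame N))// mul1r (indicF R ntN) mul0r addr0 => IH.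
  by apply: (le_trans IH); rewrite lerD2r lerDl mulr_ge0.
move: IH; rewrite (indicF R (A := ~` tame N)); last by apply.
rewrite mul0r mulr0 addr0 (indicT R tN) mul1r => IH; apply: lerD; last exact: remainder_le.
by apply: (le_trans IH); rewrite lerDl mulr_ge0.
Qed.

Let first_mfun i : continuous (partial i f).
Proof. exact: (fs [:: i]).1. Qed.

Let second_mfun i j : continuous (partial i (partial j f)).
Proof. exact: (fs [:: i; j]).1. Qed.

Let f_mfun : continuous f.
Proof. exact: (fs [::]).1. Qed.

Context (E : set Om) (FE : F (u 0%N) E).
Let H k w : R := \1_E w * \1_(tame k) w.

Let H_GT k : measurable_fun [set: GT (u k)] (H k).
Proof.
apply: measurable_funM.
  apply: (@GT_mono 0%N k) => //; apply: measurable_indic.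
  by rewrite /measurable/= filtration_id.
by apply: measurable_indic; exact: tame_meas.
Qed.

Let H_norm k w : `|H k w| <= 1.
Proof. by rewrite normrM mulr_ile1// norm_indic_le1. Qed.

Let H_mul_bnd k (h : Om -> R) c : measurable_fun [set: GT (u k)] h -> (forall w, `|h w| <= c) ->
  measurable_fun [set: GT (u k)] (fun w => H k w * h w) /\ forall w, `|H k w * h w| <= c.
Proof.
move=> mh hc; split; first exact: measurable_funM.
by move=> w; rewrite normrM; apply: le_trans (hc w); rewrite ler_piMl.
Qed.

Let fd k w := f (V k.+1 w) - f (V k w).

Let fd_intg k : intg P (fd k).
Proof.
have [c c0 fb] := iter_partial_bounded fs fc [::].
by apply: intgB; apply: (@intg_bnd _ _ _ _ _ c); try (by move=> w; exact: fb); apply: fV_mfun; exact: (fs [::]).1.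
Qed.

Let first_bnd i : exists c, forall x, `|partial i f x| <= c.
Proof. by have [c _ h] := iter_partial_bounded fs fc [:: i]; exists c. Qed.

Let first_intg k i : intg P (fun w => partial i f (V k w) * D k w 0 i).
Proof. by have [c h] := first_bnd i; apply: (@intg_mulb _ _ _ _ _ _ c) => //; apply: fV_mfun. Qed.

Let second_DD_intg k i j : intg P (fun w => partial i (partial j f) (V k w) * D k w 0 i * D k w 0 j).
Proof.
under eq_fun do rewrite -mulrA.
by apply: (@intg_mulb _ _ _ _ _ _ c2) => //; exact: fV_mfun.
Qed.

Let second_B_intg k i j : intg P (fun w => partial i (partial j f) (V k w) * dB k i j w).
Proof. by apply: (@intg_mulb _ _ _ _ _ _ c2) => //; exact: fV_mfun. Qed.

Let H_intg k (h : Om -> R) : intg P h -> intg P (fun w => H k w * h w).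
Proof. by move=> ih; apply: (@intg_mulb _ _ _ _ _ _ 1) => //; exact: (@GT_mfun k _ (@H_GT k)). Qed.

Let defect_intg k : intg P (ito_defect k).
Proof.
apply: intgB; first exact: fd_intg.
by apply: intgZ; apply: (@intg_sum _ _ _ P 'I_d) => i; apply: (@intg_sum _ _ _ P 'I_d) => j; exact: second_B_intg.
Qed.

Let remainder_intg k : intg P (remainder k).
Proof.
apply: intgB.
  by apply: intgB; [exact: fd_intg|apply: (@intg_sum _ _ _ P 'I_d) => i; exact: first_intg].
by apply: intgZ; apply: (@intg_sum _ _ _ P 'I_d) => i; apply: (@intg_sum _ _ _ P 'I_d) => j; exact: second_DD_intg.
Qed.

Let defect_remainder k : expct P (fun w => H k w * ito_defect k w) = expct P (fun w => H k w * remainder k w).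
Proof.
pose G1 i w := H k w * partial i f (V k w) * D k w 0 i.
pose G2 i j w := H k w * partial i (partial j f) (V k w) * (D k w 0 i * D k w 0 j - dB k i j w).
have i1 i : intg P (G1 i).
  rewrite /G1; under eq_fun do rewrite -mulrA; apply: H_intg; exact: first_intg.
have i2 i j : intg P (G2 i j).
  rewrite /G2; under eq_fun do rewrite -mulrA; apply: H_intg.
  apply: (@intg_mulb _ _ _ _ _ _ c2) => //; first exact: fV_mfun.
  exact: intgB.
have e1 i : expct P (G1 i) = 0.
  have [c h] := first_bnd i.
  have [h1 h2] := @H_mul_bnd k (fun w => partial i f (V k w)) c (@V_GT _ k (@first_mfun i)) (fun w => h _).
  exact: D_mean_bnd h1 h2.
have e2 i j : expct P (G2 i j) = 0.
  have [h1 h2] := @H_mul_bnd k (fun w => partial i (partial j f) (V k w)) c2 (@V_GT _ k (@second_mfun i j)) (fun w => fc2 i j _).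
  exact: DD_mean_bnd h1 h2.
have s1 : intg P (fun w => \sum_i G1 i w) by apply: (@intg_sum _ _ _ P 'I_d) => i.
have s2 : intg P (fun w => \sum_i \sum_j G2 i j w).
  by apply: (@intg_sum _ _ _ P 'I_d) => i; apply: (@intg_sum _ _ _ P 'I_d) => j.
transitivity (expct P (fun w => H k w * remainder k w + (\sum_i G1 i w + 2^-1 * \sum_i \sum_j G2 i j w))).
  congr expct; apply/funext => w; rewrite /ito_defect /remainder.
  have -> : \sum_i G1 i w = H k w * \sum_i partial i f (V k w) * D k w 0 i.
    by rewrite mulr_sumr; apply: eq_bigr => i _; rewrite /G1 mulrA.
  have -> : \sum_i \sum_j G2 i j w = H k w * (\sum_i \sum_j partial i (partial j f) (V k w) * D k w 0 i * D k w 0 j)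
     - H k w * (\sum_i \sum_j partial i (partial j f) (V k w) * dB k i j w).
    rewrite -mulrBr -sumrB mulr_sumr; apply: eq_bigr => i _.
    by rewrite -sumrB mulr_sumr; apply: eq_bigr => j _; rewrite /G2; ring.
  by rewrite /dB; ring.
rewrite expctD; [|exact: H_intg|by apply: intgD => //; exact: intgZ].
rewrite expctD//; last exact: intgZ.
rewrite expctZ// (@expct_sum _ _ _ P 'I_d)// big1 ?add0r//.
rewrite (@expct_sum _ _ _ P 'I_d); last by move=> i; apply: (@intg_sum _ _ _ P 'I_d) => j.
rewrite big1 ?mulr0 ?addr0// => i _.
by rewrite (@expct_sum _ _ _ P 'I_d)// big1.
Qed.

(** With weights known at time u k, the defect and the remainder have the same mean, and the mean of
    the squared increments is that of the increment of the trace of B. *)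
Lemma discrete_ito N :
  `|expct P (fun w => \1_E w * \sum_(k < N) \1_(tame k) w * ito_defect k w)| <=
  om * d%:R * (\sum_i expct P (fun w => B i i N w - B i i 0%N w))
   + 8 * c2 * d%:R * expct P (fun w => \1_(~` tame N) w * q w).
Proof.
have mtC : measurable (~` tame N) by apply: measurableC; exact: tame_measurable.
have E1 : expct P (fun w => \1_E w * \sum_(k < N) \1_(tame k) w * ito_defect k w) =
    expct P (fun w => \sum_(k < N) H k w * remainder k w).
  rewrite (@expct_sum _ _ _ P 'I_N); last by move=> k; exact: H_intg.
  transitivity (expct P (fun w => \sum_(k < N) H k w * ito_defect k w)).
    by congr expct; apply/funext => w; rewrite mulr_sumr; apply: eq_bigr => k _; rewrite /H mulrA.
  rewrite (@expct_sum _ _ _ P 'I_N); last by move=> k; exact: H_intg.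
  by apply: eq_bigr => k _; exact: defect_remainder.
rewrite E1; have iR : intg P (fun w => \sum_(k < N) H k w * remainder k w).
  by apply: (@intg_sum _ _ _ P 'I_N) => k; exact: H_intg.
apply: le_trans (expct_norm iR) _.
have DDi k : intg P (fun w => \sum_i D k w 0 i ^+ 2).
  by apply: (@intg_sum _ _ _ P 'I_d) => i; under eq_fun do rewrite expr2; exact: DD_intg.
have iS : intg P (fun w => \sum_(k < N) \sum_i D k w 0 i ^+ 2).
  by apply: (@intg_sum _ _ _ P 'I_N) => k; exact: DDi.
apply: (@le_trans _ _ (expct P (fun w => om * d%:R * (\sum_(k < N) \sum_i D k w 0 i ^+ 2)
    + 8 * c2 * d%:R * (\1_(~` tame N) w * q w)))).
  apply: expct_le.
  - exact: intg_norm.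
  - by apply: intgD; apply: intgZ => //; exact: intg_mul1.
  - move=> w; apply: le_trans (remainder_sum N w).
    apply: ler_norm_sumr => k.
    rewrite normrM ler_wpM2r// /H normrM; apply: le_trans (ler_piMl _ _) _ => //; first exact: norm_indic_le1.
    by rewrite indicE; case: (w \in tame k); rewrite ?normr1 ?normr0.
rewrite expctD; [|exact: intgZ|by apply: intgZ; exact: intg_mul1].
rewrite expctZ// expctZ; last exact: intg_mul1.
rewrite lerD2r ler_wpM2l ?mulr_ge0//.
rewrite (@expct_sum _ _ _ P 'I_N); last by move=> k; exact: DDi.
under eq_bigr => k _.
  rewrite (@expct_sum _ _ _ P 'I_d); last by move=> i; under eq_fun do rewrite expr2; exact: DD_intg.
  over.
rewrite exchange_big /=; apply: ler_sum => i _.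
have st k : expct P (fun w => D k w 0 i ^+ 2) = expct P (dB k i i).
  have n1 (x : Om) : `|cst (1 : R) x| <= 1 by rewrite /= normr1.
  have := @DD_mean_bnd k i i (cst 1) 1 (measurable_cst _) n1.
  rewrite (_ : (fun w => _) = (fun w => D k w 0 i ^+ 2 - dB k i i w)); last first.
    by apply/funext => w; rewrite /= mul1r expr2.
  rewrite expctB; [|by under eq_fun do rewrite expr2; exact: DD_intg|exact: dB_intg].
  by move=> H0; apply/eqP; rewrite -subr_eq0 H0.
under eq_bigr do rewrite st.
elim: N {mtC E1 iR iS} => [|N IH].
  rewrite big_ord0; under [X in _ <= expct _ X]eq_fun do rewrite subrr.
  by rewrite -[X in X <= _](expct_cst P 0).
rewrite big_ord_recr /=; apply: (le_trans (lerD IH (lexx _))).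
rewrite -expctD; [|exact: intgB|exact: dB_intg].
by rewrite le_eqVlt; apply/orP; left; apply/eqP; congr expct; apply/funext => w; rewrite /dB addrC subrKA.
Qed.

End discrete_ito.

Section time_integral_algebra.
Context (R : realType).
Notation lam := (@lebesgue_measure R).
Definition bmeas (g : R -> R) := measurable_fun setT g /\ exists c, forall x, `|g x| <= c.

Lemma bmeasD g h : bmeas g -> bmeas h -> bmeas (fun x => g x + h x).
Proof.
move=> [mg [c gc]] [mh [c' hc]]; split; first exact: measurable_funD.
by exists (c + c') => x; apply: le_trans (ler_normD _ _) _; exact: lerD.
Qed.

Lemma bmeasZ k g : bmeas g -> bmeas (fun x => k * g x).
Proof.
move=> [mg [c gc]]; split; first exact: measurable_funM.
by exists (`|k| * c) => x; rewrite normrM ler_wpM2l.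
Qed.

Lemma bmeas_sum (I : Type) (l : seq I) (g : I -> R -> R) : (forall i, bmeas (g i)) ->
  bmeas (fun x => \sum_(i <- l) g i x).
Proof.
move=> gb; elim: l => [|i l IH].
  by under eq_fun do rewrite big_nil; split => //; exists 0 => x; rewrite normr0.
by under eq_fun do rewrite big_cons; exact: bmeasD.
Qed.

Lemma tintD t g h : bmeas g -> bmeas h -> tint t (fun x => g x + h x) = tint t g + tint t h.
Proof.
move=> [mg [c gc]] [mh [c' hc]]; rewrite /tint RintegralD//.
- exact: bounded_integrable_itv mg gc.
- exact: bounded_integrable_itv mh hc.
Qed.

Lemma tintZ t k g : bmeas g -> tint t (fun x => k * g x) = k * tint t g.
Proof.
move=> [mg [c gc]]; rewrite /tint RintegralZl//.
exact: bounded_integrable_itv mg gc.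
Qed.

Lemma tint_sum t (I : Type) (l : seq I) (g : I -> R -> R) : (forall i, bmeas (g i)) ->
  tint t (fun x => \sum_(i <- l) g i x) = \sum_(i <- l) tint t (g i).
Proof.
move=> gb; elim: l => [|i l IH].
  rewrite big_nil; under [X in tint _ X]eq_fun do rewrite big_nil.
  by rewrite /tint Rintegral_cst// mul0r.
rewrite big_cons; under [X in tint _ X]eq_fun do rewrite big_cons.
rewrite tintD// ?IH//; exact: bmeas_sum.
Qed.

Lemma tint_increment_local g h c s t : bmeas g -> bmeas h -> 0 <= s -> s <= t ->
  (forall v, s <= v <= t -> `|g v - h v| <= c) ->
  `|(tint t g - tint s g) - (tint t h - tint s h)| <= c * (t - s).
Proof.
move=> gb hb s0 st ghc; have c0 : 0 <= c.
  by apply: le_trans (ghc s _); rewrite ?lexx.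
have [mg [cg gC]] := gb; have [mh [ch hC]] := hb.
rewrite /tint !Rintegral_itvB; try by [exact: bounded_integrable_itv mg gC|exact: bounded_integrable_itv mh hC|rewrite bnd_simp].
rewrite -RintegralB//; [|exact: bounded_integrable_itv mg gC|exact: bounded_integrable_itv mh hC].
have mgh : measurable_fun setT (fun v => g v - h v) by exact: measurable_funB.
have ghC v : `|g v - h v| <= cg + ch by apply: le_trans (ler_normB _ _) _; exact: lerD.
apply: (@le_trans _ _ (\int[lam]_(x in `]s, t]) `|g x - h x|)).
  by apply: le_normr_Rintegral => //; exact: bounded_integrable_itv mgh ghC.
apply: (@le_trans _ _ (\int[lam]_(x in `]s, t]) c)).
  apply: le_Rintegral => //.
  - by apply: (@bounded_integrable_itv _ _ (cg + ch)) => [|x]; [exact: mfun_norm|rewrite normr_id].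
  - by apply: (@bounded_integrable_itv _ _ c) => [|x]; [exact: measurable_cst|rewrite ger0_norm].
  - by move=> v /=; rewrite in_itv/= => /andP[sv vt]; apply: ghc; rewrite ltW.
rewrite Rintegral_cst// ler_wpM2l// [X in fine X]lebesgue_measure_itv/= lte_fin.
by case: ifPn => _; rewrite ?subr_ge0.
Qed.

End time_integral_algebra.

(** * The martingale test for one system *)

Section test_error.
Context (R : realType) (d : nat) (dd : measure_display) (Om : measurableType dd)
  (P : probability Om R) (Z : Om -> skorokhod 'rV[R]_d) (A : Om -> R -> 'M[R]_d).
Hypothesis sys : regular_system P Z A.
Notation F := (joint_filtration (fun w s => Z w s) A).
Notation GT t := (g_sigma_algebraType (F t)).
Let Ffil := joint_filtration_filtration sys.
Context (a : 'rV[R]_d -> 'M[R]_d) (C : R).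
Hypotheses (aC : forall x i j, `|a x i j| <= C) (C0 : 0 <= C)
  (a_continuous : forall x, x != 0 -> {for x, continuous a}).
Context (f : 'rV[R]_d -> R) (fs : smooth f) (fc : compactly_supported f) (c0 c2 cg : R).
Hypotheses (fc0 : forall x, `|f x| <= c0) (c2_ge0 : 0 <= c2)
  (fc2 : forall i j x, `|partial i (partial j f) x| <= c2) (cg_ge0 : 0 <= cg)
  (gcg : forall x, `|generator a f x| <= cg).

Definition test_increment s t w : R := f (Z w t) - f (Z w s)
  - (tint t (fun v => generator a f (Z w v)) - tint s (fun v => generator a f (Z w v))).

Lemma generator_jmeas : jmeas (fun w s => generator a f (Z w s)).
Proof.
by apply: (jmeas_off_zero (Z_mfun sys) (g := generator a f) (C := cg)) => //; exact: generator_off_zero.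
Qed.

Lemma test_increment_mfun s t : 0 <= s -> 0 <= t -> mfun (test_increment s t).
Proof.
move=> s0 t0; have cf : continuous f := (fs [::]).1.
apply: measurable_funB; first by apply: measurable_funB; exact: (Z_mfun sys).
by apply: measurable_funB; apply: (mfun_tint _ generator_jmeas (C := cg)) => // w v; exact: gcg.
Qed.

Lemma test_increment_bound s t w : 0 <= s -> s <= t -> `|test_increment s t w| <= 2 * c0 + cg * t.
Proof.
move=> s0 st.
exact: (increment_bound (u := fun v => f (Z w v)) (jmeas_path w generator_jmeas) (fun v => fc0 _) (fun v => gcg _) s0 st).
Qed.

Context (r K T s aa om e : R) (N : nat).
Hypotheses (r0 : 0 <= r) (K0 : 0 <= K) (T0 : 0 < T) (s0 : 0 <= s) (sT : s <= T) (N0 : (0 < N)%N)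
  (aa0 : 0 < aa) (om0 : 0 <= om) (e0 : 0 <= e)
  (fom : forall x y : 'rV[R]_d, (forall i, `|x 0 i - y 0 i| <= 4 * aa) ->
    forall i j, `|partial i (partial j f) x - partial i (partial j f) y| <= om).
Let T_ge0 := ltW T0.

Notation tau w := (Order.min T%:E (exit_time (Z w) (r + 1))).
Notation Y := (stopped_Z Z A r K T).
Notation B := (stopped_A Z A r K T).
Notation sg := (halt Z A r K T).
Notation start := (inside Z r).
Notation Jz := (overshoot_Z Z A r K T).
Notation Ja := (overshoot_A Z A r K T).
Notation gap := (gap_event Z A a r T).
Notation good := (good Z A r K T).

Context (EJ : R).
Hypothesis Z_jump_le : (\int[P]_w Z_jump (Z w) T (r + 1) <= EJ%:E)%E.
Hypothesis A_jump_fin : forall i j, (\int[P]_w A_jump (Z w) (A w) i j T (r + 1) < +oo)%E.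
Let Z_jump_fin : (\int[P]_w Z_jump (Z w) T (r + 1) < +oo)%E.
Proof. by apply: le_lt_trans Z_jump_le _; rewrite ltry. Qed.

Let N0R : 0 < N%:R :> R. Proof. by rewrite ltr0n. Qed.
Let h : R := T / N%:R.
Let h0 : 0 < h. Proof. exact: divr_gt0. Qed.
Let hN : N%:R * h = T. Proof. by rewrite /h mulrC divfK// gt_eqF. Qed.

(** Multiples of T/N clamped to [s, T]: u 0 = s, u N = T, and no step crosses the end of a block. *)
Let u k : R := Num.max s (Num.min T (k%:R * h)).
Let u_ge k : s <= u k. Proof. by rewrite le_max lexx. Qed.
Let u0 k : 0 <= u k. Proof. exact: le_trans s0 (u_ge k). Qed.
Let uT k : u k <= T. Proof. by rewrite ge_max sT ge_min lexx. Qed.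
Let uS k : u k <= u k.+1.
Proof.
rewrite /u ge_max !le_max lexx/=; apply/orP; right; rewrite le_min ge_min lexx/= ge_min.
by apply/orP; right; rewrite ler_wpM2r ?(ltW h0)// ler_nat.
Qed.
Let u_first : u 0%N = s. Proof. by rewrite /u mul0r min_r// max_l. Qed.
Let u_last : u N = T. Proof. by rewrite /u hN minxx max_r. Qed.

Let V k w : 'rV[R]_d := \row_i Y i (u k) w.
Let VE k w i : V k w 0 i = Y i (u k) w. Proof. by rewrite mxE. Qed.

Let V_start k w : start w -> V k w = Z w (Num.min (u k) (sg w)).
Proof. by move=> sw; apply/rowP => i; rewrite mxE /stopped_Z (indicT R sw) mul1r. Qed.

Let V_nostart k w : ~ start w -> V k w = 0.
Proof. by move=> sw; apply/rowP => i; rewrite !mxE /stopped_Z (indicF R sw) mul0r. Qed.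

Let V_GT (g : 'rV[R]_d -> R) k : continuous g -> measurable_fun [set: GT (u k)] (fun w => g (V k w)).
Proof.
move=> cg1.
have E : (fun w => g (V k w)) = (fun w => \1_start w * g (Z w (Num.min (u k) (sg w))) + (1 - \1_start w) * g 0).
  apply/funext => w; have [sw|nsw] := pselect (start w).
    by rewrite (indicT R sw) V_start// mul1r subrr mul0r addr0.
  by rewrite (indicF R nsw) V_nostart// mul0r subr0 mul1r add0r.
rewrite E; have m1 := inside_indic_past sys r (u0 k).
apply: measurable_funD; last first.
  by apply: measurable_funM => //; apply: measurable_funB.
apply: measurable_funM => //.
apply: (stopped_measurable Ffil (halt_past sys r K T_ge0) (halt_ge0 Z A r K T_ge0) (M := fun w t => g (Z w t))) => //.
- by apply: (adapted_GT sys) => // t t0; exact: past_Z_measurable.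
- by move=> w; apply: cadlag_rcont; exact: (cadlag_comp cg1 (path_cadlag (Z w))).
Qed.

Definition rough : set Om := [set w | exists ji : 'I_N * 'I_d,
  osc Z ji.2 (ji.1%:R * (T / N%:R)) (ji.1.+1%:R * (T / N%:R)) aa w].

(** Both times are compared with the left end of their common block, at cost 2 aa each. *)
Let steady k w v i : ~ rough w -> (k < N)%N -> u k <= v <= u k.+1 ->
  `|Z w v 0 i - Z w (u k) 0 i| <= 4 * aa.
Proof.
move=> nr kN /andP[uv vu].
have blk t : k%:R * h <= t <= k.+1%:R * h -> `|Z w t 0 i - Z w (k%:R * h) 0 i| <= 2 * aa.
  move=> tb; rewrite leNgt; apply/negP => tt; apply: nr.
  by exists (Ordinal kN, i); exists t.
have hk l : (l <= N)%N -> Num.min T (l%:R * h) = l%:R * h.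
  by move=> lN; rewrite min_r// -hN ler_wpM2r ?(ltW h0)// ler_nat.
have [ks|sk] := leP (k.+1%:R * h) s.
  have us : u k.+1 = s by rewrite /u hk// max_l.
  have -> : v = u k by apply/eqP; rewrite eq_le uv andbT (le_trans vu)// us u_ge.
  by rewrite subrr normr0 mulr_ge0// ltW.
have ub : k%:R * h <= u k by rewrite /u le_max hk ?lexx ?orbT// ltnW.
have u1 : u k.+1 = k.+1%:R * h by rewrite /u hk// max_r// ltW.
have b1 : `|Z w v 0 i - Z w (k%:R * h) 0 i| <= 2 * aa by apply: blk; rewrite (le_trans ub uv) -u1.
have b2 : `|Z w (u k) 0 i - Z w (k%:R * h) 0 i| <= 2 * aa by apply: blk; rewrite ub -u1 uS.
move: b1 b2; rewrite !ler_norml => /andP[? ?] /andP[? ?]; apply/andP; split; lra.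
Qed.

Notation tame := (tame V (4 * aa)).

Let steady_tame w : ~ rough w -> forall k, (k <= N)%N -> tame k w.
Proof.
move=> nr k kN j jk i; rewrite !mxE.
have aa4 : 0 <= 4 * aa by rewrite mulr_ge0// ltW.
have [sw|nsw] := pselect (start w); last first.
  by rewrite /stopped_Z (indicF R nsw) !mul0r subrr normr0.
rewrite /stopped_Z (indicT R sw) !mul1r.
have [su|us] := leP (sg w) (u j).
  by rewrite (min_r (le_trans su (uS j))) subrr normr0.
apply: steady => //; first exact: leq_trans jk kN.
by rewrite le_min (ltW us) uS/= ge_min lexx.
Qed.

Notation Bu := (fun i j k => B i j (u k)).
Let S w := \sum_(k < N) \1_(tame k) w * ito_defect V Bu f k w.

Let Z_bm w (g : 'rV[R]_d -> R) c : (forall x, `|g x| <= c) -> (forall x, x != 0 -> {for x, continuous g}) ->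
  bmeas (fun v => g (Z w v)).
Proof.
move=> gb gcont; split; last by exists c => v; exact: gb.
apply: (@jmeas_path _ _ _ (fun w v => g (Z w v)) w); exact: (jmeas_off_zero (Z_mfun sys) gb gcont).
Qed.

(** Over one step the generator is compared with the second derivatives frozen at u k times a(Z).
    Freezing costs at most C om per unit of time and pair of indices; replacing the integral of a(Z)
    by the increment of A costs 2 e c2 per step and pair, halved by the factor 1/2 of the
    generator. *)
Let S_good w : good w -> ~ rough w -> (forall i j, ~ gap i j e w) ->
  `|S w - test_increment s T w| <= d%:R ^+ 2 * (e * N%:R * c2 + C * om * T).
Proof.
move=> gw nr ng; have tm := steady_tame nr.
have VZ k : V k w = Z w (u k) by apply/rowP => i; rewrite mxE (good_stopped_Z i gw (uT k)).
pose q k i j := partial i (partial j f) (Z w (u k)).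
pose Gz v := generator a f (Z w v).
pose az i j v := a (Z w v) i j.
have Gb : bmeas Gz by apply: (Z_bm w gcg); exact: generator_off_zero.
have ab i j : bmeas (az i j).
  by apply: (@Z_bm w (fun x => a x i j) C) => // x x0; exact: entry_off_zero.
have SE : S w - test_increment s T w = \sum_(k < N) ((tint (u k.+1) Gz - tint (u k) Gz)
    - 2^-1 * \sum_i \sum_j q k i j * (A w (u k.+1) i j - A w (u k) i j)).
  rewrite sumrB (telescope_ord (fun k => tint (u k) Gz)) u_first u_last.
  have -> : S w = f (Z w T) - f (Z w s) - \sum_(k < N) 2^-1 * \sum_i \sum_j q k i j * (A w (u k.+1) i j - A w (u k) i j).
    rewrite -[in f (Z w T)]u_last -[in f (Z w s)]u_first -(telescope_ord (fun k => f (Z w (u k)))) -sumrB.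
    apply: eq_bigr => k _; rewrite (indicT R (tm k (ltnW (ltn_ord k)))) mul1r /ito_defect !VZ; congr (_ - _ * _).
    by apply: eq_bigr => i _; apply: eq_bigr => j _; rewrite !(good_stopped_A i j gw).
  by rewrite /test_increment; ring.
rewrite SE; apply: le_trans (ler_norm_sum _ _ _) _.
have step (k : 'I_N) : `|(tint (u k.+1) Gz - tint (u k) Gz)
    - 2^-1 * \sum_i \sum_j q k i j * (A w (u k.+1) i j - A w (u k) i j)| <=
    d%:R ^+ 2 * (e * c2) + d%:R ^+ 2 * (C * om) * (u k.+1 - u k).
  pose H v := 2^-1 * \sum_i \sum_j q k i j * az i j v.
  have Hb0 : bmeas (fun v => \sum_i \sum_j q k i j * az i j v).
    by apply: bmeas_sum => i; apply: bmeas_sum => j; exact: bmeasZ.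
  have Hb : bmeas H by exact: bmeasZ.
  have loc : `|(tint (u k.+1) Gz - tint (u k) Gz) - (tint (u k.+1) H - tint (u k) H)| <= d%:R ^+ 2 * (C * om) * (u k.+1 - u k).
    apply: tint_increment_local => // v vb.
    rewrite /Gz /H /generator -mulrBr normrM ger0_norm ?invr_ge0// -sumrB.
    have : `|\sum_(i < d) (\sum_(j < d) a (Z w v) i j * partial i (partial j f) (Z w v) - \sum_(j < d) q k i j * az i j v)| <= \sum_(i < d) \sum_(j < d) C * om.
      apply: ler_norm_sumr => i; rewrite -sumrB.
      apply: ler_norm_sumr => j.
      rewrite /az [q k i j * _]mulrC -mulrBr normrM ler_pM//.
      by apply: fom => l; exact: steady.
    rewrite sum_const2 => h1.
    have h2 : 0 <= d%:R ^+ 2 * (C * om) by rewrite !mulr_ge0// exprn_ge0.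
    by move: h1 h2; lra.
  have HA : `|(tint (u k.+1) H - tint (u k) H) - 2^-1 * \sum_i \sum_j q k i j * (A w (u k.+1) i j - A w (u k) i j)| <= d%:R ^+ 2 * (e * c2).
    have tH t : tint t H = 2^-1 * \sum_i \sum_j q k i j * tint t (az i j).
      rewrite /H tintZ// tint_sum; last by move=> i; apply: bmeas_sum => j; exact: bmeasZ.
      congr (_ * _); apply: eq_bigr => i _; rewrite tint_sum; last by move=> j; exact: bmeasZ.
      by apply: eq_bigr => j _; rewrite tintZ.
    rewrite !tH -!mulrBr normrM ger0_norm ?invr_ge0// -!sumrB.
    have : `|\sum_(i < d) (\sum_(j < d) q k i j * tint (u k.+1) (az i j) - \sum_(j < d) q k i j * tint (u k) (az i j) - \sum_(j < d) q k i j * (A w (u k.+1) i j - A w (u k) i j))| <= \sum_(i < d) \sum_(j < d) c2 * (2 * e).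
      apply: ler_norm_sumr => i; rewrite -!sumrB.
      apply: ler_norm_sumr => j.
      rewrite -!mulrBr normrM ler_pM//; first exact: fc2.
      have [Tsg _] := gw.
      have g1 := gap_small T_ge0 (ng i j) (u0 k) (le_trans (uT k) Tsg).
      have g2 := gap_small T_ge0 (ng i j) (u0 k.+1) (le_trans (uT k.+1) Tsg).
      move: g1 g2; rewrite /compensator_gap -/(az i j) !ler_norml => /andP[? ?] /andP[? ?].
      by apply/andP; split; lra.
    rewrite sum_const2 => h1.
    by move: h1; set x := d%:R ^+ 2; rewrite (_ : x * (c2 * (2 * e)) = 2 * (x * (e * c2))); [lra|ring].
  move: loc HA; set x := tint _ Gz - _; set y := tint _ H - _; set z := 2^-1 * _.
  move=> loc HA; rewrite (_ : x - z = (y - z) + (x - y)); last by ring.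
  by apply: le_trans (ler_normD _ _) _; exact: lerD.
apply: (@le_trans _ _ (\sum_(k < N) (d%:R ^+ 2 * (e * c2) + d%:R ^+ 2 * (C * om) * (u k.+1 - u k)))).
  by apply: ler_sum => k _; exact: step.
rewrite big_split /= sumr_const card_ord -mulr_sumr (telescope_ord u) u_first u_last -[X in X + _ <= _]mulr_natr.
have : d%:R ^+ 2 * (C * om) * (T - s) <= d%:R ^+ 2 * (C * om) * T.
  by rewrite ler_wpM2l ?gerBl// !mulr_ge0// exprn_ge0.
set x := d%:R ^+ 2.
have -> : x * (e * c2) * N%:R = x * (e * N%:R * c2) by ring.
have -> : x * (e * N%:R * c2 + C * om * T) = x * (e * N%:R * c2) + x * (C * om) * T by ring.
by move=> ?; rewrite lerD2l.
Qed.

Let tame_mono k l w : (k <= l)%N -> tame l w -> tame k w.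
Proof. by move=> kl h' j jk; apply: h'; exact: leq_trans kl. Qed.

Let tame_telescope (g : nat -> R) w n : exists m, \sum_(k < n) \1_(tame k) w * (g k.+1 - g k) = g m - g 0%N
  /\ (tame n w -> m = n).
Proof.
elim: n => [|n [m [IH mn]]]; first by exists 0%N; rewrite big_ord0 subrr.
rewrite big_ord_recr/=; have [tn|ntn] := pselect (tame n w); last first.
  exists m; rewrite (indicF R ntn) mul0r addr0; split=> // tn1.
  by exfalso; apply: ntn; exact: tame_mono tn1.
by exists n.+1; rewrite IH (mn tn) (indicT R tn) mul1r addrC subrKA.
Qed.

Let dB_le i j k w : `|B i j (u k.+1) w - B i j (u k) w| <=
  2^-1 * (B i i (u k.+1) w - B i i (u k) w) + 2^-1 * (B j j (u k.+1) w - B j j (u k) w).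
Proof.
have [sw|nsw] := pselect (start w); last by rewrite /stopped_A !(indicF R nsw) !mul0r !subrr normr0 !mulr0 addr0.
rewrite /stopped_A !(indicT R sw) !mul1r.
have [m0 _] := stopped_le Z A r K T_ge0 w (u0 k).
have : 0 <= Num.min (u k.+1) (sg w) - Num.min (u k) (sg w).
  by have /andP[] := min_increment (sg w) (uS k).
rewrite subr_ge0 le_eqVlt => /predU1P[->|lt]; first by rewrite !subrr normr0 !mulr0 addr0.
have sym : symmetric_mx (A w (Num.min (u k.+1) (sg w)) - A w (Num.min (u k) (sg w))).
  by rewrite /symmetric_mx linearB/= !(sys_A_sym sys)// (le_trans m0)// ltW.
have := nonneg_entry i j sym (sys_A_incr sys w m0 lt); rewrite !mxE.
by rewrite [_ / 2]mulrC mulrDr.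
Qed.

Let dB_sum i j w : \sum_(k < N) `|B i j (u k.+1) w - B i j (u k) w| <= K + \sum_l Ja l w.
Proof.
have tot l : \sum_(k < N) (B l l (u k.+1) w - B l l (u k) w) <= K + \sum_l Ja l w.
  rewrite (telescope_ord (fun k => B l l (u k) w)) u_last.
  have h1 := stopped_A_diag_ge0 sys r K T_ge0 l w (u0 0%N).
  have h2 : B l l T w - K <= Ja l w by rewrite le_max lexx orbT.
  have h3 : Ja l w <= \sum_l Ja l w.
    by rewrite (bigD1 l)//= lerDl sumr_ge0// => l' _; exact: overshoot_A_ge0.
  by move: h1 h2 h3; lra.
apply: (@le_trans _ _ (\sum_(k < N) (2^-1 * (B i i (u k.+1) w - B i i (u k) w) + 2^-1 * (B j j (u k.+1) w - B j j (u k) w)))).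
  by apply: ler_sum => k _; exact: dB_le.
by rewrite big_split /= -!mulr_sumr; have := tot i; have := tot j; lra.
Qed.

(** The increments of f telescope as long as the path is tame, hence 2 c0. The second-order part is
    bounded by the total variation of B, which its diagonal controls because the increments are
    nonnegative definite. *)
Let S_bound w : `|S w| <= 2 * c0 + d%:R ^+ 2 * c2 * (K + \sum_l Ja l w).
Proof.
have J0 : 0 <= K + \sum_l Ja l w by rewrite addr_ge0// sumr_ge0// => l _; exact: overshoot_A_ge0.
have [m [tel _]] := tame_telescope (fun k => f (V k w)) w N.
have -> : S w = (f (V m w) - f (V 0%N w)) - \sum_(k < N) \1_(tame k) w *
   (2^-1 * \sum_i \sum_j partial i (partial j f) (V k w) * (B i j (u k.+1) w - B i j (u k) w)).
  by rewrite -tel -sumrB; apply: eq_bigr => k _; rewrite -mulrBr.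
apply: le_trans (ler_normB _ _) _; apply: lerD.
  exact: ler_normB2.
apply: le_trans (ler_norm_sum _ _ _) _.
apply: (@le_trans _ _ (\sum_(k < N) \sum_(i < d) \sum_(j < d) c2 * `|B i j (u k.+1) w - B i j (u k) w|)).
  apply: ler_sum => k _; rewrite normrM; apply: le_trans (ler_piMl _ (norm_indic_le1 _ _ _)) _ => //.
  rewrite normrM; apply: le_trans (ler_piMl _ _) _ => //; first by rewrite ger0_norm ?invr_ge0// invf_le1// ler1n.
  apply: ler_norm_sumr => i.
  apply: ler_norm_sumr => j.
  by rewrite normrM ler_wpM2r.
rewrite exchange_big /=; under eq_bigr do rewrite exchange_big /=.
apply: (@le_trans _ _ (\sum_(i < d) \sum_(j < d) c2 * (K + \sum_l Ja l w))).
  apply: ler_sum => i _; apply: ler_sum => j _; rewrite -mulr_sumr ler_wpM2l//; exact: dB_sum.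
by rewrite sum_const2 mulrA.
Qed.

Notation D2 := (d%:R ^+ 2 : R).
Let D20 : 0 <= D2. Proof. exact: exprn_ge0. Qed.
Notation cB := (4 * c0 + cg * T + D2 * c2 * K).
Let c0_ge0 : 0 <= c0. Proof. exact: le_trans (normr_ge0 _) (fc0 0). Qed.
Let cB0 : 0 <= cB.
Proof. by rewrite !addr_ge0 ?mulr_ge0. Qed.

(** On the exceptional events the crude bounds of the two terms are added: 2 c0 + cg T for the test
    increment and 2 c0 + D2 c2 K plus overshoots for S, whence the constant 4 c0 + cg T + D2 c2
    K. *)
Let S_error w : `|S w - test_increment s T w| <= D2 * (e * N%:R * c2 + C * om * T)
  + cB * (\1_(~` good) w + \1_rough w + \sum_i \sum_j \1_(gap i j e) w) + D2 * c2 * \sum_l Ja l w.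
Proof.
have J0 : 0 <= \sum_l Ja l w by rewrite sumr_ge0// => l _; exact: overshoot_A_ge0.
have DJ0 : 0 <= D2 * c2 * \sum_l Ja l w by rewrite !mulr_ge0.
have eA0 : 0 <= D2 * (e * N%:R * c2 + C * om * T).
  by rewrite mulr_ge0// addr_ge0// !mulr_ge0// ltW.
have i0 (E : set Om) : 0 <= \1_E w :> R by rewrite indicE.
have gs0 : 0 <= \sum_i \sum_j \1_(gap i j e) w :> R by apply: sumr_ge0 => i _; apply: sumr_ge0.
have worst : 1 <= \1_(~` good) w + \1_rough w + \sum_i \sum_j \1_(gap i j e) w :> R ->
    `|S w - test_increment s T w| <= D2 * (e * N%:R * c2 + C * om * T)
  + cB * (\1_(~` good) w + \1_rough w + \sum_i \sum_j \1_(gap i j e) w) + D2 * c2 * \sum_l Ja l w.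
  move=> one; have h1 := S_bound w; have h2 := test_increment_bound w s0 sT.
  apply: le_trans (ler_normB _ _) _; apply: le_trans (lerD h1 h2) _.
  have : cB <= cB * (\1_(~` good) w + \1_rough w + \sum_i \sum_j \1_(gap i j e) w).
    by rewrite -[X in X <= _]mulr1 ler_wpM2l.
  by move: eA0; rewrite mulrDr; lra.
have [gw|ngw] := pselect (good w); last first.
  by apply: worst; rewrite (indicT R (A := ~` good))// -addrA lerDl addr_ge0.
have [rw|nrw] := pselect (rough w).
  by apply: worst; rewrite (indicT R rw) addrAC lerDr addr_ge0.
have [[i [j gij]]|ng] := pselect (exists i j, gap i j e w).
  apply: worst; apply: (@le_trans _ _ (\sum_i \sum_j \1_(gap i j e) w)); last by rewrite lerDr addr_ge0.
  by rewrite pair_bigA (bigD1 (i, j))//= (indicT R gij) lerDl sumr_ge0.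
apply: le_trans (S_good gw nrw _) _; first by move=> i j gij; apply: ng; exists i, j.
rewrite -addrA lerDl addr_ge0// mulr_ge0// addr_ge0// addr_ge0//.
Qed.

Lemma rough_measurable : measurable rough.
Proof.
rewrite (_ : rough = \bigcup_(ji in [set: 'I_N * 'I_d])
    osc Z ji.2 (ji.1%:R * (T / N%:R)) (ji.1.+1%:R * (T / N%:R)) aa); last first.
  by apply/seteqP; split=> w /= => [[ji h']|[ji _ h']]; exists ji.
apply: fin_bigcup_measurable => // ji _.
apply: (osc_measurable sys); first by rewrite mulr_ge0// ltW.
by rewrite ltr_pM2r// ltr_nat.
Qed.

Lemma test_error E : F s E ->
  `|expct P (fun w => \1_E w * test_increment s T w)| <=
  om * d%:R * (\sum_i (K + expct P (Ja i))) + 8 * c2 * d%:R * (2 * r ^+ 2 * prb P rough + 2 * EJ)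
  + (D2 * (e * N%:R * c2 + C * om * T)
  + cB * (prb P (~` good) + prb P rough + \sum_i \sum_j prb P (gap i j e)) + D2 * c2 * \sum_l expct P (Ja l)).
Proof.
move=> FE; have mE : measurable E := filtration_meas Ffil s0 FE.
have [Jzi Jz_le] := overshoot_Z_le sys K T_ge0 Z_jump_le.
have Jai i : intg P (Ja i) := overshoot_A_finite sys K0 T_ge0 A_jump_fin i.
have mG : measurable good := good_measurable sys r K T_ge0.
have mR := rough_measurable.
have mgap i j : measurable (gap i j e) := gap_event_measurable sys aC a_continuous r T_ge0 i j e.
pose q w := 2 * r ^+ 2 + 2 * Jz w.
have qi : intg P q by apply: intgD; [exact: intg_cst|exact: intgZ].
have uu k : 0 <= u k <= T by rewrite u0 uT.
have Bi i j k : intg P (B i j (u k)).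
  exact: (stopped_A_intg sys K0 T_ge0 Z_jump_fin A_jump_fin).
have Vq k w : \sum_i V k w 0 i ^+ 2 <= q w.
  by under eq_bigr do rewrite VE; apply: stopped_Z_bound.
have mart1 i k E' : F (u k) E' -> expct P (fun w => \1_E' w * (V k.+1 w 0 i - V k w 0 i)) = 0.
  move=> FE'; under eq_fun do rewrite !VE.
  exact: (stopped_Z_mean sys r0 K0 T_ge0 Z_jump_fin A_jump_fin (sys_Z_mart sys i) (u0 k) (uS k) (uT k.+1) FE').
have mart2 i j k E' : F (u k) E' -> expct P (fun w => \1_E' w *
     (V k.+1 w 0 i * V k.+1 w 0 j - V k w 0 i * V k w 0 j - (B i j (u k.+1) w - B i j (u k) w))) = 0.
  move=> FE'; under eq_fun do rewrite !VE.
  exact: (stopped_ZZ_mean sys r0 K0 T_ge0 Z_jump_fin A_jump_fin (sys_ZZ_mart sys i j) (u0 k) (uS k) (uT k.+1) FE').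
have FE0 : F (u 0%N) E by rewrite u_first.
have ito := @discrete_ito R dd Om P F Ffil d u u0 uS V Bu q V_GT Bi qi Vq mart1 mart2 f fs fc c2 (4 * aa) om om0 c2_ge0 fc2 fom E FE0 N.
have mT k : measurable (tame k) := tame_measurable Ffil u0 uS V_GT (4 * aa) k.
have Si : intg P S.
  apply: (@intg_sum _ _ _ P 'I_N) => k; apply: intg_mul1 => //.
  have cf : continuous f := (fs [::]).1.
  have Vm (g : 'rV[R]_d -> R) l : continuous g -> mfun (fun w => g (V l w)).
    by move=> cg1; apply: (mfun_sub (filtration_sub Ffil (u0 l))); exact: (@V_GT g l cg1).
  apply: intgB.
    by apply: intgB; apply: (@intg_bnd _ _ _ _ _ c0); try exact: Vm; move=> w; exact: fc0.
  apply: intgZ; apply: (@intg_sum _ _ _ P 'I_d) => i; apply: (@intg_sum _ _ _ P 'I_d) => j.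
  apply: (@intg_mulb _ _ _ _ _ _ c2); [exact: Vm (fs [:: i; j]).1|by move=> w; exact: fc2|exact: intgB].
have Gi : intg P (test_increment s T).
  apply: (@intg_bnd _ _ _ _ _ (2 * c0 + cg * T)); first exact: test_increment_mfun.
  by move=> w; exact: test_increment_bound.
have -> : expct P (fun w => \1_E w * test_increment s T w) =
   expct P (fun w => \1_E w * S w) - expct P (fun w => \1_E w * (S w - test_increment s T w)).
  rewrite -expctB; [|exact: intg_mul1|by apply: intg_mul1 => //; exact: intgB].
  by congr expct; apply/funext => w; ring.
apply: le_trans (ler_normB _ _) _; apply: lerD.
  apply: (le_trans ito); apply: lerD.
    apply: ler_wpM2l; first by rewrite mulr_ge0.
    apply: ler_sum => i _; have -> : K + expct P (Ja i) = expct P (fun w => K + Ja i w).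
      by rewrite expctD ?expct_cst//; exact: intg_cst.
    apply: expct_le; [exact: intgB|by apply: intgD => //; exact: intg_cst|move=> w].
    have h1 := stopped_A_diag_ge0 sys r K T_ge0 i w (u0 0%N).
    have h2 : B i i T w - K <= Ja i w by rewrite le_max lexx orbT.
    by rewrite /= u_last; move: h1 h2; lra.
  apply: ler_wpM2l; first by rewrite !mulr_ge0.
  (* A path that is not rough is tame. So the bounded part of q is integrated over [rough], and the
     overshoot over the whole space. *)
  apply: (@le_trans _ _ (expct P (fun w => 2 * r ^+ 2 * \1_rough w + 2 * Jz w))).
    apply: expct_le.
    - by apply: intg_mul1 => //; exact: measurableC.
    - by apply: intgD; apply: intgZ => //; exact: intg_indic.
    - move=> w; have J0 := overshoot_Z_ge0 Z A r K T w; have r20 := sqr_ge0 r.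
      have [rw|nrw] := pselect (rough w).
        rewrite (indicT R rw) mulr1 /q.
        have : 0 <= 2 * r ^+ 2 + 2 * Jz w by rewrite addr_ge0// mulr_ge0.
        by move=> h1; rewrite ler_piMl// indicE; case: (w \in _).
      rewrite (indicF R (A := ~` tame N)); last by apply; exact: steady_tame.
      by rewrite mul0r (indicF R nrw) mulr0 add0r mulr_ge0.
  rewrite expctD; [|by apply: intgZ; exact: intg_indic|exact: intgZ].
  rewrite !expctZ ?prb_indic//; [|exact: intg_indic].
  by rewrite lerD2l ler_wpM2l.
have iI (E' : set Om) : measurable E' -> intg P (\1_E' : Om -> R) by exact: intg_indic.
have igap : intg P (fun w => \sum_i \sum_j \1_(gap i j e) w).
  by apply: (@intg_sum _ _ _ P 'I_d) => i; apply: (@intg_sum _ _ _ P 'I_d) => j; exact: iI.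
have mC := measurableC mG.
have i3 : intg P (fun w => \1_(~` good) w + \1_rough w + \sum_i \sum_j \1_(gap i j e) w).
  by apply: intgD => //; apply: intgD; exact: iI.
have iJ : intg P (fun w => \sum_l Ja l w) by apply: (@intg_sum _ _ _ P 'I_d).
have iES : intg P (fun w => \1_E w * (S w - test_increment s T w)) by apply: intg_mul1 => //; exact: intgB.
apply: le_trans (expct_norm iES) _.
apply: (@le_trans _ _ (expct P (fun w => D2 * (e * N%:R * c2 + C * om * T)
  + cB * (\1_(~` good) w + \1_rough w + \sum_i \sum_j \1_(gap i j e) w) + D2 * c2 * \sum_l Ja l w))).
  apply: expct_le; [exact: intg_norm|by apply: intgD; [apply: intgD; [exact: intg_cst|exact: intgZ]|exact: intgZ]|move=> w].
  by rewrite normrM; apply: le_trans (S_error w); rewrite ler_piMl// norm_indic_le1.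
rewrite expctD; [|by apply: intgD; [exact: intg_cst|exact: intgZ]|exact: intgZ].
rewrite expctD; [|exact: intg_cst|exact: intgZ].
rewrite expct_cst !expctZ// expctD//; last by apply: intgD; exact: iI.
rewrite expctD; [|exact: iI|exact: iI].
rewrite !prb_indic// [in leLHS](_ : expct P (fun w => \sum_l Ja l w) = \sum_l expct P (Ja l)); last exact: (@expct_sum _ _ _ P 'I_d).
rewrite (@expct_sum _ _ _ P 'I_d); last by move=> i; apply: (@intg_sum _ _ _ P 'I_d) => j; exact: iI.
rewrite lerD2r lerD2l ler_wpM2l// lerD2l; apply: ler_sum => i _.
rewrite (@expct_sum _ _ _ P 'I_d); last by move=> j; exact: iI.
by apply: ler_sum => j _; rewrite prb_indic.
Qed.

End test_error.

(** * The martingale test along the sequence *)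

Section sequence_test.
Context (R : realType) (d : nat).
Context (disp : nat -> measure_display) (Omega : forall n, measurableType (disp n))
  (P : forall n, probability (Omega n) R)
  (Z : forall n, Omega n -> skorokhod 'rV[R]_d) (A : forall n, Omega n -> R -> 'M[R]_d).
Arguments Z : clear implicits.
Arguments A : clear implicits.
Context (sys : forall n, regular_system (P n) (Z n) (A n)).
Context (a : 'rV[R]_d -> 'M[R]_d) (C : R).
Hypotheses (aC : forall x i j, `|a x i j| <= C) (C0 : 0 <= C)
  (a_continuous : forall x, x != 0 -> {for x, continuous a}).
Hypotheses
    (Z_jumps : forall r T, 0 < r -> 0 < T ->
       (\int[P n]_w Z_jump (Z n w) T r)%E
         @[n --> \oo] --> 0%E)
    (A_jumps : forall r T i j, 0 < r -> 0 < T ->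
       (\int[P n]_w A_jump (Z n w) (A n w) i j T r)%E
         @[n --> \oo] --> 0%E)
    (A_limit : forall r T i j, 0 < r -> 0 < T ->
       cvg_prob0 P (fun n w => sup_upto (Order.min T%:E (exit_time (Z n w) r))
         (fun t => `|A n w t i j -
            \int[lebesgue_measure]_(s in `[0, t]) a (Z n w s) i j|))).
Hypothesis containment : forall T eta, 0 < eta ->
  exists K : nat, (0 < K)%N /\ \forall n \near \oo,
    prb (P n) [set w | exists2 t, 0 <= t <= T & K%:R < enorm (Z n w t)] <= eta.

(** The choices are made in the order eta, scale del of the second derivatives, radius r, number N
    of blocks, and n last: roughness is measured at scale del, its probability must beat r^2, and
    the gap tolerance depends on N. The event E comes after n, so the bound is uniform over the
    past. *)
Lemma martingale_test (f : 'rV[R]_d -> R) s t th : smooth f -> compactly_supported f ->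
  0 <= s -> s <= t -> 0 < th -> \forall n \near \oo, forall E : set (Omega n),
  joint_filtration (fun w s => Z n w s) (A n) s E ->
  `|expct (P n) (fun w => \1_E w * test_increment (Z n) a f s t w)| <= th.
Proof.
move=> fs fc s0; rewrite le_eqVlt => /predU1P[<-|st] th0.
  apply: nearW => n E FE.
  rewrite (_ : (fun w => _) = cst 0) ?expct_cst ?normr0 ?ltW//.
  by apply/funext => w; rewrite /test_increment !subrr mulr0.
have t0 : 0 < t := le_lt_trans s0 st.
have [c0 c0_ge0 fc0] := iter_partial_bounded fs fc [::].
have [c2 c2_ge0 fc2] := second_partial_bounded fs fc.
have [cg cg_ge0 gcg] := generator_bound fs fc aC C0.
have K0 := ceiling_ge0 C0 t0; set K := ceiling C t in K0 *.
pose D2 : R := d%:R ^+ 2; have D20 : 0 <= D2 by exact: exprn_ge0.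
pose cB := 4 * c0 + cg * t + D2 * c2 * K.
have cB0 : 0 <= cB by rewrite !addr_ge0 ?mulr_ge0// ltW.
(* The coefficients of eta in the five error terms [t1] to [t5], plus 1 to make M positive. *)
pose M := D2 * (K + 1) + 32 * c2 * d%:R + D2 * (c2 + C * t) + cB * (2 + D2) + D2 * c2 * d%:R + 1.
have d0 : 0 <= d%:R :> R by [].
have M0 : 0 < M.
  by rewrite ltr_wpDl// !addr_ge0 ?mulr_ge0 ?addr_ge0 ?mulr_ge0// ltW.
have [eta eta0 [eta1 etaM]] : exists2 eta : R, 0 < eta & eta <= 1 /\ eta * M <= th.
  exists (Num.min 1 (th / M)); first by rewrite lt_min ltr01 divr_gt0.
  by split; [rewrite ge_min lexx|rewrite -ler_pdivlMr// ge_min lexx orbT].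
have [del del0 Hdel] := second_partial_uniform fs fc eta0.
have aa0 : 0 < del / 4 by rewrite divr_gt0.
have fom (x y : 'rV[R]_d) : (forall i, `|x 0 i - y 0 i| <= 4 * (del / 4)) ->
    forall i j, `|partial i (partial j f) x - partial i (partial j f) y| <= eta.
  by move=> h; apply: Hdel => i; apply: (le_trans (h i)); rewrite mulrC divfK.
have [r [r0 Hr]] := good_likely sys aC C0 a_continuous A_limit containment t0 eta0.
have r21 : 0 < r ^+ 2 + 1 by rewrite ltr_wpDl// sqr_ge0.
(* Roughness enters the error with the factor r^2, from the bound on the squared norm of the stopped
   process. *)
have er0 : 0 < eta / (r ^+ 2 + 1) by rewrite divr_gt0.
have [N [N0 HN]] := osc_small sys aC C0 a_continuous Z_jumps A_jumps A_limit containment t0 aa0 er0.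
have N0R : 0 < N%:R :> R by rewrite ltr0n.
(* The gap error is incurred at each of the N steps. *)
have eN0 : 0 < eta / N%:R by rewrite divr_gt0.
apply: (filterS2 _ _ (filterI (Z_jump_le Z_jumps t0 r0 eta0) (A_jump_le A_jumps t0 r0 eta0))
  (filterI (filterI (overshoot_A_small sys C0 A_jumps t0 r0 eta0) (gap_small_prb sys aC a_continuous A_limit t0 r0 eN0 eta0)) (filterI Hr HN))).
move=> n [hZ hA] [[hJ hG] [hr hN]] E FE.
apply: le_trans (test_error (sys n) aC C0 a_continuous fs fc fc0 c2_ge0 fc2 cg_ge0 gcg (ltW r0) K0 t0 s0 (ltW st) N0 aa0 (ltW eta0) (ltW eN0) fom hZ (A_jump_finite hA) FE) _.
rewrite -/D2 -/cB.
have rough_le : prb (P n) (rough (Z n) t (del / 4) N) <= eta / (r ^+ 2 + 1) by exact: hN.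
have h0 := prb_ge0 (P n) (rough (Z n) t (del / 4) N).
have rough1 : prb (P n) (rough (Z n) t (del / 4) N) <= eta.
  by apply: (le_trans rough_le); rewrite ler_pdivrMr// ler_peMr ?(ltW eta0)// lerDr sqr_ge0.
have rough2 : r ^+ 2 * prb (P n) (rough (Z n) t (del / 4) N) <= eta.
  apply: (@le_trans _ _ (r ^+ 2 * (eta / (r ^+ 2 + 1)))); first by rewrite ler_wpM2l ?sqr_ge0.
  by rewrite mulrCA ler_piMr ?(ltW eta0)// ler_pdivrMr// mul1r lerDl.
have hJi i : expct (P n) (overshoot_A (Z n) (A n) r K t i) <= eta by have [] := hJ i.
have t1 : eta * d%:R * (\sum_i (K + expct (P n) (overshoot_A (Z n) (A n) r K t i))) <= eta * (D2 * (K + 1)).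
  have -> : eta * (D2 * (K + 1)) = eta * d%:R * (d%:R * (K + 1)) by rewrite /D2; ring.
  rewrite ler_wpM2l ?mulr_ge0 ?(ltW eta0)//.
  apply: (@le_trans _ _ (\sum_(i < d) (K + 1))); last by rewrite sumr_const card_ord mulr_natl.
  by apply: ler_sum => i _; rewrite lerD2l (le_trans (hJi i)).
have t2 : 8 * c2 * d%:R * (2 * r ^+ 2 * prb (P n) (rough (Z n) t (del / 4) N) + 2 * eta) <= eta * (32 * c2 * d%:R).
  have -> : eta * (32 * c2 * d%:R) = 8 * c2 * d%:R * (4 * eta) by ring.
  by rewrite ler_wpM2l ?mulr_ge0// -mulrA; move: rough2; lra.
have t3 : D2 * (eta / N%:R * N%:R * c2 + C * eta * t) <= eta * (D2 * (c2 + C * t)).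
  rewrite divfK ?gt_eqF// le_eqVlt; apply/orP; left; apply/eqP; ring.
have t4 : cB * (prb (P n) (~` good (Z n) (A n) r K t) + prb (P n) (rough (Z n) t (del / 4) N)
   + \sum_i \sum_j prb (P n) (gap_event (Z n) (A n) a r t i j (eta / N%:R))) <= eta * (cB * (2 + D2)).
  rewrite mulrCA ler_wpM2l//.
  have : \sum_(i < d) \sum_(j < d) prb (P n) (gap_event (Z n) (A n) a r t i j (eta / N%:R)) <= D2 * eta.
    rewrite -sum_const2; apply: ler_sum => i _; apply: ler_sum => j _; exact: (hG (i, j)).
  by move: hr rough1; rewrite -/K mulrDr [eta * D2]mulrC; lra.
have t5 : D2 * c2 * (\sum_l expct (P n) (overshoot_A (Z n) (A n) r K t l)) <= eta * (D2 * c2 * d%:R).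
  have -> : eta * (D2 * c2 * d%:R) = D2 * c2 * (d%:R * eta) by ring.
  rewrite ler_wpM2l ?mulr_ge0//.
  apply: (@le_trans _ _ (\sum_(i < d) eta)); last by rewrite sumr_const card_ord mulr_natl.
  by apply: ler_sum => i _.
apply: le_trans etaM.
have -> : eta * M = eta * (D2 * (K + 1)) + eta * (32 * c2 * d%:R) + (eta * (D2 * (c2 + C * t))
   + eta * (cB * (2 + D2)) + eta * (D2 * c2 * d%:R)) + eta by rewrite /M; ring.
by rewrite -[leLHS]addr0 lerD ?(ltW eta0)// !lerD.
Qed.

End sequence_test.

(** * Measurability on the Skorokhod space *)

Section time_changes.
Context (R : realType).

Definition glue (c : R) (l1 l2 : R -> R) (t : R) : R := if t < c then l1 t else l2 t.

Lemma glue_time_change c l1 l2 : time_change l1 -> {homo l2 : s t / s < t} ->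
  (forall v, exists t, l2 t = v) -> l1 c = l2 c -> 0 <= c -> time_change (glue c l1 l2).
Proof.
move=> [l10 l1inc l1s] l2inc l2s cc c0; split.
- rewrite /glue; case: ltP => // c0'.
  have c00 : c = 0 by apply/eqP; rewrite eq_le c0 c0'.
  by rewrite -{1}c00 -cc c00 l10.
- move=> s t st; rewrite /glue; have [sc|cs] := ltP s c; have [tc|ct] := ltP t c.
  + exact: l1inc.
  + have h1 : l1 s < l2 c by rewrite -cc; exact: l1inc.
    apply: (lt_le_trans h1); move: ct; rewrite le_eqVlt => /predU1P[->//|/l2inc/ltW//].
  + by have := lt_le_trans (lt_trans st tc) cs; rewrite ltxx.
  + exact: l2inc.
- move=> v; have [vc|cv] := ltP v (l1 c).
    have [t tv] := l1s v; exists t; rewrite /glue; case: ltP => // ct; exfalso.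
    have : l1 c <= l1 t by move: ct; rewrite le_eqVlt => /predU1P[->//|/l1inc/ltW//].
    by rewrite leNgt tv vc.
  have [t tv] := l2s v; exists t; rewrite /glue; case: ltP => // tc; exfalso.
  by have := l2inc _ _ tc; rewrite tv -cc ltNge cv.
Qed.

Lemma nat_ceil (y : R) : 0 <= y -> exists j : nat, y <= j%:R < y + 1.
Proof.
move=> y0; have /andP[h1 h2] := truncn_itv y0.
have [E|nE] := eqVneq (Num.truncn y)%:R y.
  by exists (Num.truncn y); rewrite E lexx ltrDl ltr01.
exists (Num.truncn y).+1; rewrite (ltW h2)/= -natr1 ltrD2r lt_neqAle h1 andbT.
exact: nE.
Qed.

End time_changes.

Section discretization.
Context (R : realType) (V : pseudoMetricNormedZmodType R).

Definition grid (m : nat) (t : R) : R := (Num.truncn (m.+1%:R * t))%:R / m.+1%:R.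

Section matching.
Context (x : R -> V) (cx : cadlag x) (e : R) (e0 : 0 < e).

(** On all fine grids, x sampled by [grid m] matches x up to p: [lam] takes the first grid point at
    or after p back to p, lags behind t by at most one cell, and keeps the values within e. A jump
    of x at p is thus delayed to the next grid point. *)
Let matched (p : R) := exists M0 : nat, forall m, (M0 <= m)%N -> exists (lam : R -> R) (j : nat),
  [/\ time_change lam, m.+1%:R * p <= j%:R < m.+1%:R * p + 1, lam (j%:R / m.+1%:R) = p,
    (forall t, 0 <= t <= j%:R / m.+1%:R -> lam t <= t <= lam t + m.+1%:R^-1) &
    (forall t, 0 <= t < j%:R / m.+1%:R -> `|x (grid m t) - x (lam t)| < e)].

Let matched0 : matched 0.
Proof.
exists 0%N => m _; exists id, 0%N; split.
- exact: time_change_id.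
- by rewrite mulr0 lexx add0r ltr01.
- by rewrite mul0r.
- move=> t; rewrite mul0r => /andP[ta tb]; have -> : t = 0 by apply/eqP; rewrite eq_le ta tb.
  by rewrite add0r lexx invr_ge0 ler0n.
- by move=> t; rewrite mul0r => /andP[t0 t1]; have := le_lt_trans t0 t1; rewrite ltxx.
Qed.

(** The time change is extended affinely from [c, c'] onto [p, p'], where x oscillates by less than
    e before p'; the lag is a convex combination of the lags at the two ends. *)
Let matched_step p p' : 0 <= p -> p < p' -> (forall s t, p <= s < p' -> p <= t < p' -> `|x s - x t| < e) ->
  matched p -> matched p'.
Proof.
move=> p0 pp' osc [M0 HM].
have dp : 0 < p' - p by rewrite subr_gt0.
exists (maxn M0 (Num.truncn (p' - p)^-1)) => m; rewrite geq_max => /andP[mM mN].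
(* More than one cell fits between p and p', so the grid points that follow them are distinct. *)
have Mgap : 1 < m.+1%:R * (p' - p).
  have := truncnS_gt (p' - p)^-1; rewrite invf_plt ?posrE// => h.
  have : (Num.truncn (p' - p)^-1).+1%:R <= m.+1%:R :> R by rewrite ler_nat.
  rewrite -(ler_pM2r dp); apply: lt_le_trans.
  by rewrite -ltr_pdivrMr// mul1r truncnS_gt.
have {HM mM} [lam [j [tlam /andP[j1 j2] lamj lamt lamx]]] := HM m mM.
have p'0 : 0 <= p' := le_trans p0 (ltW pp').
have [j' /andP[j'1 j'2]] : exists j' : nat, m.+1%:R * p' <= j'%:R < m.+1%:R * p' + 1.
  by apply: nat_ceil; rewrite mulr_ge0.
have M0' : 0 < m.+1%:R :> R by [].
set M := m.+1%:R in M0' Mgap j1 j2 j'1 j'2 lamj lamt lamx *.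
set c := j%:R / M; set c' := j'%:R / M.
have cM : c * M = j%:R by rewrite /c divfK// gt_eqF.
have c'M : c' * M = j'%:R by rewrite /c' divfK// gt_eqF.
have jj' : j%:R < j'%:R :> R by apply: (lt_le_trans j2); apply: le_trans j'1; move: Mgap; rewrite mulrBr; lra.
have cc' : c < c' by rewrite /c /c' ltr_pM2r ?invr_gt0.
have c0 : 0 <= c by rewrite divr_ge0.
have cp : p <= c by rewrite /c ler_pdivlMr// mulrC.
have cp1 : c <= p + M^-1 by rewrite /c ler_pdivrMr// mulrDl mulVf ?gt_eqF// mulrC ltW.
have c'p : p' <= c' by rewrite /c' ler_pdivlMr// mulrC.
have c'p1 : c' <= p' + M^-1 by rewrite /c' ler_pdivrMr// mulrDl mulVf ?gt_eqF// mulrC ltW.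
have dc : 0 < c' - c by rewrite subr_gt0.
pose k := (p' - p) / (c' - c); have k0 : 0 < k by rewrite divr_gt0.
pose l2 t := p + (t - c) * k.
have l2c' : l2 c' = p' by rewrite /l2 /k mulrC divfK ?gt_eqF// addrC subrK.
exists (glue c lam l2), j'; split.
- apply: glue_time_change => //.
  + by move=> s t st; rewrite /l2 ltrD2l ltr_pM2r// ltrD2r.
  + by move=> v; exists (c + (v - p) / k); rewrite /l2 addrAC subrr add0r divfK ?gt_eqF// addrC subrK.
  + by rewrite lamj /l2 subrr mul0r addr0.
- by rewrite j'1.
- by rewrite /glue -/c' ltNge (ltW cc')/= l2c'.
- move=> t /andP[t0 tc']; rewrite /glue; case: ltP => tc; first by apply: lamt; rewrite t0 ltW.
  have th1 : 0 <= (t - c) / (c' - c) by rewrite divr_ge0 ?subr_ge0// ltW.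
  have th2 : (t - c) / (c' - c) <= 1 by rewrite ler_pdivrMr// mul1r lerD2r.
  have tE : t = c + (t - c) / (c' - c) * (c' - c) by rewrite divfK ?gt_eqF// addrC subrK.
  have lE : l2 t = p + (t - c) / (c' - c) * (p' - p) by rewrite /l2 /k mulrA mulrAC.
  rewrite lE [X in _ <= X <= _]tE; set th := (t - c) / (c' - c) in th1 th2 *.
  have h1 : 0 <= th * (c' - p') by rewrite mulr_ge0// subr_ge0.
  have h2 : 0 <= (1 - th) * (c - p) by rewrite mulr_ge0// subr_ge0.
  have h3 : 0 <= th * (p' + M^-1 - c') by rewrite mulr_ge0// subr_ge0.
  have h4 : 0 <= (1 - th) * (p + M^-1 - c) by rewrite mulr_ge0// subr_ge0.
  apply/andP; split; rewrite -subr_ge0.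
    by have := addr_ge0 h1 h2; congr (_ <= _); ring.
  by have := addr_ge0 h3 h4; congr (_ <= _); ring.
- move=> t /andP[t0 tc']; rewrite /glue; case: (ltP t c) => tc; first by apply: lamx; rewrite t0.
  have Mt0 : 0 <= M * t by rewrite mulr_ge0.
  have /andP[g1 g2] := truncn_itv Mt0.
  apply: osc.
    rewrite /grid -/M; apply/andP; split.
      apply: (le_trans cp); rewrite /c ler_pM2r ?invr_gt0// ler_nat.
      by rewrite truncn_ge_nat// -cM mulrC ler_pM2l.
    rewrite ltr_pdivrMr// [p' * M]mulrC.
    have h : (Num.truncn (M * t) < j')%N.
      by rewrite -(ltr_nat R) (le_lt_trans g1)// -c'M mulrC ltr_pM2r.
    have h' : (Num.truncn (M * t)).+1%:R <= j'%:R :> R by rewrite ler_nat.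
    by rewrite -natr1 in h'; move: h' j'2; lra.
  rewrite /l2 lerDl mulr_ge0 ?subr_ge0 ?(ltW k0)//=.
  by rewrite -[ltRHS]l2c' /l2 ltrD2l ltr_pM2r// ltrD2r.
Qed.

(** At the supremum of the matched times, the left limit makes the supremum itself matched, and
    right-continuity goes beyond it. *)
Let matched_unbounded (T : R) : exists2 p, T < p & 0 <= p /\ matched p.
Proof.
apply: contrapT => nT.
pose S : set R := [set p | 0 <= p /\ matched p].
have S0 : S 0 by split; [exact: lexx|exact: matched0].
have ubS : ubound S T.
  by move=> p [p0 mp]; rewrite leNgt; apply/negP => Tp; apply: nT; exists p.
have hS : has_sup S by split; [exists 0|exists T].
set sg := sup S; have sg0 : 0 <= sg by apply: ub_le_sup => //; exists T.
have e20 : 0 < e / 2 by rewrite divr_gt0.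
have msg : matched sg.
  have [del del0 Hl] := cadlag_left sg cx e20.
  have [p [p0 mp] psg] := sup_adherent del0 hS.
  have : p <= sg by apply: ub_le_sup => //; exists T.
  rewrite le_eqVlt => /predU1P[<-//|psg'].
  apply: (matched_step p0 psg' _ mp) => s t /andP[ps ssg] /andP[pt tsg].
  have h1 := Hl s; have h2 := Hl t.
  rewrite (lt_le_trans psg ps) ssg in h1; rewrite (lt_le_trans psg pt) tsg in h2.
  rewrite -(subrKA (left_limit x sg)); apply: le_lt_trans (ler_normD _ _) _.
  by rewrite [ltRHS]splitr ltrD ?h1// distrC h2.
have [del del0 Hr] := cadlag_right sg cx e20.
have sd : sg < sg + del by rewrite ltrDl.
have : S (sg + del).
  split; first by rewrite addr_ge0// ltW.
  apply: (matched_step sg0 sd _ msg) => s t sb tb.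
  rewrite -(subrKA (x sg)); apply: le_lt_trans (ler_normD _ _) _.
  by rewrite [ltRHS]splitr ltrD ?Hr// distrC Hr.
move=> Ssd; have : sg + del <= sg by apply: ub_le_sup => //; exists T.
by rewrite leNgt sd.
Qed.

(** The sampled path converges to x in J1, although each jump of x may be seen up to one cell
    late. *)
Lemma grid_time_change T : exists M0 : nat, forall m, (M0 <= m)%N -> exists2 lam, time_change lam &
  forall t, 0 <= t <= T -> `|lam t - t| <= m.+1%:R^-1 /\ `|x (grid m t) - x (lam t)| < e.
Proof.
have [p Tp [p0 [M0 HM]]] := matched_unbounded T.
exists M0 => m mM; have [lam [j [tlam /andP[j1 _] lamj lamt lamx]]] := HM m mM.
exists lam => // t /andP[t0 tT].
have pj : p <= j%:R / m.+1%:R by rewrite ler_pdivlMr// mulrC.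
have tj : t < j%:R / m.+1%:R by exact: lt_le_trans (le_lt_trans tT Tp) pj.
have := lamt t; rewrite t0 (ltW tj) => /(_ isT)/andP[h1 h2]; split; last by apply: lamx; rewrite t0.
by rewrite distrC ger0_norm ?subr_ge0// lerBlDl.
Qed.

End matching.

End discretization.

Section step_paths.
Context (R : realType) (d : nat).

(** The index of the cell of t. Capping at m + 1 leaves finitely many cells, so that a step path is
    given by a finite array; on [0, m + 1] it agrees with [grid]. *)
Definition clock (m : nat) (t : R) : nat := Num.truncn (m.+1%:R * Num.min (Num.max 0 t) m.+1%:R).

Lemma clock_lt m t : (clock m t < (m.+1 * m.+1).+1)%N.
Proof.
rewrite ltnS -(ler_nat R) /clock.
have M0 : 0 <= Num.min (Num.max 0 t) m.+1%:R by rewrite le_min le_max lexx ler0n.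
have /andP[h _] := truncn_itv (mulr_ge0 (ler0n R m.+1) M0).
by apply: (le_trans h); rewrite natrM ler_wpM2l// ge_min lexx orbT.
Qed.

Lemma clock_grid m t : 0 <= t -> t <= m.+1%:R -> (clock m t)%:R / m.+1%:R = grid m t.
Proof. by move=> t0 tm; rewrite /clock /grid max_r// min_l. Qed.

Lemma clock_neg m t : t <= 0 -> clock m t = 0%N.
Proof. by move=> t0; rewrite /clock max_l// min_l// mulr0 truncn0. Qed.

Lemma clock_max m t : m.+1%:R <= t -> clock m t = (m.+1 * m.+1)%N.
Proof. by move=> mt; rewrite /clock min_r ?le_max ?mt ?orbT// -natrM natrK. Qed.

Lemma clock_right m t : exists2 del, 0 < del & forall s, t <= s < t + del -> clock m s = clock m t.
Proof.
have [t0|t0] := ltP t 0.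
  exists (- t); first by rewrite oppr_gt0.
  by move=> s /andP[_]; rewrite subrr => s0; rewrite !clock_neg// ltW.
have [mt|tm] := leP m.+1%:R t.
  by exists 1 => // s /andP[ts _]; rewrite !clock_max// (le_trans mt).
have Mt0 : 0 <= m.+1%:R * t by rewrite mulr_ge0.
have /andP[h1 h2] := truncn_itv Mt0.
pose del := Num.min (m.+1%:R - t) (((Num.truncn (m.+1%:R * t)).+1%:R - m.+1%:R * t) / m.+1%:R).
exists del; first by rewrite lt_min subr_gt0 tm/= divr_gt0// subr_gt0.
move=> s /andP[ts]; rewrite -ltrBlDl lt_min ltrD2r => /andP[sm].
rewrite ltr_pdivlMr// mulrBl ltrBlDr [t * _]mulrC subrK => sh.
have s0 := le_trans t0 ts.
rewrite /clock !max_r// !min_l ?(ltW sm) ?(ltW tm)//; apply/eqP; rewrite truncn_eq ?mulr_ge0//.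
by rewrite (le_trans h1) ?ler_wpM2l//= mulrC.
Qed.

Lemma clock_left m t : exists2 del, 0 < del & exists k, forall s, t - del < s < t -> clock m s = k.
Proof.
have [t0|t0] := leP t 0.
  exists 1 => //; exists 0%N => s /andP[_ st]; rewrite clock_neg// (le_trans (ltW st)) //.
have [mt|tm] := ltP m.+1%:R t.
  exists (t - m.+1%:R); first by rewrite subr_gt0.
  by exists (m.+1 * m.+1)%N => s /andP[+ _]; rewrite subKr => ms; rewrite clock_max// ltW.
have Mt0 : 0 < m.+1%:R * t by rewrite mulr_gt0.
have [k] : exists k : nat, k%:R < m.+1%:R * t <= k.+1%:R.
  have [j /andP[j1 j2]] := nat_ceil (ltW Mt0).
  have : 0 < j%:R :> R by exact: lt_le_trans j1.
  rewrite ltr0n; case: j j1 j2 => // k k1 k2 _; exists k.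
  by rewrite k1 andbT; move: k2; rewrite -natr1 ltrD2r.
move=> /andP[k1 k2]; exists (t - k%:R / m.+1%:R); first by rewrite subr_gt0 ltr_pdivrMr// mulrC.
exists k => s /andP[]; rewrite subKr => ks st.
have s0 : 0 <= s by apply: le_trans (ltW ks); rewrite divr_ge0.
rewrite /clock max_r// min_l; last by rewrite (le_trans (ltW st)).
apply/eqP; rewrite truncn_eq ?mulr_ge0//; apply/andP; split.
  by rewrite mulrC -ler_pdivrMr// ltW.
by apply: lt_le_trans k2; rewrite ltr_pM2l.
Qed.

Definition step_fun (m : nat) (v : {ffun 'I_(m.+1 * m.+1).+1 * 'I_d -> int}) (t : R) : 'rV[R]_d :=
  \row_i ((v (Ordinal (clock_lt m t), i))%:~R / m.+1%:R).

Lemma step_fun_clock m (v : {ffun 'I_(m.+1 * m.+1).+1 * 'I_d -> int}) s t : clock m s = clock m t -> step_fun v s = step_fun v t.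
Proof.
move=> E; apply/rowP => i; rewrite !mxE; congr ((v (_, i))%:~R / _).
exact/val_inj.
Qed.

Lemma step_fun_cadlag m (v : {ffun 'I_(m.+1 * m.+1).+1 * 'I_d -> int}) : cadlag (@step_fun m v).
Proof.
split=> [t t0|t|t].
- by apply: step_fun_clock; rewrite !clock_neg// ltW.
- have [del del0 H] := clock_right m t.
  apply: cvg_near_cst; rewrite /at_right near_withinE; apply/nbhs_ballP; exists del => //= s ts st.
  apply: step_fun_clock; apply: H; rewrite (ltW st)/= -ltrBlDl.
  by apply: le_lt_trans ts; rewrite distrC ler_norm.
- have [del del0 [k H]] := clock_left m t.
  apply/cvg_ex; exists (step_fun v (t - del / 2)).
  apply: cvg_near_cst; rewrite /at_left near_withinE; apply/nbhs_ballP; exists del => //= s ts st.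
  apply: step_fun_clock; rewrite !H//.
    by rewrite ltrD2l ltrN2 ltr_pdivrMr// ltr_pMr// ltr1n/= ltrBlDr ltrDl divr_gt0.
  rewrite st andbT ltrBlDr -ltrBlDl.
  by apply: le_lt_trans ts; rewrite ler_norm.
Qed.

Definition step_path m (v : {ffun 'I_(m.+1 * m.+1).+1 * 'I_d -> int}) : skorokhod 'rV[R]_d := Skorokhod (@step_fun_cadlag m v).

(* Finitely many sampling times and a grid of values: what is recorded takes
   countably many values, which makes every function of it measurable. *)
Definition path_code (m : nat) (x : R -> 'rV[R]_d) : {ffun 'I_(m.+1 * m.+1).+1 * 'I_d -> int} :=
  [ffun ki : 'I_(m.+1 * m.+1).+1 * 'I_d => Num.floor (m.+1%:R * x ((ki.1 : nat)%:R / m.+1%:R) 0 ki.2)].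

Lemma step_path_near m (x : R -> 'rV[R]_d) t : 0 <= t -> t <= m.+1%:R ->
  `|step_fun (path_code m x) t - x (grid m t)| <= m.+1%:R^-1.
Proof.
move=> t0 tm; apply: row_norm_le => [|i]; first by rewrite invr_ge0.
rewrite !mxE ffunE /=.
rewrite clock_grid//; set y := x _ 0 i.
have /andP[h1 h2] := floor_itv (m.+1%:R * y).
rewrite -(ler_pM2r (ltr0Sn R m)) mulVf// -[X in _ * X]ger0_norm// -normrM mulrBl divfK//.
by rewrite [y * _]mulrC ler_norml; move: h1 h2; rewrite intrD => h1 h2; apply/andP; split; lra.
Qed.

Lemma step_path_cvg (x : skorokhod 'rV[R]_d) (f : skorokhod 'rV[R]_d -> R) : continuous f ->
  f (step_path (path_code m x)) @[m --> \oo] --> f x.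
Proof.
move=> cf; apply/cvgrPdist_lt => e e0.
have /cvgrPdist_lt/(_ e e0) : f y @[y --> x] --> f x by exact: cf.
move=> [[T del] /= del0 H].
have d20 : 0 < del / 2 by rewrite divr_gt0.
have [M0 HM] := grid_time_change (path_cadlag x) d20 T.
exists (maxn M0 (maxn (Num.truncn (del / 2)^-1) (Num.truncn T))) => // m /=.
rewrite !geq_max => /and3P[mM md mT]; apply: H.
have [lam tlam Hlam] := HM m mM; exists lam => // t tT.
have [h1 h2] := Hlam t tT; have /andP[t0 tT'] := tT.
have m2 : m.+1%:R^-1 < del / 2.
  rewrite -[ltRHS]invrK ltf_pV2 ?posrE ?invr_gt0//.
  by apply: truncn_lt.
split; first by apply: (le_lt_trans h1); apply: (lt_trans m2); rewrite ltr_pdivrMr// ltr_pMr// ltr1n.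
have tm : t <= m.+1%:R.
  apply: (le_trans tT'); apply: (le_trans (ltW (truncnS_gt T))).
  by rewrite ler_nat.
have h3 := step_path_near x t0 tm.
rewrite /= -(subrKA (x (grid m t))); apply: le_lt_trans (ler_normD _ _) _.
by rewrite [ltRHS]splitr ltrD// (le_lt_trans h3).
Qed.

Lemma mfun_countable dd (U : measurableType dd) (I : countType) (q : U -> I) (h : I -> R) :
  (forall i, measurable (q @^-1` [set i])) -> mfun (fun w => h (q w)).
Proof.
move=> mq.
pose phi k (_ : U) := if (unpickle k : option I) is Some i then h i else 0.
rewrite (_ : (fun w => _) = (fun w => phi (pickle (q w)) w)); last first.
  by apply/funext => w; rewrite /phi pickleK.
apply: mfun_pieces => [k|k]; last by rewrite /phi; case: (unpickle k) => [i|]; exact: measurable_cst.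
have [[i ik]|nk] := pselect (exists i : I, pickle i = k).
  rewrite (_ : _ @^-1` _ = q @^-1` [set i])//.
  apply/seteqP; split=> w /=; last by move=> ->.
  by rewrite -ik; exact: (pcan_inj pickleK).
rewrite (_ : _ @^-1` _ = set0)//; apply/seteqP; split=> w //= E; apply: nk.
by exists (q w).
Qed.

(** By [step_path_cvg], f is the pointwise limit of its values at step paths read off from
    [path_code]. These take countably many values, on events that involve finitely many
    coordinates. *)
Lemma skorokhod_continuous_mfun dd (U : measurableType dd) (Z : U -> skorokhod 'rV[R]_d)
    (f : skorokhod 'rV[R]_d -> R) :
  (forall (g : 'rV[R]_d -> R) t, continuous g -> 0 <= t -> mfun (fun w => g (Z w t))) ->
  continuous f -> mfun (fun w => f (Z w)).
Proof.
move=> Zm cf; apply: (@measurable_fun_cvg _ _ _ _ (fun m w => f (step_path (path_code m (Z w))))).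
  move=> m; apply: (mfun_countable (q := fun w => path_code m (Z w)) (fun v => f (step_path v))) => v.
  rewrite (_ : _ @^-1` _ = \bigcap_(ki in [set: 'I_(m.+1 * m.+1).+1 * 'I_d])
     [set w | (v ki)%:~R <= m.+1%:R * Z w ((ki.1 : nat)%:R / m.+1%:R) 0 ki.2 < (v ki + 1)%:~R]); last first.
    apply/seteqP; split=> w /=.
      by move=> <- ki _; rewrite ffunE; exact: floor_itv.
    move=> H; apply/ffunP => ki; rewrite ffunE; apply/eqP; rewrite floor_eq; exact: H.
  apply: fin_bigcap_measurable => // ki _.
  have mz : mfun (fun w => m.+1%:R * Z w ((ki.1 : nat)%:R / m.+1%:R) 0 ki.2).
    apply: measurable_funM => //; apply: (Zm (fun x => x 0 ki.2)); last by rewrite divr_ge0.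
    exact: coord_continuous.
  rewrite (_ : [set w | _] = [set w | (v ki)%:~R <= m.+1%:R * Z w ((ki.1 : nat)%:R / m.+1%:R) 0 ki.2] `&`
     [set w | m.+1%:R * Z w ((ki.1 : nat)%:R / m.+1%:R) 0 ki.2 < (v ki + 1)%:~R])%classic.
    by apply: measurableI; [exact: measurable_ge_cst|exact: measurable_lt_cst].
  by apply/seteqP; split=> w /= => [/andP[]|[-> ->]].
by move=> w _; exact: step_path_cvg.
Qed.

End step_paths.

(** * Limits along an ultrafilter *)

Section separation.
Context (R : realType) (V : pseudoMetricNormedZmodType R) (O : set V).

(** The distance to the complement of O, capped at 1; the element 1 keeps the infimum meaningful
    when the complement is empty. Open sets become positivity sets of continuous functions. *)
Definition separator (x : V) : R := inf ([set 1] `|` [set `|x - y| | y in ~` O]).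

Let bounded x : has_inf ([set 1] `|` [set `|x - y| | y in ~` O]).
Proof.
split; first by exists 1; left.
by exists 0 => z [->//|[y _ <-]].
Qed.

Lemma separator_ge0 x : 0 <= separator x.
Proof. by apply: lb_le_inf; [exists 1; left|move=> z [->//|[y _ <-]]]. Qed.

Lemma separator_le1 x : separator x <= 1.
Proof. by apply: ge_inf; [case: (bounded x)|left]. Qed.

Lemma separator_off x : ~ O x -> separator x = 0.
Proof.
move=> nOx; apply/eqP; rewrite eq_le separator_ge0 andbT; apply: ge_inf; first by case: (bounded x).
by right; exists x => //; rewrite subrr normr0.
Qed.

Lemma separator_on x : open O -> O x -> 0 < separator x.
Proof.
move=> oO Ox; have /nbhs_ballP[e /= e0 H] : nbhs x O by exact: open_nbhs_nbhs.
apply: (@lt_le_trans _ _ (Num.min 1 e)); first by rewrite lt_min ltr01.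
apply: lb_le_inf; first by exists 1; left.
move=> z [->|[y nOy <-]]; first by rewrite ge_min lexx.
rewrite ge_min; apply/orP; right; rewrite leNgt; apply/negP => xy; apply: nOy; apply: H.
by rewrite -ball_normE.
Qed.

Lemma separatorE x : open O -> (0 < separator x) = (x \in O).
Proof.
move=> oO; apply/idP/idP => [h|/set_mem]; last exact: separator_on.
by rewrite inE; apply: contrapT => /separator_off E; rewrite E ltxx in h.
Qed.

Let separator_lip x y : separator x <= separator y + `|x - y|.
Proof.
rewrite -lerBlDr; apply: lb_le_inf; first by exists 1; left.
move=> z [->|[v nOv <-]].
  by rewrite lerBlDr (le_trans (separator_le1 x))// lerDl.
rewrite lerBlDr; apply: le_trans (_ : `|x - v| <= _).
  by apply: ge_inf; [case: (bounded x)|right; exists v].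
by rewrite [leRHS]addrC -(subrKA y); exact: ler_normD.
Qed.

Lemma separator_continuous : continuous separator.
Proof.
move=> x; apply/cvgrPdist_lt => e e0; apply/nbhs_ballP; exists e => // y; rewrite -ball_normE /= => xy.
apply: le_lt_trans xy; rewrite ler_norml; have := separator_lip x y; have := separator_lip y x.
by rewrite [`|y - x|]distrC => h1 h2; apply/andP; split; lra.
Qed.

End separation.

Section stable_sequences.
Context (R : realType) (d : nat) (U : free_ultrafilter).
Notation FU := (free_sets U).
Implicit Types z : nat -> skorokhod 'rV[R]_d.
#[local] Existing Instance free_ultra.

(** The S-continuity of nonstandard analysis, at finite times: a bounded start, and for each e a
    modulus of continuity that serves U-most n. *)
Definition stable z := (exists K, \forall n \near FU, `|z n 0| <= K) /\
  forall T e : R, 0 < e -> exists2 del : R, 0 < del & \forall n \near FU, forall s t,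
    s <= T -> t <= T -> `|s - t| < del -> `|z n s - z n t| <= e.

Definition limit_fun z (t : R) : 'rV[R]_d := \row_i ulim FU (fun n => z n t 0 i).

Section fixed_sequence.
Context (z : nat -> skorokhod 'rV[R]_d) (sz : stable z).

Let FF : ProperFilter FU.
Proof. by have := free_ultra U; case. Qed.

Lemma stable_bounded T : exists K, \forall n \near FU, forall t, t <= T -> `|z n t| <= K.
Proof.
have [[K HK] mod] := sz; have [del del0 Hd] := mod T 1 ltr01.
pose T' := Num.max 0 T; have T'0 : 0 <= T' by rewrite le_max lexx.
pose N := (Num.truncn (T' / (del / 2))).+1.
exists (K + N%:R); apply: filterS2 HK Hd => n hK hd t tT.
have del20 : 0 < del / 2 by rewrite divr_gt0.
have step k : forall t, t <= T -> t <= k%:R * (del / 2) -> `|z n t| <= K + k%:R.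
  elim: k => [|k IH] s sT.
    rewrite mul0r addr0 le_eqVlt => /predU1P[->//|s0].
    by have [neg _ _] := path_cadlag (z n); rewrite neg.
  move=> sk; have [sk'|ks'] := leP s (k%:R * (del / 2)).
    by apply: (le_trans (IH s sT sk')); rewrite lerD2l ler_nat.
  have s'T : s - del / 2 <= T by rewrite (le_trans _ sT)// gerBl ltW.
  have s'k : s - del / 2 <= k%:R * (del / 2).
    by rewrite lerBlDr; apply: (le_trans sk); rewrite -natr1 mulrDl mul1r.
  have h1 := IH _ s'T s'k.
  have h2 : `|z n s - z n (s - del / 2)| <= 1.
    apply: hd => //; rewrite opprB addrC subrK ger0_norm ?ltW//.
    by rewrite ltr_pdivrMr// ltr_pMr// ltr1n.
  rewrite -natr1 addrA -(subrK (z n (s - del / 2)) (z n s)) addrC.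
  by apply: le_trans (ler_normD _ _) _; exact: lerD.
apply: step => //; apply: (@le_trans _ _ T').
  by rewrite /T' le_max tT orbT.
by rewrite -ler_pdivrMr// ltW// truncnS_gt.
Qed.

Lemma limit_coord t i : z n t 0 i @[n --> FU] --> limit_fun z t 0 i.
Proof.
have [K HK] := stable_bounded t; rewrite mxE; apply: (@ulimP _ _ _ _ K).
by apply: filterS HK => n h; apply: le_trans (row_norm_ge _ _) (h t (lexx t)).
Qed.

Lemma limit_point t e : 0 < e -> \forall n \near FU, `|z n t - limit_fun z t| <= e.
Proof.
move=> e0; have : \forall n \near FU, forall i, `|z n t 0 i - limit_fun z t 0 i| <= e.
  apply: near_fintype => i; have /cvgrPdist_le/(_ e e0) := @limit_coord t i.
  by apply: filterS => n; rewrite distrC.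
apply: filterS => n h; apply: row_norm_le => [|i]; first exact: ltW.
by rewrite !mxE; have := h i; rewrite mxE.
Qed.

Lemma limit_modulus T e : 0 < e -> exists2 del : R, 0 < del & forall s t,
  s <= T -> t <= T -> `|s - t| < del -> `|limit_fun z s - limit_fun z t| <= e.
Proof.
move=> e0; have e20 : 0 < e / 2 by rewrite divr_gt0.
have e40 : 0 < e / 4 by rewrite divr_gt0.
have [_ mod] := sz; have [del del0 Hd] := mod T (e / 2) e20.
exists del => // s t sT tT st.
have HH := @filterI _ FU _ _ _ Hd (@filterI _ FU _ _ _ (limit_point s e40) (limit_point t e40)).
have [n [h [h1 h2]]] := @filter_ex _ FU _ _ (HH _ _).
have h3 := h s t sT tT st.
rewrite (_ : _ - _ = (limit_fun z s - z n s) + (z n s - z n t) + (z n t - limit_fun z t)); last first.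
  by rewrite subrKA subrKA.
apply: le_trans (ler_normD _ _) _; apply: le_trans (lerD (ler_normD _ _) (lexx _)) _.
by rewrite [`|limit_fun z s - _|]distrC; move: h1 h2 h3; lra.
Qed.

Lemma limit_continuous : continuous (limit_fun z).
Proof.
move=> t; apply/cvgrPdist_le => e e0; have [del del0 H] := limit_modulus (t + 1) e0.
apply/nbhs_ballP; exists (Num.min 1 del) => /=; first by rewrite lt_min ltr01.
move=> s /=; rewrite lt_min => /andP[ts1 tsd].
apply: H => //; first by rewrite lerDl.
by rewrite -lerBlDl; apply: ltW; apply: le_lt_trans ts1; rewrite distrC ler_norm.
Qed.

Lemma limit_cadlag : cadlag (limit_fun z).
Proof.
split=> [t t0|t|t].
- apply/rowP => i; rewrite !mxE; congr ulim; apply/funext => n.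
  by have [neg _ _] := path_cadlag (z n); rewrite neg.
- by apply: cvg_at_right_filter; exact: limit_continuous.
- by apply/cvg_ex; exists (limit_fun z t); apply: cvg_at_left_filter; exact: limit_continuous.
Qed.

(** Equicontinuity reduces the horizon to finitely many grid times, where pointwise convergence is
    enough; each of the three comparisons costs e / 3. *)
Lemma limit_uniform T e : 0 < e -> \forall n \near FU, forall t, t <= T -> `|z n t - limit_fun z t| <= e.
Proof.
move=> e0; have e30 : 0 < e / 3 by rewrite divr_gt0.
have [_ mod] := sz; have [del del0 Hd] := mod T (e / 3) e30.
have [del' del'0 Hl] := limit_modulus T e30.
pose h := Num.min del del' / 2; have h0 : 0 < h by rewrite divr_gt0// lt_min del0.
have hdel : h < del.
  by rewrite ltr_pdivrMr// gt_min ltr_pMr// ltr1n.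
have hdel' : h < del'.
  by rewrite ltr_pdivrMr// gt_min; apply/orP; right; rewrite ltr_pMr// ltr1n.
pose N := (Num.truncn (T / h)).+1.
have grid : \forall n \near FU, forall j : 'I_N, `|z n (j%:R * h) - limit_fun z (j%:R * h)| <= e / 3.
  by apply: near_fintype => j; exact: limit_point.
have [T0|T0] := ltP T 0.
  have := limit_point T e0; apply: filterS => n hn t tT.
  have [neg _ _] := path_cadlag (z n); have [neg' _ _] := limit_cadlag.
  by rewrite neg ?(le_lt_trans tT)// neg' ?(le_lt_trans tT)// -(neg _ T0) -(neg' _ T0).
apply: filterS2 Hd grid => n hd hg t tT.
wlog t0 : t tT / 0 <= t.
  move=> H; have [t0|t0] := leP 0 t; first exact: H.
  have [neg _ _] := path_cadlag (z n); have [neg' _ _] := limit_cadlag.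
  by rewrite neg// neg'//; apply: H.
have /andP[k1 k2] : (Num.truncn (t / h))%:R <= t / h < (Num.truncn (t / h)).+1%:R.
  by apply: truncn_itv; rewrite divr_ge0// ltW.
rewrite ler_pdivlMr// in k1; rewrite ltr_pdivrMr// in k2.
have kN : (Num.truncn (t / h) < N)%N.
  by rewrite ltnS; apply: le_truncn; rewrite ler_pM2r// invr_gt0.
set tk := (Num.truncn (t / h))%:R * h in k1.
have ttk : `|t - tk| <= h.
  rewrite ger0_norm ?subr_ge0// lerBlDl ltW//; move: k2; rewrite -natr1 mulrDl mul1r.
  by [].
have tkT := le_trans k1 tT.
have h1 := hg (Ordinal kN); rewrite /= -/tk in h1.
have h2 := hd t tk tT tkT (le_lt_trans ttk hdel).
have h3 := Hl t tk tT tkT (le_lt_trans ttk hdel').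
rewrite (_ : _ - _ = (z n t - z n tk) + (z n tk - limit_fun z tk) + (limit_fun z tk - limit_fun z t)); last first.
  by rewrite subrKA subrKA.
apply: le_trans (ler_normD _ _) _; apply: le_trans (lerD (ler_normD _ _) (lexx _)) _.
by rewrite [`|limit_fun z tk - _|]distrC; move: h1 h2 h3; lra.
Qed.

(** g is merely continuous; compactness of [0, T] and continuity of the limit path provide one scale
    for g around all points of the path. *)
Lemma limit_comp (g : 'rV[R]_d -> R) T e : continuous g -> 0 < e ->
  \forall n \near FU, forall t, 0 <= t <= T -> `|g (z n t) - g (limit_fun z t)| <= e.
Proof.
move=> cg e0; have e20 : 0 < e / 2 by rewrite divr_gt0.
pose Q (k : nat) (t : R) := forall y : 'rV[R]_d, `|y - limit_fun z t| <= k.+1%:R^-1 -> `|g y - g (limit_fun z t)| <= e.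
have L : forall t, [set` `[0, T]] t -> \forall t' \near t & k \near \oo, Q k t'.
  move=> t _; have /cvgrPdist_lt/(_ _ e20)/nbhs_ballP[del /= del0 Hdel] := cg (limit_fun z t).
  have del20 : 0 < del / 2 by rewrite divr_gt0.
  have /cvgrPdist_lt/(_ _ del20) nt := @limit_continuous t.
  exists ([set t' | `|limit_fun z t - limit_fun z t'| < del / 2], [set k | (Num.truncn (del / 2)^-1 <= k)%N]).
    by split; [exact: nt|exists (Num.truncn (del / 2)^-1)].
  move=> [t' k] /= [tt' Nk] y yt'.
  have kd : k.+1%:R^-1 < del / 2.
    rewrite -[ltRHS]invrK ltf_pV2 ?posrE ?invr_gt0//.
    by apply: truncn_lt.
  have h1 : `|g (limit_fun z t) - g (limit_fun z t')| < e / 2.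
    apply: Hdel; rewrite -ball_normE /=; apply: (lt_trans tt').
    by rewrite ltr_pdivrMr// ltr_pMr// ltr1n.
  have h2 : `|g (limit_fun z t) - g y| < e / 2.
    apply: Hdel; rewrite -ball_normE /= -(subrKA (limit_fun z t')).
    apply: le_lt_trans (ler_normD _ _) _; rewrite [ltRHS]splitr ltrD//.
    by rewrite distrC (le_lt_trans yt').
  rewrite -(subrKA (g (limit_fun z t))); apply: le_trans (ler_normD _ _) _.
  by rewrite [leRHS]splitr lerD// ltW// distrC.
have [N _ HN] : \forall k \near \oo, [set` `[0, T]] `<=` Q k.
  exact: (iffLR (compact_near_coveringP _) (@segment_compact R 0 T) _ \oo Q _ L).
have N0 : 0 < N.+1%:R^-1 :> R by rewrite invr_gt0.
have := limit_uniform T N0; apply: filterS => n hn t /andP[t0 tT].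
apply: (HN N (leqnn N)); first by rewrite /= in_itv/= t0.
exact: hn.
Qed.

Lemma limit_comp_cvg (g : 'rV[R]_d -> R) t : continuous g -> g (z n t) @[n --> FU] --> g (limit_fun z t).
Proof.
move=> cg; apply/cvgrPdist_le => e e0.
wlog t0 : t / 0 <= t.
  move=> H; have [t0|t0] := leP 0 t; first exact: H.
  have [neg' _ _] := limit_cadlag; rewrite neg'//.
  have := H 0 (lexx 0); apply: filterS => n.
  by have [neg _ _] := path_cadlag (z n); rewrite neg.
have := limit_comp t cg e0; apply: filterS => n /(_ t); rewrite t0 lexx => /(_ isT).
by rewrite distrC.
Qed.

Lemma limit_tint (g : 'rV[R]_d -> R) c t : continuous g -> (forall x, `|g x| <= c) -> 0 <= t ->
  tint t (fun s => g (z n s)) @[n --> FU] --> tint t (fun s => g (limit_fun z s)).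
Proof.
move=> cg gc t0; apply/cvgrPdist_le => e e0.
have e10 : 0 < e / (t + 1) by rewrite divr_gt0// ltr_wpDl.
have := limit_comp t cg e10; apply: filterS => n hn.
have bm (x : R -> 'rV[R]_d) : cadlag x -> bmeas (fun s => g (x s)).
  move=> cx; split; last by exists c => s; exact: gc.
  apply: (@jmeas_path _ unit R (fun _ s => g (x s)) tt).
  apply: jmeas_cadlag => [s _|_]; first exact: measurable_cst.
  exact: cadlag_comp cg cx.
have := @tint_increment_local R (fun s => g (limit_fun z s)) (fun s => g (z n s)) (e / (t + 1)) 0 t
  (bm _ limit_cadlag) (bm _ (path_cadlag (z n))) (lexx 0) t0.
rewrite !tint0 !subr0 => H; apply: (le_trans (H _)) => [v vt|]; first by rewrite distrC; exact: hn.
by rewrite mulrAC ler_pdivrMr ?ltr_wpDl// ler_pM2l// lerDl.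
Qed.

Definition limit_path : cpath 'rV[R]_d := @CPath R _ (Skorokhod limit_cadlag) limit_continuous.

Lemma limit_skorokhod (f : skorokhod 'rV[R]_d -> R) : continuous f ->
  f (z n) @[n --> FU] --> f limit_path.
Proof.
move=> cf; apply/cvgrPdist_le => e e0.
have /cvgrPdist_le/(_ e e0) : f y @[y --> (limit_path : skorokhod 'rV[R]_d)] --> f limit_path by exact: cf.
move=> [[T del] /= del0 H]; have del20 : 0 < del / 2 by rewrite divr_gt0.
have := limit_uniform T del20; apply: filterS => n hn; apply: H.
exists id; first exact: time_change_id.
move=> t /andP[t0 tT]; rewrite subrr normr0; split=> //=.
by apply: le_lt_trans (hn t tT) _; rewrite ltr_pdivrMr// ltr_pMr// ltr1n.
Qed.

End fixed_sequence.

End stable_sequences.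

(** * The limit process on the Loeb space *)

Section time_average.
Context d (T : measurableType d) (R : realType) (P : probability T R).
Notation lam := (@lebesgue_measure R).

Lemma expct_tint (X : T -> R -> R) C t : jmeas X -> (forall w s, 0 <= X w s <= C) ->
  expct P (fun w => tint t (X w)) = tint t (fun s => expct P (X ^~ s)).
Proof.
move=> mX XC; have mt : measurable (`[0, t]%classic : set R) by exact: measurable_itv.
pose phi (p : T * measurableTypeR R) : \bar R := (\1_`[0, t] p.2 * X p.1 p.2)%:E.
have phi0 p : (0 <= phi p)%E.
  by rewrite lee_fin mulr_ge0//; have /andP[] := XC p.1 p.2.
have mphi : measurable_fun setT phi.
  apply/measurable_EFinP; apply: measurable_funM => //.
  by apply: measurableT_comp => //; exact: measurable_indic.
have XC' w s : `|X w s| <= C by have /andP[h1 h2] := XC w s; rewrite ger0_norm.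
have E1 w : (\int[lam]_s phi (w, s) = (tint t (X w))%:E)%E.
  have ib := bounded_integrable_itv true 0 t (jmeas_path w mX) (XC' w).
  rewrite /tint /Rintegral fineK; last exact: integrable_fin_num ib.
  rewrite [RHS]integral_mkcond; apply: eq_integral => s _.
  by rewrite patchE /phi/= indicE; case: ifPn => _; rewrite ?mul1r ?mul0r.
have mXs s : mfun (X ^~ s).
  by apply: (@measurableT_comp _ _ _ _ _ _ (fun p : T * measurableTypeR R => X p.1 p.2) _ (fun w => (w, s))).
have E2 s : (\int[P]_w phi (w, s) = (\1_`[0, t] s * expct P (X ^~ s))%:E)%E.
  have iX : intg P (fun w => \1_`[0, t] s * X w s) by apply: intgZ; apply: (@intg_bnd _ _ _ _ _ C); [exact: mXs|move=> w; exact: XC'].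
  rewrite -(expctZ (\1_`[0, t] s)); last by apply: (@intg_bnd _ _ _ _ _ C); [exact: mXs|move=> w; exact: XC'].
  by rewrite EFin_expct.
have := @fubini_tonelli _ _ T (measurableTypeR R) R P lam phi mphi phi0.
have A1 : (\int[P]_w (tint t (X w))%:E = \int[P]_w \int[lam]_s phi (w, s))%E.
  by apply: eq_integral => w _; rewrite E1.
have A2 : (\int[lam]_s \int[P]_w phi (w, s) = \int[lam]_s (\1_`[0, t] s * expct P (X ^~ s))%:E)%E.
  by apply: eq_integral => s _; rewrite E2.
move=> fub; rewrite [LHS]/expct /Rintegral A1 fub A2.
rewrite /tint /Rintegral [in RHS]integral_mkcond; congr fine; apply: eq_integral => s _.
by rewrite patchE indicE; case: ifPn => _; rewrite ?mul1r ?mul0r.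
Qed.

End time_average.

Section time_integral_limits.
Context (R : realType).
Notation lam := (@lebesgue_measure R).

Lemma tint_le (g h : R -> R) t : bmeas g -> bmeas h -> (forall s, g s <= h s) -> tint t g <= tint t h.
Proof.
move=> [mg [c gc]] [mh [c' hc]] gh; apply: le_Rintegral => //.
- exact: bounded_integrable_itv mg gc.
- exact: bounded_integrable_itv mh hc.
Qed.

Lemma tint_mono (g : R -> R) s t : bmeas g -> (forall v, 0 <= g v) -> 0 <= s -> s <= t -> tint s g <= tint t g.
Proof.
move=> [mg [c gc]] g0 s0 st; rewrite -subr_ge0 /tint Rintegral_itvB; try by rewrite bnd_simp.
  by apply: Rintegral_ge0.
exact: bounded_integrable_itv mg gc.
Qed.

(** Convergence is asked at positive times only: the initial point may be 0 with positive
    probability, and a single time is Lebesgue-null. *)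
Lemma tint_dct (g_ : nat -> R -> R) (g : R -> R) c t : (forall k, measurable_fun setT (g_ k)) ->
  (forall k s, `|g_ k s| <= c) -> (forall s, 0 < s -> g_ k s @[k --> \oo] --> g s) ->
  measurable_fun setT g ->
  tint t (g_ k) @[k --> \oo] --> tint t g.
Proof.
move=> mg_ gc gg mg; have c0 : 0 <= c := le_trans (normr_ge0 _) (gc 0%N 0).
have ic : lam.-integrable `[0, t] (EFin \o (cst c)).
  by apply: (@bounded_integrable_itv _ _ c) => // x; rewrite /= ger0_norm.
have [] := @dominated_convergence _ _ R lam `[0, t]%classic _ (fun k => EFin \o g_ k) (EFin \o g) (EFin \o cst c).
- exact: measurable_itv.
- by move=> k; apply/measurable_EFinP; apply: measurable_funTS; exact: mg_.
- by apply/measurable_EFinP; apply: measurable_funTS; exact: mg.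
- exists [set 0]; split; [exact: measurable_set1|exact: lebesgue_measure_set1|].
  move=> s /= H; apply: contrapT => s0; apply: H; rewrite in_itv/= => /andP[s0' _].
  apply/cvg_EFin; first exact: nearW.
  by apply: gg; rewrite lt_neqAle s0' andbT; apply/eqP => /esym.
- exact: ic.
- by apply: aeW => s k _ /=; rewrite lee_fin.
move=> ig _ cv; rewrite /tint /Rintegral; apply: fine_cvg; rewrite fineK//.
exact: integrable_fin_num.
Qed.

End time_integral_limits.

Section zero_bump.
Context (R : realType) (V : normedModType R).

Definition bump (k : nat) (x : V) : R := 1 - damp k x.

Lemma bump01 k x : 0 <= bump k x <= 1.
Proof. by have /andP[h1 h2] := damp01 k x; rewrite /bump subr_ge0 h2 gerBl. Qed.

Lemma bump_continuous k : continuous (bump k).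
Proof. by move=> x; apply: cvgB; [exact: cvg_cst|exact: damp_continuous]. Qed.

Lemma bump_off k x : k.+1%:R^-1 <= `|x| -> bump k x = 0.
Proof.
move=> h; rewrite /bump /damp min_l ?subrr//.
by rewrite -ler_pdivrMl// mulr1.
Qed.

Lemma smoothen_dist (g : V -> R) c k x : (forall y, `|g y| <= c) -> `|g x - smoothen g k x| <= 2 * c * bump k x.
Proof.
move=> gc; have -> : g x - smoothen g k x = (g x - g 0) * bump k x by rewrite /smoothen /bump; ring.
have /andP[b0 _] := bump01 k x.
rewrite normrM (ger0_norm b0) ler_wpM2r//; apply: le_trans (ler_normB _ _) _.
by rewrite mulr_natl mulr2n lerD.
Qed.

End zero_bump.

Lemma sigma_algebra_preimage (T1 T2 : Type) (h : T1 -> T2) (S : set (set T1)) :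
  sigma_algebra [set: T1] S -> sigma_algebra [set: T2] [set A | S (h @^-1` A)].
Proof.
move=> [S0 SD SU]; split => /=.
- by rewrite preimage_set0.
- by move=> A SA; rewrite setTD preimage_setC -setTD; exact: SD.
- by move=> A SA; rewrite preimage_bigcup; exact: SU.
Qed.

Section modulus.
Context (R : realType) (d : nat).

Lemma enorm_le_row (x : 'rV[R]_d) : `|x| <= enorm x.
Proof. by apply: row_norm_le => [|i]; [exact: enorm_ge0|exact: coord_enorm]. Qed.

Lemma enorm_ge_row (x : 'rV[R]_d) : enorm x <= d%:R * `|x|.
Proof.
rewrite -ler_sqr ?nnegrE ?enorm_ge0 ?mulr_ge0// enorm_sqr.
apply: (@le_trans _ _ (\sum_(i < d) `|x| ^+ 2)).
  apply: ler_sum => i _; rewrite -[leLHS]real_normK ?num_real// ler_sqr ?nnegrE//; exact: row_norm_ge.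
rewrite sumr_const card_ord exprMn -[leLHS]mulr_natl ler_wpM2r ?sqr_ge0//.
case: d => [|k]; first by rewrite expr0n.
by rewrite expr2 ler_peMr// ler1n.
Qed.

(** Times closer than the length of a block lie in the same block or in adjacent ones, so at most
    three comparisons with left ends of blocks occur, each at cost 2 aa. *)
Lemma rough_modulus dd (Om : measurableType dd) (Z : Om -> skorokhod 'rV[R]_d) (S aa : R) N w s t :
  0 < S -> 0 < aa -> (0 < N)%N -> ~ rough Z S aa N w -> s <= S -> t <= S -> `|s - t| < S / N%:R ->
  `|Z w s - Z w t| <= 6 * aa.
Proof.
move=> S0 aa0 N0 nr; have N0R : 0 < N%:R :> R by rewrite ltr0n.
pose h := S / N%:R; have h0 : 0 < h by rewrite divr_gt0.
have aa6 : 0 <= 6 * aa by rewrite mulr_ge0// ltW.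
have hN : N%:R * h = S by rewrite /h mulrC divfK// gt_eqF.
have blk k v i : (k < N)%N -> k%:R * h <= v <= k.+1%:R * h -> `|Z w v 0 i - Z w (k%:R * h) 0 i| <= 2 * aa.
  move=> kN vb; rewrite leNgt; apply/negP => vv; apply: nr.
  by exists (Ordinal kN, i); exists v.
suff H v v' i : 0 <= v -> v <= v' -> v' <= S -> v' - v < h -> `|Z w v 0 i - Z w v' 0 i| <= 6 * aa.
  have H' v v' : 0 <= v -> v <= v' -> v' <= S -> v' - v < h -> `|Z w v - Z w v'| <= 6 * aa.
    by move=> v0 vv v'S vh; apply: row_norm_le => // i; rewrite !mxE; exact: H.
  have max0 v : Z w v = Z w (Num.max 0 v).
    have [v0|v0] := leP 0 v; first by [].
    by have [neg _ _] := path_cadlag (Z w); rewrite neg.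
  have maxS v : v <= S -> Num.max 0 v <= S by move=> vS; rewrite ge_max (ltW S0).
  have max00 (v : R) : 0 <= Num.max 0 v by rewrite le_max lexx.
  have maxle (v v' : R) : v <= v' -> Num.max 0 v <= Num.max 0 v' /\ Num.max 0 v' - Num.max 0 v <= v' - v.
    by move=> vv; case: (leP 0 v) => v0; case: (leP 0 v') => v'0; split; lra.
  move=> sS tS st; rewrite (max0 s) (max0 t).
  have [ste|ts] := leP s t.
    have [m1 m2] := maxle _ _ ste; apply: H' => //; first exact: maxS.
    by apply: le_lt_trans m2 _; apply: le_lt_trans st; rewrite distrC; exact: ler_norm.
  have [m1 m2] := maxle _ _ (ltW ts); rewrite distrC; apply: H' => //; first exact: maxS.
  by apply: le_lt_trans m2 _; apply: le_lt_trans st; exact: ler_norm.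
move=> v0 vv' v'S vh.
have /andP[k1 k2] : (Num.truncn (v / h))%:R <= v / h < (Num.truncn (v / h)).+1%:R.
  by apply: truncn_itv; rewrite divr_ge0// ltW.
set k := Num.truncn (v / h) in k1 k2.
rewrite ler_pdivlMr// in k1; rewrite ltr_pdivrMr// in k2.
have [kN|Nk] := ltnP k N; last first.
  have : N%:R * h <= k%:R * h by rewrite ler_pM2r// ler_nat.
  rewrite hN => Sk; have -> : v' = v by apply/eqP; rewrite eq_le vv' andbT (le_trans v'S)// (le_trans Sk).
  by rewrite subrr normr0.
have b1 := blk k v i kN; rewrite k1 (ltW k2) in b1; have {}b1 := b1 isT.
have [v'k|kv'] := leP v' (k.+1%:R * h).
  have b2 := blk k v' i kN; rewrite (le_trans k1 vv') v'k in b2; have {}b2 := b2 isT.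
  by move: b1 b2; rewrite !ler_norml => /andP[? ?] /andP[? ?]; apply/andP; split; lra.
have k1N : (k.+1 < N)%N.
  by rewrite -(ltr_nat R) -(ltr_pM2r h0) hN (lt_le_trans kv').
have b3 := blk k (k.+1%:R * h) i kN; rewrite lexx ler_pM2r// ler_nat leqnSn in b3; have {}b3 := b3 isT.
have b2 := blk k.+1 v' i k1N; rewrite (ltW kv') in b2.
have v'2 : v' <= k.+2%:R * h.
  move: vh k2; rewrite ltrBlDl -[k.+2%:R]natr1 mulrDl mul1r => vh k2; rewrite (le_trans (ltW vh))// lerD2r ltW//.
have {}b2 := b2 v'2.
by move: b1 b2 b3; rewrite !ler_norml => /andP[? ?] /andP[? ?] /andP[? ?]; apply/andP; split; lra.
Qed.

End modulus.

Lemma dist_chain (R : realDomainType) (x1 x2 x3 x4 p q e : R) : `|x1 - x2| <= p -> `|x2 - x3| <= e -> `|x3 - x4| <= q ->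
  p <= q + e -> `|x1 - x4| <= 2 * q + 2 * e.
Proof. by rewrite !ler_norml => /andP[? ?] /andP[? ?] /andP[? ?] ?; apply/andP; split; lra. Qed.

Lemma dist_increment (R : realFieldType) (x1 x2 x3 x4 y1 y2 y3 y4 p q e : R) :
  `|x1 - x2| <= e / 4 -> `|x3 - x4| <= e / 4 -> `|y1 - y2| <= p + e / 4 -> `|y3 - y4| <= q + e / 4 -> p <= q ->
  `|x3 - x1 - (y3 - y1) - (x4 - x2 - (y4 - y2))| <= 2 * q + e.
Proof. by rewrite !ler_norml => /andP[? ?] /andP[? ?] /andP[? ?] /andP[? ?] ?; apply/andP; split; lra. Qed.

Lemma martingale_bounded dd (T : measurableType dd) (R : realType) (P : probability T R)
    (F : R -> set (set T)) (M : T -> R -> R) (c : R -> R) :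
  adapted F M -> (forall t, 0 <= t -> F t `<=` measurable) -> (forall w t, 0 <= t -> `|M w t| <= c t) ->
  (forall s t E, 0 <= s -> s <= t -> F s E -> expct P (fun w => \1_E w * (M w t - M w s)) = 0) ->
  martingale P F M.
Proof.
move=> adM Fm Mc M0.
have mM t : 0 <= t -> mfun (M ^~ t) by move=> t0 _ B mB; rewrite setTI; apply: (Fm t t0); exact: adM.
have iM t : 0 <= t -> intg P (M ^~ t).
  by move=> t0; apply: (@intg_bnd _ _ _ _ _ (c t)); [exact: mM|move=> w; exact: Mc].
split=> // s t s0 st E FE; have t0 := le_trans s0 st.
have mE := Fm s s0 E FE; have is_ := iM s s0; have it := iM t t0.
rewrite (integral_indicE mE it) (integral_indicE mE is_); congr EFin.
apply/eqP; rewrite -subr_eq0 -expctB; [|exact: intg_mul1|exact: intg_mul1].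
by under [X in expct _ X]eq_fun do rewrite -mulrBr; rewrite M0.
Qed.

Lemma cvg_expct (R : realType) (disp : nat -> measure_display) (Omega : forall n, measurableType (disp n))
    (P : forall n, probability (Omega n) R) (X : forall n, Omega n -> R)
    dd (T : measurableType dd) (Q : probability T R) (Y : T -> R) :
  (forall n, intg (P n) (X n)) -> intg Q Y ->
  (\int[P n]_w (X n w)%:E)%E @[n --> \oo] --> (\int[Q]_w (Y w)%:E)%E <->
  expct (P n) (X n) @[n --> \oo] --> expct Q Y.
Proof.
move=> iX iY; rewrite -(EFin_expct iY).
under eq_fun do rewrite -(EFin_expct (iX _)).
by split=> [/fine_cvg//|h]; apply/cvg_EFin; [exact: nearW|exact: h].
Qed.

Lemma separator_min_continuous (R : realType) (d : nat) (O : set 'rV[R]_d) (c : R) :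
  continuous (fun x : 'rV[R]_d => Num.min 1 (c * separator O x)).
Proof.
move=> x; have h1 : {for x, continuous (cst 1 : 'rV[R]_d -> R)} by exact: (@cst_continuous _ _ (1 : R)).
have h2 : {for x, continuous (fun y => c * separator O y)}.
  have hs : separator O y @[y --> x] --> separator O x := @separator_continuous R _ O x.
  exact: cvgM (cvg_cst _) hs.
exact: continuous_min h1 h2.
Qed.

Section loeb_limit.
Context (R : realType) (d : nat) (U : free_ultrafilter).
Context (disp : nat -> measure_display) (Omega : forall n, measurableType (disp n))
  (P : forall n, probability (Omega n) R) (Z : forall n, Omega n -> skorokhod 'rV[R]_d)
  (F : forall n, R -> set (set (Omega n))).
Arguments Z : clear implicits.
Arguments F : clear implicits.
Hypotheses (Ffil : forall n, filtration (F n))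
  (Z_past : forall n (g : 'rV[R]_d -> R) s t, continuous g -> 0 <= s -> s <= t ->
     measurable_fun [set: g_sigma_algebraType (F n t)] (fun w => g (Z n w s)))
  (Zm : forall n (g : 'rV[R]_d -> R) t, continuous g -> 0 <= t -> mfun (fun w => g (Z n w t)))
  (rough_meas : forall n (T aa : R) N, 0 < T -> (0 < N)%N -> measurable (rough (Z n) T aa N))
  (rough_small : forall T aa eta : R, 0 < T -> 0 < aa -> 0 < eta -> exists N : nat, (0 < N)%N /\
     \forall n \near \oo, prb (P n) (rough (Z n) T aa N) <= eta)
  (start_small : forall eta : R, 0 < eta -> exists K : nat, \forall n \near \oo,
     prb (P n) [set w | K%:R < enorm (Z n w 0)] <= eta)
  (nonzero : forall t eta : R, 0 < t -> 0 < eta -> exists2 e : R, 0 < e & \forall n \near \oo,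
     prb (P n) [set w | enorm (Z n w t) <= e] <= eta).
Notation FU := (free_sets U).
Notation T := (uprod U Omega).
Notation LT := (g_sigma_algebraType (@measurable _ T)).
Notation L := (loeb P : probability LT R).
#[local] Existing Instance free_ultra.
Let FF : ProperFilter FU.
Proof. by have := free_ultra U; case. Qed.

Let upath (w : T) : nat -> skorokhod 'rV[R]_d := fun n => Z n (w n).

Definition start_event K : set LT := internal U (fun n => [set w : Omega n | enorm (Z n w 0) <= K%:R]).
Definition calm_event (p m N : nat) : set LT :=
  internal U (fun n => ~` rough (Z n) p.+1%:R m.+1%:R^-1 N.+1).
(** Countably many conditions that force stability: a bounded start and, for each horizon p + 1 and
    scale 1/(m + 1), a number of blocks for which U-most paths are not rough. *)
Definition regular_event : set LT :=
  (\bigcup_K start_event K) `&` \bigcap_p \bigcap_m \bigcup_N calm_event p m N.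
Notation Gamma := regular_event.

Lemma regular_measurable : measurable Gamma.
Proof.
apply: measurableI.
  apply: bigcupT_measurable => K; apply: measurable_internal => n.
  by apply: measurable_le_cst; apply: Zm => //; exact: enorm_continuous.
apply: bigcapT_measurable => p; apply: bigcapT_measurable => m; apply: bigcupT_measurable => N.
by apply: measurable_internal => n; apply: measurableC; exact: rough_meas.
Qed.

Lemma regular_stable w : Gamma w -> stable U (upath w).
Proof.
move=> [[K _ HK] H]; split.
  by exists K%:R; apply: filterS HK => n; exact: le_trans (enorm_le_row _).
(* [rough_modulus] at scale 1/(m + 1) gives the bound 6/(m + 1). *)
move=> S e e0; pose p := Num.truncn S; pose m := Num.truncn (6 / e).
have [N _ HN] := H p I m I.
have p0 : 0 < p.+1%:R :> R by [].
exists (p.+1%:R / N.+1%:R); first by rewrite divr_gt0.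
apply: filterS HN => n nr s t sS tS st.
have Sp : S <= p.+1%:R by rewrite ltW// truncnS_gt.
have m0 : 0 < m.+1%:R^-1 :> R by rewrite invr_gt0.
have h := rough_modulus p0 m0 (ltn0Sn N) nr (le_trans sS Sp) (le_trans tS Sp) st.
apply: (le_trans h).
rewrite ler_pdivrMr// mulrC -ler_pdivrMr//; exact: ltW (truncnS_gt _).
Qed.

Lemma loeb_le (E : forall n, set (Omega n)) eta : (forall n, measurable (E n)) ->
  (\forall n \near \oo, prb (P n) (E n) <= eta) -> prb L (internal U E) <= eta.
Proof.
move=> mE HE; rewrite loebE//; apply: (@ulim_le_cst _ _ _ _ _ 1).
  by apply: nearW => n; rewrite ger0_norm ?prb_ge0// prb_le1.
exact: free_infty HE.
Qed.

Let null_cup (E : nat -> set LT) : (forall k, measurable (E k)) -> (forall eta : R, 0 < eta -> exists k, prb L (~` E k) <= eta) ->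
  L (~` \bigcup_k E k) = 0%E.
Proof.
move=> mE H; have mU : measurable (~` \bigcup_k E k).
  by apply: measurableC; exact: bigcupT_measurable.
rewrite prb_fin//; congr EFin; apply/eqP; rewrite eq_le prb_ge0 andbT.
apply/ler_addgt0Pr => e e0; rewrite add0r; have [k Hk] := H e e0.
apply: le_trans Hk; apply: prb_le => //; first exact: measurableC.
by move=> w nw Ew; apply: nw; exists k.
Qed.

Lemma regular_full : prb L (~` Gamma) = 0.
Proof.
have mG := regular_measurable.
suff : L.-negligible (~` Gamma).
  by move=> /(negligibleP _ (measurableC mG)) h; rewrite /prb h.
have m0 k : 0 < k.+1%:R^-1 :> R by rewrite invr_gt0.
have msE K : measurable (start_event K).
  by apply: measurable_internal => n; apply: measurable_le_cst; apply: Zm => //; exact: enorm_continuous.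
have mcE p m N : measurable (calm_event p m N).
  by apply: measurable_internal => n; apply: measurableC; exact: rough_meas.
rewrite (_ : ~` Gamma = (~` \bigcup_K start_event K) `|` \bigcup_p \bigcup_m ~` \bigcup_N calm_event p m N); last first.
  by rewrite setCI setC_bigcap; congr setU; apply: eq_bigcupr => p _; rewrite setC_bigcap.
apply: negligibleU.
  apply/negligibleP; first by apply: measurableC; exact: bigcupT_measurable.
  apply: null_cup => // eta eta0; have [K HK] := start_small eta0; exists K.
  rewrite -internalC; apply: loeb_le.
    by move=> n; apply: measurableC; apply: measurable_le_cst; apply: Zm => //; exact: enorm_continuous.
  apply: filterS HK => n; congr (prb _ _ <= _); apply/seteqP; split=> w /=; first by rewrite ltNge => /negP.
  by move/negP; rewrite -ltNge.
apply: negligible_bigcup => p; apply: negligible_bigcup => m.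
apply/negligibleP; first by apply: measurableC; exact: bigcupT_measurable.
apply: null_cup => // eta eta0.
have [[|N] [N0 HN]] := rough_small (ltr0Sn R p) (m0 m) eta0; first by [].
exists N.
rewrite -internalC; apply: loeb_le.
  by move=> n; do 2 apply: measurableC; exact: rough_meas.
by apply: filterS HN => n; rewrite setCK.
Qed.

(** Off the regular event, whose complement is null, the zero path is used, so that every value is a
    continuous path. *)
Definition loeb_path (w : T) : cpath 'rV[R]_d :=
  match pselect (Gamma w) with left g => limit_path (regular_stable g) | right _ => cpath0 _ end.
Notation Phi := loeb_path.

Lemma loeb_pathE w t : Gamma w -> Phi w t = limit_fun U (upath w) t.
Proof. by move=> g; rewrite /loeb_path; case: pselect. Qed.

Lemma expct_regular (X Y : LT -> R) C : mfun X -> mfun Y -> (forall w, `|X w| <= C) -> (forall w, `|Y w| <= C) ->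
  (forall w, Gamma w -> X w = Y w) -> expct L X = expct L Y.
Proof.
move=> mX mY XC YC XY; have iX : intg L X by apply: (@intg_bnd _ _ _ _ _ C).
have iY : intg L Y by apply: (@intg_bnd _ _ _ _ _ C).
apply/eqP; rewrite -subr_eq0 -expctB//.
rewrite (_ : (fun w => _) = (fun w => \1_(~` Gamma) w * (X w - Y w))); last first.
  apply/funext => w; have [g|ng] := pselect (Gamma w).
    by rewrite XY// subrr mulr0.
  by rewrite (indicT R (A := ~` Gamma))// mul1r.
apply/eqP; apply: expct_null; [exact: measurableC regular_measurable|exact: regular_full|exact: intgB].
Qed.

(** Standard parts are measurable for bounded functions only; this allows an unbounded g(Z) to be
    reached as a limit of clipped versions on the regular event. *)
Lemma mfun_regular (X : LT -> R) (X_ : nat -> LT -> R) c : (forall k, mfun (X_ k)) ->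
  (forall w, Gamma w -> X_ k w @[k --> \oo] --> X w) -> (forall w, ~ Gamma w -> X w = c) -> mfun X.
Proof.
move=> mX_ XX Xc; apply: (@measurable_fun_cvg _ _ _ _ (fun k w => \1_Gamma w * X_ k w + (1 - \1_Gamma w) * c)).
  have mG := mfun_indic (R := R) regular_measurable.
  move=> k; apply: measurable_funD; first by apply: measurable_funM; [exact: mG|exact: mX_].
  by apply: measurable_funM; [apply: measurable_funB; [exact: measurable_cst|exact: mG]|exact: measurable_cst].
move=> w _; have [g|ng] := pselect (Gamma w).
  rewrite (indicT R g); under eq_fun do rewrite mul1r subrr mul0r addr0.
  exact: XX.
rewrite (indicF R ng); under eq_fun do rewrite mul0r subr0 mul1r add0r.
by rewrite Xc//; exact: cvg_cst.
Qed.

Lemma loeb_stdpart w (g : 'rV[R]_d -> R) t : Gamma w -> continuous g ->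
  stdpart U (fun n v => g (Z n v t)) w = g (Phi w t).
Proof.
move=> gw cg; rewrite loeb_pathE//; apply: ulim_eq.
exact: (@limit_comp_cvg R d U (upath w) (regular_stable gw) g t cg).
Qed.

Lemma loeb_path_mfun (g : 'rV[R]_d -> R) t : continuous g -> 0 <= t -> mfun (fun w : LT => g (Phi w t)).
Proof.
move=> cg t0; apply: (@mfun_regular _ (fun k => stdpart U (fun n v => clip k%:R (g (Z n v t)))) (g 0)).
- move=> k; apply: (@mfun_stdpart _ _ _ _ _ k%:R).
    by move=> n w; exact: clip_le.
  by move=> n; apply: (Zm (g := fun x => clip k%:R (g x))) => // x; exact: continuous_comp (cg x) (@clip_continuous _ _ _).
- move=> w gw; apply: cvg_near_cst; exists (Num.truncn `|g (Phi w t)|).+1 => // k /= kk.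
  rewrite (loeb_stdpart (g := fun x => clip k%:R (g x)))//; last first.
    by move=> x; exact: continuous_comp (cg x) (@clip_continuous _ _ _).
  by apply: clip_id; exact/ltW/truncn_lt.
- by move=> w ng; rewrite /loeb_path; case: pselect.
Qed.

Lemma loeb_expct (g : 'rV[R]_d -> R) c t : continuous g -> (forall x, `|g x| <= c) -> 0 <= t ->
  expct L (fun w => g (Phi w t)) = ulim FU (fun n => expct (P n) (fun w => g (Z n w t))).
Proof.
move=> cg gc t0; rewrite -(@expct_stdpart _ _ _ _ _ (fun n v => g (Z n v t)) c)//; last by move=> n; exact: Zm.
apply: (expct_regular (C := c)) => //.
- exact: loeb_path_mfun.
- by apply: (@mfun_stdpart _ _ _ _ _ c) => // n; exact: Zm.
- by move=> w; apply: stdpart_bnd.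
- by move=> w gw; rewrite loeb_stdpart.
Qed.

(** On the regular event f(Z_n) converges along U to f at the limit path;
    [skorokhod_continuous_mfun] makes both sides measurable for an arbitrary J1-continuous f. *)
Lemma loeb_skorokhod (f : skorokhod 'rV[R]_d -> R) c : continuous f -> (forall x, `|f x| <= c) ->
  expct L (fun w => f (Phi w)) = ulim FU (fun n => expct (P n) (fun w => f (Z n w))).
Proof.
move=> cf fc; have mf n : mfun (fun w => f (Z n w)) by apply: skorokhod_continuous_mfun => //; exact: Zm.
rewrite -(@expct_stdpart _ _ _ _ _ (fun n v => f (Z n v)) c)//.
apply: (expct_regular (C := c)) => //.
- apply: (@skorokhod_continuous_mfun R d _ LT (fun w => Phi w) f) => // g t; exact: loeb_path_mfun.
- exact: (@mfun_stdpart _ _ _ _ _ c).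
- by move=> w; apply: stdpart_bnd.
- move=> w gw; rewrite /loeb_path; case: pselect => // g.
  by apply/esym/ulim_eq; exact: (@limit_skorokhod R d U (upath w) (regular_stable g) f cf).
Qed.

Lemma loeb_jmeas (g : 'rV[R]_d -> R) c : (forall x, `|g x| <= c) ->
  (forall x, x != 0 -> {for x, continuous g}) -> jmeas (fun (w : LT) s => g (Phi w s)).
Proof.
move=> gc gcont; apply: (@jmeas_off_zero _ LT R d (fun w => Phi w)) gc gcont => h t ch t0.
exact: loeb_path_mfun.
Qed.

Lemma loeb_jmeas_continuous (g : 'rV[R]_d -> R) : continuous g -> jmeas (fun (w : LT) s => g (Phi w s)).
Proof.
move=> cg; apply: (@jmeas_continuous _ LT R d (fun w => Phi w)) => // h t ch t0.
exact: loeb_path_mfun.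
Qed.

(** For k >= d / e, a point of sup norm below 1/(k + 1) has Euclidean norm at most e, so the bump is
    dominated by the indicator of an event that [nonzero] makes unlikely. *)
Lemma bump_expct t : 0 < t -> expct L (fun w => bump k (Phi w t)) @[k --> \oo] --> 0.
Proof.
move=> t0; apply/cvgrPdist_le => eta eta0; have [e e0 He] := nonzero t0 eta0.
exists (Num.truncn (d%:R / e)) => // k /= kk.
have bb (x : 'rV[R]_d) : `|bump k x| <= 1 by have /andP[h1 h2] := bump01 k x; rewrite ger0_norm.
rewrite sub0r normrN ger0_norm; last by apply: expct_ge0 => w; have /andP[] := bump01 k (Phi w t).
rewrite (loeb_expct (@bump_continuous R _ k) bb (ltW t0)).
apply: (@ulim_le_cst _ _ _ _ _ 1).
  apply: nearW => n; rewrite ger0_norm; last by apply: expct_ge0 => w; have /andP[] := bump01 k (Z n w t).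
  rewrite -[leRHS](expct_cst (P n)); apply: expct_le; [|exact: intg_cst|by move=> w; have /andP[] := bump01 k (Z n w t)].
  by apply: (@intg_bnd _ _ _ _ _ 1) => [|w]; [apply: Zm; [exact: bump_continuous|exact: ltW]|exact: bb].
apply: filterS (free_infty U He) => n; apply: le_trans.
have mE : measurable [set w : Omega n | enorm (Z n w t) <= e].
  by apply: measurable_le_cst; apply: Zm; [exact: enorm_continuous|exact: ltW].
rewrite prb_indic//; apply: expct_le; [|exact: intg_indic|move=> w].
  by apply: (@intg_bnd _ _ _ _ _ 1) => [|w]; [apply: Zm; [exact: bump_continuous|exact: ltW]|exact: bb].
have [h|h] := leP k.+1%:R^-1 `|Z n w t|; first by rewrite bump_off// indicE.
rewrite (indicT R (A := [set w | enorm (Z n w t) <= e])); first by have /andP[] := bump01 k (Z n w t).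
apply: le_trans (enorm_ge_row _) _; apply: (@le_trans _ _ (d%:R * k.+1%:R^-1)); first by rewrite ler_wpM2l// ltW.
rewrite ler_pdivrMr// mulrC -ler_pdivrMr//; apply: ltW; apply: lt_le_trans (truncnS_gt _) _.
by rewrite ler_nat.
Qed.

(** By Tonelli, the mean time spent near 0 is the time integral of the fixed-time means, each of
    which tends to 0 at positive times. *)
Lemma occupation t : expct L (fun w => tint t (fun s => bump k (Phi w s))) @[k --> \oo] --> 0.
Proof.
have bj k : jmeas (fun (w : LT) s => bump k (Phi w s)) by apply: loeb_jmeas_continuous; exact: bump_continuous.
have b01 k w s : 0 <= bump k (Phi w s) <= 1 by exact: bump01.
rewrite (_ : (fun k => _) = (fun k => tint t (fun s => expct L (fun w => bump k (Phi w s))))); last first.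
  by apply/funext => k; exact: (expct_tint L _ (bj k) (b01 k)).
suff : tint t (fun s => expct L (fun w => bump k (Phi w s))) @[k --> \oo] --> tint t (cst 0).
  by rewrite {2}/tint Rintegral_cst// mul0r.
apply: (@tint_dct _ _ _ 1).
- move=> k.
  pose phi (p : LT * measurableTypeR R) : \bar R := (bump k (Phi p.1 p.2))%:E.
  have phi0 p : (0 <= phi p)%E by rewrite lee_fin; have /andP[] := b01 k p.1 p.2.
  have mphi : measurable_fun setT phi by apply/measurable_EFinP; exact: bj.
  have mG := @measurable_fun_fubini_tonelli_G _ _ LT (measurableTypeR R) R L phi mphi phi0.
  by apply: (@measurableT_comp _ _ _ _ _ _ fine _ (fubini_G L phi)) => //; exact: measurable_fine.
- move=> k s; rewrite ger0_norm; last by apply: expct_ge0 => w; have /andP[] := b01 k w s.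
  have bm : mfun (fun w : LT => bump k (Phi w s)).
    by apply: (@measurableT_comp _ _ _ _ _ _ (fun p : LT * measurableTypeR R => bump k (Phi p.1 p.2)) _ (fun w => (w, s))) => //; exact: bj.
  rewrite -[leRHS](expct_cst L); apply: expct_le; [|exact: intg_cst|by move=> w; have /andP[] := b01 k w s].
  by apply: (@intg_bnd _ _ _ _ _ 1) => // w; have /andP[h1 h2] := b01 k w s; rewrite ger0_norm.
- by move=> s s0; exact: bump_expct.
- exact: measurable_cst.
Qed.

Section test_function.
Context (a : 'rV[R]_d -> 'M[R]_d) (C : R).
Hypotheses (aC : forall x i j, `|a x i j| <= C) (C0 : 0 <= C)
  (a_continuous : forall x, x != 0 -> {for x, continuous a}).
Context (f : 'rV[R]_d -> R) (fs : smooth f) (fc : compactly_supported f) (c0 cg : R).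
Hypotheses (fc0 : forall x, `|f x| <= c0) (cg_ge0 : 0 <= cg) (gcg : forall x, `|generator a f x| <= cg).
Let G := generator a f.
Let G_off : forall x, x != 0 -> {for x, continuous G}.
Proof. exact: generator_off_zero. Qed.
Let cf : continuous f := (fs [::]).1.

(** Replacing G by its continuous version costs 2 cg times the occupation of the bump, for Z n as
    well as for the limit. The bump being continuous, the occupation of Z n tends to that of the
    limit; the discontinuity at 0 is thus charged to the limit path alone. *)
Let generator_limit w r k e : Gamma w -> 0 <= r -> 0 < e -> \forall n \near FU,
  `|tint r (fun v => G (Z n (w n) v)) - tint r (fun v => G (Phi w v))| <= 4 * cg * tint r (fun v => bump k (Phi w v)) + e.
Proof.
move=> gw r0 e0; have st := regular_stable gw.
have PhiE : (fun v => Phi w v) = limit_fun U (upath w) by apply/funext => v; exact: loeb_pathE.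
have GPb : bmeas (fun v => G (Phi w v)).
  by split; [exact: jmeas_path w (loeb_jmeas gcg G_off)|exists cg => v; exact: gcg].
have Gkc k' : continuous (smoothen G k') by apply: smoothen_continuous gcg G_off _.
have Gkb k' x : `|smoothen G k' x| <= cg by exact: smoothen_bound.
have bb k' (x : 'rV[R]_d) : `|bump k' x| <= 1 by have /andP[h1 h2] := bump01 k' x; rewrite ger0_norm.
have contb (g : 'rV[R]_d -> R) c : continuous g -> (forall x, `|g x| <= c) -> bmeas (fun v => g (Phi w v)).
  by move=> cg' gc; split; [exact: jmeas_path w (loeb_jmeas_continuous cg')|exists c => v; exact: gc].
have Gdist (x : R -> 'rV[R]_d) : bmeas (fun v => G (x v)) -> bmeas (fun v => smoothen G k (x v)) -> bmeas (fun v => bump k (x v)) ->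
    `|tint r (fun v => G (x v)) - tint r (fun v => smoothen G k (x v))| <= 2 * cg * tint r (fun v => bump k (x v)).
  move=> b1 b2 b3; have [m1 _] := b1; have [m2 _] := b2.
  apply: (le_trans (@tint_dist_le _ _ _ cg _ m1 m2 (fun v => gcg _) (fun v => Gkb k _))).
  rewrite -tintZ//; apply: tint_le; [|exact: bmeasZ|by move=> v; exact: smoothen_dist].
  split; first by apply: mfun_norm; exact: measurable_funB.
  by exists (cg + cg) => v; rewrite normr_id; apply: le_trans (ler_normB _ _) _; apply: lerD; [exact: gcg|exact: Gkb].
have e40 : 0 < e / 2 by rewrite divr_gt0.
pose e' := e / 2 / (2 * cg + 1); have e'0 : 0 < e' by rewrite divr_gt0// ltr_wpDl// mulr_ge0.
have /cvgrPdist_le/(_ _ e40) H1 := @limit_tint R d U (upath w) st (smoothen G k) cg r (Gkc k) (Gkb k) r0.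
have /cvgrPdist_le/(_ _ e'0) H2 := @limit_tint R d U (upath w) st (bump k) 1 r (@bump_continuous R _ k) (bb k) r0.
apply: filterS2 H1 H2 => n; rewrite -!PhiE => h1 h2.
have zb (g : 'rV[R]_d -> R) c : continuous g -> (forall x, `|g x| <= c) -> bmeas (fun v => g (Z n (w n) v)).
  move=> cg' gc; split; last by exists c => v; exact: gc.
  by apply: (@jmeas_path _ _ _ (fun w' v => g (Z n w' v)) (w n)); apply: jmeas_continuous => //; exact: Zm.
have zG : bmeas (fun v => G (Z n (w n) v)).
  split; last by exists cg => v; exact: gcg.
  by apply: (@jmeas_path _ _ _ (fun w' v => G (Z n w' v)) (w n)); apply: (jmeas_off_zero (@Zm n) gcg G_off).
have d1 := Gdist (Z n (w n)) zG (zb _ _ (Gkc k) (Gkb k)) (zb _ _ (@bump_continuous R _ k) (bb k)).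
have d2 := Gdist (Phi w) GPb (contb _ _ (Gkc k) (Gkb k)) (contb _ _ (@bump_continuous R _ k) (bb k)).
have d3 : tint r (fun v => bump k (Z n (w n) v)) <= tint r (fun v => bump k (Phi w v)) + e'.
  by move: h2; rewrite distrC => /(le_trans (ler_norm _)); rewrite lerBlDl.
have d4 : 2 * cg * tint r (fun v => bump k (Z n (w n) v)) <= 2 * cg * tint r (fun v => bump k (Phi w v)) + e / 2.
  apply: (@le_trans _ _ (2 * cg * (tint r (fun v => bump k (Phi w v)) + e'))); first by rewrite ler_wpM2l// mulr_ge0.
  have cg2 : 0 < 2 * cg + 1 by rewrite ltr_wpDl// mulr_ge0.
  rewrite mulrDr lerD2l /e' mulrCA ler_piMr ?(ltW e40)//.
  by rewrite ler_pdivrMr// mul1r lerDl.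
rewrite distrC in h1.
rewrite (_ : 4 * cg * _ = 2 * (2 * cg * tint r (fun v => bump k (Phi w v)))); last by ring.
rewrite [in leRHS](_ : e = 2 * (e / 2)); last by rewrite mulrCA divff// mulr1.
by apply: (dist_chain d1 h1 _ d4); rewrite distrC.
Qed.

Let Psi := fun w : LT => (Phi w : skorokhod 'rV[R]_d).

Lemma loeb_test_increment w s t k : Gamma w -> 0 <= s -> s <= t ->
  `|stdpart U (fun n v => test_increment (Z n) a f s t v) w - test_increment Psi a f s t w| <=
  8 * cg * tint t (fun v => bump k (Phi w v)).
Proof.
move=> gw s0 st; have t0 := le_trans s0 st.
have bb (x : 'rV[R]_d) : `|bump k x| <= 1 by have /andP[h1 h2] := bump01 k x; rewrite ger0_norm.
have bmP : bmeas (fun v => bump k (Phi w v)).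
  split; last by exists 1 => v; exact: bb.
  exact: jmeas_path w (loeb_jmeas_continuous (@bump_continuous R _ k)).
have tst : tint s (fun v => bump k (Phi w v)) <= tint t (fun v => bump k (Phi w v)).
  by apply: tint_mono => // v; have /andP[] := bump01 k (Phi w v).
have zG n : measurable_fun setT (fun v => G (Z n (w n) v)).
  by apply: (@jmeas_path _ _ _ (fun w' v => G (Z n w' v)) (w n)); apply: (jmeas_off_zero (@Zm n) gcg G_off).
apply/ler_addgt0Pr => e e0; have e40 : 0 < e / 4 by rewrite divr_gt0.
rewrite -(@ulim_cst FU _ R (test_increment Psi a f s t w)) /stdpart.
rewrite -(@ulimB FU _ R _ _ (2 * c0 + cg * t + `|test_increment Psi a f s t w|)); last first.
- by apply: nearW => n; rewrite lerDr addr_ge0 ?mulr_ge0//; exact: le_trans (normr_ge0 _) (fc0 0).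
- apply: nearW => n; rewrite -[leLHS]addr0 lerD//.
  exact: (increment_bound (u := fun v => f (Z n (w n) v)) (zG n) (fun v => fc0 _) (fun v => gcg _) s0 st).
apply: ulim_norm.
have fl r : \forall n \near FU, `|f (Z n (w n) r) - f (Phi w r)| <= e / 4.
  have /cvgrPdist_le/(_ _ e40) := @limit_comp_cvg R d U (upath w) (regular_stable gw) f r cf.
  by apply: filterS => n; rewrite (loeb_pathE _ gw) distrC.
apply: (filterS2 _ _ (filterI (fl s) (fl t)) (filterI (generator_limit k gw s0 e40) (generator_limit k gw t0 e40))).
move=> n [f1 f2] [g1 g2]; rewrite /cst /test_increment /Psi.
have c8 : 4 * cg * tint s (fun v => bump k (Phi w v)) <= 4 * cg * tint t (fun v => bump k (Phi w v)).
  by rewrite ler_wpM2l// mulr_ge0.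
move: f1 f2 g1 g2 c8; rewrite -/G.
rewrite (_ : 8 * cg * _ = 2 * (4 * cg * tint t (fun v => bump k (Phi w v)))); last by ring.
exact: dist_increment.
Qed.

Lemma loeb_test_mfun s t : 0 <= s -> 0 <= t -> mfun (test_increment Psi a f s t : LT -> R).
Proof.
move=> s0 t0; apply: measurable_funB; first by apply: measurable_funB; exact: loeb_path_mfun.
by apply: measurable_funB; apply: (mfun_tint _ (loeb_jmeas gcg G_off) (C := cg)) => // w v; exact: gcg.
Qed.

Lemma loeb_test_bound s t w : 0 <= s -> s <= t -> `|test_increment Psi a f s t w| <= 2 * c0 + cg * t.
Proof.
move=> s0 st.
exact: (increment_bound (u := fun v => f (Phi w v)) (jmeas_path (w : LT) (loeb_jmeas gcg G_off)) (fun v => fc0 _) (fun v => gcg _) s0 st).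
Qed.

Hypothesis test : forall s t th, 0 <= s -> s <= t -> 0 < th -> \forall n \near \oo, forall E : set (Omega n),
  F n s E -> `|expct (P n) (fun w => \1_E w * test_increment (Z n) a f s t w)| <= th.

(** The standard part of the prelimit increments has mean 0 on approximable events. Its L1 distance
    from the increment of the limit path is at most 8 cg times the mean occupation of the k-th bump,
    for every k, hence 0. *)
Lemma loeb_martingale s t E : 0 <= s -> s <= t -> uapprox P (fun n => F n s) E ->
  expct L (fun w => \1_E w * test_increment Psi a f s t w) = 0.
Proof.
move=> s0 st uE; have t0 := le_trans s0 st; have [mE _] := uE.
pose g n v := test_increment (Z n) a f s t v.
have zG n : jmeas (fun w' v => G (Z n w' v)) by apply: (jmeas_off_zero (@Zm n) gcg G_off).
have gm n : mfun (g n).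
  apply: measurable_funB; first by apply: measurable_funB; exact: Zm.
  by apply: measurable_funB; apply: (mfun_tint _ (zG n) (C := cg)) => // w v; exact: gcg.
have gb n w : `|g n w| <= 2 * c0 + cg * t.
  exact: (increment_bound (u := fun v => f (Z n w v)) (jmeas_path w (zG n)) (fun v => fc0 _) (fun v => gcg _) s0 st).
have Fm n : F n s `<=` measurable by have [_ h _] := Ffil n; exact: h.
have z0 : expct L (fun w => \1_E w * stdpart U g w) = 0.
  apply: (expct_uapprox_eq0 Fm gm gb) uE => A FA.
  apply/cvgrPdist_le => th th0; have := free_infty U (test s0 st th0).
  by apply: filterS => n /(_ (A n) (FA n)); rewrite sub0r normrN.
have ms : mfun (stdpart U g : LT -> R) by apply: (@mfun_stdpart _ _ _ _ _ (2 * c0 + cg * t)).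
have is_ : intg L (stdpart U g : LT -> R) by apply: (@intg_bnd _ _ _ _ _ (2 * c0 + cg * t)) => // w; exact: stdpart_bnd.
have ip : intg L (test_increment Psi a f s t : LT -> R).
  by apply: (@intg_bnd _ _ _ _ _ (2 * c0 + cg * t)); [exact: loeb_test_mfun|move=> w; exact: loeb_test_bound].
pose X (w : LT) : R := stdpart U g w - test_increment Psi a f s t w.
have iX : intg L X by exact: intgB.
have bb k (x : 'rV[R]_d) : `|bump k x| <= 1 by have /andP[h1 h2] := bump01 k x; rewrite ger0_norm.
have bj k : jmeas (fun (w : LT) s => bump k (Phi w s)) by apply: loeb_jmeas_continuous; exact: bump_continuous.
have tb k w : `|tint t (fun v => bump k (Phi w v))| <= t.
  have := tint_increment (jmeas_path (w : LT) (bj k)) (fun v => bb k _) (lexx 0) t0.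
  by rewrite tint0 !subr0 mul1r.
have it k : intg L (fun w => tint t (fun v => bump k (Phi w v))).
  by apply: (@intg_bnd _ _ _ _ _ t) => //; apply: (mfun_tint _ (bj k) (C := 1)) => // w v; exact: bb.
have EX k : expct L (fun w => `|X w|) <= 8 * cg * expct L (fun w => tint t (fun v => bump k (Phi w v))).
  have mG := regular_measurable.
  have -> : expct L (fun w => `|X w|) = expct L (fun w => \1_Gamma w * `|X w|).
    apply: (expct_regular (C := 2 * (2 * c0 + cg * t))).
    - by apply: mfun_norm; exact: intg_meas iX.
    - by apply: measurable_funM; [exact: mfun_indic|apply: mfun_norm; exact: intg_meas iX].
    - move=> w; rewrite normr_id; apply: le_trans (ler_normB _ _) _; rewrite mulr_natl mulr2n lerD//.
        exact: stdpart_bnd.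
      exact: loeb_test_bound.
    - move=> w; rewrite normrM normr_id; apply: le_trans (ler_piMl _ (norm_indic_le1 _ _ _)) _ => //.
      apply: le_trans (ler_normB _ _) _; rewrite mulr_natl mulr2n lerD//; first exact: stdpart_bnd.
      exact: loeb_test_bound.
    - by move=> w gw; rewrite (indicT R gw) mul1r.
  rewrite -expctZ//; apply: expct_le; [by apply: intg_mul1 => //; exact: intg_norm|exact: intgZ|move=> w].
  have [gw|ngw] := pselect (Gamma w).
    by rewrite (indicT R gw) mul1r; exact: loeb_test_increment.
  rewrite (indicF R ngw) mul0r mulr_ge0 ?mulr_ge0//; apply: Rintegral_ge0 => v _.
  by have /andP[] := bump01 k (Phi w v).
have X0 : expct L (fun w => `|X w|) <= 0.
  have cv : 8 * cg * expct L (fun w => tint t (fun v => bump k (Phi w v))) @[k --> \oo] --> 8 * cg * 0.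
    by apply: cvgMr; exact: occupation.
  rewrite mulr0 in cv; apply: (ler_cvg_to (@cvg_cst _ _ _ \oo _) cv); exact: nearW.
apply/eqP; rewrite -normr_le0; apply: le_trans X0.
have -> : expct L (fun w => \1_E w * test_increment Psi a f s t w) = - expct L (fun w => \1_E w * X w).
  rewrite -[LHS]subr0 -z0 -expctB; [|exact: intg_mul1|exact: intg_mul1].
  rewrite -expctN; last exact: intg_mul1.
  by congr expct; apply/funext => w; rewrite /X; ring.
rewrite normrN; apply: le_trans (expct_norm (intg_mul1 mE iX)) _; apply: expct_le.
- by apply: intg_norm; exact: intg_mul1.
- exact: intg_norm.
- by move=> w; rewrite normrM ler_piMl// norm_indic_le1.
Qed.

End test_function.

(** A change inside the null complement of the regular event does not affect approximation in
    probability. *)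
Lemma uapprox_regular s (S E : set LT) : uapprox P (fun n => F n s) S -> measurable E ->
  (forall w, Gamma w -> E w <-> S w) -> 0 <= s -> uapprox P (fun n => F n s) E.
Proof.
move=> [mS HS] mE ES s0; split=> // e e0; have [A FA HA] := HS e e0.
have mA : measurable (internal U A : set LT).
  by apply: measurable_internal => n; have [_ h _] := Ffil n; exact: h (FA n).
exists A => //; apply: le_trans HA; have mG := measurableC regular_measurable.
have msd (B : set LT) : measurable B -> measurable (symdiff B (internal U A)).
  by move=> mB; apply: measurableU; exact: measurableD.
rewrite -[leRHS]addr0 -regular_full; apply: le_trans (prbU _ _ mG); last exact: msd.
apply: prb_le; [exact: msd|by apply: measurableU => //; exact: msd|].
move=> w sw; have [g|ng] := pselect (Gamma w); last by right.
left; case: sw => -[h1 h2]; [left|right]; split=> //; first exact: (ES w g).1.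
by move/(ES w g).2.
Qed.

(** The open set is where [separator] is positive, and a strict inequality for a standard part is a
    countable union of internal events built from F n s. *)
Lemma separator_past (O : set 'rV[R]_d) s u : open O -> 0 <= u -> u <= s ->
  uapprox P (fun n => F n s) [set w : LT | O (Phi w u)].
Proof.
move=> oO u0 us; have s0 := le_trans u0 us.
have Fm n : F n s `<=` measurable by have [_ h _] := Ffil n; exact: h.
have sF n : sigma_algebra [set: Omega n] (F n s) by have [h _ _] := Ffil n; exact: h.
have Fid n (B : set (Omega n)) : measurable (B : set (g_sigma_algebraType (F n s))) -> F n s B.
  by move=> mB; rewrite -(sigma_algebra_id (sF n)).
have csep := separator_continuous (O := O).
have sb (x : 'rV[R]_d) : `|separator O x| <= 1 by rewrite ger0_norm ?separator_ge0 ?separator_le1.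
have OE w : O (Phi w u) <-> 0 < separator O (Phi w u).
  by rewrite separatorE// inE.
apply: (@uapprox_regular _ [set w | 0 < stdpart U (fun n v => separator O (Z n v u)) w]).
- rewrite (stdpart_gtE _ (C := 1)); last by move=> n w; exact: sb.
  have [_ _ hU] := @sigma_algebra_uapprox R U _ _ P (fun n => F n s) sF Fm; apply: hU => k.
  apply: uapprox_internal => // n; apply: Fid; apply: measurable_gt_cst; exact: Z_past.
- rewrite (_ : [set w | _] = [set w : LT | 0 < separator O (Phi w u)]).
    by apply: measurable_gt_cst; exact: loeb_path_mfun.
  by apply/seteqP; split=> w /= /OE.
- by move=> w gw; split=> /= [/OE|h]; [|apply/OE; move: h]; rewrite loeb_stdpart.
- exact: s0.
Qed.

(** Since approximable events form a sigma-algebra, both generations, of the past by coordinates and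
    of Borel sets by open sets, reduce the claim to open sets. *)
Lemma loeb_past s (E : set (cpath 'rV[R]_d)) : 0 <= s ->
  <<s past (fun z : cpath 'rV[R]_d => z : R -> 'rV[R]_d) s >> E ->
  uapprox P (fun n => F n s) (Phi @^-1` E).
Proof.
move=> s0; have Fm n : F n s `<=` measurable by have [_ h _] := Ffil n; exact: h.
have sF n : sigma_algebra [set: Omega n] (F n s) by have [h _ _] := Ffil n; exact: h.
have sU := @sigma_algebra_uapprox R U _ _ P (fun n => F n s) sF Fm.
move: E; apply: smallest_sub; first exact: (sigma_algebra_preimage Phi sU).
move=> _ [u /andP[u0 us] [B BB ->]] /=.
suff : [set B | uapprox P (fun n => F n s) ((fun w => Phi w u) @^-1` B)] B by [].
move: B BB; apply: smallest_sub; first exact: (sigma_algebra_preimage (fun w => Phi w u) sU).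
by move=> O oO; exact: separator_past.
Qed.

Lemma loeb_path_measurable : measurable_fun [set: LT] (Phi : LT -> cpath_space 'rV[R]_d).
Proof.
move=> _ B mB; rewrite setTI.
suff : [set B | measurable (Phi @^-1` B : set LT)] B by [].
move: B mB; apply: smallest_sub.
  by apply: (sigma_algebra_preimage Phi); exact: sigma_algebra_measurable.
move=> E [t t0 Et]; have [mE _] := loeb_past t0 (@sub_sigma_algebra _ setT _ _ Et); exact: mE.
Qed.

Definition loeb_law : probability (cpath_space 'rV[R]_d) R := law L loeb_path_measurable.

Lemma cpath_mfun (g : 'rV[R]_d -> R) t : continuous g -> 0 <= t ->
  mfun (fun z : cpath_space 'rV[R]_d => g ((z : cpath 'rV[R]_d) t)).
Proof.
move=> cg t0; apply: mfun_gt => c; apply: sub_sigma_algebra; exists t => //.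
exists t; first by rewrite lexx t0.
exists [set x | c < g x] => //; apply: sub_sigma_algebra.
by apply: (@open_comp _ _ g [set x | c < x]); [move=> x _; exact: cg|exact: open_gt].
Qed.

Lemma cpath_skorokhod_mfun (f : skorokhod 'rV[R]_d -> R) : continuous f ->
  mfun (fun z : cpath_space 'rV[R]_d => f (z : cpath 'rV[R]_d)).
Proof.
move=> cf; apply: (@skorokhod_continuous_mfun R d _ (cpath_space 'rV[R]_d) (fun z => (z : cpath 'rV[R]_d) : skorokhod 'rV[R]_d)) => //.
by move=> g t cg t0; exact: cpath_mfun.
Qed.

Lemma loeb_law_cvg (f : skorokhod 'rV[R]_d -> R) c : continuous f -> (forall x, `|f x| <= c) ->
  expct loeb_law (fun z : cpath_space 'rV[R]_d => f (z : cpath 'rV[R]_d)) = ulim FU (fun n => expct (P n) (fun w => f (Z n w))).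
Proof.
move=> cf fc; rewrite -(loeb_skorokhod cf fc) expct_law//; first exact: cpath_skorokhod_mfun.
apply: (@intg_bnd _ _ _ _ _ c) => [|w]; last exact: fc.
by apply: measurableT_comp (cpath_skorokhod_mfun cf) loeb_path_measurable.
Qed.

(** Means of bounded continuous functions at time 0 agree with those under v. The functions min 1 (k
    separator) tend to the indicator of an open set, and open sets form a generating pi-system. *)
Lemma loeb_law_initial (v : probability (borel 'rV[R]_d) R) :
  weak_cvg P (fun n w => Z n w 0) v (fun x => x : 'rV[R]_d) ->
  forall B : set (borel 'rV[R]_d), measurable B -> loeb_law [set z : cpath 'rV[R]_d | B (z 0)] = v B.
Proof.
move=> cv0; pose start (z : cpath_space 'rV[R]_d) : borel 'rV[R]_d := (z : cpath 'rV[R]_d) 0.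
have mstart : measurable_fun [set: cpath_space 'rV[R]_d] start.
  move=> _ B mB; rewrite setTI; apply: sub_sigma_algebra; exists 0; first exact: lexx.
  by exists 0; [rewrite lexx|exists B].
pose v' := law loeb_law mstart.
have open_mfun (g : 'rV[R]_d -> R) : continuous g -> mfun (g : borel 'rV[R]_d -> R).
  move=> cg; apply: mfun_gt => c; apply: sub_sigma_algebra.
  by apply: (@open_comp _ _ g [set x | c < x]); [move=> x _; exact: cg|exact: open_gt].
have bounded_test (g : 'rV[R]_d -> R) c : continuous g -> (forall x, `|g x| <= c) ->
    expct v' (g : borel 'rV[R]_d -> R) = expct v (g : borel 'rV[R]_d -> R).
  move=> cg gc; have mg := open_mfun g cg.
  have m0 : mfun (fun z : cpath_space 'rV[R]_d => g ((z : cpath 'rV[R]_d) 0)) by exact: cpath_mfun.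
  have mP0 : mfun (fun w : LT => g (Phi w 0)) by exact: loeb_path_mfun.
  rewrite expct_law//; last by apply: (@intg_bnd _ _ _ _ _ c) => [|w]; [exact: m0|exact: gc].
  rewrite expct_law//; last by apply: (@intg_bnd _ _ _ _ _ c) => [|w]; [exact: mP0|exact: gc].
  rewrite [LHS](loeb_expct cg gc (lexx 0)); apply: (@ulim_eq FU _ R).
  have iv : intg v (g : borel 'rV[R]_d -> R) by apply: (@intg_bnd _ _ _ _ _ c).
  have iP n : intg (P n) (fun w => g (Z n w 0)).
    by apply: (@intg_bnd _ _ _ _ _ c) => [|w]; [exact: Zm|exact: gc].
  have /(cvg_expct iP iv) cv := cv0 g cg (ex_intro _ c gc).
  by move=> B /cv; exact: free_infty.
suff H B : measurable B -> v' B = v B by move=> B mB; exact: H.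
apply: (@measure_unique _ R (borel 'rV[R]_d) (@open 'rV[R]_d) (fun=> setT)) => //.
- exact: openI.
- move=> _; exact: openT.
- by rewrite bigcup_const.
- move=> O oO; have mO : measurable (O : set (borel 'rV[R]_d)) by exact: sub_sigma_algebra.
  pose g k (x : 'rV[R]_d) := Num.min 1 (k%:R * separator O x).
  have cgk k : continuous (g k).
    exact: separator_min_continuous.
  have g01 k x : 0 <= g k x <= 1.
    by rewrite le_min ler01 mulr_ge0 ?separator_ge0//= ge_min lexx.
  have gb k x : `|g k x| <= 1 by have /andP[h1 h2] := g01 k x; rewrite ger0_norm.
  have gO x : g k x @[k --> \oo] --> (\1_O x : R).
    have [Ox|nOx] := pselect (O x).
      rewrite indicT//; apply: cvg_near_cst; have s0 := separator_on oO Ox.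
      exists (Num.truncn (separator O x)^-1).+1 => // k /= kk.
      rewrite /g min_l// -ler_pdivrMr// mul1r; apply: ltW; apply: lt_le_trans (truncnS_gt _) _.
      by rewrite ler_nat.
    rewrite indicF//; apply: cvg_near_cst; apply: nearW => k.
    by rewrite /g separator_off// mulr0 min_r.
  have lim (m : probability (borel 'rV[R]_d) R) : expct m (g k : borel 'rV[R]_d -> R) @[k --> \oo] --> prb m O.
    rewrite prb_indic//; apply: (@expct_dct _ _ _ _ _ _ (cst 1)) => //.
    - by move=> k; exact: open_mfun.
    - exact: intg_cst.
  rewrite [LHS](prb_fin _ mO) [RHS](prb_fin _ mO); congr EFin; apply: (cvg_unique _ (lim v')) => //.
  rewrite (_ : (fun k => _) = (fun k => expct v (g k : borel 'rV[R]_d -> R))); first exact: lim.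
  by apply/funext => k; exact: (bounded_test _ 1).
- by move=> _; apply: fin_num_fun_lty; exact: fin_num_measure.
Qed.

(** Events of the past are pulled back by the limit path to approximable events of the Loeb space.
    Adaptedness of M depends on a and f but not on the law, so it can be supplied from any solution
    of the martingale problem. *)
Lemma loeb_law_martingale (a : 'rV[R]_d -> 'M[R]_d) C (f : 'rV[R]_d -> R) :
  (forall x i j, `|a x i j| <= C) -> 0 <= C -> (forall x, x != 0 -> {for x, continuous a}) ->
  smooth f -> compactly_supported f ->
  (forall s t th, 0 <= s -> s <= t -> 0 < th -> \forall n \near \oo, forall E : set (Omega n),
    F n s E -> `|expct (P n) (fun w => \1_E w * test_increment (Z n) a f s t w)| <= th) ->
  let M (z : cpath 'rV[R]_d) t := f (z t) - f (z 0) - \int[lebesgue_measure]_(s in `[0, t]) generator a f (z s) in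
  let FC t := <<s past (fun z : cpath 'rV[R]_d => z : R -> _) t >> in
  adapted FC M -> martingale loeb_law FC M.
Proof.
move=> aC C0 acont fs fc test M FC adM.
have [c0 _ fc0] : exists2 c, 0 <= c & forall x, `|f x| <= c := iter_partial_bounded fs fc [::].
have [cg cg_ge0 gcg] := generator_bound fs fc aC C0.
pose Psi (w : LT) : skorokhod 'rV[R]_d := Phi w.
have FCm t : 0 <= t -> FC t `<=` (measurable : set (set (cpath_space 'rV[R]_d))).
  move=> t0; apply: smallest_sub; first exact: sigma_algebra_measurable.
  by move=> E Et; apply: sub_sigma_algebra; exists t.
have mM t : 0 <= t -> mfun (fun z : cpath_space 'rV[R]_d => M z t).
  by move=> t0 _ B mB; rewrite setTI; apply: (FCm t t0); exact: adM.
have Mb z t : 0 <= t -> `|M z t| <= 2 * c0 + cg * t.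
  move=> t0.
  have jm : jmeas (fun (z : cpath_space 'rV[R]_d) s => generator a f ((z : cpath 'rV[R]_d) s)).
    apply: (@jmeas_off_zero _ (cpath_space 'rV[R]_d) R d (fun z => (z : cpath 'rV[R]_d) : skorokhod 'rV[R]_d)) gcg _.
      by move=> g u cg' u0; exact: cpath_mfun.
    exact: generator_off_zero.
  have := increment_bound (u := fun v => f (z v)) (jmeas_path (z : cpath_space 'rV[R]_d) jm) (fun v => fc0 _) (fun v => gcg _) (lexx 0) t0.
  by rewrite tint0 subr0.
apply: (@martingale_bounded _ (cpath_space 'rV[R]_d) R loeb_law FC M _ adM FCm Mb) => s t E s0 st FE; have t0 := le_trans s0 st.
have mE : measurable (E : set (cpath_space 'rV[R]_d)) := FCm s s0 E FE.
have mD : mfun (fun z : cpath_space 'rV[R]_d => \1_E z * (M z t - M z s)).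
  apply: measurable_funM; first exact: mfun_indic.
  by apply: measurable_funB; exact: mM.
have MD w : M (Phi w) t - M (Phi w) s = test_increment (fun w : LT => Phi w : skorokhod _) a f s t w.
  by rewrite /M /test_increment /tint; ring.
have <- := loeb_martingale acont fs fc0 cg_ge0 gcg test s0 st (loeb_past s0 FE).
rewrite expct_law; [|exact: mD|].
  by congr expct; apply/funext => w /=; rewrite MD.
apply: (@intg_bnd _ _ _ _ _ (2 * c0 + cg * t + (2 * c0 + cg * s))).
  exact: measurableT_comp mD loeb_path_measurable.
move=> w /=; rewrite normrM; apply: le_trans (ler_piMl _ (norm_indic_le1 _ _ _)) _ => //.
by apply: le_trans (ler_normB _ _) _; rewrite lerD// Mb.
Qed.

End loeb_limit.

(** If u were at distance more than e from l infinitely often, these indices would belong to some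
    free ultrafilter, along which the limit could not be l. *)
Lemma cvg_ulim (R : realType) (u : nat -> R) (l C : R) : (forall n, `|u n| <= C) ->
  (forall U : free_ultrafilter, ulim (free_sets U) u = l) -> u n @[n --> \oo] --> l.
Proof.
move=> uC ul; apply: contrapT => /cvgrPdist_le ncv.
have [e [e0 He]] : exists e, 0 < e /\ ~ \forall n \near \oo, `|l - u n| <= e.
  apply: contrapT => H; apply: ncv => e e0; apply: contrapT => He; apply: H.
  by exists e; split.
pose A n := ~ (`|l - u n| <= e).
have pA : ProperFilter (within A \oo).
  split; last exact: within_filter.
  move=> HA; apply: He; apply: (@filterS _ \oo _ _ _ _ HA) => n nA.
  by apply: contrapT => h; exact: nA h.
have [G [uG AG]] := ultraFilterLemma pA.
have sub : \oo `<=` G by move=> B oB; apply: AG; exact: filterS oB.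
pose U := FreeUltrafilter uG sub.
have GA : G A by apply: AG; exact: withinT.
have pG : ProperFilter G := @ultra_proper _ _ uG.
have : u @ G --> l.
  by rewrite -(ul U); apply: (@ulimP G uG R u C); apply: filterE.
move=> /cvgrPdist_le/(_ _ e0) GB.
by have [n [/= h1 h2]] := filter_ex (filterI GA GB); exact: h1.
Qed.

Lemma rough_start (R : realType) d (disp : nat -> measure_display) (Omega : forall n, measurableType (disp n))
    (P : forall n, probability (Omega n) R) (Z : forall n, Omega n -> skorokhod 'rV[R]_d) :
  (forall T eta : R, 0 < eta -> exists K : nat, (0 < K)%N /\ \forall n \near \oo,
     prb (P n) [set w | exists2 t, 0 <= t <= T & K%:R < enorm (Z n w t)] <= eta) ->
  forall eta : R, 0 < eta -> exists K : nat, \forall n \near \oo,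
     prb (P n) [set w | K%:R < enorm (Z n w 0)] <= eta.
Proof.
move=> cont eta eta0; have [K [_ HK]] := cont 0 eta eta0; exists K.
apply: filterS HK => n; congr (prb _ _ <= _); apply/seteqP; split=> w /=.
  by case=> t; rewrite -eq_le => /eqP <-.
by exists 0; rewrite ?lexx.
Qed.

Theorem theorem4p1 (R : realType) (d : nat)
    (a : 'rV[R]_d -> 'M[R]_d)
    (a_bounded : exists C, forall x i j, `|a x i j| <= C)
    (a_continuous : forall x, x != 0 -> {for x, continuous a})
    (a_sym : forall x, symmetric_mx (a x))
    (a_nonneg : forall x, nonneg_def (a x))
    (v : probability (borel 'rV[R]_d) R)
    (wp : well_posed a v)
    (disp : nat -> measure_display)
    (Omega : forall n, measurableType (disp n))
    (P : forall n, probability (Omega n) R)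
    (Z : forall n, Omega n -> skorokhod 'rV[R]_d)
    (A : forall n, Omega n -> R -> 'M[R]_d)
    (Z_meas : forall n, measurable_process (fun w t => Z n w t))
    (A_meas : forall n, measurable_process (A n))
    (A_sym : forall n w t, 0 <= t -> symmetric_mx (A n w t))
    (A_start : forall n w, A n w 0 = 0)
    (A_cadlag : forall n w i j, cadlag (fun t => A n w t i j))
    (A_incr : forall n w s t, 0 <= s -> s < t ->
       nonneg_def (A n w t - A n w s))
    (Z_mart : forall n i,
       local_martingale (P n) (joint_filtration (fun w s => Z n w s) (A n))
         (fun w t => Z n w t 0 i))
    (ZZ_mart : forall n i j,
       local_martingale (P n) (joint_filtration (fun w s => Z n w s) (A n))

         (fun w t => Z n w t 0 i * Z n w t 0 j - A n w t i j))
    (Z_jumps : forall r T, 0 < r -> 0 < T ->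
       (\int[P n]_w sup_upto (Order.min T%:E (exit_time (Z n w) r))
           (fun t => (enorm (Z n w t - left_limit (Z n w) t) ^+ 2)%R))%E
         @[n --> \oo] --> 0%E)
    (A_jumps : forall r T i j, 0 < r -> 0 < T ->
       (\int[P n]_w sup_upto (Order.min T%:E (exit_time (Z n w) r))
           (fun t => `|A n w t i j - left_limit (fun s => A n w s i j) t|%R))%E
         @[n --> \oo] --> 0%E)
    (A_limit : forall r T i j, 0 < r -> 0 < T ->
       cvg_prob0 P (fun n w => sup_upto (Order.min T%:E (exit_time (Z n w) r))
         (fun t => `|A n w t i j -
            \int[lebesgue_measure]_(s in `[0, t]) a (Z n w s) i j|)))
    (Z0_L2 : (ereal_sup (range (fun n =>
       \int[P n]_w ((enorm (Z n w 0) ^+ 2)%R)%:E)) < +oo)%E)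
    (Z0_cvg : weak_cvg P (fun n w => Z n w 0) v (fun x => x : 'rV[R]_d))
    (delta : R) (delta_gt1 : 1 < delta)
    (disp' : measure_display) (Omega' : measurableType disp')
    (P' : probability Omega' R) (rho : Omega' -> skorokhod R)
    (rho_bessel : bessel P' delta (fun w t => rho w t))
    (norm_cvg : weak_cvg P (fun n w => enorm_path (Z n w)) P' rho) :
  forall Q : probability (cpath_space 'rV[R]_d) R, martingale_problem a v Q ->
    weak_cvg P Z Q (fun z : cpath 'rV[R]_d => z : skorokhod 'rV[R]_d).
Proof.
have [C0 aC0] := a_bounded; pose C := `|C0|.
have aC x i j : `|a x i j| <= C by apply: le_trans (aC0 x i j) (ler_norm _).
have sys n : regular_system (P n) (Z n) (A n).
  exact: (RegularSystem (Z_meas n) (A_meas n) (A_sym n) (A_start n) (A_cadlag n) (A_incr n) (Z_mart n) (ZZ_mart n)).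
have delta_gt0 : 0 < delta by exact: lt_trans delta_gt1.
have containment := norm_containment Z_meas rho_bessel norm_cvg.
have nonzero := norm_nonzero Z_meas delta_gt0 rho_bessel norm_cvg.
have Ffil n := joint_filtration_filtration (sys n).
have Zm n g t := @Z_mfun _ _ _ _ _ _ _ (sys n) g t.
have Z_past n g s t := @past_Z_measurable R d _ (Omega n) (Z n) (A n) g s t.
have rough_meas n T aa N := @rough_measurable _ _ _ _ _ _ _ (sys n) T aa N.
have rough_small T aa eta := @osc_small R d disp Omega P Z A sys a C aC (normr_ge0 _) a_continuous Z_jumps A_jumps A_limit containment T aa eta.
have start_small := rough_start containment.
have test f s t th := @martingale_test R d disp Omega P Z A sys a C aC (normr_ge0 _) a_continuous Z_jumps A_jumps A_limit containment f s t th.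
move=> Q MQ f cf [c fc].
have [Q0 MQ0 uniq] := wp.
have iP n : intg (P n) (fun w => f (Z n w)).
  apply: (@intg_bnd _ _ _ _ _ c) => [|w]; last exact: fc.
  by apply: skorokhod_continuous_mfun => // g t; exact: Zm.
have iQ : intg Q (fun z : cpath_space 'rV[R]_d => f (z : cpath 'rV[R]_d)).
  by apply: (@intg_bnd _ _ _ _ _ c) => [|w]; [exact: cpath_skorokhod_mfun|exact: fc].
apply/(cvg_expct iP iQ); apply: (@cvg_ulim R _ _ c) => [n|U].
  apply: le_trans (expct_norm (iP n)) _; rewrite -[leRHS](expct_cst (P n)).
  by apply: expct_le; [exact: intg_norm|exact: intg_cst|move=> w; exact: fc].
pose QU := loeb_law U Ffil Z_past Zm rough_meas rough_small start_small.
rewrite -(loeb_law_cvg U Ffil Z_past Zm rough_meas rough_small start_small cf fc).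
have MU : martingale_problem a v QU.
  split; first exact: (loeb_law_initial U Ffil Z_past Zm rough_meas rough_small start_small Z0_cvg).
  (* Adaptedness of the test process is read off from the given solution Q. *)
  move=> g gs gc; have [_ /(_ g gs gc)[adM _ _]] := MQ.
  apply: (loeb_law_martingale U Ffil Z_past Zm rough_meas rough_small start_small nonzero aC (normr_ge0 _) a_continuous gs gc _ adM).
  by move=> s t th s0 st th0; exact: test.
rewrite /expct /Rintegral; congr fine; apply: eq_measure_integral => B mB _.
exact: etrans (uniq QU MU B mB) (esym (uniq Q MQ B mB)).
Qed.
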